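(* Let $1<p<\infty$, let $\mu,\lambda$ be dyadic bi-parameter $A_p$ weights on $\mathbb{R}^2$, and let $C_b=[S_1S_2,b]$ be the commutator of the tensor product $S_1S_2=S\otimes S$ of the dyadic shift $S$ with multiplication by $b$. Then $$\|b\|_{p,\mathrm{bmo}(\mu,\lambda)}\lesssim\|C_b\|_{L^p(\mu)\to L^p(\lambda)}\lesssim\|b\|_{p,\mathrm{bmo}(\mu,\lambda)}$$ with constants independent of the symbol $b$ in dyadic $\mathrm{bmo}(\mu,\lambda)$.
   Context: $\mathcal{D}$ denotes the family of all dyadic intervals in $\mathbb{R}$. For $I\in\mathcal{D}$, $I_-$ and $I_+$ are its left and right halves, and $h_I=(\mathbf{1}_{I_+}-\mathbf{1}_{I_-})/\sqrt{|I|}$ is the $L^2$-normalized Haar function; $\{h_I\}_{I\in\mathcal{D}}$ is an orthonormal basis of $L^2(\mathbb{R})$. The shift $S$ is the linear operator determined by $h_{I_-}\mapsto -h_{I_+}$ and $h_{I_+}\mapsto h_{I_-}$ for all $I\in\mathcal{D}$, i.e. $Sf=\sum_{I\in\mathcal{D}}\big((f,h_{I_+})h_{I_-}-(f,h_{I_-})h_{I_+}\big)$. On functions of $(x_1,x_2)\in\mathbb{R}^2$, $S_i$ denotes $S$ acting in the variable $x_i$, so $S_1S_2=S\otimes S$. A weight on $\mathbb{R}^2$ is a locally integrable function that is positive almost everywhere. A weight $w$ on $\mathbb{R}^2$ is a dyadic bi-parameter $A_p$ weight if $$\sup_R\left(\frac1{|R|}\int_Rw(x)\,dx\right)\left(\frac1{|R|}\int_Rw(x)^{-1/(p-1)}\,dx\right)^{p-1}<\infty,$$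 the supremum being over all dyadic rectangles $R=R_1\times R_2$, $R_1,R_2\in\mathcal{D}$. Write $\|f\|_{L^p(w)}^p=\int|f|^pw\,dx$, $w(R)=\int_Rw\,dx$ and $\langle b\rangle_R=\frac1{|R|}\int_Rb\,dx$. The weighted dyadic little BMO norm of a locally integrable $b$ is $$\|b\|_{p,\mathrm{bmo}(\mu,\lambda)}=\sup_R\left(\frac1{\mu(R)}\int_R|b(x)-\langle b\rangle_R|^p\lambda(x)\,dx\right)^{1/p},$$ the supremum being over all dyadic rectangles $R$; $b\in\mathrm{bmo}(\mu,\lambda)$ means this is finite. The commutator is $C_bf=S_1S_2(bf)-b\,S_1S_2f$, understood initially for bounded compactly supported $f$ and extended by density; $\|C_b\|_{L^p(\mu)\to L^p(\lambda)}$ is its operator norm. *)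

(* Defs.v *)
From mathcomp Require Import all_boot all_order all_algebra finmap.
From mathcomp Require Import all_classical all_reals all_analysis.

Set Implicit Arguments.
Unset Strict Implicit.
Unset Printing Implicit Defensive.
Import Order.TTheory GRing.Theory Num.Theory.
Import numFieldNormedType.Exports.

Local Open Scope classical_set_scope.
Local Open Scope ring_scope.

Section Defs.
Context {R : realType}.

(** R^2 with its Borel sigma-algebra, in the form in which [lebesgue_measure]
    presents R; as a type it is convertible to [R * R]. *)
Local Notation borelR2 := (measurableTypeR R * measurableTypeR R)%type.

Definition leb2 : {measure set borelR2 -> \bar R} :=
  (@lebesgue_measure R \x @lebesgue_measure R)%E.

Definition loc_integrable2 (f : R * R -> R) : Prop :=
  measurable_fun [set: borelR2] f /\
  forall K : set (R * R), compact K ->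
    (\int[leb2]_(z in K) `|f z|%:E < +oo)%E.

(** [I = (k, m)] encodes the dyadic interval [[m 2^k, (m+1) 2^k[]; the
    encoding is a bijection onto the family of all dyadic intervals. *)
Definition dyadic_index : Type := (int * int)%type.

Definition dlen (I : dyadic_index) : R := 2 ^ I.1.

Definition dyadic (I : dyadic_index) : set R :=
  `[I.2%:~R * dlen I, (I.2 + 1)%:~R * dlen I[.

Definition left_half (I : dyadic_index) : dyadic_index := (I.1 - 1, I.2 * 2).
Definition right_half (I : dyadic_index) : dyadic_index :=
  (I.1 - 1, I.2 * 2 + 1).

Definition haar (I : dyadic_index) (x : R) : R :=
  (\1_(dyadic (right_half I)) x - \1_(dyadic (left_half I)) x)
    / Num.sqrt (dlen I).

Definition haar_coef (f : R -> R) (I : dyadic_index) : R :=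
  Rintegral (@lebesgue_measure R) setT (fun x => f x * haar I x).

Definition shift_term (f : R -> R) (I : dyadic_index) (x : R) : R :=
  haar_coef f (right_half I) * haar (left_half I) x
  - haar_coef f (left_half I) * haar (right_half I) x.

(** [is_shift f g] means [g = S f] almost everywhere, the Haar series of [S f]
    being summed unconditionally in L^1_loc.  This agrees with the bounded
    operator S on L^2 and with its extensions by density to the (weighted)
    L^p spaces, and determines [g] up to a null set. *)
Definition is_shift (f g : R -> R) : Prop :=
  [/\ locally_integrable setT f, locally_integrable setT g &
    forall (K : set R) (e : R), compact K -> 0 < e ->
      exists F0 : {fset dyadic_index}, forall F : {fset dyadic_index},
        (F0 `<=` F)%fset ->
        (\int[lebesgue_measure]_(x in K)
           `|g x - \sum_(I <- F) shift_term f I x|%:E <= e%:E)%E].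

Definition is_shift1 (f g : R * R -> R) : Prop :=
  measurable_fun [set: borelR2] g /\
  {ae @lebesgue_measure R, forall y : R,
    is_shift (fun x => f (x, y)) (fun x => g (x, y))}.

Definition is_shift2 (f g : R * R -> R) : Prop :=
  measurable_fun [set: borelR2] g /\
  {ae @lebesgue_measure R, forall x : R,
    is_shift (fun y => f (x, y)) (fun y => g (x, y))}.

Definition is_shift12 (f g : R * R -> R) : Prop :=
  exists u : R * R -> R, is_shift2 f u /\ is_shift1 u g.

Definition is_commutator (b f g : R * R -> R) : Prop :=
  exists u v : R * R -> R,
    [/\ is_shift12 (fun z => b z * f z) u, is_shift12 f v &
        forall z, g z = u z - b z * v z].

Definition drect (Q : dyadic_index * dyadic_index) : set (R * R) :=
  dyadic Q.1 `*` dyadic Q.2.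

Definition darea (Q : dyadic_index * dyadic_index) : R := dlen Q.1 * dlen Q.2.

Definition weight2 (w : R * R -> R) : Prop :=
  loc_integrable2 w /\ {ae leb2, forall z, 0 < w z}.

Definition wmass (w : R * R -> R) (A : set (R * R)) : \bar R :=
  (\int[leb2]_(z in A) (w z)%:E)%E.

Definition Ap_char (p : R) (w : R * R -> R) : \bar R :=
  ereal_sup (range (fun Q : dyadic_index * dyadic_index =>
    ((darea Q)^-1%:E * wmass w (drect Q)) *
    ((darea Q)^-1%:E * wmass (fun z => w z `^ (- (p - 1)^-1))%R (drect Q))
      `^ (p - 1))%E).

Definition dyadic_Ap (p : R) (w : R * R -> R) : Prop :=
  weight2 w /\ (Ap_char p w < +oo)%E.

Definition rect_avg (b : R * R -> R) (Q : dyadic_index * dyadic_index) : R :=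
  (darea Q)^-1 * Rintegral leb2 (drect Q) b.

(** [fine] is harmless below: when mu is a weight, mu(Q) is a positive real. *)
Definition bmo_norm (p : R) (mu la b : R * R -> R) : \bar R :=
  ereal_sup (range (fun Q : dyadic_index * dyadic_index =>
    ((fine (wmass mu (drect Q)))^-1%:E *
      \int[leb2]_(z in drect Q) (`|b z - rect_avg b Q| `^ p * la z)%:E)
      `^ p^-1)%E).

Definition wLp_norm (p : R) (w f : R * R -> R) : \bar R :=
  ((\int[leb2]_z (`|f z| `^ p * w z)%:E) `^ p^-1)%E.

Definition test_function (f : R * R -> R) : Prop :=
  [/\ measurable_fun [set: borelR2] f,
      exists M : R, forall z, `|f z| <= M &
      compact (closure [set z | f z != 0])].

(** Operator norm on the dense class of test functions; it is [+oo] if the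
    commutator is undefined on some test function or is unbounded. *)
Definition commutator_norm (p : R) (mu la b : R * R -> R) : \bar R :=
  ereal_inf [set C%:E | C in [set C : R | 0 <= C /\
    forall f, test_function f -> exists g, is_commutator b f g /\
      (wLp_norm p la g <= C%:E * wLp_norm p mu f)%E]].

End Defs.

(* Main.v *)
(** On the binary tree of dyadic subintervals of an interval, the shift [S] becomes
    a martingale transform. Weighted bounds for its martingale, and for its
    commutator with [b], are finite inequalities on trees: Muckenhoupt's maximal
    theorem together with a stopping-time estimate of paraproduct type, applied to
    the expansion of the commutator tested against a function, in which the
    diagonal terms cancel because [S] is antisymmetric. The passage to the limit
    uses dyadic differentiation and Fatou's lemma.

    In the plane almost every fibre of a bi-parameter [A_p] weight, and of a symbol
    in bmo, satisfies the one-dimensional condition with the same constant.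
    The upper bound then follows from [[S_1 S_2, b] = S_1 [S_2, b] + [S_1, b] S_2].

    For the lower bound, test on [f = 1_(I x J)]. Since [S] moves every Haar function
    to the sibling interval, [S_1 S_2 f] vanishes on [PI x R] and [R x PJ], where [PI]
    and [PJ] are the parents; there the commutator equals [S_1 S_2 (b f)], from which
    the oscillation of [b] on [I x J] is recovered because [S^2 = - 1] up to averages. *)
Require Import Defs.
From mathcomp Require Import all_boot all_order all_algebra finmap.
From mathcomp Require Import all_classical all_reals all_analysis measurable_realfun.
From mathcomp Require Import ring lra zify.
Import Order.TTheory GRing.Theory Num.Theory.
Local Open Scope ring_scope.
Set Implicit Arguments.
Unset Strict Implicit.
Unset Printing Implicit Defensive.
Import numFieldNormedType.Exports.
Local Open Scope classical_set_scope.

(** * Martingales on the binary tree *)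

Section PowerInequalities.
Context {R : realType}.
Implicit Types (p q t x y : R).

(** Estimates are proved at finite depth, where every quantity is finite: Young's inequality with a
    free parameter then replaces products of norms, and the quantity to be bounded can be absorbed
    without prior knowledge that it is finite. The transforms carry multipliers [c] of modulus at
    most 1 because the Haar series must converge unconditionally: a finite Haar sum is a transform
    whose [c] is an indicator. An interval alone does not determine the shift of a function on it,
    since the coefficient at the interval comes from its sibling; [isolated] intervals, for which
    the other halves of all ancestors miss the function, remove this obstacle, and they exhaust both
    half-lines when the support is compact. On the line the operator is an upper limit of explicit
    step functions, so that acting in one variable of the plane keeps joint measurability, whereas
    [is_shift] fixes a function only up to null sets depending on the fibre. The oscillation of [b]
    is governed by the weight (mu/la)^(1/p), which is an A_2 weight; its averages are comparable to
    products of root averages of mu and of the dual of la. *)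

Definition conjugate p q := [/\ 1 < p, 1 < q & (p - 1) * (q - 1) = 1].

Lemma conjugate_sym p q : conjugate p q -> conjugate q p.
Proof. by case=> p1 q1 pq; split; rewrite // mulrC. Qed.

Lemma conjugateE p q : conjugate p q -> p * q = p + q.
Proof. by case=> _ _; lra. Qed.

Lemma conjugate_inv p q : conjugate p q -> p^-1 + q^-1 = 1.
Proof.
move=> pq; case: (pq) => p1 q1 _; have := conjugateE pq => H.
have p0 : p != 0 by lra.
have q0 : q != 0 by lra.
have -> : p^-1 + q^-1 = (p + q) / (p * q) by field; rewrite p0 q0.
by rewrite -H divff // mulf_neq0.
Qed.

Lemma young p q x y : conjugate p q -> 0 <= x -> 0 <= y ->
  x * y <= p^-1 * x `^ p + q^-1 * y `^ q.
Proof.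
move=> pq x0 y0; case: (pq) => p1 q1 _; rewrite mulrC [in X in _ <= X + _]mulrC [in X in _ <= _ + X]mulrC mulrC.
by apply: conjugate_powR (conjugate_inv pq) => //; lra.
Qed.

(* The free parameter replaces Hoelder's inequality: optimising over [t] would
   give the product of the norms. *)
Lemma young_scaled p q t x y : conjugate p q -> 0 < t -> 0 <= x -> 0 <= y ->
  x * y <= t `^ p * x `^ p + t `^ (- q) * y `^ q.
Proof.
move=> pq t0 x0 y0; case: (pq) => p1 q1 _.
have -> : x * y = (t * x) * (y / t) by field; lra.
have ty : 0 <= y / t by rewrite divr_ge0 // ltW.
have tx : 0 <= t * x by rewrite mulr_ge0 // ltW.
apply: (le_trans (young pq tx ty)).
rewrite powRM ?(ltW t0) // powRM ?invr_ge0 ?(ltW t0) //.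
have -> : t^-1 `^ q = t `^ (- q).
  by rewrite -[t^-1]powR_inv1 ?(ltW t0) // -powRrM mulN1r.
rewrite [y `^ q * _]mulrC.
have a0 : 0 <= t `^ p * x `^ p by rewrite mulr_ge0 ?powR_ge0.
have b0 : 0 <= t `^ (- q) * y `^ q by rewrite mulr_ge0 ?powR_ge0.
have pi : p^-1 <= 1 by rewrite invf_le1; lra.
have qi : q^-1 <= 1 by rewrite invf_le1; lra.
by nra.
Qed.

Lemma young_scaled_dual p q t x y : conjugate p q -> 0 < t -> 0 <= x -> 0 <= y ->
  x * y <= t `^ (- p) * x `^ p + t `^ q * y `^ q.
Proof.
by move=> pq t0 x0 y0; rewrite mulrC addrC young_scaled//; exact: conjugate_sym.
Qed.

Lemma powR_mono p x y : 0 < p -> 0 <= x -> x <= y -> x `^ p <= y `^ p.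
Proof.
by move=> p0 x0 xy; rewrite ge0_ler_powR ?nnegrE ?(ltW p0) ?(le_trans x0 xy).
Qed.

(** Convexity of the power [q], with the tangent at [y]; it is read off from Young's inequality for
    [x] and [y ^ (q - 1)], whose conjugate power is [y ^ q]. *)
Lemma young_tangent q x y : 1 < q -> 0 <= x -> 0 <= y ->
  y `^ q - x `^ q <= q * y `^ (q - 1) * (y - x).
Proof.
move=> q1 x0 y0.
pose p := q / (q - 1).
have pq : conjugate q p.
  split=> //; last by rewrite /p; field; lra.
  by rewrite /p -(@ltr_pM2r _ (q - 1)) ?divfK; lra.
have := young pq x0 (powR_ge0 y (q - 1)).
rewrite -powRrM; have -> : (q - 1) * p = q by rewrite /p; field; lra.
have := mulr_powRB1 y0 (lt_trans ltr01 q1).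
set z := y `^ (q - 1); set w := y `^ q; set v := x `^ q => yz H.
have pE : p^-1 = (q - 1) / q by rewrite /p invf_div.
have := ler_wpM2l (ltW (lt_trans ltr01 q1)) H.
rewrite pE (_ : q * (q^-1 * v + _) = v + (q - 1) * w); last by field; lra.
by nra.
Qed.

(** The function t^q w - q A t m of t has derivative q (t^(q-1) w - A m), which the hypothesis at
    [y] makes nonpositive on [x, y]; the tangent inequality stands in for the derivative. *)
Lemma max_step q A x y w m : 1 < q -> 0 <= A -> 0 <= x -> 0 <= m -> 0 <= w ->
  x <= y -> y `^ (q - 1) * w <= A * m ->
  y `^ q * w - q * A * y * m <= x `^ q * w - q * A * x * m.
Proof.
move=> q1 A0 x0 m0 w0 xy H.
have y0 := le_trans x0 xy.
have := ler_wpM2r w0 (young_tangent q1 x0 y0).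
have qy : 0 <= q * (y - x) by rewrite mulr_ge0 ?subr_ge0//; lra.
have := ler_wpM2l qy H.
by lra.
Qed.

Lemma pow_conj p q x : conjugate p q -> 0 <= x -> (x `^ (p - 1)) `^ q = x `^ p.
Proof.
move=> pq x0; rewrite -powRrM; congr (_ `^ _).
by have := conjugateE pq; lra.
Qed.

Lemma pow_conj1 p q x : conjugate p q -> 0 <= x ->
  (x `^ (p - 1)) `^ (q - 1) = x.
Proof. by move=> [_ _ pq] x0; rewrite -powRrM pq powRr1. Qed.

(** Supplies the Young parameter that leaves a term with coefficient one half, ready to be
    absorbed. *)
Lemma half_scale q (K : R) : 1 < q -> 0 < K -> exists2 t, 0 < t & K * t `^ q = 2^-1.
Proof.
move=> q1 K0; exists ((2 * K)^-1 `^ q^-1).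
  by rewrite powR_gt0 // invr_gt0; lra.
have q0 : q != 0 by lra.
have K2 : 0 <= (2 * K)^-1 by rewrite invr_ge0; lra.
by rewrite -powRrM mulVf // powRr1 //; field; lra.
Qed.

End PowerInequalities.

(** * Averages, sums and martingales along finite paths *)

Section Paths.
Context {R : realType}.
Implicit Types (a f g w : seq bool -> R) (s : seq bool) (k n : nat).

(* A path lists its most recent step first; [true] is the right half. *)
Fixpoint ave k a s : R :=
  if k is k'.+1 then (ave k' a (true :: s) + ave k' a (false :: s)) / 2 else a s.

(** The expected sum of [a] over the first [k] nodes of a random path from [s]. The weight 2^-j of
    level j makes the product rule for martingales exact. *)
Fixpoint nsum k a s : R :=
  if k is k'.+1
  then a s + (nsum k' a (true :: s) + nsum k' a (false :: s)) / 2 else 0.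

Definition mart a := forall s, a s = (a (true :: s) + a (false :: s)) / 2.

Definition dif a s := (a (true :: s) - a (false :: s)) / 2.

Fixpoint rmax a s : R :=
  if s is _ :: s' then Num.max (rmax a s') (a s) else a s.

(* The martingale with terminal values [a] at depth [n], frozen afterwards. *)
Definition clos n a s : R :=
  if (size s <= n)%N then ave (n - size s) a s else a (drop (size s - n) s).

Lemma normr_half (x : R) : `|x / 2| = `|x| / 2.
Proof. by rewrite normrM [X in _ * X]ger0_norm ?invr_ge0. Qed.

Lemma ave_mart k a s : mart a -> ave k a s = a s.
Proof. by move=> ma; elim: k s => //= k IH s; rewrite !IH -ma. Qed.

Lemma ave_le k a b s : (forall t, size t = (size s + k)%N -> a t <= b t) ->
  ave k a s <= ave k b s.
Proof.
elim: k s => /= [|k IH] s ab; first by rewrite ab ?addn0.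
rewrite ler_pM2r ?invr_gt0 ?ltr0n// lerD//; apply: IH => t st; apply: ab;
  by rewrite st /= addSnnS.
Qed.

Lemma eq_ave k a b s : (forall t, size t = (size s + k)%N -> a t = b t) ->
  ave k a s = ave k b s.
Proof.
by move=> ab; apply/eqP; rewrite eq_le !ave_le// => t /ab ->.
Qed.

Lemma ave_lin k x y a b s :
  ave k (fun t => x * a t + y * b t) s = x * ave k a s + y * ave k b s.
Proof. by elim: k s => //= k IH s; rewrite !IH; lra. Qed.

Lemma aveZ k x a s : ave k (fun t => x * a t) s = x * ave k a s.
Proof. by elim: k s => //= k IH s; rewrite !IH; lra. Qed.

Lemma aveB k a b s : ave k (fun t => a t - b t) s = ave k a s - ave k b s.
Proof. by elim: k s => //= k IH s; rewrite !IH; lra. Qed.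

Lemma ave_ge0 k a s : (forall t, size t = (size s + k)%N -> 0 <= a t) ->
  0 <= ave k a s.
Proof.
move=> a0; have := @ave_le k (fun=> 0) a s a0.
by rewrite ave_mart // => t; lra.
Qed.

Lemma ave_norm k a s : `|ave k a s| <= ave k (fun t => `|a t|) s.
Proof.
elim: k s => //= k IH s.
rewrite normr_half ler_pM2r ?invr_gt0 ?ltr0n//.
by rewrite (le_trans (ler_normD _ _)) // lerD.
Qed.

Lemma ave_add k m a s : ave (k + m) a s = ave k (ave m a) s.
Proof. by elim: k s => //= k IH s; rewrite !IH. Qed.

Lemma nsum_le k a b s : (forall t, (size t < size s + k)%N -> a t <= b t) ->
  nsum k a s <= nsum k b s.
Proof.
elim: k s => //= k IH s ab; rewrite lerD//; first by rewrite ab // addnS ltnS leq_addr.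
by rewrite ler_pM2r ?invr_gt0 ?ltr0n// lerD//; apply: IH => t st; apply: ab;
  rewrite -addSnnS.
Qed.

Lemma eq_nsum k a b s : (forall t, (size t < size s + k)%N -> a t = b t) ->
  nsum k a s = nsum k b s.
Proof. by move=> ab; apply/eqP; rewrite eq_le !nsum_le// => t /ab ->. Qed.

Lemma nsum_lin k x y a b s :
  nsum k (fun t => x * a t + y * b t) s = x * nsum k a s + y * nsum k b s.
Proof. by elim: k s => [|k IH] s /=; rewrite ?IH; lra. Qed.

Lemma nsum_norm k a s : `|nsum k a s| <= nsum k (fun t => `|a t|) s.
Proof.
elim: k s => [|k IH] s /=; first by rewrite normr0.
rewrite (le_trans (ler_normD _ _))// lerD//.
rewrite normr_half ler_pM2r ?invr_gt0 ?ltr0n//.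
by rewrite (le_trans (ler_normD _ _)) // lerD.
Qed.

Lemma mart_clos n a : mart (clos n a).
Proof.
move=> s; rewrite /clos /=; case: (ltngtP (size s) n) => [sn|sn|sn].
- by rewrite -[in LHS](subnSK sn).
- by rewrite !(subSn (ltnW sn)) /=; lra.
- by rewrite sn subnn subSnn /= drop0; lra.
Qed.

Lemma clos_leaf n a s : size s = n -> clos n a s = a s.
Proof. by move=> sn; rewrite /clos sn leqnn subnn. Qed.

Lemma clos_ge0 n a s : (forall t, size t = n -> 0 <= a t) -> 0 <= clos n a s.
Proof.
move=> a0; rewrite /clos; case: leqP => sn; last first.
  by apply: a0; rewrite size_drop subKn // ltnW.
by apply: ave_ge0 => t; rewrite subnKC // => /a0.
Qed.

Lemma clos_norm n a s : `|clos n a s| <= clos n (fun t => `|a t|) s.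
Proof. by rewrite /clos; case: leqP => // _; exact: ave_norm. Qed.

Lemma mart_stepE a s b : mart a ->
  a (b :: s) = a s + (if b then 1 else -1) * dif a s.
Proof. by move=> ma; rewrite (ma s) /dif; case: b; lra. Qed.

Lemma mart_child2 F s b : mart F -> (forall t, 0 <= F t) -> F (b :: s) <= 2 * F s.
Proof.
move=> mF F0; rewrite (mF s); have := F0 (true :: s); have := F0 (false :: s).
by case: b; lra.
Qed.

Lemma mart_eq0 F s b : mart F -> (forall t, 0 <= F t) -> F s = 0 -> F (b :: s) = 0.
Proof.
move=> mF F0 Fs; have := mart_child2 s b mF F0; rewrite Fs.
by have := F0 (b :: s); lra.
Qed.

Lemma dif_le f F s : mart F -> (forall t, `|f t| <= F t) -> `|dif f s| <= F s.
Proof.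
move=> mF fF; rewrite (mF s) /dif normr_half.
rewrite ler_pM2r ?invr_gt0 ?ltr0n// (le_trans (ler_normB _ _))//.
by rewrite lerD.
Qed.

Lemma rmax_ge a s : a s <= rmax a s.
Proof. by case: s => //= b s; rewrite le_max lexx orbT. Qed.

Lemma rmax_mono a s b : rmax a s <= rmax a (b :: s).
Proof. by rewrite /= le_max lexx. Qed.

Lemma rmax_ge0 a s : (forall t, 0 <= a t) -> 0 <= rmax a s.
Proof. by move=> a0; rewrite (le_trans (a0 s)) ?rmax_ge. Qed.

Lemma mono_ave_ge V k s : (forall b t, V t <= V (b :: t)) -> V s <= ave k V s.
Proof.
move=> mV; elim: k s => //= k IH s.
have := IH (true :: s); have := IH (false :: s).
by have := mV true s; have := mV false s; lra.
Qed.

(** Summation by parts: one step down, the mean of [f * a] changes by [f] times the drift of [a]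
    plus the product of the two differences, the drift of [f] being zero. *)
Lemma ave_prod f a k s : mart f ->
  ave k (fun t => f t * a t) s =
  f s * a s + nsum k (fun t => f t * ((a (true :: t) + a (false :: t)) / 2 - a t)
                               + dif f t * dif a t) s.
Proof.
move=> mf; elim: k s => /= [|k IH] s; first by rewrite addr0.
rewrite !IH /dif (mf s); lra.
Qed.

Lemma ave_prod_mart f g k s : mart f -> mart g ->
  ave k (fun t => f t * g t) s = f s * g s + nsum k (fun t => dif f t * dif g t) s.
Proof.
move=> mf mg; rewrite ave_prod//; congr (_ + _); apply: eq_nsum => t _.
by rewrite -mg; lra.
Qed.

End Paths.

(** * The weighted maximal theorem on a finite tree *)

Section MaximalFunction.
Context {R : realType}.
Implicit Types (p q A : R) (F P S w m xi : seq bool -> R).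

(** The potential X^q w - q A X m, with X the running maximum of [xi], decreases in mean: by
    [max_step] when the maximum is renewed, by the martingale property otherwise. At the root it is
    nonpositive because q > 1. *)
Lemma rmax_potential q A n w m xi : 1 < q -> 0 <= A -> mart w -> mart m ->
  (forall s, 0 <= w s) -> (forall s, 0 <= m s) -> (forall s, 0 <= xi s) ->
  (forall s, (size s <= n)%N -> xi s `^ (q - 1) * w s <= A * m s) ->
  ave n (fun s => rmax xi s `^ q * w s) [::] <=
    q * A * ave n (fun s => rmax xi s * m s) [::].
Proof.
move=> q1 A0 mw mm w0 m0 xi0 H.
pose U s := rmax xi s `^ q * w s - q * A * (rmax xi s * m s).
have UE k s : (size s + k)%N = n -> ave k U s <= U s.
  elim: k s => //= k IH s sn.
  have step b : U (b :: s) <=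
      rmax xi s `^ q * w (b :: s) - q * A * rmax xi s * m (b :: s).
    rewrite /U /= maxEle; case: ifP => xX; last by rewrite -!mulrA.
    rewrite [q * A * (_ * _)]mulrA; apply: max_step => //; first exact: rmax_ge0.
    by apply: (H (b :: s)); rewrite -sn /= -addn1 leq_add2l.
  have := IH (true :: s); have := IH (false :: s).
  rewrite /= !addSnnS => /(_ sn) h1 /(_ sn) h2.
  have := step true; have := step false.
  have -> : U s = rmax xi s `^ q * w s - q * A * (rmax xi s * m s) by [].
  by rewrite (mw s) (mm s); lra.
have := UE n [::] erefl.
rewrite /U aveB aveZ => h; rewrite -subr_le0; apply: (le_trans h).
rewrite /= -(mulr_powRB1 (xi0 [::])); last lra.
have := ler_wpM2l (xi0 [::]) (H [::] isT).
have : 0 <= xi [::] * (A * m [::]) by rewrite !mulr_ge0.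
have : 0 <= (q - 1) * (xi [::] * (A * m [::])) by rewrite !mulr_ge0//; lra.
lra.
Qed.

(* [P] and [S] are the roots of the averages of a weight and of its dual
   weight, so that the [A_p] condition reads [P * S <= A]. *)
Definition Ap_pair p q A P S :=
  [/\ mart (fun s => P s `^ p), mart (fun s => S s `^ q),
      forall s, 0 < P s, forall s, 0 < S s & forall s, 1 <= P s * S s <= A].

Lemma Ap_pair_sym p q A P S : Ap_pair p q A P S -> Ap_pair q p A S P.
Proof. by case=> *; split=> // s; rewrite mulrC. Qed.

(* Lerner's proof of Muckenhoupt's theorem: the maximal function is controlled
   by two maximal functions relative to the dual weight and to the weight. *)
Lemma rmax_weighted p q A : conjugate p q -> 1 <= A -> exists2 C, 0 < C &
  forall P S F n, Ap_pair p q A P S -> mart F -> (forall s, 0 <= F s) ->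
  ave n (fun s => (rmax F s * P s) `^ p) [::] <=
    C * ave n (fun s => (F s / S s) `^ p) [::].
Proof.
move=> pq A1; case: (pq) => p1 q1 _.
have qp := conjugate_sym pq.
have [t1 t10 t1E] := half_scale q1 (lt_trans ltr01 q1).
have Ap0 : 0 < A `^ p by rewrite powR_gt0; lra.
have pA0 : 0 < p * A `^ p by rewrite mulr_gt0//; lra.
have [t2 t20 t2E] := half_scale p1 pA0.
pose K1 := 2 * q * t1 `^ (- p); pose K2 := 2 * (p * A `^ p) * t2 `^ (- q).
have K10 : 0 < K1 by rewrite !mulr_gt0 ?powR_gt0//; lra.
have K20 : 0 < K2 by rewrite mulr_gt0 ?powR_gt0// mulr_gt0//; lra.
exists (K2 * K1); first by rewrite mulr_gt0.
move=> P S F n [mP mS P0 S0 PS] mF F0.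
(* A power of the average of f/v in the measure v whose averages are [S s ^ q]. The exponent p - 1
   turns the hypothesis of the potential estimate into the equality xi^(q-1) S^q = F, hence the
   constant 1. *)
pose xi s := (F s / S s `^ q) `^ (p - 1).
have xi0 s : 0 <= xi s by exact: powR_ge0.
pose V := rmax xi; have V0 s : 0 <= V s by exact: rmax_ge0.
pose X := rmax F; have X0 s : 0 <= X s by exact: rmax_ge0.
have Sq0 s : 0 < S s `^ q by rewrite powR_gt0.
have step1 : ave n (fun s => (V s * S s) `^ q) [::] <=
    K1 * ave n (fun s => (F s / S s) `^ p) [::].
  have := @rmax_potential q 1 n (fun s => S s `^ q) F xi q1 ler01 mS mF
    (fun s => powR_ge0 _ _) F0 xi0.
  rewrite mulr1; move=> /(_ _)/le_trans H.
  have {H}H : ave n (fun s => V s `^ q * S s `^ q) [::] <= q *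
      ave n (fun s => t1 `^ q * (V s * S s) `^ q + t1 `^ (- p) * (F s / S s) `^ p) [::].
    apply: H => [s _|].
      by rewrite /xi pow_conj1 ?divr_ge0 ?mul1r ?divfK ?gt_eqF// ltW.
    rewrite ler_pM2l; last lra.
    apply: ave_le => s _; rewrite -/V.
    have -> : V s * F s = (V s * S s) * (F s / S s) by field; rewrite gt_eqF.
    by apply: (young_scaled qp) => //; rewrite ?mulr_ge0 ?invr_ge0 // ltW.
  rewrite ave_lin in H.
  have E : ave n (fun s => (V s * S s) `^ q) [::] = ave n (fun s => V s `^ q * S s `^ q) [::].
    by apply: eq_ave => s _; rewrite powRM // ltW.
  move: H; rewrite E.
  rewrite mulrDr mulrA t1E /K1; lra.
suff step2 : ave n (fun s => (X s * P s) `^ p) [::] <=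
    K2 * ave n (fun s => (V s * S s) `^ q) [::].
  by rewrite (le_trans step2)// -[in X in _ <= X]mulrA ler_pM2l.
(* Second use, for the weight itself: F^(p-1) P^p = xi (P S)^p is at most A^p xi, and the increasing
   process [V] lies below the martingale that closes its terminal values. *)
have := @rmax_potential p (A `^ p) n (fun s => P s `^ p) (clos n V) F p1
  (ltW Ap0) mP (mart_clos n V) (fun s => powR_ge0 _ _)
  (fun s => clos_ge0 _ (fun t _ => V0 t)) F0.
move=> /(_ _)/le_trans H.
have {H}H : ave n (fun s => X s `^ p * P s `^ p) [::] <= (p * A `^ p) *
    ave n (fun s => t2 `^ p * (X s * P s) `^ p + t2 `^ (- q) * (V s * S s) `^ q) [::].
  apply: H => [s sn|].
    have Vm : V s <= clos n V s.
      by rewrite /clos sn; apply: mono_ave_ge => b t; exact: rmax_mono.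
    apply: (@le_trans _ _ (A `^ p * xi s)); last first.
      by rewrite ler_pM2l// (le_trans _ Vm)// rmax_ge.
    have -> : F s `^ (p - 1) * P s `^ p = xi s * (P s * S s) `^ p.
      have -> : F s `^ (p - 1) = xi s * S s `^ p.
        have <- : (S s `^ q) `^ (p - 1) = S s `^ p.
          by rewrite -powRrM; congr (_ `^ _); have := conjugateE pq; lra.
        rewrite /xi -powRM ?divr_ge0 ?(ltW (Sq0 s))//.
        by rewrite divfK // lt0r_neq0.
      by rewrite powRM ?(ltW (P0 _)) ?(ltW (S0 _))//; ring.
    rewrite mulrC ler_wpM2r// ge0_ler_powR ?nnegrE ?mulr_ge0 ?(ltW (P0 _)) ?(ltW (S0 _))//.
    - by lra.
    - by lra.
    - by have /andP[] := PS s.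
  rewrite ler_pM2l//; apply: ave_le => s sn; rewrite -/X clos_leaf //.
  have -> : X s * V s = (X s * P s) * (V s / P s) by field; rewrite gt_eqF.
  apply: (le_trans (young_scaled pq t20 _ _)).
  - by rewrite mulr_ge0// ltW.
  - by rewrite divr_ge0// ltW.
  rewrite lerD2l ler_wpM2l ?powR_ge0// ge0_ler_powR ?nnegrE//.
  - by lra.
  - by rewrite divr_ge0// ltW.
  - by rewrite mulr_ge0// ltW.
  rewrite ler_wpM2l// -[(P s)^-1]mul1r ler_pdivrMr// mulrC.
  by have /andP[] := PS s.
rewrite ave_lin in H.
have E : ave n (fun s => (X s * P s) `^ p) [::] = ave n (fun s => X s `^ p * P s `^ p) [::].
    by apply: eq_ave => s _; rewrite powRM // ltW.
  move: H; rewrite E.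
rewrite mulrDr mulrA t2E /K2; lra.
Qed.

End MaximalFunction.

(** * Stopping-time estimate of a trilinear sum *)

Section Paraproduct.
Context {R : realType}.
Implicit Types (a f g b F G H nu ka X Y : seq bool -> R) (s : seq bool) (k n : nat)
  (stop : pred (seq bool)).

(** Differences are grouped by parent because the shift exchanges the coefficients of two
    siblings. *)
Definition osc f s := `|dif f s| + `|dif f (true :: s)| + `|dif f (false :: s)|.

Definition osc2 f s :=
  dif f s ^+ 2 + (dif f (true :: s) ^+ 2 + dif f (false :: s) ^+ 2) / 2.

Lemma osc_ge0 f s : 0 <= osc f s.
Proof. by rewrite !addr_ge0. Qed.

Lemma osc_sqr f s : osc f s ^+ 2 <= 6 * osc2 f s.
Proof.
rewrite /osc /osc2 -!(real_normK (num_real (dif f _))).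
set x := `|_|; set y := `|_|; set z := `|_|.
have := sqr_ge0 (x - y); have := sqr_ge0 (y - z); have := sqr_ge0 (x - z).
have := sqr_ge0 x; nra.
Qed.

Lemma osc_le f F s : mart F -> (forall t, `|f t| <= F t) -> osc f s <= 5 * F s.
Proof.
move=> mF fF; have F0 t : 0 <= F t by rewrite (le_trans _ (fF t)).
rewrite /osc; have := dif_le s mF fF.
have := dif_le (true :: s) mF fF; have := dif_le (false :: s) mF fF.
have := mF s; have := F0 s; lra.
Qed.

(* The part of a tree lying above the stopping nodes. *)
Fixpoint stopped_sum (stop : pred (seq bool)) k a s : R :=
  if stop s then 0 else if k is k'.+1
  then a s + (stopped_sum stop k' a (true :: s) + stopped_sum stop k' a (false :: s)) / 2
  else 0.

Fixpoint stopped_ave (stop : pred (seq bool)) k a s : R :=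
  if stop s then 0 else if k is k'.+1
  then (stopped_ave stop k' a (true :: s) + stopped_ave stop k' a (false :: s)) / 2
  else a s.

(** For a martingale, [osc2] is the mean of f^2 over the grandchildren minus f^2 at the node, so the
    sum telescopes for the potential formed by f^2 plus its mean over the children. A child of an
    unstopped node is at most 12z and its own children at most 24z, which the constant covers with
    room to spare. *)
Lemma stopped_sum_osc2 stop f F (z : R) k s : mart f -> mart F ->
  (forall t, `|f t| <= F t) -> (forall t, ~~ stop t -> F t <= 6 * z) ->
  F s <= 12 * z ->
  stopped_sum stop k (osc2 f) s <=
    24 * 48 * z ^+ 2 - f s ^+ 2 - (f (true :: s) ^+ 2 + f (false :: s) ^+ 2) / 2.
Proof.
move=> mf mF fF Fz; have F0 t : 0 <= F t by rewrite (le_trans _ (fF t)).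
elim: k s => [|k IH] s Fs.
  have -> : stopped_sum stop 0 (osc2 f) s = 0 by rewrite /=; case: ifP.
  have h t (u : R) : `|f t| <= u -> f t ^+ 2 <= u ^+ 2.
    move=> ftu; rewrite -(real_normK (num_real (f t))) ler_pXn2r// nnegrE //.
    by rewrite (le_trans _ ftu).
  have c e : `|f (e :: s)| <= 24 * z.
    by rewrite (le_trans (fF _))// (le_trans (mart_child2 _ _ mF F0)); lra.
  have := h _ _ (c true); have := h _ _ (c false).
  have := h _ _ (le_trans (fF s) Fs); nra.
have [ss|ss] := boolP (stop s).
  rewrite /= ss; have := IH s Fs; suff -> : stopped_sum stop k (osc2 f) s = 0 by [].
  by case: (k) => [|j] /=; rewrite ss.
rewrite /= (negbTE ss).
have c e : F (e :: s) <= 12 * z.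
  by rewrite (le_trans (mart_child2 _ _ mF F0)) //; have := Fz s ss; lra.
have := IH _ (c true); have := IH _ (c false).
rewrite /osc2 /dif (mf s) (mf (true :: s)) (mf (false :: s)); nra.
Qed.

Lemma nsum_eq0 a F k s : mart F -> (forall t, 0 <= F t) ->
  (forall t, F t = 0 -> a t = 0) -> F s = 0 -> nsum k a s = 0.
Proof.
move=> mF F0 Fa; elim: k s => //= k IH s Fs.
by rewrite Fa // !IH ?(mart_eq0 _ mF F0 Fs)//; lra.
Qed.

(** Markov's inequality: a nonnegative martingale that is at least 1 at the stopping nodes bounds
    the stopped mass by its initial value. *)
Lemma stopped_ave_weak stop (W : seq bool -> R) k s : mart W -> (forall t, 0 <= W t) ->
  (forall t, stop t -> 1 <= W t) -> 1 - W s <= stopped_ave stop k (fun=> 1) s.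
Proof.
move=> mW W0 Wst; elim: k s => [|k IH] s /=; have [ss|_] := boolP (stop s).
- by have := Wst s ss; lra.
- by have := W0 s; lra.
- by have := Wst s ss; lra.
- by have := IH (true :: s); have := IH (false :: s); rewrite (mW s); lra.
Qed.

Lemma stopped_ave_le stop k a b s : (forall t, a t <= b t) ->
  stopped_ave stop k a s <= stopped_ave stop k b s.
Proof.
move=> ab; elim: k s => [|k IH] s /=; case: ifP => //= _.
by have := IH (true :: s); have := IH (false :: s); lra.
Qed.

Lemma stopped_ave_lin stop k (x y : R) a b s :
  stopped_ave stop k (fun t => x * a t + y * b t) s =
  x * stopped_ave stop k a s + y * stopped_ave stop k b s.
Proof. by elim: k s => [|k IH] s /=; case: ifP => _; rewrite ?IH; lra. Qed.

Lemma stopped_ave_mart stop k a s : mart a -> (forall t, 0 <= a t) ->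
  stopped_ave stop k a s <= a s.
Proof.
move=> ma a0; elim: k s => [|k IH] s /=; case: ifP => // _.
by rewrite (ma s); have := IH (true :: s); have := IH (false :: s); lra.
Qed.

(** Since nu ka >= 1, the arithmetic-geometric inequality gives 1 <= ka(s) nu + ka / (4 ka(s)).
    Averaged over the unstopped part, the last term contributes at most 1/4 of the available 1/2,
    and nu(s) ka(s) <= A concludes. *)
Lemma stopped_ave_A2 stop k nu ka (A : R) s : mart ka ->
  (forall t, 0 < nu t) -> (forall t, 0 < ka t) ->
  (forall t, 1 <= nu t * ka t <= A) ->
  2^-1 <= stopped_ave stop k (fun=> 1) s ->
  nu s <= 4 * A * stopped_ave stop k nu s.
Proof.
move=> mka nu0 ka0 nk half.
have k0 := ka0 s.
have H : stopped_ave stop k (fun=> 1) s <=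
    ka s * stopped_ave stop k nu s + (4 * ka s)^-1 * stopped_ave stop k ka s.
  rewrite -stopped_ave_lin; apply: stopped_ave_le => t.
  have /andP[nk1 _] := nk t; have := nu0 t; have := ka0 t; move=> kt nt.
  rewrite -(ler_pM2l (_ : 0 < 4 * ka s)); last lra.
  rewrite mulrDr [_ * (_^-1 * _)]mulrA divff ?mul1r; last by lra.
  rewrite -(ler_pM2l nt); have := sqr_ge0 (2 * ka s * nu t - 1); nra.
have un0 : 0 <= stopped_ave stop k nu s.
  elim: (k) s {half k0 H} => [|j IH] s /=; case: ifP => // _; first exact: ltW.
  by rewrite mulr_ge0 ?addr_ge0.
have h4 : (4 * ka s)^-1 * stopped_ave stop k ka s <= 4^-1.
  have := stopped_ave_mart stop k s mka (fun t => ltW (ka0 t)).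
  rewrite -(@ler_pM2l _ (4 * ka s)^-1) ?invr_gt0; last lra.
  by have -> : (4 * ka s)^-1 * ka s = 4^-1 by field; lra.
have /andP[nk1 nkA] := nk s.
have h5 : 4^-1 <= ka s * stopped_ave stop k nu s by lra.
have := ler_wpM2l (ltW (nu0 s)) h5; have := ler_wpM2r un0 nkA; lra.
Qed.

(* Stopping-time proof: inside a stopping tree the martingales [f], [b] and [G]
   are bounded by their initial size, so that Cauchy-Schwarz applies; the part of
   the root not covered by the stopping nodes carries a fixed fraction of [nu]. *)
Lemma paraproduct_bound f F b th G Ga nu ka X Y (A : R) :
  mart f -> mart F -> (forall s, `|f s| <= F s) ->
  mart b -> (forall Q, exists2 H, mart H /\ (forall s, `|b s - b Q| <= H s)
                                & H Q <= th Q) ->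
  mart G -> (forall s, 0 <= G s) ->
  mart nu -> mart ka -> (forall s, 0 < nu s) -> (forall s, 0 < ka s) ->
  (forall s, 1 <= nu s * ka s <= A) ->
  (forall s, th s * G s <= Ga s * nu s) -> (forall s, 0 <= Ga s) ->
  (forall s, F s <= X s) -> (forall c s, X s <= X (c :: s)) ->
  (forall s, Ga s <= Y s) -> (forall c s, Y s <= Y (c :: s)) ->
  forall k Q, nsum k (fun s => osc f s * osc b s * G s) Q <=
    72 * 48 * 48 * A * ave k (fun s => X s * Y s * nu s) Q.
Proof.
move=> mf mF fF mb bH mG G0 mnu mka nu0 ka0 nk thG Ga0 FX Xm GY Ym.
have F0 s : 0 <= F s by rewrite (le_trans _ (fF s)).
have X0 s : 0 <= X s by rewrite (le_trans _ (FX s)).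
have Y0 s : 0 <= Y s by rewrite (le_trans _ (GY s)).
have A1 : 1 <= A by have /andP[] := nk [::]; exact: le_trans.
pose tau s := osc f s * osc b s * G s; rewrite -/tau.
pose E k := ave k (fun s => X s * Y s * nu s).
have E0 k s : 0 <= E k s.
  by apply: ave_ge0 => t _; rewrite !mulr_ge0// ltW.
move=> k Q; have [n] := ubnP k; elim: n k Q => // n IHn k Q kn.
have [H [mH bHs] HQ] := bH Q.
have H0 s : 0 <= H s by rewrite (le_trans _ (bHs s)).
have th0 : 0 <= th Q by rewrite (le_trans _ HQ).
have oscf s : osc f s <= 5 * F s by exact: osc_le.
have difb s : dif b s = dif (fun t => b t - b Q) s by rewrite /dif; lra.
have mbQ : mart (fun t => b t - b Q) by move=> s; rewrite (mb s); lra.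
have oscb s : osc b s <= 5 * H s by rewrite /osc !difb; exact: osc_le.
have rhs0 : 0 <= 72 * 48 * 48 * A * E k Q by rewrite !mulr_ge0//; lra.
have [FQ0|FQ] := eqVneq (F Q) 0.
  rewrite (@nsum_eq0 tau F) // => t Ft; rewrite /tau; have := oscf t.
  have := osc_ge0 f t; rewrite Ft => o1 o2.
  by have -> : osc f t = 0 by [lra]; rewrite !mul0r.
have [GQ0|GQ] := eqVneq (G Q) 0.
  by rewrite (@nsum_eq0 tau G) // => t Gt; rewrite /tau Gt mulr0.
have [thQ0|thQ] := eqVneq (th Q) 0.
  rewrite (@nsum_eq0 tau H) //; last by have := H0 Q; lra.
  move=> t Ht; rewrite /tau; have := oscb t.
  have := osc_ge0 b t; rewrite Ht => o1 o2.
  by have -> : osc b t = 0 by [lra]; rewrite mulr0 mul0r.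
have {}FQ : 0 < F Q by rewrite lt_def FQ F0.
have {}GQ : 0 < G Q by rewrite lt_def GQ G0.
have {}thQ : 0 < th Q by rewrite lt_def thQ th0.
(* The ratio 6 makes each of the three conditions hold on at most a sixth of the mass, as the
   martingale [W] below records; at least half of the root is never stopped. *)
pose stop s := [|| 6 * F Q < F s, 6 * G Q < G s | 6 * th Q < H s].
have nstop s : ~~ stop s -> [/\ F s <= 6 * F Q, G s <= 6 * G Q & H s <= 6 * th Q].
  by rewrite !negb_or -!leNgt => /and3P.
have QN : ~~ stop Q by rewrite !negb_or -!leNgt; apply/and3P; split; lra.
pose W s := (6 * F Q)^-1 * F s + (6 * G Q)^-1 * G s + (6 * th Q)^-1 * H s.
have half : 2^-1 <= stopped_ave stop k (fun=> 1) Q.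
  have W0 s : 0 <= W s by rewrite !addr_ge0// mulr_ge0// invr_ge0; lra.
  apply: le_trans (@stopped_ave_weak stop W k Q _ W0 _).
  - have -> : W Q = 6^-1 + 6^-1 + (6 * th Q)^-1 * H Q by rewrite /W; field; lra.
    have : (6 * th Q)^-1 * H Q <= 6^-1.
      by rewrite -(@ler_pM2l _ (6 * th Q)) ?mulrA ?divff; lra.
    lra.
  - by move=> s; rewrite /W (mF s) (mG s) (mH s); lra.
  - have big (x y : R) : 0 < x -> x < y -> 1 <= x^-1 * y.
      by move=> x0 xy; rewrite mulrC ler_pdivlMr// mul1r ltW.
    have pos (x y : R) : 0 < x -> 0 <= y -> 0 <= (6 * x)^-1 * y.
      by move=> x0 y0; rewrite mulr_ge0// invr_ge0; lra.
    move=> s; rewrite /W; have := pos _ _ FQ (F0 s); have := pos _ _ GQ (G0 s).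
    have := pos _ _ thQ (H0 s); move=> p1 p2 p3.
    by case/or3P => /big; lra.
have nuQ := stopped_ave_A2 mka nu0 ka0 nk half.
have tree : stopped_sum stop k tau Q <= 18 * 48 * 48 * (G Q * F Q * th Q).
  (* This ratio balances Cauchy-Schwarz: both energies become the same multiple of [F Q * th Q]. *)
  pose t := th Q / F Q.
  have t0 : 0 < t by rewrite divr_gt0.
  have cs s j : stopped_sum stop j tau s <= 18 * G Q *
      (t * stopped_sum stop j (osc2 f) s + t^-1 * stopped_sum stop j (osc2 b) s).
    elim: j s => [|j IH] s /=; have [ss|/nstop[_ Gs _]] := boolP (stop s); rewrite ?mulr0 ?addr0 ?mulr0//.
    suff : tau s <= 18 * G Q * (t * osc2 f s + t^-1 * osc2 b s).
      by have := IH (true :: s); have := IH (false :: s); lra.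
    apply: (@le_trans _ _ (osc f s * osc b s * (6 * G Q))).
      by rewrite ler_wpM2l// mulr_ge0 ?osc_ge0.
    have h : osc f s * osc b s <= 3 * (t * osc2 f s + t^-1 * osc2 b s).
      have ti0 : 0 < t^-1 by rewrite invr_gt0.
      have := ler_wpM2l (ltW t0) (osc_sqr f s).
      have := ler_wpM2l (ltW ti0) (osc_sqr b s).
      have : 0 <= t * (osc f s - t^-1 * osc b s) ^+ 2 by rewrite mulr_ge0 ?sqr_ge0// ltW.
      have -> : t * (osc f s - t^-1 * osc b s) ^+ 2 =
        t * osc f s ^+ 2 - 2 * (osc f s * osc b s) + t^-1 * osc b s ^+ 2 by field; lra.
      lra.
    by have := ler_wpM2l (ltW GQ) h; lra.
  apply: (le_trans (cs Q k)).
  have s1 : stopped_sum stop k (osc2 f) Q <= 24 * 48 * F Q ^+ 2.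
    apply: le_trans (@stopped_sum_osc2 stop f F (F Q) k Q mf mF fF _ _) _.
    - by move=> s /nstop[].
    - lra.
    - have := sqr_ge0 (f Q); have := sqr_ge0 (f (true :: Q)).
      by have := sqr_ge0 (f (false :: Q)); lra.
  have s2 : stopped_sum stop k (osc2 b) Q <= 24 * 48 * th Q ^+ 2.
    have -> : osc2 b = osc2 (fun s => b s - b Q).
      by apply/funext => s; rewrite /osc2 !difb.
    apply: le_trans (@stopped_sum_osc2 stop _ H (th Q) k Q mbQ mH bHs _ _) _.
    - by move=> s /nstop[].
    - lra.
    - have := sqr_ge0 (b Q - b Q); have := sqr_ge0 (b (true :: Q) - b Q).
      by have := sqr_ge0 (b (false :: Q) - b Q); lra.
  have ti0 : 0 < t^-1 by rewrite invr_gt0.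
  have := ler_wpM2l (ltW t0) s1; have := ler_wpM2l (ltW ti0) s2.
  have -> : t^-1 * (24 * 48 * th Q ^+ 2) = 24 * 48 * (F Q * th Q) by rewrite /t; field; lra.
  have -> : t * (24 * 48 * F Q ^+ 2) = 24 * 48 * (F Q * th Q) by rewrite /t; field; lra.
  move=> h1 h2.
  have : t * stopped_sum stop k (osc2 f) Q + t^-1 * stopped_sum stop k (osc2 b) Q
    <= 48 * 48 * (F Q * th Q) by lra.
  by move=> /(ler_wpM2l (ltW GQ)); lra.
pose B := F Q * Ga Q.
have B0 : 0 <= B by rewrite mulr_ge0.
(* Subtrees hanging from stopping nodes are covered by the induction on height. On the unstopped
   leaves the increasing processes satisfy X Y >= [B], so the part of [E] found there pays for the
   stopping tree of [Q]. *)
have rest j s : (j < n)%N -> F Q <= X s -> Ga Q <= Y s ->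
    nsum j tau s <= stopped_sum stop j tau s +
      72 * 48 * 48 * A * (E j s - B * stopped_ave stop j nu s).
  elim: j s => [|j IH] s jn FXs GYs.
    have -> : stopped_sum stop 0 tau s = 0 by rewrite /=; case: ifP.
    rewrite add0r mulr_ge0//; first by rewrite mulr_ge0//; lra.
    have XY : B <= X s * Y s by rewrite ler_pM.
    have := ler_wpM2r (ltW (nu0 s)) XY; rewrite /E /=; case: ifP => _; last by lra.
    by rewrite mulr0 subr0 => _; rewrite !mulr_ge0// ltW.
  have [ss|ss] := boolP (stop s).
    have -> : stopped_sum stop j.+1 tau s = 0 by rewrite /= ss.
    have -> : stopped_ave stop j.+1 nu s = 0 by rewrite /= ss.
    by rewrite add0r mulr0 subr0; exact: IHn.
  have jn' := ltnW jn.
  have h1 := IH (true :: s) jn' (le_trans FXs (Xm _ _)) (le_trans GYs (Ym _ _)).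
  have h2 := IH (false :: s) jn' (le_trans FXs (Xm _ _)) (le_trans GYs (Ym _ _)).
  rewrite /E /= (negbTE ss) -/(E j (true :: s)) -/(E j (false :: s)).
  lra.
(* The root has full height, so the induction hypothesis is out of reach for it; being unstopped, it
   is opened once and [rest] is applied to its children. *)
have total : nsum k tau Q <= stopped_sum stop k tau Q +
    72 * 48 * 48 * A * (E k Q - B * stopped_ave stop k nu Q).
  case: k kn {rhs0 half nuQ tree} => [|k] kn.
    have -> : stopped_sum stop 0 tau Q = 0 by rewrite /= (negbTE QN).
    rewrite add0r mulr_ge0//; first by rewrite mulr_ge0//; lra.
    have XY : B <= X Q * Y Q by rewrite ler_pM.
    have := ler_wpM2r (ltW (nu0 Q)) XY; rewrite /E /= (negbTE QN); lra.
  have kn' : (k < n)%N by [].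
  have h1 := rest k (true :: Q) kn' (le_trans (FX Q) (Xm _ _)) (le_trans (GY Q) (Ym _ _)).
  have h2 := rest k (false :: Q) kn' (le_trans (FX Q) (Xm _ _)) (le_trans (GY Q) (Ym _ _)).
  rewrite /E /= (negbTE QN) -/(E k (true :: Q)) -/(E k (false :: Q)); lra.
rewrite -/(E k Q); apply: (le_trans total).
suff : stopped_sum stop k tau Q <= 72 * 48 * 48 * A * (B * stopped_ave stop k nu Q).
  by lra.
apply: (le_trans tree).
have := ler_wpM2l (F0 Q) (thG Q); have := ler_wpM2l B0 nuQ; rewrite /B; lra.
Qed.

End Paraproduct.

(** * The shift as a martingale transform *)

Section ShiftProcess.
Context {R : realType}.
Implicit Types (c f g b F phi Phi : seq bool -> R) (s : seq bool) (k n : nat).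

(* The Haar coefficient (up to normalisation) at the interval [s] of the shift of
   [f] with multipliers [c]: it comes from the sibling of [s]. *)
Definition epend c f s : R :=
  if s is e :: s' then c s' * (if e then -1 else 1) * dif f (~~ e :: s') else 0.

(* The martingale of the shift of [f]. *)
Fixpoint sproc c f s : R :=
  if s is e :: s' then sproc c f s' + (if e then 1 else -1) * epend c f s' else 0.

Lemma mart_sproc c f : mart (sproc c f).
Proof. by move=> s /=; lra. Qed.

Lemma dif_sproc c f s : dif (sproc c f) s = epend c f s.
Proof. by rewrite /dif /=; lra. Qed.

Lemma sprocB c f g s : sproc c (fun t => f t - g t) s = sproc c f s - sproc c g s.
Proof.
elim: s => [|e s IH] /=; first by rewrite subr0.
by rewrite IH; case: s {IH} => [|e' s] /=; rewrite /dif; lra.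
Qed.

Lemma epend_le c f s e : (forall t, `|c t| <= 1) ->
  `|epend c f (e :: s)| <= `|dif f (~~ e :: s)|.
Proof.
move=> c1; rewrite /epend !normrM.
have -> : `|(if e then -1 else 1) : R| = 1 by case: e; rewrite ?normrN normr1.
by rewrite mulr1 ler_piMl.
Qed.

Lemma dif_le_osc f s e : `|dif f (e :: s)| <= osc f s.
Proof.
rewrite /osc; have := normr_ge0 (dif f s); have := normr_ge0 (dif f (true :: s)).
by have := normr_ge0 (dif f (false :: s)); case: e; lra.
Qed.

Lemma dif_le_osc0 f s : `|dif f s| <= osc f s.
Proof.
rewrite /osc; have := normr_ge0 (dif f (true :: s)).
by have := normr_ge0 (dif f (false :: s)); lra.
Qed.

(** Every node except the root is charged to its parent: the mean over two children matches the
    halved weight of their level. *)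
Lemma nsum_regroup k (T U : seq bool -> R) s : (forall t, 0 <= T t) ->
  (forall e t, T (e :: t) <= U t) -> nsum k T s <= T s + nsum k U s.
Proof.
move=> T0 TU; elim: k s => [|k IH] s /=; first by rewrite addr0.
have := TU true s; have := TU false s.
by have := IH (true :: s); have := IH (false :: s); lra.
Qed.

Lemma nsum_epend k c f g : (forall t, `|c t| <= 1) ->
  nsum k (fun s => `|epend c f s * dif g s|) [::] <=
  nsum k (fun s => osc f s * osc g s) [::].
Proof.
move=> c1; have := @nsum_regroup k (fun s => `|epend c f s * dif g s|)
  (fun s => osc f s * osc g s) [::] (fun t => normr_ge0 _).
rewrite /= mul0r normr0 add0r; apply => e t; rewrite normrM ler_pM//.
  by rewrite (le_trans (epend_le _ _ _ c1))// dif_le_osc.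
by rewrite dif_le_osc.
Qed.

Lemma ave_sproc n c f phi : mart phi ->
  ave n (fun s => sproc c f s * phi s) [::] =
  nsum n (fun s => epend c f s * dif phi s) [::].
Proof.
move=> mphi; rewrite ave_prod_mart//; last exact: mart_sproc.
by rewrite /= mul0r add0r; apply: eq_nsum => t _; rewrite dif_sproc.
Qed.

Lemma mart_const (x : R) : mart (fun=> x).
Proof. by move=> s; lra. Qed.

Lemma martD f g : mart f -> mart g -> mart (fun s => f s + g s).
Proof. by move=> mf mg s; rewrite (mf s) (mg s); lra. Qed.

Lemma ave_rmax_prod (p q t : R) F (G P S nu : seq bool -> R) n : conjugate p q -> 0 < t ->
  (forall s, 0 <= F s) -> (forall s, 0 <= G s) ->
  (forall s, 0 < P s) -> (forall s, 0 < S s) -> (forall s, nu s <= P s * S s) ->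
  ave n (fun s => rmax F s * rmax G s * nu s) [::] <=
    t `^ p * ave n (fun s => (rmax F s * P s) `^ p) [::] +
    t `^ (- q) * ave n (fun s => (rmax G s * S s) `^ q) [::].
Proof.
move=> pq t0 F0 G0 P0 S0 nuPS; rewrite -ave_lin; apply: ave_le => s _.
have X0 := rmax_ge0 s F0; have Y0 := rmax_ge0 s G0.
apply: (@le_trans _ _ ((rmax F s * P s) * (rmax G s * S s))).
  by rewrite mulrACA ler_wpM2l// mulr_ge0.
by apply: young_scaled => //; rewrite mulr_ge0// ltW.
Qed.

(** The trilinear estimate with [nu] and [ka] equal to 1, [g] in the role of [b] and third factor 1.
    The deviation of [g] from its value at [Q] is at most [G s + G Q], whence the factor 2 between
    72 and 144. *)
Lemma bilinear_bound f F g (G : seq bool -> R) k : mart f -> mart F -> (forall s, `|f s| <= F s) ->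
  mart g -> mart G -> (forall s, `|g s| <= G s) ->
  nsum k (fun s => osc f s * osc g s) [::] <=
    144 * 48 * 48 * ave k (fun s => rmax F s * rmax G s) [::].
Proof.
move=> mf mF fF mg mG gG.
have G0 s : 0 <= G s by rewrite (le_trans _ (gG s)).
have c1 := @mart_const 1.
have gH Q : exists2 H, mart H /\ (forall s, `|g s - g Q| <= H s) & H Q <= 2 * G Q.
  exists (fun s => G s + G Q); last by lra.
  split; first by apply: martD => //; exact: mart_const.
  by move=> s; rewrite (le_trans (ler_normB _ _))// lerD.
have := @paraproduct_bound R f F g (fun s => 2 * G s) (fun=> 1) (fun s => 2 * G s)
  (fun=> 1) (fun=> 1) (rmax F) (fun s => 2 * rmax G s) 1 mf mF fF mg gH c1
  (fun=> ler01) c1 c1 (fun=> ltr01) (fun=> ltr01).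
have h11 (s : seq bool) : (1 : R) <= (1 : R) * (1 : R) <= (1 : R) by apply/andP; split; lra.
have h0 s : 0 <= 2 * G s by rewrite mulr_ge0.
move=> /(_ h11 (fun s => lexx _) h0 (rmax_ge F) (fun e s => rmax_mono F s e)).
have h2 s : 2 * G s <= 2 * rmax G s by rewrite ler_pM2l ?rmax_ge.
have h3 e s : 2 * rmax G s <= 2 * rmax G (e :: s) by rewrite ler_pM2l ?rmax_mono.
move=> /(_ h2 h3 k [::]).
under eq_nsum do rewrite mulr1.
have -> : ave k (fun s => rmax F s * (2 * rmax G s) * 1) [::] =
    2 * ave k (fun s => rmax F s * rmax G s) [::].
  by rewrite -aveZ; apply: eq_ave => t _; ring.
by clear h11; lra.
Qed.

(** Duality: the transform is tested against the function that realises its own weighted norm [Z];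
    the pairing is bounded by running maxima, and the maximal theorem for the weight and for its
    dual lets [Z] be absorbed. *)
Lemma sproc_weighted (p q A : R) : conjugate p q -> 1 <= A -> exists2 C, 0 < C &
  forall (P S : seq bool -> R) c f F n, Ap_pair p q A P S -> mart f -> mart F ->
    (forall s, `|f s| <= F s) -> (forall s, `|c s| <= 1) ->
  ave n (fun s => (`|sproc c f s| * P s) `^ p) [::] <=
    C * ave n (fun s => (F s / S s) `^ p) [::].
Proof.
move=> pq A1; have qp := conjugate_sym pq; case: (pq) => p1 q1 _.
have [C1 C10 max1] := rmax_weighted pq A1.
have [C2 C20 max2] := rmax_weighted qp A1.
pose K : R := 144 * 48 * 48.
have K0 : 0 < K by rewrite /K; lra.
have KC2 : 0 < K * C2 by rewrite mulr_gt0.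
have [t t0 tE] := half_scale q1 KC2.
exists (2 * K * t `^ (- p) * C1); first by rewrite !mulr_gt0 ?powR_gt0//; lra.
move=> P S c f F n AP mf mF fF c1; case: (AP) => mP mS P0 S0 PS.
have F0 s : 0 <= F s by rewrite (le_trans _ (fF s)).
pose v := sproc c f.
(* Extremal: [v s * phi0 s] is the p-th power in [Z], while the dual weighted norm of [phi0] is
   controlled by [Z] itself. *)
pose phi0 s := Num.sg (v s) * (`|v s| * P s) `^ (p - 1) * P s.
pose phi := clos n phi0; pose Phi := clos n (fun s => `|phi0 s|).
have Phi0 s : 0 <= Phi s by exact: clos_ge0.
pose Z := ave n (fun s => (`|v s| * P s) `^ p) [::].
have ZE : Z = ave n (fun s => v s * phi s) [::].
  apply: eq_ave => s sn; rewrite /phi clos_leaf // /phi0.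
  rewrite -(@mulr_powRB1 _ (`|v s| * P s)); [|by rewrite mulr_ge0// ltW|lra].
  by set r := _ `^ (p - 1); rewrite normrEsg; ring.
have Z1 : Z <= K * ave n (fun s => rmax F s * rmax Phi s) [::].
  rewrite ZE ave_sproc; last exact: mart_clos.
  rewrite (le_trans (ler_norm _))// (le_trans (nsum_norm _ _ _))//.
  rewrite (le_trans (nsum_epend _ _ _ c1))//.
  apply: bilinear_bound => //; try exact: mart_clos.
  by move=> s; exact: clos_norm.
have Z2 : ave n (fun s => (Phi s / P s) `^ q) [::] <= Z.
  apply: ave_le => s sn; rewrite -(pow_conj pq) ?mulr_ge0 ?(ltW (P0 s))//.
  rewrite ge0_ler_powR ?nnegrE ?divr_ge0 ?powR_ge0 ?(ltW (P0 s))//; first lra.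
  rewrite ler_pdivrMr// /Phi clos_leaf// /phi0 !normrM.
  rewrite [X in _ * X]ger0_norm ?(ltW (P0 s))// ler_wpM2r ?(ltW (P0 s))//.
  rewrite [X in _ * X]ger0_norm ?powR_ge0// ler_piMl ?powR_ge0//.
  by rewrite normr_sg lern1 leq_b1.
have Z3 : ave n (fun s => rmax F s * rmax Phi s) [::] <=
    t `^ (- p) * ave n (fun s => (rmax F s * P s) `^ p) [::] +
    t `^ q * ave n (fun s => (rmax Phi s * S s) `^ q) [::].
  rewrite -ave_lin; apply: ave_le => s _.
  have X0 := rmax_ge0 s F0; have Y0 := rmax_ge0 s Phi0.
  apply: (@le_trans _ _ ((rmax F s * P s) * (rmax Phi s * S s))).
    rewrite mulrACA ler_peMr ?mulr_ge0//; by have /andP[] := PS s.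
  by apply: young_scaled_dual => //; rewrite mulr_ge0// ltW.
have M1 := max1 P S F n AP mF F0.
have M2 := max2 S P Phi n (Ap_pair_sym AP) (mart_clos _ _) Phi0.
have tp0 : 0 < t `^ (- p) by rewrite powR_gt0.
have tq0 : 0 < t `^ q by rewrite powR_gt0.
have {}M2 := le_trans M2 (ler_wpM2l (ltW C20) Z2).
have := ler_wpM2l (ltW tp0) M1; have := ler_wpM2l (ltW tq0) M2 => m2 m1.
have {Z3}Z4 := le_trans Z1 (ler_wpM2l (ltW K0) (le_trans Z3 (lerD m1 m2))).
have e : K * (t `^ q * (C2 * Z)) = 2^-1 * Z by rewrite -tE; ring.
rewrite -/Z; move: Z4; rewrite mulrDr e; lra.
Qed.

End ShiftProcess.

(** * Expansion and estimate of the commutator on a finite tree *)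

Section Commutator.
Context {R : realType}.
Implicit Types (b f g phi F Phi G nu ka P S : seq bool -> R) (s : seq bool).

Local Notation one := (fun=> 1 : R).
Local Notation sh := (sproc one).
Local Notation ep := (epend one).

(** The two children of a node contribute the same product, symmetric in the siblings, with opposite
    signs; at the root both terms are 0 by definition. *)
Lemma antisymmetric_epend k g phi :
  nsum k (fun s => ep g s * dif phi s + dif g s * ep phi s) [::] = 0.
Proof.
pose W s := ep g s * dif phi s + dif g s * ep phi s; rewrite -/W.
have H j s : nsum j.+1 W s = W s.
  elim: j s => [|j IH] s; first by rewrite /=; lra.
  have -> : nsum j.+2 W s = W s + (nsum j.+1 W (true :: s) + nsum j.+1 W (false :: s)) / 2 by [].
  by rewrite !IH /W /=; lra.
case: k => [|k] //; rewrite H /W /=; lra.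
Qed.

(** The diagonal part of the product below [s]: what conditional expectation of the product adds to
    the product of the values, by [clos_prod]. *)
Definition trace n b f s := nsum (n - size s) (fun t => dif b t * dif f t) s.

Lemma clos_prod n b f s : mart b -> mart f -> (size s <= n)%N ->
  clos n (fun t => b t * f t) s = b s * f s + trace n b f s.
Proof. by move=> mb mf sn; rewrite /clos sn ave_prod_mart. Qed.

Lemma traceE n b f s : (size s < n)%N ->
  trace n b f s = dif b s * dif f s + (trace n b f (true :: s) + trace n b f (false :: s)) / 2.
Proof. by move=> sn; rewrite /trace /= -(subnSK sn). Qed.

(** Summation by parts for the martingale [sh phi] and the process [trace], which is 0 at depth [n]
    and whose mean decrease at [s] is [dif b s * dif f s]. *)
Lemma nsum_epend_trace n b f phi :
  nsum n (fun s => ep phi s * dif (trace n b f) s) [::] =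
  nsum n (fun s => sh phi s * (dif b s * dif f s)) [::].
Proof.
have := @ave_prod R (sh phi) (trace n b f) n [::] (mart_sproc _ _).
rewrite (@eq_ave _ _ _ (fun=> 0)) => [|s sn]; last first.
  by rewrite /trace sn add0n subnn /= mulr0.
rewrite ave_mart; last exact: mart_const.
rewrite /= mul0r add0r => /esym.
rewrite (@eq_nsum _ _ _ (fun s => 1 * (ep phi s * dif (trace n b f) s) +
   -1 * (sh phi s * (dif b s * dif f s)))) => [|s sn]; last first.
  by rewrite dif_sproc (traceE _ _ sn); lra.
by rewrite nsum_lin; lra.
Qed.

Lemma dif_prod b f s :
  mart b -> mart f -> dif (fun t => b t * f t) s = b s * dif f s + f s * dif b s.
Proof. by move=> mb mf; rewrite /dif (mb s) (mf s); lra. Qed.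

Lemma dif_clos_prod n b f s : mart b -> mart f -> (size s < n)%N ->
  dif (clos n (fun t => b t * f t)) s =
  b s * dif f s + f s * dif b s + dif (trace n b f) s.
Proof.
move=> mb mf sn; rewrite -dif_prod// {1}/dif !clos_prod// /dif; lra.
Qed.

(* What remains of the commutator once the two trace terms are removed; only
   oscillations of [b] enter. *)
Definition comm_term b f phi s : R :=
  if s is e :: s' then (if e then -1 else 1) *
    ((b (~~ e :: s') - b s) * dif f (~~ e :: s') * dif phi s
     + f (~~ e :: s') * dif b (~~ e :: s') * dif phi s
     - phi s * dif f (~~ e :: s') * dif b s) else 0.

(** Differences of b f and of b phi are pointwise products plus differences of traces. The products
    combine to [comm_term]; antisymmetry moves the shift from the trace of b f to [phi], and
    summation by parts turns both trace terms into sums against [dif b]. *)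
Lemma commutator_expansion n b f phi : mart b -> mart f -> mart phi ->
  ave n (fun s => (sh (clos n (fun t => b t * f t)) s - b s * sh f s) * phi s) [::] =
  nsum n (comm_term b f phi) [::]
  - nsum n (fun s => sh phi s * (dif b s * dif f s)) [::]
  - nsum n (fun s => sh f s * (dif b s * dif phi s)) [::].
Proof.
move=> mb mf mp; set h := clos n (fun t => b t * f t).
pose k := clos n (fun t => b t * phi t).
have -> : ave n (fun s => (sh h s - b s * sh f s) * phi s) [::] =
    ave n (fun s => sh h s * phi s) [::] - ave n (fun s => sh f s * k s) [::].
  by rewrite -aveB; apply: eq_ave => s sn; rewrite /k clos_leaf//; ring.
rewrite !ave_sproc//; last exact: mart_clos.
have anti := antisymmetric_epend n (trace n b f) phi.
have E1 : nsum n (fun s => ep h s * dif phi s) [::] -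
    nsum n (fun s => ep f s * dif k s) [::] =
  nsum n (fun s => 1 * (1 * comm_term b f phi s + 1 * (ep (trace n b f) s * dif phi s))
    + -1 * (ep f s * dif (trace n b phi) s)) [::].
  have -> (x y : R) : x - y = 1 * x + -1 * y by lra.
  rewrite -nsum_lin; apply: eq_nsum => s; rewrite add0n => sn.
  rewrite /k dif_clos_prod//.
  case: s sn => [|e s] sn /=; first by lra.
  rewrite /h dif_clos_prod//.
  by case: e {sn} => /=; lra.
rewrite E1 !nsum_lin nsum_epend_trace.
have : nsum n (fun s => 1 * (ep (trace n b f) s * dif phi s) +
     1 * (ep phi s * dif (trace n b f) s)) [::] = 0.
  by rewrite -[RHS]anti; apply: eq_nsum => t _; ring.
rewrite nsum_lin nsum_epend_trace; lra.
Qed.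

Lemma comm_term_le n b f F phi Phi : mart b -> mart f -> mart F ->
  (forall s, `|f s| <= F s) -> mart phi -> mart Phi -> (forall s, `|phi s| <= Phi s) ->
  `|nsum n (comm_term b f phi) [::]| <=
    6 * nsum n (fun s => osc phi s * osc b s * F s) [::] +
    2 * nsum n (fun s => osc f s * osc b s * Phi s) [::].
Proof.
move=> mb mf mF fF mp mP pP.
have F0 s : 0 <= F s by rewrite (le_trans _ (fF s)).
have P0 s : 0 <= Phi s by rewrite (le_trans _ (pP s)).
rewrite (le_trans (nsum_norm _ _ _))// -nsum_lin.
have := @nsum_regroup R n (fun s => `|comm_term b f phi s|)
  (fun s => 6 * (osc phi s * osc b s * F s) + 2 * (osc f s * osc b s * Phi s)) [::]
  (fun=> normr_ge0 _).
rewrite /= normr0 add0r; apply => e s.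
rewrite normrM (_ : `|(if e then -1 else 1) : R| = 1) ?mul1r; last first.
  by case: e; rewrite ?normrN normr1.
have ob g : `|dif g (e :: s)| <= osc g s by exact: dif_le_osc.
have ob' g : `|dif g (~~ e :: s)| <= osc g s by exact: dif_le_osc.
have Fe : `|dif f (~~ e :: s)| <= 2 * F s.
  by rewrite (le_trans (dif_le _ mF fF))// mart_child2.
have Fe2 : `|f (~~ e :: s)| <= 2 * F s by rewrite (le_trans (fF _))// mart_child2.
have Pe : `|phi (e :: s)| <= 2 * Phi s by rewrite (le_trans (pP _))// mart_child2.
have bb : `|b (~~ e :: s) - b (e :: s)| <= 2 * osc b s.
  have -> : b (~~ e :: s) - b (e :: s) = (if e then -1 else 1) * (2 * dif b s).
    by rewrite /dif; case: e {ob ob' Fe Fe2 Pe} => /=; lra.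
  rewrite normrM (_ : `|(if e then -1 else 1) : R| = 1) ?mul1r; last first.
    by case: e {ob ob' Fe Fe2 Pe}; rewrite ?normrN normr1.
  by rewrite normrM [X in X * _]ger0_norm// ler_pM2l//; exact: dif_le_osc0.
have op := osc_ge0 phi s; have obs := osc_ge0 b s; have off := osc_ge0 f s.
rewrite (le_trans (ler_normB _ _))//.
have -> : 6 * (osc phi s * osc b s * F s) + 2 * (osc f s * osc b s * Phi s) =
  (2 * osc b s * (2 * F s) * osc phi s + 2 * F s * osc b s * osc phi s)
  + 2 * Phi s * osc f s * osc b s by ring.
apply: lerD; last by do 2 rewrite normrM; rewrite !ler_pM ?mulr_ge0.
apply: (le_trans (ler_normD _ _)).
by apply: lerD; do 2 rewrite normrM; rewrite !ler_pM ?mulr_ge0.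
Qed.

(** Four trilinear sums: two from [comm_term], with coefficients 6 and 2, and two from the traces,
    where the closed martingale of the modulus of [sh f] or [sh phi] is the third factor and
    [sproc_weighted] controls it. Each costs the same bound, hence the factor 10. *)
Lemma commutator_form (p q A : R) : conjugate p q -> 1 <= A -> exists2 C, 0 < C &
  forall (Pu Su Pv Sv : seq bool -> R) nu ka b f F phi Phi n (B t : R),
  Ap_pair p q A Pu Su -> Ap_pair p q A Pv Sv ->
  mart nu -> mart ka -> (forall s, 0 < nu s) -> (forall s, 0 < ka s) ->
  (forall s, 1 <= nu s * ka s <= A) -> (forall s, nu s <= Pu s * Sv s) ->
  mart b -> 0 <= B -> (forall Q, exists2 H, mart H /\ (forall s, `|b s - b Q| <= H s)
                                & H Q <= B * nu Q) ->
  mart f -> mart F -> (forall s, `|f s| <= F s) ->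
  mart phi -> mart Phi -> (forall s, `|phi s| <= Phi s) -> 0 < t ->
  `|ave n (fun s => (sh (clos n (fun t => b t * f t)) s - b s * sh f s) * phi s) [::]|
    <= C * B * (t `^ p * ave n (fun s => (F s / Su s) `^ p) [::] +
                t `^ (- q) * ave n (fun s => (Phi s / Pv s) `^ q) [::]).
Proof.
move=> pq A1; have qp := conjugate_sym pq.
have [C1 C10 max1] := rmax_weighted pq A1.
have [C2 C20 max2] := rmax_weighted qp A1.
have [D1 D10 lin1] := sproc_weighted pq A1.
have [D2 D20 lin2] := sproc_weighted qp A1.
pose K : R := 72 * 48 * 48 * A.
have K0 : 0 < K by rewrite /K mulr_gt0//; lra.
pose C0 := C1 + C2 + C1 * D1 + C2 * D2.
have CD1 : 0 < C1 * D1 by rewrite mulr_gt0.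
have CD2 : 0 < C2 * D2 by rewrite mulr_gt0.
have C00 : 0 < C0 by rewrite /C0; lra.
exists (10 * K * C0); first by rewrite !mulr_gt0//; lra.
move=> Pu Su Pv Sv nu ka b f F phi Phi n B t APu APv mnu mka nu0 ka0 nk nuPS
  mb B0 bH mf mF fF mp mPhi pP t0.
have F0 s : 0 <= F s by rewrite (le_trans _ (fF s)).
have Phi0 s : 0 <= Phi s by rewrite (le_trans _ (pP s)).
case: (APu) => _ _ Pu0 Su0 PSu; case: (APv) => _ _ Pv0 Sv0 PSv.
pose N1 := ave n (fun s => (F s / Su s) `^ p) [::].
pose N2 := ave n (fun s => (Phi s / Pv s) `^ q) [::].
have N10 : 0 <= N1 by apply: ave_ge0 => s _; exact: powR_ge0.
have N20 : 0 <= N2 by apply: ave_ge0 => s _; exact: powR_ge0.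
rewrite -/N1 -/N2.
have tp : 0 < t `^ p by rewrite powR_gt0.
have tq : 0 < t `^ (- q) by rewrite powR_gt0.
have para g G G' : mart g -> mart G -> (forall s, `|g s| <= G s) ->
    mart G' -> (forall s, 0 <= G' s) ->
    nsum n (fun s => osc g s * osc b s * G' s) [::] <=
    K * (B * ave n (fun s => rmax G s * rmax G' s * nu s) [::]).
  move=> mg mG gG mG' G'0.
  have thG s : (B * nu s) * G' s <= (B * G' s) * nu s by rewrite mulrAC.
  have GG s : 0 <= B * G' s by rewrite mulr_ge0.
  have := @paraproduct_bound R g G b (fun s => B * nu s) G' (fun s => B * G' s) nu ka
    (rmax G) (fun s => B * rmax G' s) A mg mG gG mb bH mG' G'0 mnu mka nu0 ka0 nk
    thG GG (rmax_ge G) (fun e s => rmax_mono G s e).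
  have h1 s : B * G' s <= B * rmax G' s by rewrite ler_wpM2l// rmax_ge.
  have h2 e s : B * rmax G' s <= B * rmax G' (e :: s) by rewrite ler_wpM2l// rmax_mono.
  move=> /(_ h1 h2 n [::]); rewrite -/K => /le_trans; apply.
  rewrite ler_wpM2l// ?(ltW K0)// -aveZ; apply: ave_le => s _.
  by rewrite le_eqVlt; apply/orP; left; apply/eqP; ring.
have nuPS' s : nu s <= Sv s * Pu s by rewrite mulrC.
have maxF := max1 Pu Su F n APu mF F0.
have maxPhi := max2 Sv Pv Phi n (Ap_pair_sym APv) mPhi Phi0.
have weak (r x y z : R) : 1 < r -> 0 < x -> 0 < y -> 0 <= z -> 1 <= y * x ->
    (z / x) `^ r <= (z * y) `^ r.
  move=> r1 x0 y0 z0 xy; rewrite ge0_ler_powR ?nnegrE ?divr_ge0 ?mulr_ge0 ?(ltW x0) ?(ltW y0)//; first lra.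
  by rewrite ler_wpM2l// -[x^-1]mul1r ler_pdivrMr.
case: (pq) => p1 q1 _.
pose Gf := clos n (fun s => `|sh f s|); pose Gp := clos n (fun s => `|sh phi s|).
have Gf0 s : 0 <= Gf s by exact: clos_ge0.
have Gp0 s : 0 <= Gp s by exact: clos_ge0.
have one1 (s : seq bool) : `|1 : R| <= 1 by rewrite normr1.
have maxGf : ave n (fun s => (rmax Gf s * Pu s) `^ p) [::] <= C1 * (D1 * N1).
  rewrite (le_trans (max1 Pu Su Gf n APu (mart_clos _ _) Gf0))// ler_pM2l//.
  apply: le_trans (lin1 Pu Su one f F n APu mf mF fF one1).
  apply: ave_le => s sn; rewrite /Gf clos_leaf//; apply: weak => //.
  by have /andP[] := PSu s.
have maxGp : ave n (fun s => (rmax Gp s * Sv s) `^ q) [::] <= C2 * (D2 * N2).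
  rewrite (le_trans (max2 Sv Pv Gp n (Ap_pair_sym APv) (mart_clos _ _) Gp0))// ler_pM2l//.
  apply: le_trans (lin2 Sv Pv one phi Phi n (Ap_pair_sym APv) mp mPhi pP one1).
  apply: ave_le => s sn; rewrite /Gp clos_leaf//; apply: weak => //.
  by rewrite mulrC; have /andP[] := PSv s.
clear one1; have a1 := ave_rmax_prod n pq t0 F0 Phi0 Pu0 Sv0 nuPS.
have a2 := ave_rmax_prod n pq t0 F0 Gp0 Pu0 Sv0 nuPS.
have a3 := ave_rmax_prod n pq t0 Gf0 Phi0 Pu0 Sv0 nuPS.
pose T := t `^ p * N1 + t `^ (- q) * N2.
have tN1 : 0 <= t `^ p * N1 by rewrite mulr_ge0// ltW.
have tN2 : 0 <= t `^ (- q) * N2 by rewrite mulr_ge0// ltW.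
have fin x y c d : 0 < c -> c <= C0 -> 0 < d -> d <= C0 -> x <= c * N1 -> y <= d * N2 ->
    t `^ p * x + t `^ (- q) * y <= C0 * T.
  move=> c0 cC d0 dC xN yN.
  have h1 := ler_wpM2l (ltW tp) xN; have h2 := ler_wpM2l (ltW tq) yN.
  have := ler_wpM2r tN1 cC; have := ler_wpM2r tN2 dC; rewrite /T; lra.
have cC1 : C1 <= C0 by rewrite /C0; lra.
have cC2 : C2 <= C0 by rewrite /C0; lra.
have cD1 : C1 * D1 <= C0 by rewrite /C0; lra.
have cD2 : C2 * D2 <= C0 by rewrite /C0; lra.
rewrite mulrA in maxGf; rewrite mulrA in maxGp.
have {}a1 := le_trans a1 (fin _ _ _ _ C10 cC1 C20 cC2 maxF maxPhi).
have {}a2 := le_trans a2 (fin _ _ _ _ C10 cC1 CD2 cD2 maxF maxGp).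
have {}a3 := le_trans a3 (fin _ _ _ _ CD1 cD1 C20 cC2 maxGf maxPhi).
have KB x : x <= C0 * T -> K * (B * x) <= K * (B * (C0 * T)).
  by move=> xT; rewrite ler_pM2l// ler_wpM2l.
have b1 := le_trans (para f F Phi mf mF fF mPhi Phi0) (KB _ a1).
have b2 : nsum n (fun s => osc phi s * osc b s * F s) [::] <= K * (B * (C0 * T)).
  apply: le_trans (para phi Phi F mp mPhi pP mF F0) (KB _ _).
  apply: le_trans a1; apply: ave_le => s _.
  by rewrite [rmax Phi s * _]mulrC.
have b3 := le_trans (para f F Gp mf mF fF (mart_clos _ _) Gp0) (KB _ a2).
have b4 : nsum n (fun s => osc phi s * osc b s * Gf s) [::] <= K * (B * (C0 * T)).
  apply: le_trans (para phi Phi Gf mp mPhi pP (mart_clos _ _) Gf0) (KB _ _).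
  apply: le_trans a3; apply: ave_le => s _.
  by rewrite [rmax Phi s * _]mulrC.
have trb g h : `|nsum n (fun s => sh h s * (dif b s * dif g s)) [::]| <=
    nsum n (fun s => osc g s * osc b s * clos n (fun s => `|sh h s|) s) [::].
  apply: (le_trans (nsum_norm _ _ _)); apply: nsum_le => s sn.
  rewrite add0n in sn.
  have hc : `|sh h s| <= clos n (fun s => `|sh h s|) s.
    apply: le_trans (clos_norm n (sh h) s).
    by rewrite /clos (ltnW sn) ave_mart//; exact: mart_sproc.
  do 2 rewrite normrM; rewrite mulrC ler_pM ?mulr_ge0// [osc g s * _]mulrC.
  by rewrite ler_pM//; exact: dif_le_osc0.
rewrite commutator_expansion//.
have c1 := comm_term_le n mb mf mF fF mp mPhi pP.
have c2 := trb f phi; have c3 := trb phi f.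
rewrite (le_trans (ler_normB _ _))//.
have := ler_normB (nsum n (comm_term b f phi) [::])
  (nsum n (fun s => sh phi s * (dif b s * dif f s)) [::]).
rewrite -/Gp -/Gf in c2 c3.
move=> h; have -> : 10 * K * C0 * B * T = 10 * (K * (B * (C0 * T))) by ring.
lra.
Qed.

End Commutator.

(** * Dyadic intervals and weights on the line *)

Section Dyadic.
Context {R : realType}.
Implicit Types (I Q : dyadic_index) (s t : seq bool) (a : seq bool -> R).
Local Notation lam := (@lebesgue_measure R).

Lemma eq_lam (D : set R) (f g : R -> \bar R) : (forall x, D x -> f x = g x) ->
  (\int[lam]_(x in D) f x = \int[lam]_(x in D) g x)%E.
Proof. by move=> fg; apply: eq_integral => x /set_mem /fg. Qed.

Lemma dlen_gt0 I : 0 < dlen I :> R.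
Proof. by rewrite exprz_gt0. Qed.

Definition child (e : bool) I := if e then right_half I else left_half I.

Definition node Q s := foldr child Q s.

Lemma dlen_child e I : dlen (child e I) = dlen I / 2 :> R.
Proof. by case: e; rewrite /dlen /= expfzDr ?pnatr_eq0// expN1r. Qed.

Lemma dyadicE I (x : R) :
  dyadic I x = (I.2%:~R * dlen I <= x < (I.2 + 1)%:~R * dlen I) :> Prop.
Proof. by rewrite /dyadic /= in_itv. Qed.

Lemma measurable_dyadic I : measurable (dyadic I : set R).
Proof. exact: measurable_itv. Qed.

Lemma measurable_dyadicR I : measurable (dyadic I : set (measurableTypeR R)).
Proof. exact: measurable_itv. Qed.
Hint Resolve measurable_dyadic measurable_dyadicR : core.

Lemma lebesgue_dyadic I : lam (dyadic I) = (dlen I)%:E.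
Proof.
rewrite /dyadic lebesgue_measure_itv /= lte_fin ltr_pM2r ?dlen_gt0// ltr_int ltrDl ltr01.
by rewrite -EFinD; congr EFin; rewrite intrD; ring.
Qed.

Lemma lebesgue_dyadicM I :
  (lam : {measure set (measurableTypeR R) -> \bar R}) (dyadic I) = (dlen I)%:E.
Proof. exact: lebesgue_dyadic. Qed.

(** Doubling [x] expresses both halves in multiples of [dlen I], so that nesting and disjointness
    become linear arithmetic. *)
Lemma dyadic_child e I (x : R) : dyadic (child e I) x =
  ((2 * I.2 + e%:Z)%:~R * dlen I <= 2 * x < (2 * I.2 + e%:Z + 1)%:~R * dlen I) :> Prop.
Proof.
rewrite dyadicE dlen_child.
have h (m : int) : m%:~R * (dlen I / 2) = (m%:~R * dlen I) / 2 :> R by ring.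
have -> : (child e I).2 = 2 * I.2 + e%:Z by case: e; rewrite /= mulrC ?addr0.
by rewrite !h ler_pdivrMr// ltr_pdivlMr// [x * 2]mulrC.
Qed.

Lemma dyadic_childP e I (x : R) : dyadic (child e I) x ->
  dyadic I x /\ ~ dyadic (child (~~ e) I) x.
Proof.
rewrite !dyadic_child dyadicE.
rewrite !intrD !intrM; have := dlen_gt0 I; set d := dlen I; set m := (I.2)%:~R.
by case: e => /= d0 /andP[h1 h2]; split; [|move=> /andP[h3 h4]| |move=> /andP[h3 h4]]; try (apply/andP; split); lra.
Qed.

Lemma dyadic_cover I (x : R) : dyadic I x ->
  dyadic (child true I) x \/ dyadic (child false I) x.
Proof.
rewrite !dyadic_child dyadicE !intrD !intrM; have := dlen_gt0 I.
set d := dlen I; set m := (I.2)%:~R => d0 /andP[h1 h2].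
have [h|h] := lerP ((2 * m + 1) * d) (2 * x); [left|right]; apply/andP; split => /=; lra.
Qed.

Lemma dyadic_split I : dyadic I = dyadic (child true I) `|` dyadic (child false I) :> set R.
Proof.
apply/seteqP; split => x; first exact: dyadic_cover.
by case=> /dyadic_childP[].
Qed.

Lemma dyadic_disj I : [disjoint (dyadic (child true I) : set R) & dyadic (child false I)].
Proof.
apply/disj_setPS => x [/dyadic_childP[_ /=]]; exact.
Qed.

Lemma node_sub Q s (x : R) : dyadic (node Q s) x -> dyadic Q x.
Proof. by elim: s => //= e s IH /dyadic_childP[/IH]. Qed.

Lemma node_cat Q s t : node Q (s ++ t) = node (node Q t) s.
Proof. by rewrite /node foldr_cat. Qed.

Lemma node_exists Q n (x : R) : dyadic Q x -> exists2 s, size s = n & dyadic (node Q s) x.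
Proof.
move=> Qx; elim: n => [|n [s sn sx]]; first by exists [::].
by have [h|h] := dyadic_cover sx; [exists (true :: s)|exists (false :: s)]; rewrite //= sn.
Qed.

Definition avg (f : R -> R) I : R := (dlen I)^-1 * Rintegral lam (dyadic I) f.

Definition intg (f : R -> R) I := lam.-integrable (dyadic I) (EFin \o f).

Lemma intg_sub f I J : dyadic J `<=` (dyadic I : set R) -> intg f I -> intg f J.
Proof. by move=> JI fI; apply: integrableS fI. Qed.

Lemma intg_child f I e : intg f I -> intg f (child e I).
Proof. by apply: intg_sub => x /dyadic_childP[]. Qed.

Lemma intg_node f Q s : intg f Q -> intg f (node Q s).
Proof. by apply: intg_sub => x /node_sub. Qed.

Lemma avg_child f I : intg f I ->
  avg f I = (avg f (child true I) + avg f (child false I)) / 2.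
Proof.
move=> fI; rewrite /avg !dlen_child [in LHS]dyadic_split Rintegral_setU//.
- by have := dlen_gt0 I => d0; field; lra.
- by rewrite -dyadic_split.
- exact: dyadic_disj.
Qed.

Lemma avg_lin (x y : R) f g I : intg f I -> intg g I ->
  avg (fun z => x * f z + y * g z) I = x * avg f I + y * avg g I.
Proof.
move=> fI gI; rewrite /avg RintegralD//; first by rewrite !RintegralZl//; ring.
- by have := integrableZl (measurable_dyadicR I) x fI.
- by have := integrableZl (measurable_dyadicR I) y gI.
Qed.

Lemma intg_lin (x y : R) f g I : intg f I -> intg g I ->
  intg (fun z => x * f z + y * g z) I.
Proof.
move=> fI gI.
by have := integrableD (measurable_dyadicR I) (integrableZl (measurable_dyadicR I) x fI)
  (integrableZl (measurable_dyadicR I) y gI).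
Qed.

Lemma intgD f g I : intg f I -> intg g I -> intg (fun z => f z + g z) I.
Proof. by move=> fI gI; have := integrableD (measurable_dyadicR I) fI gI. Qed.

Lemma intg_norm f I : intg f I -> intg (fun x => `|f x|) I.
Proof. by move=> fI; exact: integrable_norm. Qed.

Lemma intg_cst (c : R) I : intg (fun=> c) I.
Proof.
apply/integrableP; split; first exact: measurable_cst.
rewrite (eq_integral (fun=> `|c|%:E)) => [|x _]; last by [].
by rewrite integral_cst// lebesgue_dyadicM -EFinM ltry.
Qed.

Lemma avg_cst (c : R) I : avg (fun=> c) I = c.
Proof.
have := Rintegral_cst lam (measurable_dyadicR I) c.
by rewrite /avg => ->; rewrite lebesgue_dyadicM /= mulrCA mulVf ?mulr1// gt_eqF// dlen_gt0.
Qed.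

Lemma avg_le f g I : intg f I -> intg g I -> (forall x, dyadic I x -> f x <= g x) ->
  avg f I <= avg g I.
Proof.
by move=> fI gI fg; rewrite /avg ler_pM2l ?invr_gt0 ?dlen_gt0// le_Rintegral.
Qed.

Lemma avg_norm f I : intg f I -> `|avg f I| <= avg (fun x => `|f x|) I.
Proof.
move=> fI; rewrite /avg normrM gtr0_norm ?invr_gt0 ?dlen_gt0//.
by rewrite ler_pM2l ?invr_gt0 ?dlen_gt0// le_normr_Rintegral.
Qed.

Lemma avg_ge0 f I : (forall x, dyadic I x -> 0 <= f x) -> 0 <= avg f I.
Proof.
by move=> f0; rewrite mulr_ge0 ?invr_ge0 ?(ltW (dlen_gt0 _))// Rintegral_ge0.
Qed.

Lemma integral_avg f I : intg f I -> (forall x, dyadic I x -> 0 <= f x) ->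
  (\int[lam]_(x in dyadic I) (f x)%:E)%E = (dlen I * avg f I)%:E.
Proof.
move=> fI f0; rewrite /avg mulVKf ?gt_eqF ?dlen_gt0// /Rintegral fineK//.
exact: integrable_fin_num.
Qed.

Lemma mart_avg f Q : intg f Q -> mart (fun s => avg f (node Q s)).
Proof. by move=> fQ s; rewrite avg_child//; exact: intg_node. Qed.

End Dyadic.

Section NonnegativeIntegrals.
Context d (T : measurableType d) (R : realType) (m : {measure set T -> \bar R}).
Local Open Scope ereal_scope.

Lemma integral_eq0_ae (D : set T) (f : T -> \bar R) : measurable D ->
  measurable_fun D f -> (forall x, D x -> 0 <= f x) ->
  \int[m]_(x in D) f x <= 0 -> {ae m, forall x, D x -> f x = 0}.
Proof.
move=> mD mf f0 If.
apply/(ae_eq_integral_abs m mD mf); apply/eqP; rewrite eq_le; apply/andP; split.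
  apply: le_trans If; rewrite le_eqVlt; apply/orP; left; apply/eqP.
  by apply: eq_integral => x /set_mem Dx; rewrite gee0_abs// f0.
by apply: integral_ge0 => x Dx; exact: abse_ge0.
Qed.

End NonnegativeIntegrals.

(** * Hoelder's inequality and one-dimensional weights *)

Section Weights.
Context {R : realType}.
Implicit Types (p q : R) (I Q : dyadic_index) (s : seq bool) (a : seq bool -> R).
Local Notation lam := (@lebesgue_measure R).
Hint Resolve measurable_dyadic measurable_dyadicR : core.

(** The choice t = (Y/X)^(1/(pq)) equalises the two terms. If X or Y is 0, a suitable parameter
    bounds a positive z by a quantity strictly below z. *)
Lemma young_optimal p q (z X Y : R) : conjugate p q -> 0 <= X -> 0 <= Y ->
  (forall t, 0 < t -> z <= p^-1 * (t `^ p * X) + q^-1 * (t `^ (- q) * Y)) ->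
  z <= X `^ p^-1 * Y `^ q^-1.
Proof.
move=> pq X0 Y0 H; case: (pq) => p1 q1 pq1.
have pi : 0 < p^-1 <= 1 by rewrite invr_gt0 invf_le1; lra.
have qi : 0 < q^-1 <= 1 by rewrite invr_gt0 invf_le1; lra.
have [X00|X00] := eqVneq X 0.
  rewrite X00 powR0 ?mul0r ?invr_eq0; [|by apply/eqP; lra..].
  rewrite leNgt; apply/negP => z0.
  have d0 : 0 < Y / z + 1 by have : 0 <= Y / z; [rewrite divr_ge0 // ltW|lra].
  have := H ((Y / z + 1) `^ q^-1) (powR_gt0 _ d0).
  rewrite X00 mulr0 mulr0 add0r -powRrM mulrN mulVf ?powR_inv1 ?(ltW d0)//; last by lra.
  have -> : (Y / z + 1)^-1 * Y = z * (Y / (Y + z)) by field; lra.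
  have : Y / (Y + z) < 1 by rewrite ltr_pdivrMr; lra.
  have : 0 <= Y / (Y + z) by rewrite divr_ge0; lra.
  set r := Y / _; move=> r0 r1 zr.
  have : z * r < z * 1 by rewrite ltr_pM2l.
  have : 0 <= z * r by rewrite mulr_ge0// ltW.
  nra.
have [Y00|Y00] := eqVneq Y 0.
  rewrite Y00 [0 `^ _]powR0 ?mulr0 ?invr_eq0; [|by apply/eqP; lra..].
  rewrite leNgt; apply/negP => z0.
  have d0 : 0 < X / z + 1 by have : 0 <= X / z; [rewrite divr_ge0 // ltW|lra].
  have := H ((X / z + 1) `^ - p^-1) (powR_gt0 _ d0).
  rewrite Y00 mulr0 mulr0 addr0 -powRrM mulNr mulVf ?powR_inv1 ?(ltW d0)//; last by lra.
  have -> : (X / z + 1)^-1 * X = z * (X / (X + z)) by field; lra.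
  have : X / (X + z) < 1 by rewrite ltr_pdivrMr; lra.
  have : 0 <= X / (X + z) by rewrite divr_ge0; lra.
  set r := X / _; move=> r0 r1 zr.
  have : z * r < z * 1 by rewrite ltr_pM2l.
  have : 0 <= z * r by rewrite mulr_ge0// ltW.
  nra.
have {X00}X0 : 0 < X by rewrite lt_def X00.
have {Y00}Y0 : 0 < Y by rewrite lt_def Y00.
set al := X `^ p^-1; set be := Y `^ q^-1.
have al0 : 0 < al by rewrite powR_gt0.
have be0 : 0 < be by rewrite powR_gt0.
have XE : X = al `^ p by rewrite /al -powRrM mulVf ?powRr1 ?(ltW X0)//; lra.
have YE : Y = be `^ q by rewrite /be -powRrM mulVf ?powRr1 ?(ltW Y0)//; lra.
clearbody al be.
have tE (r : R) : (be `^ p^-1 / al `^ q^-1) `^ r = be `^ (p^-1 * r) * al `^ (- (q^-1 * r)).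
  rewrite powRM ?powR_ge0 ?invr_ge0 ?powR_ge0// -powRrM; congr (_ * _).
  by rewrite -powRN -powRrM mulNr.
have c := conjugateE pq.
have ci := conjugate_inv pq.
have := H (be `^ p^-1 / al `^ q^-1) (divr_gt0 (powR_gt0 _ be0) (powR_gt0 _ al0)).
rewrite !tE XE YE.
have -> : be `^ (p^-1 * p) * al `^ (- (q^-1 * p)) * al `^ p = be * al.
  rewrite mulVf ?powRr1 ?(ltW be0)//; last lra.
  rewrite -mulrA -powRD ?(gt_eqF al0) ?(gt_eqF be0) ?implybT//; congr (_ * _).
  have -> : - (q^-1 * p) + p = 1 by rewrite (_ : q^-1 = 1 - p^-1); [field|]; lra.
  by rewrite powRr1 // ltW.
have -> : be `^ (p^-1 * - q) * al `^ (- (q^-1 * - q)) * be `^ q = be * al.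
  have -> : - (q^-1 * - q) = 1 by field; lra.
  rewrite powRr1 ?(ltW al0)// mulrAC -powRD ?(gt_eqF al0) ?(gt_eqF be0) ?implybT//; congr (_ * _).
  have -> : p^-1 * - q + q = 1 by rewrite (_ : p^-1 = 1 - q^-1); [field|]; lra.
  by rewrite powRr1 // ltW.
by rewrite -mulrDl ci mul1r mulrC.
Qed.

(** Young's inequality with a parameter is integrated and then optimised; the factor [k]
    accommodates averages. *)
Lemma holder_Rintegral d (T : measurableType d) (m : {measure set T -> \bar R})
    p q (D : set T) (k : R) (a b c : T -> R) : conjugate p q -> measurable D -> 0 <= k ->
  m.-integrable D (EFin \o a) -> m.-integrable D (EFin \o b) ->
  m.-integrable D (EFin \o c) ->
  (forall x, D x -> 0 <= a x) -> (forall x, D x -> 0 <= b x) ->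
  (forall x, D x -> c x <= a x `^ p^-1 * b x `^ q^-1) ->
  k * Rintegral m D c <= (k * Rintegral m D a) `^ p^-1 * (k * Rintegral m D b) `^ q^-1.
Proof.
move=> pq mD k0 ia ib ic a0 b0 cab.
apply: (young_optimal pq).
- by rewrite mulr_ge0// Rintegral_ge0.
- by rewrite mulr_ge0// Rintegral_ge0.
move=> t t0; case: (pq) => p1 q1 _.
have -> : p^-1 * (t `^ p * (k * Rintegral m D a)) + q^-1 * (t `^ (- q) * (k * Rintegral m D b)) =
  k * Rintegral m D (fun x => (p^-1 * t `^ p) * a x + (q^-1 * t `^ (- q)) * b x).
  rewrite RintegralD//.
  - by rewrite !RintegralZl//; ring.
  - by have := integrableZl mD (p^-1 * t `^ p) ia.
  - by have := integrableZl mD (q^-1 * t `^ (- q)) ib.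
rewrite ler_wpM2l// le_Rintegral//.
  by have := integrableD mD (integrableZl mD (p^-1 * t `^ p) ia)
     (integrableZl mD (q^-1 * t `^ (- q)) ib).
move=> x Dx; rewrite (le_trans (cab _ Dx))//.
have := young pq (mulr_ge0 (ltW t0) (powR_ge0 (a x) p^-1))
  (divr_ge0 (powR_ge0 (b x) q^-1) (ltW t0)).
rewrite !powRM ?powR_ge0 ?(ltW t0) ?invr_ge0 ?(ltW t0)// -![(_ `^ _^-1) `^ _]powRrM.
rewrite !mulVf; [|lra..]; rewrite !powRr1 ?a0 ?b0//.
rewrite -[t^-1 `^ q](_ : t `^ (- q) = _); last first.
  by rewrite -[t^-1]powR_inv1 ?(ltW t0)// -powRrM mulN1r.
have -> : t * a x `^ p^-1 * (b x `^ q^-1 / t) = a x `^ p^-1 * b x `^ q^-1 by field; lra.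
lra.
Qed.

Lemma avg_holder p q (a b c : R -> R) I : conjugate p q ->
  intg a I -> intg b I -> intg c I ->
  (forall x, dyadic I x -> 0 <= a x) -> (forall x, dyadic I x -> 0 <= b x) ->
  (forall x, dyadic I x -> c x <= a x `^ p^-1 * b x `^ q^-1) ->
  avg c I <= avg a I `^ p^-1 * avg b I `^ q^-1.
Proof.
move=> pq ia ib ic a0 b0 cab; apply: (holder_Rintegral pq) => //.
by rewrite invr_ge0 ltW ?dlen_gt0.
Qed.

Definition dual p (u : R -> R) x := u x `^ (- (p - 1)^-1).

(* A one-dimensional dyadic [A_p] weight, normalised to be positive everywhere. *)
Definition Ap1 p q (A : R) (u : R -> R) :=
  [/\ measurable_fun setT u, forall x, 0 < u x,
      forall I, intg u I, forall I, intg (dual p u) I &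
      forall I, avg u I `^ p^-1 * avg (dual p u) I `^ q^-1 <= A].

Lemma dual_gt0 p u x : 0 < u x -> 0 < dual p u x.
Proof. exact: powR_gt0. Qed.

Lemma conj_invB p q : conjugate p q -> (p - 1)^-1 = q - 1.
Proof.
move=> [p1 q1 pq]; have h : p - 1 != 0 by lra.
by apply: (mulfI h); rewrite divff.
Qed.

Lemma dual_root p q u x : conjugate p q -> 0 < u x ->
  u x `^ p^-1 * dual p u x `^ q^-1 = 1.
Proof.
move=> pq u0; rewrite /dual (conj_invB pq) -powRrM -powRD ?(gt_eqF u0) ?implybT//.
have := conjugate_inv pq; case: (pq) => p1 q1 _ ci.
have -> : p^-1 + - (q - 1) * q^-1 = p^-1 + q^-1 - 1 by field; lra.
by rewrite ci subrr powRr0.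
Qed.

Lemma dualK p q u x : conjugate p q -> 0 < u x -> dual q (dual p u) x = u x.
Proof.
move=> pq u0; rewrite /dual (conj_invB pq) (conj_invB (conjugate_sym pq)).
by rewrite -powRrM mulrNN mulrC; case: pq => _ _ ->; rewrite powRr1// ltW.
Qed.

Lemma measurable_dual p u : measurable_fun setT u -> measurable_fun setT (dual p u).
Proof. by move=> mu; exact: (measurableT_comp (measurable_powR (- (p - 1)^-1)) mu). Qed.

Lemma Ap1_dual p q A u : conjugate p q -> Ap1 p q A u -> Ap1 q p A (dual p u).
Proof.
move=> pq [mu u0 iu iv Au].
have E : dual q (dual p u) = u by apply/funext => x; rewrite (dualK pq).
split.
- exact: measurable_dual.
- by move=> x; exact: dual_gt0.
- exact: iv.
- by rewrite E.
- by move=> I; rewrite E mulrC.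
Qed.

Lemma avg_gt0 (f : R -> R) I : intg f I -> (forall x, dyadic I x -> 0 < f x) -> 0 < avg f I.
Proof.
move=> fI f0.
have f0' x : dyadic I x -> 0 <= f x by move=> /f0/ltW.
rewrite lt_def avg_ge0// andbT; apply/eqP => f00.
have mf : measurable_fun (dyadic I) (EFin \o f) by case/integrableP: fI.
have : (\int[lam]_(x in dyadic I) (f x)%:E <= 0)%E by rewrite integral_avg// f00 mulr0.
move/(integral_eq0_ae (measurable_dyadicR I) mf (fun x Ix => f0' x Ix)) => [N [mN N0 sub]].
have : (lam (dyadic I) <= 0)%E.
  rewrite -N0 le_measure ?inE// => x Ix; apply: sub => /= /(_ Ix) [] fx.
  by have := f0 x Ix; rewrite fx ltxx.
by rewrite lebesgue_dyadic lee_fin leNgt dlen_gt0.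
Qed.

Definition rootavg p (u : R -> R) Q s := avg u (node Q s) `^ p^-1.

Lemma rootavgK p u Q s : 1 < p -> 0 < avg u (node Q s) ->
  rootavg p u Q s `^ p = avg u (node Q s).
Proof. by move=> p1 a0; rewrite /rootavg -powRrM mulVf ?powRr1 ?(ltW a0)//; lra. Qed.

Lemma mart_rootavg p u Q : 1 < p -> (forall x, 0 < u x) -> intg u Q ->
  mart (fun s => rootavg p u Q s `^ p).
Proof.
move=> p1 u0 iu; have -> : (fun s => rootavg p u Q s `^ p) = (fun s => avg u (node Q s)).
  by apply/funext => s; rewrite rootavgK//; apply: avg_gt0 => //; exact: intg_node.
exact: mart_avg.
Qed.

(** The lower bound is Hoelder's inequality for 1 = u^(1/p) v^(1/q), with v the dual weight. *)
Lemma Ap1_pair p q A u Q : conjugate p q -> Ap1 p q A u ->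
  Ap_pair p q A (rootavg p u Q) (rootavg q (dual p u) Q).
Proof.
move=> pq [mu u0 iu iv Au]; case: (pq) => p1 q1 _.
have a0 s : 0 < avg u (node Q s) by apply: avg_gt0.
have b0 s : 0 < avg (dual p u) (node Q s) by apply: avg_gt0 => // x _; exact: dual_gt0.
split.
- exact: mart_rootavg.
- by apply: mart_rootavg => // x; exact: dual_gt0.
- by move=> s; rewrite powR_gt0.
- by move=> s; rewrite powR_gt0.
move=> s; rewrite Au andbT.
have i1 := intg_cst (1 : R) (node Q s).
rewrite -(avg_cst 1 (node Q s)).
apply: avg_holder => // x _; try exact: ltW.
- exact/ltW/dual_gt0.
- by rewrite (dual_root pq).
Qed.

End Weights.

(** * Step functions attached to paths and their weighted norms *)

Section Steps.
Context {R : realType}.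
Implicit Types (p q : R) (I Q : dyadic_index) (s t : seq bool) (a : seq bool -> R)
  (f u : R -> R).
Local Notation lam := (@lebesgue_measure R).
Hint Resolve measurable_dyadic measurable_dyadicR : core.

(* The function equal to [a t] on the interval [node Q t] for each path [t] that
   extends [s] by [k] steps. *)
Fixpoint step Q k a s (x : R) : R :=
  if k is k'.+1 then step Q k' a (true :: s) x + step Q k' a (false :: s) x
  else a s * \1_(dyadic (node Q s)) x.

Lemma step_out Q k a s x : ~ dyadic (node Q s) x -> step Q k a s x = 0.
Proof.
elim: k s => [|k IH] s sx /=; first by rewrite indicE memNset// mulr0.
by rewrite !IH ?addr0// => h; apply: sx; have [] := dyadic_childP h.
Qed.

Lemma step_in Q a s t x : dyadic (node Q (t ++ s)) x ->
  step Q (size t) a s x = a (t ++ s).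
Proof.
elim/last_ind: t s => [|t e IH] s /=; first by move=> sx; rewrite indicE mem_set// mulr1.
rewrite size_rcons /= cat_rcons => tx; have /IH : dyadic (node Q (t ++ e :: s)) x by [].
move: tx; rewrite node_cat => /node_sub /= /dyadic_childP[_ h].
by have := @step_out Q (size t) a (~~ e :: s) x h; case: e {h} => /= ->; rewrite ?addr0 ?add0r.
Qed.

Lemma stepE Q a t n x : size t = n -> dyadic (node Q t) x -> step Q n a [::] x = a t.
Proof. by move=> <- tx; rewrite -[in RHS](cats0 t) step_in cats0. Qed.

Lemma measurable_step Q k a s : measurable_fun setT (step Q k a s).
Proof.
elim: k s => [|k IH] s /=; last exact: measurable_funD.
apply: measurable_funM => //; apply: measurable_indic; exact: measurable_dyadic.
Qed.

Lemma step_child Q k a s e x : dyadic (node Q (e :: s)) x ->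
  step Q k.+1 a s x = step Q k a (e :: s) x.
Proof.
move=> /dyadic_childP[_ h].
by have := @step_out Q k a (~~ e :: s) x h; case: e {h} => /= ->; rewrite ?addr0 ?add0r.
Qed.

Lemma integral_step Q k a s (w : R -> R) : (forall t, 0 <= a t) ->
  measurable_fun setT w -> (forall x, 0 <= w x) -> (forall I, intg w I) ->
  (\int[lam]_(x in dyadic (node Q s)) (step Q k a s x * w x)%:E =
    (dlen (node Q s) * ave k (fun t => a t * avg w (node Q t)) s)%:E)%E.
Proof.
move=> a0 mw w0 iw; elim: k s => [|k IH] s.
  rewrite (@eq_lam _ _ _ (fun x => (a s)%:E * (w x)%:E)%E) => [|x sx]; last first.
    by rewrite /= indicE mem_set// mulr1.
  rewrite ge0_integralZl//.
  - by rewrite integral_avg// -EFinM mulrCA.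
  - exact/measurable_EFinP/measurable_funTS.
  - by move=> x _; rewrite lee_fin.
  - by rewrite lee_fin.
have step0 j r x : 0 <= step Q j a r x.
  by elim: j r => [|j IHj] r /=; rewrite ?mulr_ge0 ?addr_ge0// indicE.
rewrite [in LHS]dyadic_split ge0_integral_setU//; last first.
- exact: dyadic_disj.
- by move=> x _; rewrite lee_fin mulr_ge0.
- apply/measurable_EFinP; apply: measurable_funTS; apply: measurable_funM => //.
  exact: measurable_step.
have E e : (\int[lam]_(x in dyadic (child e (node Q s))) (step Q k.+1 a s x * w x)%:E =
    \int[lam]_(x in dyadic (node Q (e :: s))) (step Q k a (e :: s) x * w x)%:E)%E.
  by apply: eq_lam => x sx; rewrite (step_child _ _ sx).
have D e : dlen (node Q (e :: s)) = dlen (node Q s) / 2 :> R by exact: dlen_child.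
by rewrite !E !IH !D -EFinD; congr EFin; rewrite [ave k.+1 _ _]/=; ring.
Qed.

Lemma step_fun Q n a (x : R) (g : R -> R) : dyadic Q x ->
  g (step Q n a [::] x) = step Q n (fun t => g (a t)) [::] x.
Proof.
by move=> Qx; have [t tn tx] := node_exists n Qx; rewrite !(stepE _ tn tx).
Qed.

Lemma step_norm_weighted p Q n a u : 1 < p -> measurable_fun setT u ->
  (forall x, 0 < u x) -> (forall I, intg u I) ->
  (\int[lam]_(x in dyadic Q) (`|step Q n a [::] x| `^ p * u x)%:E =
   (dlen Q * ave n (fun t => (`|a t| * rootavg p u Q t) `^ p) [::])%:E)%E.
Proof.
move=> p1 mu u0 iu.
rewrite (@eq_lam _ _ _ (fun x => (step Q n (fun t => `|a t| `^ p) [::] x * u x)%:E)); last first.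
  by move=> x Qx; rewrite (step_fun _ _ (fun r => `|r| `^ p) Qx).
rewrite (@integral_step Q n _ [::] u)//.
- congr EFin; congr (_ * _); apply: eq_ave => t _.
  by rewrite powRM ?powR_ge0// rootavgK//; exact: avg_gt0.
- by move=> x; exact: ltW.
Qed.

(** Hoelder for |f| = (|f|^p u)^(1/p) v^(1/q), with v the dual weight. The left side is what the
    tree estimates leave; this returns them to the norm of [f]. *)
Lemma Lp_majorant p q A u f Q t : conjugate p q -> Ap1 p q A u ->
  intg f Q -> intg (fun x => `|f x| `^ p * u x) Q ->
  (avg (fun x => `|f x|) (node Q t) / rootavg q (dual p u) Q t) `^ p
    <= avg (fun x => `|f x| `^ p * u x) (node Q t).
Proof.
move=> pq uA fQ fpQ; case: (uA) => mu u0 iu iv _; case: (pq) => p1 q1 _.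
have S0 : 0 < rootavg q (dual p u) Q t.
  by rewrite powR_gt0// avg_gt0// => x _; exact: dual_gt0.
have N0 : 0 <= avg (fun x => `|f x| `^ p * u x) (node Q t).
  by apply: avg_ge0 => x _; rewrite mulr_ge0 ?powR_ge0// ltW.
have -> : avg (fun x => `|f x| `^ p * u x) (node Q t) =
    (avg (fun x => `|f x| `^ p * u x) (node Q t) `^ p^-1) `^ p.
  by rewrite -powRrM mulVf ?powRr1//; lra.
apply: powR_mono; first lra.
  by rewrite divr_ge0 ?(ltW S0)// avg_ge0.
rewrite ler_pdivrMr//; apply: avg_holder => //.
- exact: intg_node.
- exact/intg_norm/intg_node.
- by move=> x _; rewrite mulr_ge0 ?powR_ge0// ltW.
- by move=> x _; exact/ltW/dual_gt0.
- move=> x _; rewrite powRM ?powR_ge0 ?(ltW (u0 x))// -mulrA (dual_root pq)// mulr1.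
  by rewrite -powRrM mulfV ?powRr1//; lra.
Qed.

Lemma young_root p q (x y : R) : conjugate p q -> 0 <= x -> 0 <= y ->
  x `^ p^-1 * y `^ q^-1 <= x + y.
Proof.
move=> pq x0 y0; case: (pq) => p1 q1 _.
have pi : p^-1 <= 1 by rewrite invf_le1; lra.
have qi : q^-1 <= 1 by rewrite invf_le1; lra.
have K (r z : R) : 1 < r -> 0 <= z -> (z `^ r^-1) `^ r = z.
  by move=> r1 z0; rewrite -powRrM mulVf ?powRr1//; lra.
have := young pq (powR_ge0 x p^-1) (powR_ge0 y q^-1).
rewrite (K p x)// (K q y)//.
have : 0 <= (1 - p^-1) * x by rewrite mulr_ge0//; lra.
have : 0 <= (1 - q^-1) * y by rewrite mulr_ge0//; lra.
lra.
Qed.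

Lemma Lp_intg p q A u f I : conjugate p q -> Ap1 p q A u ->
  measurable_fun setT f -> intg (fun x => `|f x| `^ p * u x) I -> intg f I.
Proof.
move=> pq uA mf fI; case: (uA) => mu u0 iu iv _; case: (pq) => p1 q1 _.
apply: (@le_integrable _ _ _ lam _ (measurable_dyadicR I) _
  (EFin \o (fun x => `|f x| `^ p * u x + dual p u x))).
- exact/measurable_EFinP/measurable_funTS.
- move=> x _; rewrite /= lee_fin.
  have v0 := dual_gt0 p (u0 x).
  have a0 : 0 <= `|f x| `^ p * u x by rewrite mulr_ge0 ?powR_ge0// ltW.
  rewrite [leRHS]ger0_norm; last by rewrite addr_ge0// ltW.
  have := young_root pq a0 (ltW v0).
  rewrite {1}powRM ?powR_ge0 ?(ltW (u0 x))// -mulrA (dual_root pq)// mulr1.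
  by rewrite -powRrM mulfV ?powRr1//; lra.
- exact: intgD.
Qed.

Lemma ave_Lp_majorant p q A u f Q n : conjugate p q -> Ap1 p q A u ->
  intg f Q -> intg (fun x => `|f x| `^ p * u x) Q ->
  ave n (fun t => (avg (fun x => `|f x|) (node Q t) / rootavg q (dual p u) Q t) `^ p) [::]
    <= avg (fun x => `|f x| `^ p * u x) Q.
Proof.
move=> pq uA fQ fpQ; have m := mart_avg fpQ.
rewrite -[leRHS](ave_mart n [::] m).
by apply: ave_le => t _; exact: (Lp_majorant _ pq uA).
Qed.

Lemma measurable_Lp p f u : measurable_fun setT f -> measurable_fun setT u ->
  measurable_fun setT (fun x => `|f x| `^ p * u x).
Proof.
move=> mf mu; apply: measurable_funM => //.
by apply: (measurableT_comp (measurable_powR p)); exact: measurableT_comp.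
Qed.

Lemma intg_ltoo f I : measurable_fun setT f -> (forall x, 0 <= f x) ->
  (\int[lam]_(x in dyadic I) (f x)%:E < +oo)%E -> intg f I.
Proof.
move=> mf f0 foo; apply/integrableP; split.
  exact/measurable_EFinP/measurable_funTS.
by rewrite (@eq_lam _ _ _ (fun x => (f x)%:E))// => x _; rewrite /= ger0_norm.
Qed.

Section OneTop.
Variables (p q A : R).
Hypotheses (pq : conjugate p q) (A1 : 1 <= A).

(** The maximum is taken over the closure of the modulus of [sproc]: unlike the modulus it is a
    martingale, so the maximal theorem applies, and it dominates the modulus at every depth up to
    [n]. *)
Lemma shift_step_bound : exists2 C, 0 < C & forall u Q f c n, Ap1 p q A u ->
  measurable_fun setT f -> intg (fun x => `|f x| `^ p * u x) Q ->
  (forall s, `|c s| <= 1) ->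
  (\int[lam]_(x in dyadic Q)
     (`|step Q n (rmax (clos n (fun t => `|sproc c (fun s => avg f (node Q s)) t|))) [::] x|
        `^ p * u x)%:E <= C%:E * \int[lam]_(x in dyadic Q) (`|f x| `^ p * u x)%:E)%E.
Proof.
have [C1 C10 max1] := rmax_weighted pq A1.
have [D1 D10 lin1] := sproc_weighted pq A1.
case: (pq) => p1 q1 _.
exists (C1 * D1); first by rewrite mulr_gt0.
move=> u Q f c n uA mf fp c1; case: (uA) => mu u0 iu iv _.
have fQ := Lp_intg pq uA mf fp.
have AP := Ap1_pair Q pq uA; case: (AP) => _ _ P0 S0 PS.
rewrite step_norm_weighted// integral_avg//; last first.
  by move=> x _; rewrite mulr_ge0 ?powR_ge0// ltW.
rewrite -EFinM lee_fin mulrCA ler_pM2l ?dlen_gt0//.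
set v := sproc c _; set V := clos n _.
have V0 s : 0 <= V s by exact: clos_ge0.
rewrite (@eq_ave _ _ _ (fun t => (rmax V t * rootavg p u Q t) `^ p)); last first.
  by move=> t _; rewrite ger0_norm// rmax_ge0.
rewrite (le_trans (max1 _ _ V n AP (mart_clos _ _) V0))// -mulrA ler_pM2l//.
have h1 : ave n (fun s => (V s / rootavg q (dual p u) Q s) `^ p) [::] <=
    ave n (fun s => (`|v s| * rootavg p u Q s) `^ p) [::].
  apply: ave_le => s sn; rewrite /V clos_leaf//.
  apply: powR_mono; [lra|by rewrite divr_ge0// ltW|].
  rewrite ler_wpM2l// -[(_)^-1]mul1r ler_pdivrMr//.
  by have /andP[] := PS s.
apply: (le_trans h1).
have mF := mart_avg (intg_norm fQ).
have fF s : `|avg f (node Q s)| <= avg (fun x => `|f x|) (node Q s).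
  exact/avg_norm/intg_node.
apply: le_trans (lin1 _ _ c _ _ n AP (mart_avg fQ) mF fF c1) _.
by rewrite ler_pM2l// (ave_Lp_majorant _ pq uA).
Qed.

Lemma max_step_bound : exists2 C, 0 < C & forall u Q f n, Ap1 p q A u ->
  measurable_fun setT f -> intg (fun x => `|f x| `^ p * u x) Q ->
  (\int[lam]_(x in dyadic Q)
     (`|step Q n (rmax (fun s => avg (fun x => `|f x|) (node Q s))) [::] x|
        `^ p * u x)%:E <= C%:E * \int[lam]_(x in dyadic Q) (`|f x| `^ p * u x)%:E)%E.
Proof.
have [C1 C10 max1] := rmax_weighted pq A1.
case: (pq) => p1 q1 _; exists C1 => // u Q f n uA mf fp; case: (uA) => mu u0 iu iv _.
have fQ := Lp_intg pq uA mf fp.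
have AP := Ap1_pair Q pq uA; case: (AP) => _ _ P0 S0 PS.
rewrite step_norm_weighted// integral_avg//; last first.
  by move=> x _; rewrite mulr_ge0 ?powR_ge0// ltW.
rewrite -EFinM lee_fin mulrCA ler_pM2l ?dlen_gt0//.
set V := fun s => avg _ (node Q s).
have V0 s : 0 <= V s by exact: avg_ge0.
rewrite (@eq_ave _ _ _ (fun t => (rmax V t * rootavg p u Q t) `^ p)); last first.
  by move=> t _; rewrite ger0_norm// rmax_ge0.
rewrite (le_trans (max1 _ _ V n AP (mart_avg (intg_norm fQ)) V0))// ler_pM2l//.
by rewrite (ave_Lp_majorant _ pq uA).
Qed.

End OneTop.

End Steps.

Section AlmostEverywhere.
Context d (T : measurableType d) (R : realType) (m : {measure set T -> \bar R}).
Implicit Types P Q : T -> Prop.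

Lemma ae_imp P Q : (forall x, P x -> Q x) -> {ae m, forall x, P x} -> {ae m, forall x, Q x}.
Proof.
by move=> PQ [N [mN N0 sub]]; exists N; split=> // x /= nQ; apply: sub => /= /PQ.
Qed.

Lemma ae_true P : (forall x, P x) -> {ae m, forall x, P x}.
Proof. by move=> H; exists set0; split => // x /= []. Qed.

Lemma ae_and P Q : {ae m, forall x, P x} -> {ae m, forall x, Q x} ->
  {ae m, forall x, P x /\ Q x}.
Proof.
move=> hP hQ; have := negligibleU hP hQ; apply: negligibleS => x /= /not_andP.
by case=> h; [left|right].
Qed.

Lemma ae_all (I : countType) (P : I -> T -> Prop) :
  (forall i, {ae m, forall x, P i x}) -> {ae m, forall x, forall i, P i x}.
Proof.
move=> H; pose F k := if @choice.unpickle I k is Some i then ~` [set x | P i x] else set0.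
have FN k : m.-negligible (F k).
  by rewrite /F; case: choice.unpickle => [i|]; [exact: H|exact: negligible_set0].
apply: negligibleS (negligible_bigcup FN) => x /= /existsNP[i Pi].
by exists (choice.pickle i) => //; rewrite /F choice.pickleK.
Qed.

End AlmostEverywhere.

(** * Dyadic differentiation *)

Section Differentiation.
Context {R : realType}.
Implicit Types (I Q : dyadic_index) (s t : seq bool) (f : R -> R).
Local Notation lam := (@lebesgue_measure R).
Hint Resolve measurable_dyadic measurable_dyadicR : core.

Definition dint (k : int) (x : R) : dyadic_index := (k, Num.floor (x / 2 ^ k)).

Lemma dint_mem k (x : R) : dyadic (dint k x) x.
Proof.
rewrite dyadicE /dint /dlen /=.
have d0 : 0 < 2 ^ k :> R by rewrite exprz_gt0.
by rewrite -ler_pdivlMr// -ltr_pdivrMr// Num.Theory.floor_itv.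
Qed.

Lemma dint_uniq I (x : R) : dyadic I x -> I = dint I.1 x.
Proof.
rewrite dyadicE /dlen => h; case: I h => k m /= h; congr pair.
have d0 : 0 < 2 ^ k :> R by rewrite exprz_gt0.
apply/esym/Num.Theory.floor_def.
by rewrite ler_pdivlMr// ltr_pdivrMr.
Qed.

Lemma node_scale Q s : (node Q s).1 = Q.1 - (size s)%:Z.
Proof.
elim: s => [|e s IH] /=; first by rewrite subr0.
have -> : (child e (node Q s)).1 = (node Q s).1 - 1 by case: e.
by rewrite IH -addn1 PoszD opprD addrA.
Qed.

Lemma dyadic_ball I (x y : R) : dyadic I x -> dyadic I y -> ball x (dlen I) y.
Proof.
rewrite !dyadicE !intrD => h1 h2; rewrite /ball /=.
have := dlen_gt0 (R := R) I; move: h1 h2; set d := dlen I; set m := (I.2)%:~R.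
by move=> h1 h2 d0; rewrite ltr_norml; apply/andP; split; lra.
Qed.

Lemma dyadic_nicely_shrinking (K : int) (x : R) :
  nicely_shrinking x (fun n => dyadic (dint (K - n%:Z) x)).
Proof.
split; first by move=> n.
have d0 n : 0 < (2 : R) ^ (K - n%:Z) by rewrite exprz_gt0.
exists (2, fun n => PosNum (d0 n)); split => //=.
- have -> : (fun n : nat => (2 : R) ^ (K - n%:Z)) = (fun n => (2 : R) ^ K * (2^-1 ^+ n)).
    by apply/funext => n; rewrite expfzDr ?pnatr_eq0// exprVn -exprnN.
  rewrite -[X in _ --> X](mulr0 ((2 : R) ^ K)); apply: cvgMr.
  by apply: cvg_expr; rewrite ger0_norm ?invr_ge0// invf_lt1// ltr1n.
- move=> n y yI; exact: dyadic_ball (dint_mem _ _) yI.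
- move=> n; rewrite lebesgue_measure_ball ?(ltW (d0 n))// lebesgue_dyadicM -EFinM lee_fin.
  by rewrite mulr_natl.
Qed.

(** The nodes containing [x] shrink nicely to it, so Lebesgue differentiation applies to [f] cut off
    to [Q]. *)
Lemma dyadic_differentiation f Q : intg f Q ->
  {ae lam, forall x, dyadic Q x ->
    step Q n (fun s => avg f (node Q s)) [::] x @[n --> \oo] --> f x}.
Proof.
move=> fQ.
have lf : locally_integrable setT (f \_ (dyadic Q)).
  apply: open_integrable_locally; first exact: openT.
  have := proj1 (@integrable_mkcond _ (measurableTypeR R) R lam (dyadic Q) (EFin \o f)
    (measurable_dyadicR Q)) fQ.
  by rewrite restrict_EFin.
apply: ae_imp (lebesgue_differentiation lf) => x xL Qx.
have := nice_lebesgue_differentiation (dyadic_nicely_shrinking Q.1) lf xL.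
rewrite [(f \_ _) x]patchE mem_set//.
set a := (fun n => _); set b := (fun n => step _ _ _ _ _).
suff -> : a = EFin \o b by move=> /fine_cvg.
apply/funext => n; rewrite /a /b /=.
have [t tn tx] := node_exists n Qx.
rewrite (stepE _ tn tx).
have <- : node Q t = dint (Q.1 - n%:Z) x by rewrite -tn -node_scale; exact: dint_uniq.
rewrite lebesgue_dyadicM inver gt_eqF ?dlen_gt0// /avg EFinM; congr (_ * _)%E.
rewrite /Rintegral fineK; last first.
  by apply: integrable_fin_num => //; exact: intg_node.
by apply: eq_lam => y /node_sub Qy; rewrite patchE mem_set.
Qed.

End Differentiation.

(** * The difference between a function and its conditional expectations *)

Section TopLimit.
Context {R : realType}.
Implicit Types (I Q : dyadic_index) (s t : seq bool) (a c : seq bool -> R)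
  (f u : R -> R).
Local Notation lam := (@lebesgue_measure R).
Hint Resolve measurable_dyadic measurable_dyadicR : core.

Lemma powR_add_le p (x y : R) : 0 < p -> 0 <= x -> 0 <= y ->
  (x + y) `^ p <= 2 `^ p * (x `^ p + y `^ p).
Proof.
move=> p0 x0 y0; have [xy|/ltW yx] := leP x y.
- apply: (@le_trans _ _ ((2 * y) `^ p)); first by apply: powR_mono; lra.
  by rewrite powRM// ler_wpM2l ?powR_ge0// lerDr powR_ge0.
- apply: (@le_trans _ _ ((2 * x) `^ p)); first by apply: powR_mono; lra.
  by rewrite powRM// ler_wpM2l ?powR_ge0// lerDl powR_ge0.
Qed.

Lemma powR_sum_le p (x y z : R) : 0 < p -> `|x| <= `|y| + `|z| ->
  `|x| `^ p <= 2 `^ p * (`|y| `^ p + `|z| `^ p).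
Proof.
by move=> p0 h; apply: le_trans (powR_add_le p0 _ _) => //; exact: powR_mono.
Qed.

Lemma powR_cvg0_seq p (r : nat -> R) : 1 <= p -> r n @[n --> \oo] --> 0 ->
  `|r n| `^ p @[n --> \oo] --> 0.
Proof.
move=> p1 /cvgrPdist_le h; apply/cvgrPdist_le => e e0.
have m0 : 0 < Num.min e 1 by rewrite lt_min e0 ltr01.
have := h _ m0; apply: filterS => n; rewrite !sub0r !normrN le_min => /andP[re r1].
rewrite ger0_norm ?powR_ge0//.
have [->|rn0] := eqVneq `|r n| 0; first by rewrite powR0 ?ltW//; lra.
by apply: le_trans re; apply: ge1r_powR => //; rewrite lt_def rn0 normr_ge0.
Qed.

Definition dyadic_avg Q f s := avg f (node Q s).

Definition defect Q f m x := f x - step Q m (dyadic_avg Q f) [::] x.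

Lemma measurable_defect Q f m : measurable_fun setT f -> measurable_fun setT (defect Q f m).
Proof. by move=> mf; apply: measurable_funB => //; exact: measurable_step. Qed.

Lemma dif_clos n a s : (n <= size s)%N -> dif (clos n a) s = 0.
Proof.
by move=> ns; rewrite /dif /clos /= !ltnNge ns /= !subSn //= subrr mul0r.
Qed.

Lemma clos_mart n a s : mart a -> (size s <= n)%N -> clos n a s = a s.
Proof. by move=> ma sn; rewrite /clos sn ave_mart. Qed.

Lemma clos_mart_drop n a s : (n <= size s)%N -> clos n a s = a (drop (size s - n) s).
Proof.
rewrite leq_eqVlt => /predU1P[->|ns]; first by rewrite clos_leaf // subnn drop0.
by rewrite /clos leqNgt ns.
Qed.

(** A frozen martingale has no differences from depth [m] on, so the multipliers there act on
    nothing and the transform freezes too. *)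
Lemma sproc_clos m c a s : mart a ->
  (forall t, (size t < m)%N -> c t = 1) -> (m <= size s)%N ->
  sproc c (clos m a) s = sproc (fun=> 1) a (drop (size s - m) s).
Proof.
move=> ma c1; have small t : (size t <= m)%N -> sproc c (clos m a) t = sproc (fun=> 1) a t.
  elim: t => //= e t IH tm; rewrite IH; last exact: ltnW.
  congr (_ + _ * _); case: t tm {IH} => [|e' t] //= tm.
  rewrite c1; last exact: ltnW.
  by congr (_ * _); rewrite /dif !clos_mart.
elim: s => [|e s IH] ms; first by rewrite drop_oversize.
move: ms; rewrite leq_eqVlt => /predU1P[ms|ms].
  by rewrite small ?ms// subnn drop0.
rewrite /= subSn // IH //=.
suff -> : epend c (clos m a) s = 0 by rewrite mulr0 addr0.
case: s ms {IH} => [|e' s] //= ms.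
by rewrite dif_clos ?mulr0.
Qed.

Lemma intg_step Q n a s I : intg (step Q n a s) I.
Proof.
elim: n s => [|n IH] s; last by apply: intgD.
apply: (@le_integrable _ _ _ lam _ (measurable_dyadicR I) _ (EFin \o (fun=> `|a s|))).
- apply/measurable_EFinP; apply: measurable_funTS; exact: (measurable_step Q 0 a s).
- move=> x _; rewrite /= lee_fin normr_id normrM ler_piMr//.
  by rewrite indicE; case: (_ \in _); rewrite ?normr1 ?normr0.
- exact: intg_cst.
Qed.

Lemma eq_avg f g I : (forall x, dyadic I x -> f x = g x) -> avg f I = avg g I.
Proof. by move=> fg; rewrite /avg; congr (_ * _); apply: eq_Rintegral => x /set_mem /fg. Qed.

Lemma avg_step Q n a t : avg (step Q n a [::]) (node Q t) = clos n a t.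
Proof.
have big s : (n <= size s)%N -> avg (step Q n a [::]) (node Q s) = clos n a s.
  move=> ns; rewrite clos_mart_drop//.
  rewrite -[RHS](avg_cst _ (node Q s)); apply: eq_avg => x.
  rewrite -[in node Q s](cat_take_drop (size s - n) s) node_cat => /node_sub tx.
  by rewrite (stepE _ _ tx)// size_drop subKn.
have [tn|/ltnW] := leqP (size t) n; last exact: big.
have [k] := ubnP (n - size t); elim: k t tn => // k IH t tn kn.
move: tn; rewrite leq_eqVlt => /predU1P[tn|tn]; first by rewrite big ?tn.
rewrite (mart_avg (intg_step Q n a [::] Q)) (mart_clos n a t).
by rewrite !IH //= -ltnS (leq_trans _ kn)// ltnS ltn_sub2l.
Qed.

Lemma avg_defect Q f m t : intg f Q ->
  avg (defect Q f m) (node Q t) = dyadic_avg Q f t - clos m (dyadic_avg Q f) t.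
Proof.
move=> fQ; rewrite -(avg_step Q).
rewrite (@eq_avg _ (fun x => 1 * f x + -1 * step Q m (dyadic_avg Q f) [::] x)); last first.
  by move=> x _; rewrite /defect; ring.
by rewrite avg_lin; [rewrite /dyadic_avg; ring|exact: intg_node|exact: intg_step].
Qed.

(* Subtracting the conditional expectation removes the terms of the shift above
   depth [m], whatever the multipliers below. *)
Lemma step_sproc_defect Q f c m n x : intg f Q -> dyadic Q x -> (m <= n)%N ->
  (forall t, (size t < m)%N -> c t = 1) ->
  step Q n (sproc c (dyadic_avg Q (defect Q f m))) [::] x =
  step Q n (sproc c (dyadic_avg Q f)) [::] x -
  step Q m (sproc (fun=> 1) (dyadic_avg Q f)) [::] x.
Proof.
move=> fQ Qx mn c1; have [t tn tx] := node_exists n Qx.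
have tE : dyadic (node Q (drop (n - m) t)) x.
  by move: tx; rewrite -[in node Q t](cat_take_drop (n - m) t) node_cat => /node_sub.
rewrite !(stepE _ tn tx) (stepE _ _ tE); last by rewrite size_drop tn subKn.
have -> : dyadic_avg Q (defect Q f m) = fun s => dyadic_avg Q f s - clos m (dyadic_avg Q f) s.
  by apply/funext => s; rewrite /dyadic_avg avg_defect.
by rewrite sprocB (sproc_clos (mart_avg fQ) c1) ?tn.
Qed.

End TopLimit.

(** * Monotone limits of maximal functions and convergence in weighted norm *)

Section ShiftLimit.
Context {R : realType}.
Implicit Types (I Q : dyadic_index) (s t : seq bool) (a c : seq bool -> R)
  (f g h u : R -> R) (p : R).
Local Notation lam := (@lebesgue_measure R).
Hint Resolve measurable_dyadic measurable_dyadicR : core.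

Lemma le_lam Q (f g : R -> \bar R) : (forall x, dyadic Q x -> (0 <= f x)%E) ->
  measurable_fun (dyadic Q) f -> measurable_fun (dyadic Q) g ->
  (forall x, dyadic Q x -> (f x <= g x)%E) ->
  (\int[lam]_(x in dyadic Q) f x <= \int[lam]_(x in dyadic Q) g x)%E.
Proof. by move=> f0 mf mg fg; exact: ge0_le_integral. Qed.

Lemma ge0_lamZl Q (f : R -> \bar R) (k : R) : 0 <= k -> measurable_fun (dyadic Q) f ->
  (forall x, dyadic Q x -> (0 <= f x)%E) ->
  (\int[lam]_(x in dyadic Q) (k%:E * f x) = k%:E * \int[lam]_(x in dyadic Q) f x)%E.
Proof. by move=> k0 mf f0; rewrite ge0_integralZl. Qed.

Lemma ge0_lamD Q (f g : R -> \bar R) : measurable_fun (dyadic Q) f ->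
  measurable_fun (dyadic Q) g -> (forall x, dyadic Q x -> (0 <= f x)%E) ->
  (forall x, dyadic Q x -> (0 <= g x)%E) ->
  (\int[lam]_(x in dyadic Q) (f x + g x) =
   \int[lam]_(x in dyadic Q) f x + \int[lam]_(x in dyadic Q) g x)%E.
Proof. by move=> mf mg f0 g0; rewrite ge0_integralD. Qed.

Lemma measurable_step_weighted p u Q n a (D : set R) : measurable_fun setT u ->
  measurable_fun D (fun x => (`|step Q n a [::] x| `^ p * u x)%:E).
Proof.
move=> mu; apply/measurable_EFinP; apply: measurable_funTS.
by apply: measurable_Lp => //; exact: measurable_step.
Qed.

(* [G] is the monotone limit of the weighted running maxima of [V]. *)
Lemma sup_step p u Q V (K : \bar R) : 0 < p -> measurable_fun setT u -> (forall x, 0 < u x) ->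
  (forall t, 0 <= V t) ->
  (forall n, (\int[lam]_(x in dyadic Q) (`|step Q n (rmax V) [::] x| `^ p * u x)%:E <= K)%E) ->
  exists G : R -> \bar R, [/\ measurable_fun (dyadic Q) G,
    forall x n, dyadic Q x -> ((`|step Q n (rmax V) [::] x| `^ p * u x)%:E <= G x)%E,
    forall x, dyadic Q x -> (0 <= G x)%E &
    (\int[lam]_(x in dyadic Q) G x <= K)%E].
Proof.
move=> p0 mu u0 V0 HK.
pose g n x := (`|step Q n (rmax V) [::] x| `^ p * u x)%:E.
have g0 n x : (0 <= g n x)%E by rewrite lee_fin mulr_ge0 ?powR_ge0 ?(ltW (u0 x)).
have ndS x : dyadic Q x -> {homo (fun n => step Q n (rmax V) [::] x) : n m / (n <= m)%N >-> n <= m}.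
  move=> Qx; apply: homo_leq => //; first by move=> y z w; exact: le_trans.
  move=> n; have [t tn tx] := node_exists n.+1 Qx.
  rewrite (stepE _ tn tx); case: t tn tx => // e t [tn] tx.
  rewrite (stepE _ tn); first exact: rmax_mono.
  by have [] := dyadic_childP tx.
have nd x : dyadic Q x -> {homo (g^~ x) : n m / (n <= m)%N >-> (n <= m)%E}.
  move=> Qx n m nm; rewrite lee_fin ler_wpM2r ?(ltW (u0 x))//.
  have S0 k : 0 <= step Q k (rmax V) [::] x.
    have [t tn tx] := node_exists k Qx; rewrite (stepE _ tn tx); exact: rmax_ge0.
  by apply: powR_mono => //; rewrite !ger0_norm//; exact: ndS.
have cv x : dyadic Q x -> cvgn (g^~ x) by move=> Qx; apply: ereal_nondecreasing_is_cvgn; exact: nd.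
have mg n : measurable_fun (dyadic Q) (g n) by exact: measurable_step_weighted.
exists (fun x => limn (g^~ x)); split.
- by have := @emeasurable_fun_cvg _ _ _ (dyadic Q) g (fun x => limn (g^~ x)) mg; apply => x Qx; exact: cv.
- move=> x n Qx; apply: lime_ge; first exact: cv.
  by exists n => // m /= nm; exact: nd.
- by move=> x Qx; apply: lime_ge; [exact: cv|exact: nearW].
- have := @monotone_convergence _ _ _ lam _ (measurable_dyadicR Q) g mg (fun n x _ => g0 n x) nd.
  move=> ->; apply: lime_le; last by apply: nearW => n; exact: HK.
  apply: ereal_nondecreasing_is_cvgn => n m nm; apply: le_lam => //.
  by move=> x Qx; exact: nd.
Qed.

Definition Lpint p u Q f := (\int[lam]_(x in dyadic Q) (`|f x| `^ p * u x)%:E)%E.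

Lemma Lpint_ge0 p u Q f : (forall x, 0 < u x) -> (0 <= Lpint p u Q f)%E.
Proof. by move=> u0; apply: integral_ge0 => x _; rewrite lee_fin mulr_ge0 ?powR_ge0 ?(ltW (u0 x)). Qed.

Lemma Lpint_intg p u Q f : measurable_fun setT u -> (forall x, 0 < u x) ->
  measurable_fun setT f -> (Lpint p u Q f < +oo)%E -> intg (fun x => `|f x| `^ p * u x) Q.
Proof.
move=> mu u0 mf; apply: intg_ltoo; first exact: measurable_Lp.
by move=> x; rewrite mulr_ge0 ?powR_ge0 ?(ltW (u0 x)).
Qed.

Lemma Lpint_fin p u Q f : intg (fun x => `|f x| `^ p * u x) Q -> (Lpint p u Q f < +oo)%E.
Proof. by move=> /(integrable_fin_num (measurable_dyadicR Q)) h; rewrite /Lpint ltey_eq h. Qed.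

Lemma Lpint_tri p u Q f g h : measurable_fun setT u -> (forall x, 0 < u x) -> 0 < p ->
  measurable_fun setT f -> measurable_fun setT g -> measurable_fun setT h ->
  (forall x, dyadic Q x -> `|f x| <= `|g x| + `|h x|) ->
  (Lpint p u Q f <= (2 `^ p)%:E * (Lpint p u Q g + Lpint p u Q h))%E.
Proof.
move=> mu u0 p0 mf mg mh fgh.
have m (k : R -> R) : measurable_fun setT k -> measurable_fun (dyadic Q) (fun x => (`|k x| `^ p * u x)%:E).
  by move=> mk; apply/measurable_EFinP; apply: measurable_funTS; exact: measurable_Lp.
have n0 (k : R -> R) x : (0 <= (`|k x| `^ p * u x)%:E)%E.
  by rewrite lee_fin mulr_ge0 ?powR_ge0 ?(ltW (u0 x)).
rewrite /Lpint -ge0_lamD; [|exact: m|exact: m|by []|by []].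
rewrite -ge0_lamZl; [|exact: powR_ge0|by apply: emeasurable_funD; exact: m|].
  apply: le_lam => //; [exact: m|by apply: measurable_funeM; apply: emeasurable_funD; exact: m|].
  move=> x Qx; rewrite -EFinD -EFinM lee_fin -mulrDl mulrA ler_wpM2r ?(ltW (u0 x))//.
  by apply: powR_sum_le => //; exact: fgh.
by move=> x _; rewrite adde_ge0 ?n0.
Qed.

Section Bounds.
Variables (p q A : R).
Hypotheses (pq : conjugate p q) (A1 : 1 <= A).

(** Dominated convergence: differentiation gives the pointwise limit, and the majorant combines
    |f|^p u with the limit of the weighted running maxima, integrable by the maximal theorem. *)
Lemma defect_cvg0 u Q f : Ap1 p q A u -> measurable_fun setT f ->
  intg (fun x => `|f x| `^ p * u x) Q ->
  Lpint p u Q (defect Q f n) @[n --> \oo] --> 0%E.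
Proof.
move=> uA mf fp; case: (uA) => mu u0 iu iv _; case: (pq) => p1 q1 _.
have p0 : 0 < p by lra.
have fQ := Lp_intg pq uA mf fp.
pose V s := avg (fun x => `|f x|) (node Q s).
have V0 s : 0 <= V s by exact: avg_ge0.
have [C C0 Cb] := max_step_bound pq A1.
have [G [mG gG G0 iG]] := sup_step p0 mu u0 V0 (fun n => Cb u Q f n uA mf fp).
pose h n x := (`|defect Q f n x| `^ p * u x)%:E.
pose g x := ((2 `^ p)%:E * ((`|f x| `^ p * u x)%:E + G x))%E.
have mh n : measurable_fun (dyadic Q) (h n).
  apply/measurable_EFinP; apply: measurable_funTS; apply: measurable_Lp => //.
  exact: measurable_defect.
have mfp : measurable_fun (dyadic Q) (fun x => (`|f x| `^ p * u x)%:E).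
  by apply/measurable_EFinP; apply: measurable_funTS; exact: measurable_Lp.
have fp0 x : (0 <= (`|f x| `^ p * u x)%:E)%E by rewrite lee_fin mulr_ge0 ?powR_ge0 ?(ltW (u0 x)).
have mg : measurable_fun (dyadic Q) g.
  by apply: measurable_funeM; exact: emeasurable_funD.
have g0 x : dyadic Q x -> (0 <= g x)%E.
  by move=> Qx; rewrite mule_ge0 ?lee_fin ?powR_ge0// adde_ge0// G0.
have ig : lam.-integrable (dyadic Q) g.
  apply/integrableP; split => //.
  rewrite (@eq_lam _ _ _ g) => [|x Qx]; last by rewrite gee0_abs// g0.
  rewrite ge0_lamZl ?powR_ge0//; [|exact: emeasurable_funD|]; last first.
    by move=> x Qx; rewrite adde_ge0// G0.
  rewrite ge0_lamD//.
  have f1 := Lpint_fin fp.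
  have f2 : (C%:E * Lpint p u Q f < +oo)%E by rewrite lte_mul_pinfty ?lee_fin ?(ltW C0).
  by rewrite lte_mul_pinfty ?lee_fin ?powR_ge0// lte_add_pinfty// (le_lt_trans iG).
have cv : {ae lam, forall x, dyadic Q x -> h n x @[n --> \oo] --> 0%E}.
  apply: ae_imp (dyadic_differentiation fQ) => x H Qx.
  apply: cvg_EFin; first by apply: nearW.
  rewrite [X in X @ _](_ : _ = fun n => u x * `|defect Q f n x| `^ p); last first.
    by apply/funext => n; rewrite /= mulrC.
  rewrite -[X in _ --> X](mulr0 (u x)); apply: cvgMr.
  apply: powR_cvg0_seq; first lra.
  rewrite /defect -[X in _ --> X](subrr (f x)); apply: cvgB; [exact: cvg_cst|exact: H].
have hg : {ae lam, forall x n, dyadic Q x -> (`|h n x| <= g x)%E}.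
  apply: ae_true => x n Qx.
  rewrite gee0_abs; last by rewrite lee_fin mulr_ge0 ?powR_ge0 ?(ltW (u0 x)).
  apply: (@le_trans _ _ ((2 `^ p)%:E * ((`|f x| `^ p * u x)%:E +
      (`|step Q n (rmax V) [::] x| `^ p * u x)%:E))%E); last first.
    by rewrite lee_wpmul2l ?lee_fin ?powR_ge0// leeD2l// gG.
  rewrite -EFinD -EFinM lee_fin -mulrDl mulrA ler_wpM2r ?(ltW (u0 x))//.
  apply: powR_sum_le => //; rewrite /defect (le_trans (ler_normB _ _))// lerD2l.
  have [t tn tx] := node_exists n Qx; rewrite !(stepE _ tn tx).
  rewrite [leRHS]ger0_norm ?rmax_ge0// (le_trans (avg_norm _))//; first exact: intg_node.
  exact: (@rmax_ge _ V).
have [_ _] := dominated_convergence (measurable_dyadicR Q) mh (measurable_cst 0%E) cv ig hg.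
by rewrite integral0.
Qed.

End Bounds.

End ShiftLimit.

(** * The shift on one dyadic interval *)

Section ShiftOnTop.
Context {R : realType}.
Implicit Types (I Q : dyadic_index) (s t : seq bool) (a c : seq bool -> R)
  (f g h u : R -> R) (p q : R).
Local Notation lam := (@lebesgue_measure R).
Hint Resolve measurable_dyadic measurable_dyadicR : core.

Definition sseq Q f n x := step Q n (sproc (fun=> 1) (dyadic_avg Q f)) [::] x.

(** An upper limit is measurable before any convergence is known; it is the limit where a finite one
    exists, and [fine] gives 0 at infinite values. *)
Definition Slim Q f x : R := fine (limn_esup (fun n => (sseq Q f n x)%:E)).

Lemma Slim_cvg Q f x : cvgn (fun n => sseq Q f n x) ->
  sseq Q f n x @[n --> \oo] --> Slim Q f x.
Proof.
move=> h; have hE : (sseq Q f n x)%:E @[n --> \oo] --> (limn (fun n => sseq Q f n x))%:E.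
  by apply: cvg_EFin h; exact: nearW.
by rewrite /Slim (cvg_limn_einf_sup hE).2.
Qed.

Lemma measurable_Slim Q f : measurable_fun setT (Slim Q f).
Proof.
apply: (measurableT_comp (@fine_measurable R setT measurableT)) => //.
apply: measurable_fun_limn_esup => n; apply/measurable_EFinP; exact: measurable_step.
Qed.

Lemma rmax_le (a b : seq bool -> R) t : (forall s, (size s <= size t)%N -> a s <= b s) ->
  rmax a t <= rmax b t.
Proof.
elim: t => [|e t IH] ab /=; first exact: ab.
rewrite ge_max !le_max; apply/andP; split; last by rewrite (ab (e :: t))// orbT.
by rewrite IH// => s st; rewrite ab// ltnW.
Qed.

Lemma shift_max_bound p q A : conjugate p q -> 1 <= A -> exists2 C, 0 < C &
  forall u Q f c n, Ap1 p q A u ->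
  measurable_fun setT f -> intg (fun x => `|f x| `^ p * u x) Q ->
  (forall s, `|c s| <= 1) ->
  (\int[lam]_(x in dyadic Q)
     (`|step Q n (rmax (fun t => `|sproc c (dyadic_avg Q f) t|)) [::] x|
        `^ p * u x)%:E <= C%:E * Lpint p u Q f)%E.
Proof.
move=> pq A1; have [C C0 HC] := shift_step_bound pq A1; exists C; first exact: C0.
move=> u Q f c n uA mf fp c1.
case: (uA) => mu u0 iu iv _; case: (pq) => p1 q1 _.
apply: le_trans (HC u Q f c n uA mf fp c1).
apply: le_lam.
- by move=> x _; rewrite lee_fin mulr_ge0 ?powR_ge0 ?(ltW (u0 x)).
- exact: measurable_step_weighted.
- exact: measurable_step_weighted.
move=> x Qx; rewrite lee_fin ler_wpM2r ?(ltW (u0 x))//.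
have [t tn tx] := node_exists n Qx; rewrite !(stepE _ tn tx).
have v0 s : 0 <= rmax (fun t => `|sproc c (dyadic_avg Q f) t|) s by exact: rmax_ge0.
apply: powR_mono => //; first lra.
rewrite !ger0_norm//; last by apply: rmax_ge0 => s; exact: clos_ge0.
apply: rmax_le => s; rewrite tn => sn.
apply: le_trans (clos_norm n _ s).
by rewrite clos_mart//; exact: mart_sproc.
Qed.

Section Bounds.
Variables (p q A : R).
Hypotheses (pq : conjugate p q) (A1 : 1 <= A).

Lemma root_bound (r g u0 : R) : 0 < u0 -> 0 <= r -> `|r| `^ p * u0 <= g -> r <= (g / u0) `^ p^-1.
Proof.
case: pq => p1 _ _ u00 r0; rewrite -ler_pdivlMr// ger0_norm// => h.
have -> : r = (r `^ p) `^ p^-1 by rewrite -powRrM mulfV ?powRr1//; lra.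
by apply: powR_mono => //; [rewrite invr_gt0; lra|exact: powR_ge0].
Qed.

Lemma limit_bound (r : nat -> R) (l u0 : R) (G : \bar R) N : 0 < u0 ->
  r n @[n --> \oo] --> l ->
  (forall n, (N <= n)%N -> ((`|r n| `^ p * u0)%:E <= G)%E) -> ((`|l| `^ p * u0)%:E <= G)%E.
Proof.
case: (pq) => p1 _ _ u00 rl; case: G => [g| |] H.
- have h n : (N <= n)%N -> `|r n| <= (g / u0) `^ p^-1.
    by move=> /H; rewrite lee_fin => /= hn; apply: root_bound => //; rewrite normr_id.
  have g0 : 0 <= g / u0.
    have := H N (leqnn N); rewrite lee_fin => hN; rewrite divr_ge0 ?(ltW u00)//.
    by apply: le_trans hN; rewrite mulr_ge0 ?powR_ge0 ?(ltW u00).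
  have ln : `|l| <= (g / u0) `^ p^-1.
    rewrite -(cvg_lim (@Rhausdorff R) (cvg_norm rl)); apply: limr_le.
      by apply/cvg_ex; exists `|l|; exact: cvg_norm.
    by exists N => // n /= Nn; exact: h.
  rewrite lee_fin -ler_pdivlMr//.
  have -> : g / u0 = ((g / u0) `^ p^-1) `^ p by rewrite -powRrM mulVf ?powRr1//; lra.
  by apply: powR_mono => //; lra.
- by rewrite leey.
- by have := H N (leqnn N).
Qed.

Lemma cauchy_seq_cvg (r : nat -> R) :
  (forall e, 0 < e -> exists m, forall n, (m <= n)%N -> `|r n - r m| <= e) -> cvgn r.
Proof.
move=> H; apply/cauchy_cvgP/cauchyP => e e0.
have e2 : 0 < e / 2 by rewrite divr_gt0.
have [m hm] := H (e / 2) e2.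
exists (r m); exists m => // n /= mn; rewrite /ball /= distrC.
by apply: le_lt_trans (hm n mn) _; rewrite ltr_pdivrMr// ltr_pMr// ltr1n.
Qed.

(** Below depth [m] the shift of [f] moves like the shift of [defect Q f m], whose maximal function
    is bounded in norm by the defect, which tends to 0. In the second clause the multipliers from
    depth [m] on are arbitrary: unconditional summation rests on this. *)
Lemma shift_limit : exists2 C, 0 < C & forall u Q f, Ap1 p q A u ->
  measurable_fun setT f -> intg (fun x => `|f x| `^ p * u x) Q ->
  [/\ {ae lam, forall x, dyadic Q x -> sseq Q f n x @[n --> \oo] --> Slim Q f x},
    forall m n c, (m <= n)%N -> (forall s, `|c s| <= 1) ->
      (forall s, (size s < m)%N -> c s = 1) ->
      (Lpint p u Q (fun x => (Slim Q f x - step Q n (sproc c (dyadic_avg Q f)) [::] x)%R)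
         <= C%:E * Lpint p u Q (defect Q f m))%E &
    (Lpint p u Q (Slim Q f) <= C%:E * Lpint p u Q f)%E].
Proof.
have [C C0 HC] := shift_max_bound pq A1.
case: (pq) => p1 q1 _; have p0 : 0 < p by lra.
have p2 : 0 < 2 `^ p by rewrite powR_gt0.
exists (2 `^ p * (C + C) + C); first by rewrite addr_gt0// mulr_gt0// addr_gt0.
move=> u Q f uA mf fp; case: (uA) => mu u0 iu iv _.
have fQ := Lp_intg pq uA mf fp.
have mdef m : measurable_fun setT (defect Q f m) by exact: measurable_defect.
have dcv := defect_cvg0 pq A1 uA mf fp.
have one1 (s : seq bool) : `|(fun=> 1) s : R| <= 1 by rewrite normr1.
have ddef m : intg (fun x => `|defect Q f m x| `^ p * u x) Q.
  apply: Lpint_intg => //.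
  have := @Lpint_tri _ p u Q (defect Q f m) f (step Q m (dyadic_avg Q f) [::]) mu u0 p0
    (mdef m) mf (measurable_step _ _ _ _) (fun x _ => ler_normB _ _).
  move/le_lt_trans; apply; rewrite lte_mul_pinfty ?lee_fin ?powR_ge0//.
  rewrite lte_add_pinfty//; first exact: Lpint_fin.
  by rewrite /Lpint step_norm_weighted// ltry.
pose V g (c : seq bool -> R) t := `|sproc c (dyadic_avg Q g) t|.
have V0 g c t : 0 <= V g c t by exact: normr_ge0.
have Vle g c n x N : dyadic Q x -> (n <= N)%N ->
    `|step Q n (sproc c (dyadic_avg Q g)) [::] x| <= `|step Q N (rmax (V g c)) [::] x|.
  move=> Qx nN; have [t tn tx] := node_exists N Qx; rewrite (stepE _ tn tx).
  have tE : dyadic (node Q (drop (N - n) t)) x.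
    by move: tx; rewrite -[in node Q t](cat_take_drop (N - n) t) node_cat => /node_sub.
  rewrite (stepE _ _ tE) ?size_drop ?tn ?subKn// [leRHS]ger0_norm ?rmax_ge0//.
  apply: (le_trans (rmax_ge (V g c) _)).
  rewrite -[in leRHS](cat_take_drop (N - n) t); elim: (take _ t) => //= e r IH.
  by rewrite le_max IH.
have sup g c : measurable_fun setT g -> intg (fun x => `|g x| `^ p * u x) Q ->
    (forall s, `|c s| <= 1) ->
    exists G : R -> \bar R, [/\ measurable_fun (dyadic Q) G,
    forall x n, dyadic Q x -> ((`|step Q n (sproc c (dyadic_avg Q g)) [::] x| `^ p * u x)%:E <= G x)%E,
    forall x, dyadic Q x -> (0 <= G x)%E &
    (\int[lam]_(x in dyadic Q) G x <= C%:E * Lpint p u Q g)%E].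
  move=> mg gp c1.
  have [G [mG gG G0 iG]] := sup_step p0 mu u0 (V0 g c) (fun n => HC u Q g c n uA mg gp c1).
  exists G; split => // x n Qx; apply: le_trans (gG x n Qx).
  by rewrite lee_fin ler_wpM2r ?(ltW (u0 x))//; apply: powR_mono => //; exact: Vle.
have [G HG] := choice (fun m => sup (defect Q f m) (fun=> 1) (mdef m) (ddef m) one1).
have sE m n x : dyadic Q x -> (m <= n)%N ->
    step Q n (sproc (fun=> 1) (dyadic_avg Q (defect Q f m))) [::] x = sseq Q f n x - sseq Q f m x.
  by move=> Qx mn; rewrite step_sproc_defect.
have scv : {ae lam, forall x, dyadic Q x -> sseq Q f n x @[n --> \oo] --> Slim Q f x}.
  (* The infimum of the majorants [G m] has integral 0 and so vanishes almost everywhere; at such a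
     point some [G m x] is as small as desired, which makes the sequence Cauchy. *)
  pose H x := einfs (fun m => G m x) 0%N.
  have mH : measurable_fun (dyadic Q) H.
    by apply: measurable_fun_einfs => m; have [] := HG m.
  have H0 x : dyadic Q x -> (0 <= H x)%E.
    by move=> Qx; apply: le_ereal_inf_tmp => _ [m _ <-]; have [_ _ + _] := HG m; apply.
  have HG' m x : (H x <= G m x)%E by apply: ereal_inf_lbound; exists m.
  have iH : (\int[lam]_(x in dyadic Q) H x <= 0)%E.
    have lim0 : (C%:E * Lpint p u Q (defect Q f n) @[n --> \oo] --> (0 : \bar R))%E.
      by rewrite -[X in _ --> X](mule0 C%:E); apply: cvgeZl.
    rewrite -(cvg_lim (@ereal_hausdorff R) lim0); apply: lime_ge.
      by apply/cvg_ex; exists 0%E.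
    apply: nearW => m; have [mG _ _ iG] := HG m; apply: le_trans iG.
    by apply: le_lam => // x _; exact: HG'.
  apply: ae_imp (integral_eq0_ae (measurable_dyadicR Q) mH H0 iH) => x Hx Qx.
  apply: Slim_cvg; apply: cauchy_seq_cvg => e e0.
  have eu : 0 < e `^ p * u x by rewrite mulr_gt0 ?powR_gt0.
  have [m Gm] : exists m, (G m x <= (e `^ p * u x)%:E)%E.
    apply: contrapT => /forallNP nG; have : ((e `^ p * u x)%:E <= H x)%E.
      by apply: le_ereal_inf_tmp => _ [m _ <-]; apply/ltW; rewrite ltNge; apply/negP/nG.
    by rewrite Hx// lee_fin leNgt eu.
  exists m => n mn; have [_ + _ _] := HG m => /(_ x n Qx)/le_trans/(_ Gm).
  rewrite sE// lee_fin ler_pM2r// => h; rewrite leNgt; apply/negP => he.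
  by move: h; rewrite leNgt; apply/negP/negPn; rewrite gt0_ltr_powR ?nnegrE ?(ltW e0).
have limG m x : dyadic Q x -> sseq Q f n x @[n --> \oo] --> Slim Q f x ->
    ((`|Slim Q f x - sseq Q f m x| `^ p * u x)%:E <= G m x)%E.
  move=> Qx h; have hm : sseq Q f n x - sseq Q f m x @[n --> \oo] --> Slim Q f x - sseq Q f m x.
    by apply: cvgB => //; exact: cvg_cst.
  apply: (limit_bound (N := m) (u0 x) hm) => n mn.
  by rewrite -sE//; have [_ + _ _] := HG m; apply.
have mS := measurable_Slim Q f.
have aele (h1 h2 : R -> \bar R) : measurable_fun (dyadic Q) h1 -> measurable_fun (dyadic Q) h2 ->
    (forall x, dyadic Q x -> (0 <= h1 x)%E) -> (forall x, dyadic Q x -> (0 <= h2 x)%E) ->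
    (forall x, dyadic Q x -> sseq Q f n x @[n --> \oo] --> Slim Q f x -> (h1 x <= h2 x)%E) ->
    (\int[lam]_(x in dyadic Q) h1 x <= \int[lam]_(x in dyadic Q) h2 x)%E.
  move=> m1 m2 h10 h20 h12; apply: ae_ge0_le_integral => //.
  by apply: ae_imp scv => x hx Qx; apply: h12 => //; exact: hx.
have mm (g : R -> R) : measurable_fun setT g -> measurable_fun (dyadic Q) (fun x => (`|g x| `^ p * u x)%:E).
  by move=> mg; apply/measurable_EFinP; apply: measurable_funTS; exact: measurable_Lp.
have pos (g : R -> R) x : (0 <= (`|g x| `^ p * u x)%:E)%E.
  by rewrite lee_fin mulr_ge0 ?powR_ge0 ?(ltW (u0 x)).
have C'1 : 2 `^ p * (C + C) <= 2 `^ p * (C + C) + C by rewrite lerDl ltW.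
have C'2 : C <= 2 `^ p * (C + C) + C by rewrite lerDr mulr_ge0 ?addr_ge0 ?powR_ge0 ?(ltW C0).
split => //.
- move=> m n c mn c1 cm.
  have m1 : measurable_fun setT (fun x => Slim Q f x - sseq Q f m x).
    by apply: measurable_funB => //; exact: measurable_step.
  have m2 := measurable_step Q n (sproc c (dyadic_avg Q (defect Q f m))) [::].
  have b1 : (Lpint p u Q (fun x => (Slim Q f x - sseq Q f m x)%R) <=
      C%:E * Lpint p u Q (defect Q f m))%E.
    have [mG _ G0 iG] := HG m; apply: le_trans iG; apply: aele => //.
    - exact: (mm _ m1).
    - by move=> x _; exact: (pos (fun x => Slim Q f x - sseq Q f m x) x).
    by move=> x Qx h; exact: (limG m x Qx h).
  have b2 : (Lpint p u Q (step Q n (sproc c (dyadic_avg Q (defect Q f m))) [::]) <=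
      C%:E * Lpint p u Q (defect Q f m))%E.
    have [G' [mG' gG' G'0 iG']] := sup (defect Q f m) c (mdef m) (ddef m) c1.
    apply: le_trans iG'; apply: le_lam => //.
    - exact: (mm _ m2).
    - by move=> x Qx; exact: gG'.
  apply: (@le_trans _ _ ((2 `^ p)%:E * (C%:E * Lpint p u Q (defect Q f m) +
       C%:E * Lpint p u Q (defect Q f m)))%E).
    apply: le_trans (Lpint_tri mu u0 p0 _ m1 m2 _) _.
    - by apply: measurable_funB => //; exact: measurable_step.
    - move=> x Qx; rewrite step_sproc_defect// -/(sseq Q f m x).
      have -> : Slim Q f x - step Q n (sproc c (dyadic_avg Q f)) [::] x =
        (Slim Q f x - sseq Q f m x) -
        (step Q n (sproc c (dyadic_avg Q f)) [::] x - sseq Q f m x) by ring.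
      exact: ler_normB.
    - by apply: lee_wpmul2l; [rewrite lee_fin powR_ge0|exact: leeD].
  rewrite -ge0_muleDl ?lee_fin ?(ltW C0)// muleA -EFinD -EFinM.
  by rewrite lee_wpmul2r ?Lpint_ge0 ?lee_fin.
- have [G' [mG' gG' G'0 iG']] := sup f (fun=> 1) mf fp one1.
  apply: (@le_trans _ _ (C%:E * Lpint p u Q f)%E); last first.
    by rewrite lee_wpmul2r ?Lpint_ge0 ?lee_fin.
  apply: le_trans iG'; apply: aele => //; first exact: (mm _ mS).
  move=> x Qx h; apply: (limit_bound (N := 0%N) (u0 x) h) => n _; exact: gG'.
Qed.

End Bounds.

End ShiftOnTop.

(** * Pairings of weighted functions and the Bloom weight *)

Section CommutatorOnTop.
Context {R : realType}.
Implicit Types (I Q : dyadic_index) (s t : seq bool) (a c : seq bool -> R)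
  (f g h u b : R -> R) (p q A : R).
Local Notation lam := (@lebesgue_measure R).
Hint Resolve measurable_dyadic measurable_dyadicR : core.

Lemma powR_cvg_pos (r : nat -> R) (l e : R) : 0 < l -> r n @[n --> \oo] --> l ->
  r n `^ e @[n --> \oo] --> l `^ e.
Proof.
move=> l0 rl.
have c : {for l, continuous (fun x => x `^ e)}.
  apply: differentiable_continuous; apply/derivable1_diffP.
  by apply: derivable_powR; rewrite in_itv /= l0.
exact: (cvg_comp _ _ rl c).
Qed.

Lemma powR_cvg (r : nat -> R) (l e : R) : 1 <= e -> r n @[n --> \oo] --> l ->
  `|r n| `^ e @[n --> \oo] --> `|l| `^ e.
Proof.
move=> e1 rl; have [l0|l0] := eqVneq l 0.
  rewrite l0 normr0 powR0; last by lra.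
  by apply: powR_cvg0_seq => //; rewrite -l0.
by apply: powR_cvg_pos; [rewrite normr_gt0|exact: cvg_norm].
Qed.

(** The parameter is fixed first, to make the term with [X] small; its inverse power may then be
    large, since [y] tends to 0. *)
Lemma young_cvg0 p q (X : R) (z y : nat -> R) : conjugate p q -> 0 <= X ->
  (forall tau, 0 < tau -> forall n, `|z n| <= tau `^ p * X + tau `^ (- q) * y n) ->
  (forall n, 0 <= y n) ->
  y n @[n --> \oo] --> 0 -> z n @[n --> \oo] --> 0.
Proof.
move=> pq X0 H y0 yc; case: (pq) => p1 q1 _; apply/cvgrPdist_le => e e0.
have X1 : 0 < 2 * (X + 1) / e by rewrite divr_gt0 ?mulr_gt0//; lra.
have [tau tau0 tauE] := half_scale p1 X1.
have tX : tau `^ p * X <= e / 2 / 2.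
  have -> : tau `^ p = e / (4 * (X + 1)).
    apply: (mulfI (lt0r_neq0 X1)); rewrite tauE; field.
    by apply/andP; split; lra.
  rewrite mulrAC ler_pdivrMr; last lra.
  have -> : e / 2 / 2 * (4 * (X + 1)) = e * (X + 1) by field.
  by rewrite ler_pM2l//; lra.
have tq : 0 < tau `^ (- q) by rewrite powR_gt0.
have d0 : 0 < e / 2 / tau `^ (- q) by rewrite !divr_gt0.
move/cvgrPdist_le: yc => /(_ _ d0); apply: filterS => n.
rewrite !sub0r !normrN (ger0_norm (y0 n)) ler_pdivlMr// mulrC => yn.
by apply: (le_trans (H _ tau0 n)); lra.
Qed.

Lemma avg_mulC_step Q n a b t : (size t <= n)%N -> measurable_fun setT b -> intg b Q ->
  (forall k s, intg (fun x => b x * step Q k a s x) Q) ->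
  avg (fun x => b x * step Q n a [::] x) (node Q t) =
  ave (n - size t) (fun s => dyadic_avg Q b s * a s) t.
Proof.
move=> tn mb bQ ib; have [k] := ubnP (n - size t); elim: k t tn => // k IH t tn kn.
move: tn; rewrite leq_eqVlt => /predU1P[tn|tn].
  rewrite -tn subnn /= (@eq_avg _ _ (fun x => a t * b x + 0 * b x)).
    by rewrite avg_lin; [rewrite /dyadic_avg; ring|exact: intg_node|exact: intg_node].
  by move=> x tx; rewrite (stepE _ _ tx)//; ring.
have lt e : (n - size (e :: t) < k)%N by rewrite -ltnS (leq_trans _ kn)// ltnS ltn_sub2l.
by rewrite (mart_avg (ib n [::])) (IH (true :: t))// (IH (false :: t))// -[in RHS](subnSK tn).
Qed.

Lemma pow_root p (x a : R) : 1 < p -> 0 <= x -> 0 <= a ->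
  (x * a `^ p^-1) `^ p = x `^ p * a.
Proof.
by move=> p1 x0 a0; rewrite powRM ?powR_ge0// -powRrM mulVf ?powRr1//; lra.
Qed.

Lemma root_pow p (x a : R) : 1 < p -> 0 <= x -> 0 <= a ->
  (x `^ p * a) `^ p^-1 = x * a `^ p^-1.
Proof.
by move=> p1 x0 a0; rewrite powRM ?powR_ge0// -powRrM mulfV ?powRr1//; lra.
Qed.

Lemma intg_mul p q A u f g I : conjugate p q -> Ap1 p q A u -> measurable_fun setT f ->
  measurable_fun setT g -> intg (fun x => `|f x| `^ p * u x) I ->
  intg (fun x => `|g x| `^ q * dual p u x) I -> intg (fun x => f x * g x) I.
Proof.
move=> pq uA mf mg fp gq; case: (uA) => mu u0 iu iv _; case: (pq) => p1 q1 _.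
apply: (@le_integrable _ _ _ lam _ (measurable_dyadicR I) _
  (EFin \o (fun x => `|f x| `^ p * u x + `|g x| `^ q * dual p u x))).
- apply/measurable_EFinP; apply: measurable_funTS; exact: measurable_funM.
- move=> x _; rewrite /= lee_fin.
  have v0 := dual_gt0 p (u0 x).
  have a0 : 0 <= `|f x| `^ p * u x by rewrite mulr_ge0 ?powR_ge0 ?(ltW (u0 x)).
  have b0 : 0 <= `|g x| `^ q * dual p u x by rewrite mulr_ge0 ?powR_ge0 ?(ltW v0).
  rewrite [leRHS]ger0_norm ?addr_ge0// normrM.
  apply: le_trans (young_root pq a0 b0).
  rewrite (root_pow p1 (normr_ge0 (f x)) (ltW (u0 x))).
  by rewrite (root_pow q1 (normr_ge0 (g x)) (ltW v0)) mulrACA (dual_root pq (u0 x)) mulr1.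
- exact: intgD.
Qed.

Lemma avg_mul_young p q A u f g I (tau : R) : conjugate p q -> Ap1 p q A u -> 0 < tau ->
  measurable_fun setT f ->
  measurable_fun setT g -> intg (fun x => `|f x| `^ p * u x) I ->
  intg (fun x => `|g x| `^ q * dual p u x) I ->
  `|avg (fun x => f x * g x) I| <= tau `^ p * avg (fun x => `|f x| `^ p * u x) I +
     tau `^ (- q) * avg (fun x => `|g x| `^ q * dual p u x) I.
Proof.
move=> pq uA tau0 mf mg fp gq; case: (uA) => mu u0 iu iv _; case: (pq) => p1 q1 _.
have fg := intg_mul pq uA mf mg fp gq.
rewrite (le_trans (avg_norm fg))// -avg_lin//; apply: avg_le.
- exact: intg_norm.
- exact: intg_lin.
move=> x _; have v0 := dual_gt0 p (u0 x).
have := @young_scaled _ p q tau (`|f x| * u x `^ p^-1) (`|g x| * dual p u x `^ q^-1) pq tau0.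
rewrite !mulr_ge0 ?powR_ge0// => /(_ isT isT).
rewrite mulrACA (dual_root pq (u0 x)) mulr1 -normrM.
by rewrite (pow_root p1 (normr_ge0 (f x)) (ltW (u0 x))) (pow_root q1 (normr_ge0 (g x)) (ltW v0)).
Qed.

(** The closure is constant below each node of depth [m] and leaves the inner average. *)
Lemma ave_clos_mul n m (phi0 w : seq bool -> R) : (m <= n)%N ->
  ave n (fun s => w s * clos m phi0 s) [::] = ave m (fun s => phi0 s * ave (n - m) w s) [::].
Proof.
move=> mn; rewrite -{1}(subnKC mn) ave_add; apply: eq_ave => s sm.
have H k r : (m <= size r)%N -> ave k (fun t => w t * clos m phi0 t) r =
    clos m phi0 r * ave k w r.
  elim: k r => /= [|k IH] r mr; first by rewrite mulrC.
  by rewrite !IH ?(ltnW (_ : m < (size r).+1)%N)// !(clos_mart_drop phi0 mr)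
    !clos_mart_drop ?(leq_trans mr)//= subSn//=; ring.
by rewrite H ?clos_leaf // sm.
Qed.

(* The geometric mean of two dual weights is an [A_2] weight. *)
Definition bloom p q (u v : R -> R) x := u x `^ p^-1 * dual p v x `^ q^-1.

Section Bloom.
Variables (p q A : R) (mu la : R -> R).
Hypotheses (pq : conjugate p q) (A1 : 1 <= A) (muA : Ap1 p q A mu) (laA : Ap1 p q A la).

Lemma intg_bloom I : intg (bloom p q mu la) I.
Proof.
case: muA => mmu mu0 imu imu' _; case: laA => mla la0 ila ila' _.
apply: (@le_integrable _ _ _ lam _ (measurable_dyadicR I) _
  (EFin \o (fun x => mu x + dual p la x))).
- apply/measurable_EFinP; apply: measurable_funTS; apply: measurable_funM.
    exact: (measurableT_comp (measurable_powR _) mmu).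
  exact: (measurableT_comp (measurable_powR _) (measurable_dual p mla)).
- move=> x _; rewrite /= lee_fin; have v0 := dual_gt0 p (la0 x).
  rewrite !ger0_norm ?addr_ge0 ?mulr_ge0 ?powR_ge0 ?(ltW (mu0 x)) ?(ltW v0)//.
  exact: (young_root pq (ltW (mu0 x)) (ltW v0)).
- exact: intgD.
Qed.

Lemma bloom_gt0 x : 0 < bloom p q mu la x.
Proof.
case: muA => mmu mu0 _ _ _; case: laA => mla la0 _ _ _.
by rewrite mulr_gt0// powR_gt0// dual_gt0.
Qed.

Lemma avg_bloom_le I :
  avg (bloom p q mu la) I <= avg mu I `^ p^-1 * avg (dual p la) I `^ q^-1.
Proof.
case: muA => mmu mu0 imu imu' _; case: laA => mla la0 ila ila' _.
apply: avg_holder => // [|x _|x _]; [exact: intg_bloom|exact: ltW|exact/ltW/dual_gt0].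
Qed.

End Bloom.

Lemma Ap1_mono p q A A' u : A <= A' -> Ap1 p q A u -> Ap1 p q A' u.
Proof. by move=> AA [? ? ? ? h]; split => // I; exact: le_trans (h I) AA. Qed.

Lemma half_power_ge1 (x : R) : 0 <= x -> 1 <= x `^ 2^-1 -> 1 <= x.
Proof.
move=> x0 h; have := powR_mono (ltr0n R 2) ler01 h.
by rewrite powR1 -powRrM mulVf// powRr1.
Qed.

Lemma cross_mul (x x' y y' A : R) : 0 <= x -> 0 <= x' -> 0 <= y -> 0 <= y' ->
  x * x' <= A -> y * y' <= A -> x * y' * (y * x') <= A ^+ 2.
Proof.
move=> x0 x'0 y0 y'0 hx hy; rewrite (_ : x * y' * (y * x') = (x * x') * (y * y')); last by ring.
by rewrite expr2 ler_pM// mulr_ge0.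
Qed.

Lemma conjugate2 : conjugate (2 : R) 2.
Proof. by split; lra. Qed.

Section BloomPair.
Variables (p q A : R) (mu la : R -> R).
Hypotheses (pq : conjugate p q) (A1 : 1 <= A) (muA : Ap1 p q A mu) (laA : Ap1 p q A la).
Local Notation nu := (bloom p q mu la).
Local Notation ka := (bloom p q la mu).

(** The two weights are reciprocal, so Cauchy-Schwarz gives the lower bound. Above, Hoelder on both
    factors regroups into the A_p products of [mu] and of [la], each at most [A]. *)
Lemma bloom_pair I : 1 <= avg nu I * avg ka I <= A ^+ 2.
Proof.
case: (muA) => mmu mu0 imu imu' Amu; case: (laA) => mla la0 ila ila' Ala.
have inu := intg_bloom pq muA laA; have ika := intg_bloom pq laA muA.
have nu0 x := bloom_gt0 muA laA x; have ka0 x := bloom_gt0 laA muA x.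
have an := avg_gt0 (inu I) (fun x _ => nu0 x).
have ak := avg_gt0 (ika I) (fun x _ => ka0 x).
apply/andP; split.
- have c2 := conjugate2.
  have nk x : nu x * ka x = 1.
    have e1 := dual_root pq (mu0 x); have e2 := dual_root pq (la0 x).
    rewrite /bloom; move: e1 e2; set a := _ `^ _; set a' := dual p mu x `^ _.
    set v := la x `^ _; set v' := dual p la x `^ _ => e1 e2.
    by rewrite -[RHS]mulr1 -{1}e1 -e2; ring.
  have h := avg_holder c2 (inu I) (ika I) (intg_cst 1 I) (fun x _ => ltW (nu0 x))
    (fun x _ => ltW (ka0 x)) (_ : forall x, dyadic I x -> 1 <= nu x `^ 2^-1 * ka x `^ 2^-1).
  have {}h : avg (fun=> 1) I <= avg nu I `^ 2^-1 * avg ka I `^ 2^-1.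
    by apply: h => x _; rewrite -(powRM _ (ltW (nu0 x)) (ltW (ka0 x))) nk powR1.
  rewrite avg_cst -(powRM _ (ltW an) (ltW ak)) in h.
  exact: half_power_ge1 (mulr_ge0 (ltW an) (ltW ak)) h.
- have h1 := avg_bloom_le pq muA laA I; have h2 := avg_bloom_le pq laA muA I.
  apply: (le_trans (ler_pM (ltW an) (ltW ak) h1 h2)).
  by apply: cross_mul (Amu I) (Ala I); exact: powR_ge0.
Qed.

End BloomPair.

End CommutatorOnTop.

(** * Convergence of pairings and averages *)

Section CommutatorLimit.
Context {R : realType}.
Implicit Types (I Q : dyadic_index) (s t : seq bool) (a c : seq bool -> R)
  (f g h u b : R -> R) (p q A : R).
Local Notation lam := (@lebesgue_measure R).
Hint Resolve measurable_dyadic measurable_dyadicR : core.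

Lemma mart_iter2 (F : seq bool -> R) s : mart F -> (forall t, 0 <= F t) ->
  F s <= 2 ^+ size s * F [::].
Proof.
move=> mF F0; elim: s => [|e s IH] /=; first by rewrite expr0 mul1r.
rewrite (le_trans (mart_child2 _ _ mF F0))// exprS -mulrA ler_pM2l//.
Qed.

Lemma weighted_ge0 p u f x : (forall x, 0 < u x) -> 0 <= `|f x| `^ p * u x.
Proof. by move=> u0; rewrite mulr_ge0 ?powR_ge0 ?(ltW (u0 x)). Qed.

Lemma intg_step_mul Q k a s b : measurable_fun setT b -> intg b Q ->
  intg (fun x => b x * step Q k a s x) Q.
Proof.
move=> mb bQ; elim: k s => [|k IH] s /=; last first.
  apply: (@eq_integrable _ _ _ lam _ (measurable_dyadicR Q)
    (EFin \o (fun x => b x * step Q k a (true :: s) x + b x * step Q k a (false :: s) x))).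
    by move=> x _ /=; rewrite mulrDr.
  exact: intgD.
apply: (@le_integrable _ _ _ lam _ (measurable_dyadicR Q) _ (EFin \o (fun x => `|a s| * `|b x|))).
- apply/measurable_EFinP; apply: measurable_funTS; apply: measurable_funM => //.
  exact: (measurable_step Q 0 a s).
- move=> x _; rewrite /= lee_fin [leRHS]ger0_norm ?mulr_ge0// !normrM mulrCA.
  rewrite ler_wpM2l// ler_piMr//.
  by rewrite indicE; case: (_ \in _); rewrite ?normr1 ?normr0.
- apply: (@eq_integrable _ _ _ lam _ (measurable_dyadicR Q)
    (EFin \o (fun x => `|a s| * `|b x| + 0 * `|b x|))).
    by move=> x _ /=; rewrite mul0r addr0.
  by apply: intg_lin; exact: intg_norm.
Qed.

Section Pairing.
Variables (p q A : R) (u : R -> R) (Q : dyadic_index).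
Hypotheses (pq : conjugate p q) (A1 : 1 <= A) (uA : Ap1 p q A u).

(** Young's inequality is used on the node; passing from the node up to [Q] costs a factor 2 per
    generation, harmless since [s] is fixed. *)
Lemma pairing_cvg0 b (g : nat -> R -> R) s : measurable_fun setT b ->
  (forall n, measurable_fun setT (g n)) -> intg (fun x => `|b x| `^ p * u x) Q ->
  (forall n, intg (fun x => `|g n x| `^ q * dual p u x) Q) ->
  Lpint q (dual p u) Q (g n) @[n --> \oo] --> 0%E ->
  avg (fun x => b x * g n x) (node Q s) @[n --> \oo] --> 0.
Proof.
move=> mb mg bp gq gc; case: (uA) => mu u0 iu iv _.
have v0 x : 0 < dual p u x by exact: dual_gt0.
pose X := avg (fun x => `|b x| `^ p * u x) (node Q s).
pose Y n t := avg (fun x => `|g n x| `^ q * dual p u x) (node Q t).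
have Y0 n t : 0 <= Y n t by apply: avg_ge0 => x _; exact: weighted_ge0.
apply: (@young_cvg0 _ p q X _ (fun n => 2 ^+ size s * Y n [::]) pq).
- by apply: avg_ge0 => x _; exact: weighted_ge0.
- move=> tau tau0 n.
  apply: (le_trans (avg_mul_young pq uA tau0 mb (mg n) (intg_node s bp) (intg_node s (gq n)))).
  rewrite lerD2l ler_wpM2l ?powR_ge0//.
  exact: (mart_iter2 s (mart_avg (gq n)) (Y0 n)).
- by move=> n; rewrite mulr_ge0 ?exprn_ge0.
- rewrite -[X in _ --> X](mulr0 (2 ^+ size s)); apply: cvgMr.
  rewrite -[X in _ --> X](mulr0 (dlen Q)^-1); apply: cvgMr.
  exact: fine_cvg gc.
Qed.

Lemma pairing_cvg b h (g : nat -> R -> R) s : measurable_fun setT b ->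
  measurable_fun setT h ->
  (forall n, measurable_fun setT (g n)) -> intg (fun x => `|b x| `^ p * u x) Q ->
  intg (fun x => `|h x| `^ q * dual p u x) Q ->
  (forall n, intg (fun x => `|g n x| `^ q * dual p u x) Q) ->
  Lpint q (dual p u) Q (fun x => (h x - g n x)%R) @[n --> \oo] --> 0%E ->
  avg (fun x => b x * g n x) (node Q s) @[n --> \oo] --> avg (fun x => b x * h x) (node Q s).
Proof.
move=> mb mh mg bp hq gq gc; case: (uA) => mu u0 iu iv _; case: (pq) => p1 q1 _.
have v0 x : 0 < dual p u x by exact: dual_gt0.
have mhg n : measurable_fun setT (fun x => h x - g n x) by exact: measurable_funB.
have hgq n : intg (fun x => `|h x - g n x| `^ q * dual p u x) Q.
  apply: Lpint_intg => //; first exact: measurable_dual.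
  have q0 : 0 < q by lra.
  apply: le_lt_trans (Lpint_tri (measurable_dual p mu) v0 q0 (mhg n) mh (mg n)
    (fun x _ => ler_normB _ _)) _.
  by rewrite lte_mul_pinfty ?lee_fin ?powR_ge0// lte_add_pinfty// Lpint_fin.
have H := pairing_cvg0 s mb mhg bp hgq gc.
have -> : (fun n => avg (fun x => b x * g n x) (node Q s)) =
    (fun n => avg (fun x => b x * h x) (node Q s) - avg (fun x => b x * (h x - g n x)) (node Q s)).
  apply/funext => n.
  have i1 := intg_node s (intg_mul pq uA mb mh bp hq).
  have i2 := intg_node s (intg_mul pq uA mb (mg n) bp (gq n)).
  rewrite (@eq_avg _ (fun x => b x * (h x - g n x)) (fun x => 1 * (b x * h x) + -1 * (b x * g n x))).
    by rewrite avg_lin//; ring.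
  by move=> x _; ring.
rewrite -[X in _ --> X]subr0; apply: cvgB => //; exact: cvg_cst.
Qed.

Lemma intg_weighted_step n a : intg (fun x => `|step Q n a [::] x| `^ p * u x) Q.
Proof.
case: (uA) => mu u0 iu iv _; case: (pq) => p1 q1 _.
apply: Lpint_intg => //; first exact: measurable_step.
by rewrite /Lpint step_norm_weighted// ltry.
Qed.

Lemma step_shift_cvg f : measurable_fun setT f -> intg (fun x => `|f x| `^ p * u x) Q ->
  Lpint p u Q (fun x => (Slim Q f x - sseq Q f n x)%R) @[n --> \oo] --> 0%E.
Proof.
move=> mf fp; have [C C0 HC] := shift_limit pq A1; have [_ h _] := HC u Q f uA mf fp.
case: (uA) => mu u0 iu iv _.
have one1 (s : seq bool) : `|(fun=> 1) s : R| <= 1 by rewrite normr1.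
have dc := defect_cvg0 pq A1 uA mf fp.
apply: (@squeeze_cvge _ _ _ _ (cst 0%E) _ (fun n => C%:E * Lpint p u Q (defect Q f n))%E).
- apply: nearW => n; rewrite Lpint_ge0//=; exact: (h n n (fun=> 1) (leqnn n) one1 (fun _ _ => erefl)).
- exact: cvg_cst.
- by rewrite -[X in _ --> X](mule0 C%:E); apply: cvgeZl.
Qed.

Lemma Slim_intg f : measurable_fun setT f -> intg (fun x => `|f x| `^ p * u x) Q ->
  intg (fun x => `|Slim Q f x| `^ p * u x) Q.
Proof.
move=> mf fp; have [C C0 HC] := shift_limit pq A1; have [_ _ h] := HC u Q f uA mf fp.
case: (uA) => mu u0 iu iv _; apply: Lpint_intg => //; first exact: measurable_Slim.
by apply: le_lt_trans h _; rewrite lte_mul_pinfty ?lee_fin ?(ltW C0)// Lpint_fin.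
Qed.

End Pairing.

(** Averaging is pairing with the constant 1, which lies in L^q of the dual weight. *)
Lemma avg_cvg p q A u Q h (g : nat -> R -> R) s : conjugate p q -> Ap1 p q A u ->
  measurable_fun setT h ->
  (forall n, measurable_fun setT (g n)) ->
  intg (fun x => `|h x| `^ p * u x) Q ->
  (forall n, intg (fun x => `|g n x| `^ p * u x) Q) ->
  Lpint p u Q (fun x => (h x - g n x)%R) @[n --> \oo] --> 0%E ->
  avg (g n) (node Q s) @[n --> \oo] --> avg h (node Q s).
Proof.
move=> pq uA mh mg hp gp gc; have [mu u0 iu iv _] := uA.
have dd x : dual q (dual p u) x = u x by exact: (dualK pq (u0 x)).
have dfun : dual q (dual p u) = u by apply/funext.
have one : intg (fun x => `|1 : R| `^ q * dual p u x) Q.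
  by under eq_fun do rewrite normr1 powR1 mul1r; exact: iv.
have e (k : R -> R) : avg k (node Q s) = avg (fun x => 1 * k x) (node Q s).
  by apply: eq_avg => x _; rewrite mul1r.
rewrite e (_ : (fun n => _) = (fun n => avg (fun x => 1 * g n x) (node Q s))); last first.
  by apply/funext => n; exact: e.
apply: (@pairing_cvg q p A (dual p u) Q (conjugate_sym pq) (Ap1_dual pq uA)
   (fun=> 1) h g s) => //; rewrite ?dfun//.
Qed.

End CommutatorLimit.

(** * The commutator form tested at a fixed depth *)

Section CommutatorOnTop.
Context {R : realType}.
Implicit Types (I Q : dyadic_index) (s t : seq bool) (a c phi : seq bool -> R)
  (f g h u b mu la : R -> R) (p q A B : R).
Local Notation lam := (@lebesgue_measure R).
Local Notation one := (fun=> 1 : R).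
Hint Resolve measurable_dyadic measurable_dyadicR : core.

Lemma sproc_cvg (a : nat -> seq bool -> R) (l : seq bool -> R) s :
  (forall t, a n t @[n --> \oo] --> l t) ->
  sproc one (a n) s @[n --> \oo] --> sproc one l s.
Proof.
move=> al; elim: s => [|e s IH] /=; first exact: cvg_cst.
apply: cvgD => //; apply: cvgMr.
case: s {IH} => [|e' s] /=; first exact: cvg_cst.
by apply: cvgMr; rewrite /dif; apply: cvgMl; apply: cvgB; exact: al.
Qed.

(** The closed product is the pairing of [b] with the conditional expectation of [f], and the latter
    tends to [f] in L^q of the dual weight. *)
Lemma clos_prod_cvg p q A la Q b f t : conjugate p q -> 1 <= A -> Ap1 p q A la ->
  measurable_fun setT b -> measurable_fun setT f ->
  intg (fun x => `|b x| `^ p * la x) Q -> intg (fun x => `|f x| `^ q * dual p la x) Q ->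
  clos n (fun s => dyadic_avg Q b s * dyadic_avg Q f s) t @[n --> \oo] -->
  dyadic_avg Q (fun x => b x * f x) t.
Proof.
move=> pq A1 laA mb mf bp fq.
have H := @pairing_cvg R p q A la Q pq laA b f (fun n => step Q n (dyadic_avg Q f) [::]) t
  mb mf (fun n => measurable_step Q n _ [::]) bp fq
  (fun n => intg_weighted_step Q (conjugate_sym pq) (Ap1_dual pq laA) n _)
  (defect_cvg0 (conjugate_sym pq) A1 (Ap1_dual pq laA) mf fq).
have bQ : intg b Q by exact: Lp_intg pq laA mb bp.
apply: cvg_trans H; apply: near_eq_cvg; near=> n.
have tn : (size t <= n)%N by near: n; exact: nbhs_infty_ge.
rewrite (avg_mulC_step tn mb bQ); last by move=> k s; exact: intg_step_mul.
by rewrite /clos tn.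
Unshelve. all: by end_near.
Qed.

(** [sseq Q f n] has exactly these averages at nodes of depth at most [n], and averages pass to the
    limit. *)
Lemma avg_Slim p q A u Q f s : conjugate p q -> 1 <= A -> Ap1 p q A u ->
  measurable_fun setT f -> intg (fun x => `|f x| `^ p * u x) Q ->
  avg (Slim Q f) (node Q s) = sproc one (dyadic_avg Q f) s.
Proof.
move=> pq A1 uA mf fp.
have H := @avg_cvg R p q A u Q (Slim Q f) (sseq Q f) s pq uA (measurable_Slim Q f)
  (fun n => measurable_step Q n _ [::]) (Slim_intg pq A1 uA mf fp)
  (fun n => intg_weighted_step Q pq uA n _) (step_shift_cvg pq A1 uA mf fp).
apply: (cvg_unique _ H); first exact: norm_hausdorff.
apply: (@cvg_trans _ (nbhs (sproc one (dyadic_avg Q f) s))) => //.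
apply: cvg_near_cst; near=> n.
have sn : (size s <= n)%N by near: n; exact: nbhs_infty_ge.
by rewrite avg_step clos_mart//; exact: mart_sproc.
Unshelve. all: by end_near.
Qed.

Lemma div_powR (x S p : R) : 0 <= x -> 0 < S -> (x / S) `^ p = x `^ p * S `^ (- p).
Proof.
move=> x0 S0; have S0' := ltW S0.
rewrite powRM ?invr_ge0//; congr (_ * _).
by rewrite -[in LHS](powR_inv1 S0') -powRrM mulN1r.
Qed.

Lemma dual_power (S k p q : R) : conjugate p q -> 0 < S ->
  (`|Num.sg k * `|k| `^ (p - 1) * S `^ (- p)| * S) `^ q = (`|k| / S) `^ p.
Proof.
move=> pq S0; have S0' := ltW S0; have [p1 q1 pq1] := pq.
have -> : `|Num.sg k * `|k| `^ (p - 1) * S `^ (- p)| * S = (`|k| / S) `^ (p - 1).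
  rewrite !normrM [X in _ * X * S]ger0_norm ?powR_ge0// [X in _ * X * _ * S]ger0_norm ?powR_ge0//.
  rewrite (_ : `|Num.sg k| * `|k| `^ (p - 1) = `|k| `^ (p - 1)); last first.
    rewrite normr_sg; have [->|k0] := eqVneq k 0; last by rewrite mul1r.
    by rewrite normr0 mul0r powR0//; lra.
  rewrite -mulrA div_powR//; congr (_ * _); rewrite opprB.
  rewrite -{2}(powRr1 S0') -powRD; last by rewrite (gt_eqF S0) implybT.
  by congr (_ `^ _); ring.
by rewrite (pow_conj pq)// divr_ge0.
Qed.

Lemma dual_product (S k p q : R) : conjugate p q -> 0 < S ->
  Num.sg k * `|k| `^ (p - 1) * S `^ (- p) * k = (`|k| / S) `^ p.
Proof.
move=> pq S0; have [p1 q1 pq1] := pq.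
rewrite div_powR//.
rewrite mulrAC; congr (_ * _); rewrite mulrAC -normrEsg.
have [->|k0] := eqVneq k 0; first by rewrite normr0 mul0r powR0//; lra.
rewrite -{1}(powRr1 (normr_ge0 k)) -powRD; last by rewrite normr_eq0 k0 implybT.
by congr (_ `^ _); ring.
Qed.

(** The chain x <= x (n k) <= n (x y); here n is an average of the Bloom weight and k one of its
    reciprocal. *)
Lemma product_compare (x y k n K : R) : 0 < x -> 0 < n -> 1 <= n * k -> k <= y ->
  x * y <= K -> x <= K * n.
Proof.
move=> x0 n0 g1 ky xy; apply: (@le_trans _ _ (x * (n * k))).
  by rewrite ler_peMr// ltW.
rewrite mulrCA [leRHS]mulrC ler_pM2l//; apply: le_trans xy; rewrite ler_pM2l//.
Qed.

Section Bound.
Variables (p q A : R).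
Hypotheses (pq : conjugate p q) (A1 : 1 <= A).

(** Normalised by root averages and not by the Bloom weight: this form passes from rectangles to
    fibres by differentiation, and [product_compare] relates the two. *)
Definition bmo1 mu la Q b B := forall s,
  avg (fun x => `|b x - dyadic_avg Q b s|) (node Q s) <=
    B * (rootavg p mu Q s * rootavg q (dual p la) Q s).

(** The test function stays at depth [m] while [b] and [f] are resolved at depth [n], so that [n]
    can tend to infinity first. The tree estimate is used with A^2, which bounds the A_p pairs and
    the Bloom pair alike. *)
Lemma form_top : exists2 C, 0 < C & forall mu la Q b f B n m phi tau,
  Ap1 p q A mu -> Ap1 p q A la -> intg b Q -> intg f Q ->
  intg (fun x => `|f x| `^ p * mu x) Q ->
  0 <= B -> bmo1 mu la Q b B -> (m <= n)%N -> 0 < tau ->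
  `|ave m (fun s => phi s * ave (n - m) (fun s =>
       sproc one (clos n (fun t => dyadic_avg Q b t * dyadic_avg Q f t)) s
       - dyadic_avg Q b s * sproc one (dyadic_avg Q f) s) s) [::]| <=
  C * B * (tau `^ p * avg (fun x => `|f x| `^ p * mu x) Q +
    tau `^ (- q) * ave m (fun s => (`|phi s| * rootavg q (dual p la) Q s) `^ q) [::]).
Proof.
have A21 : 1 <= A ^+ 2 by rewrite exprn_ege1.
have A0 : 0 <= A by exact: le_trans ler01 A1.
have AA2 : A <= A ^+ 2 by rewrite expr2 ler_peMl.
have [C C0 HC] := commutator_form pq A21.
exists (C * A ^+ 2); first by rewrite mulr_gt0// (lt_le_trans ltr01).
move=> mu la Q b f B n m phi tau muA laA bQ fQ fp B0 hb mn t0.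
have [p1 q1 _] := pq.
have [mmu mu0 imu idmu _] := muA; have [mla la0 ila idla _] := laA.
have dla0 x : 0 < dual p la x by exact: dual_gt0.
have dmu0 x : 0 < dual p mu x by exact: dual_gt0.
have muP := Ap1_pair Q pq (Ap1_mono AA2 muA).
have laP := Ap1_pair Q pq (Ap1_mono AA2 laA).
have H1 := @bloom_pair R p q A mu la pq muA laA.
have n0 s : 0 < avg (bloom p q mu la) (node Q s).
  by apply: avg_gt0; [exact: (intg_bloom pq muA laA)|move=> x _; exact: (bloom_gt0 muA laA)].
have k0 s : 0 < avg (bloom p q la mu) (node Q s).
  by apply: avg_gt0; [exact: (intg_bloom pq laA muA)|move=> x _; exact: (bloom_gt0 laA muA)].
have nle s : avg (bloom p q mu la) (node Q s) <= rootavg p mu Q s * rootavg q (dual p la) Q s.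
  exact: (avg_bloom_le pq muA laA).
have kle s : avg (bloom p q la mu) (node Q s) <= rootavg p la Q s * rootavg q (dual p mu) Q s.
  exact: (avg_bloom_le pq laA muA).
have pos : forall s, 0 < rootavg p mu Q s * rootavg q (dual p la) Q s.
  by move=> s; case: muP => _ _ h1 _ _; case: laP => _ _ _ h2 _; exact: mulr_gt0 (h1 s) (h2 s).
have nuge s : rootavg p mu Q s * rootavg q (dual p la) Q s <=
    A ^+ 2 * avg (bloom p q mu la) (node Q s).
  case: (Ap1_pair Q pq muA) => _ _ h1 h2 h3; case: (Ap1_pair Q pq laA) => _ _ h4 h5 h6.
  have /andP[_ c1] := h3 s; have /andP[_ c2] := h6 s.
  have /andP[g1 _] := H1 (node Q s).
  exact: (product_compare (pos s) (n0 s) g1 (kle s)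
    (cross_mul (ltW (h1 s)) (ltW (h2 s)) (ltW (h4 s)) (ltW (h5 s)) c1 c2)).
pose F s := avg (fun x => `|f x|) (node Q s).
pose Phi := clos m (fun s => `|phi s|).
have mphi : mart (clos m phi) by exact: mart_clos.
have mPhi : mart Phi by exact: mart_clos.
have := HC _ _ _ _ (fun s => avg (bloom p q mu la) (node Q s))
   (fun s => avg (bloom p q la mu) (node Q s)) (dyadic_avg Q b) (dyadic_avg Q f) F
   (clos m phi) Phi n (B * A ^+ 2) tau muP laP
   (mart_avg (intg_bloom pq muA laA Q)) (mart_avg (intg_bloom pq laA muA Q))
   n0 k0 (fun s => H1 _) nle (mart_avg bQ) _ _ (mart_avg fQ) (mart_avg (intg_norm fQ))
   (fun s => avg_norm (intg_node s fQ)) mphi mPhi (clos_norm m phi) t0.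
have BA : 0 <= B * A ^+ 2 by rewrite mulr_ge0// (le_trans ler01).
move=> /(_ BA).
have bH t : exists2 H, mart H /\ (forall s, `|dyadic_avg Q b s - dyadic_avg Q b t| <= H s)
     & H t <= B * A ^+ 2 * avg (bloom p q mu la) (node Q t).
  have bt : intg (fun x => b x - dyadic_avg Q b t) Q.
    apply: (@eq_integrable _ _ _ lam _ (measurable_dyadicR Q)
      (EFin \o (fun x => 1 * b x + -1 * (fun=> dyadic_avg Q b t) x))).
      by move=> x _ /=; congr (_%:E); ring.
    by apply: intg_lin => //; exact: intg_cst.
  exists (fun s => avg (fun x => `|b x - dyadic_avg Q b t|) (node Q s)).
    split; first by apply: mart_avg; exact: intg_norm.
    move=> s; apply: le_trans (avg_norm (intg_node s bt)).
    rewrite (@eq_avg _ (fun x => b x - dyadic_avg Q b t)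
      (fun x => 1 * b x + -1 * (fun=> dyadic_avg Q b t) x)); last by move=> x _ /=; ring.
    rewrite avg_lin; [|exact: intg_node|exact: intg_cst].
    by rewrite avg_cst mul1r mulN1r.
  apply: le_trans (hb t) _; rewrite -mulrA; apply: ler_wpM2l => //; exact: nuge.
move=> /(_ bH).
rewrite ave_clos_mul// => /le_trans; apply.
rewrite [C * A ^+ 2 * B]mulrAC -[C * B * _]mulrA; apply: ler_wpM2l.
  by rewrite mulr_ge0// ltW.
apply: lerD; apply: ler_wpM2l; rewrite ?powR_ge0//.
  exact: (ave_Lp_majorant n pq muA fQ fp).
set ph := step Q m phi [::].
have qp := conjugate_sym pq; have dlaA := Ap1_dual pq laA.
have iph : intg (fun x => `|ph x| `^ q * dual p la x) Q by exact: (intg_weighted_step Q qp dlaA).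
have := ave_Lp_majorant n qp dlaA (intg_step Q m phi [::] Q) iph.
have -> : avg (fun x => `|ph x| `^ q * dual p la x) Q =
    ave m (fun s => (`|phi s| * rootavg q (dual p la) Q s) `^ q) [::].
  have := step_norm_weighted Q m phi q1 (measurable_dual p mla) dla0 idla.
  rewrite (integral_avg iph); last by move=> x _; exact: weighted_ge0.
  by move=> [] /mulfI; apply; rewrite gt_eqF// dlen_gt0.
apply: le_trans; apply: ave_le => t _.
have e1 : rootavg p (dual q (dual p la)) Q t = rootavg p la Q t.
  rewrite /rootavg; congr (_ `^ _); apply: eq_avg => x _; exact: (dualK pq).
rewrite e1 /Phi -(avg_step Q m).
rewrite (@eq_avg _ (step Q m (fun s => `|phi s|) [::]) (fun x => `|ph x|)) //.
by move=> x xt; rewrite (step_fun m phi (fun y => `|y|) (node_sub xt)).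
Qed.

End Bound.

End CommutatorOnTop.

(** * The weighted norm of the commutator on one interval *)

Section CommutatorBound.
Context {R : realType}.
Implicit Types (I Q : dyadic_index) (s t : seq bool) (a c phi : seq bool -> R)
  (f g h u b mu la : R -> R) (p q A B : R).
Local Notation lam := (@lebesgue_measure R).
Local Notation one := (fun=> 1 : R).
Hint Resolve measurable_dyadic measurable_dyadicR : core.

Lemma intgB f g I : intg f I -> intg g I -> intg (fun z => f z - g z) I.
Proof.
move=> fi gi; apply: (@eq_integrable _ _ _ lam _ (measurable_dyadicR I)
    (EFin \o (fun x => 1 * f x + -1 * g x))).
  by move=> x _ /=; rewrite mul1r mulN1r.
exact: intg_lin.
Qed.

Lemma avgB f g I : intg f I -> intg g I ->
  avg (fun z => f z - g z) I = avg f I - avg g I.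
Proof.
move=> fi gi; rewrite (@eq_avg _ _ (fun x => 1 * f x + -1 * g x)).
  by rewrite avg_lin// mul1r mulN1r.
by move=> x _; rewrite mul1r mulN1r.
Qed.

(** For tau = (2D)^(1/q) the last term is X/2, and tau^p = (2D)^(p-1). *)
Lemma absorb (X D N p q : R) : conjugate p q -> 0 < D -> 0 <= N ->
  (forall tau, 0 < tau -> X <= D * (tau `^ p * N + tau `^ (- q) * X)) ->
  X <= (2 * D) `^ p * N.
Proof.
move=> pq D0 N0; have [p1 q1 pq1] := pq.
have D2 : 0 < 2 * D by rewrite mulr_gt0.
move=> /(_ ((2 * D) `^ q^-1) (powR_gt0 _ D2)).
rewrite -!powRrM mulrN mulVf; last by rewrite gt_eqF//; lra.
have -> : q^-1 * p = p - 1.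
  have q0 : q != 0 by rewrite gt_eqF//; lra.
  by apply: (mulfI q0); rewrite mulrA divff// mul1r; lra.
rewrite (powR_inv1 (ltW D2)) => H.
have e : (2 * D) `^ p = (2 * D) `^ (p - 1) * (2 * D).
  rewrite -{3}(powRr1 (ltW D2)) -powRD; last by rewrite (gt_eqF D2) implybT.
  by congr (_ `^ _); ring.
have e2 : D * ((2 * D)^-1 * X) = X / 2 by field; rewrite gt_eqF.
rewrite e; move: H; rewrite mulrDr e2; move: ((2 * D) `^ (p - 1)) => Y; lra.
Qed.

Lemma ave_integral Q n a : (forall t, 0 <= a t) ->
  (\int[lam]_(x in dyadic Q) (step Q n a [::] x)%:E = (dlen Q * ave n a [::])%:E)%E.
Proof.
move=> a0.
have := @integral_step R Q n a [::] (fun=> 1) a0 (measurable_cst _) (fun=> ler01)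
  (fun I => intg_cst 1 I).
rewrite (@eq_lam _ _ _ (fun x => (step Q n a [::] x)%:E)); last first.
  by move=> x _; rewrite mulr1.
move=> ->; congr (_ * _)%:E; apply: eq_ave => t _; by rewrite avg_cst mulr1.
Qed.

Section Bound.
Variables (p q A : R).
Hypotheses (pq : conjugate p q) (A1 : 1 <= A).

(** The step function extremal for the averages [k] of the commutator is inserted in [form_top] and
    [n] tends to infinity; the quantity sought then stands on both sides and is absorbed. *)
Lemma dual_norm_top : exists2 C, 0 < C & forall mu la Q b f B m,
  Ap1 p q A mu -> Ap1 p q A la -> measurable_fun setT b -> measurable_fun setT f ->
  intg (fun x => `|b x| `^ p * la x) Q -> intg (fun x => `|f x| `^ p * mu x) Q ->
  intg (fun x => `|f x| `^ q * dual p la x) Q ->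
  intg (fun x => `|b x * f x| `^ p * la x) Q ->
  0 <= B -> bmo1 p q mu la Q b B ->
  ave m (fun s => (`|avg (fun x => Slim Q (fun x => b x * f x) x - b x * Slim Q f x) (node Q s)|
     / rootavg q (dual p la) Q s) `^ p) [::] <=
  (C * B) `^ p * avg (fun x => `|f x| `^ p * mu x) Q.
Proof.
have [C C0 HC] := form_top pq A1; exists (2 * C); first by rewrite mulr_gt0.
move=> mu la Q b f B m muA laA mb mf bp fp fq bfp B0 hb.
have [mmu mu0 imu idmu _] := muA; have [mla la0 ila idla _] := laA.
have dla0 x : 0 < dual p la x by exact: dual_gt0.
have bQ : intg b Q by exact: Lp_intg pq laA mb bp.
have fQ : intg f Q by exact: Lp_intg pq muA mf fp.
have mbf : measurable_fun setT (fun x => b x * f x) by exact: measurable_funM.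
have qp := conjugate_sym pq; have dlaA := Ap1_dual pq laA.
have [p1 q1 _] := pq.
have ibS : intg (fun x => b x * Slim Q f x) Q.
  exact: intg_mul pq laA mb (measurable_Slim Q f) bp (Slim_intg qp A1 dlaA mf fq).
have iS : intg (Slim Q (fun x => b x * f x)) Q.
  exact: Lp_intg pq laA (measurable_Slim _ _) (Slim_intg pq A1 laA mbf bfp).
set k := fun s => avg (fun x => Slim Q (fun x => b x * f x) x - b x * Slim Q f x) (node Q s).
set S := rootavg q (dual p la) Q.
have S0 s : 0 < S s by rewrite powR_gt0// avg_gt0.
set Nf := avg (fun x => `|f x| `^ p * mu x) Q.
have Nf0 : 0 <= Nf by apply: avg_ge0 => x _; exact: weighted_ge0.
set X := ave m (fun s => (`|k s| / S s) `^ p) [::].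
pose w n s := sproc one (clos n (fun t => dyadic_avg Q b t * dyadic_avg Q f t)) s
       - dyadic_avg Q b s * sproc one (dyadic_avg Q f) s.
have wk s : size s = m -> ave (n - m) (w n) s @[n --> \oo] --> k s.
  move=> sm.
  have -> : k s = sproc one (dyadic_avg Q (fun x => b x * f x)) s
      - avg (fun x => b x * Slim Q f x) (node Q s).
    rewrite -(avg_Slim s pq A1 laA mbf bfp) /k.
    exact: avgB (intg_node s iS) (intg_node s ibS).
  have H1 := @sproc_cvg R _ _ s (fun t => @clos_prod_cvg R p q A la Q b f t pq A1 laA mb mf bp fq).
  have H2 := @pairing_cvg R p q A la Q pq laA b (Slim Q f) (sseq Q f) s
    mb (measurable_Slim Q f) (fun n => measurable_step Q n _ [::]) bp
    (Slim_intg qp A1 dlaA mf fq)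
    (fun n => intg_weighted_step Q qp dlaA n _) (step_shift_cvg qp A1 dlaA mf fq).
  apply: cvg_trans (cvgB H1 H2); apply: near_eq_cvg; near=> n.
  have mn : (size s <= n)%N by near: n; exact: nbhs_infty_ge.
  rewrite /w aveB ave_mart; last exact: mart_sproc.
  congr (_ - _); rewrite -sm (avg_mulC_step mn mb bQ)//.
  by move=> j r; exact: intg_step_mul.
pose phi s := Num.sg (k s) * `|k s| `^ (p - 1) * S s `^ (- p).
have lim : ave m (fun s => phi s * ave (n - m) (w n) s) [::] @[n --> \oo] --> X.
  have -> : X = ave m (fun s => phi s * k s) [::].
    by apply: eq_ave => s _; rewrite /phi (dual_product _ pq (S0 s)).
  have : forall s, size s = (size (nil : seq bool) + m)%N ->
     phi s * ave (n - m) (w n) s @[n --> \oo] --> phi s * k s.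
    by move=> s sm; apply: cvgMr; exact: wk.
  move: {1 3 5}m => j; elim: j [::] => [|j IH] s hs /=.
    by apply: hs; rewrite addn0.
  by apply: cvgMl; apply: cvgD; apply: IH => t st; apply: hs; rewrite st /= addSnnS.
have XX : ave m (fun s => (`|phi s| * S s) `^ q) [::] = X.
  by apply: eq_ave => s _; exact: dual_power.
have main tau : 0 < tau -> X <= C * B * (tau `^ p * Nf + tau `^ (- q) * X).
  move=> t0; rewrite -{2}XX; apply: (ler_cvg_to lim (@cvg_cst _ _ _ _ _)).
  near=> n; have mn : (m <= n)%N by near: n; exact: nbhs_infty_ge.
  exact: le_trans (ler_norm _) (HC mu la Q b f B n m phi tau muA laA bQ fQ fp B0 hb mn t0).
move: B0; rewrite le_eqVlt => /predU1P[B0|B0].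
  have X0 : X <= 0 by have := main _ ltr01; rewrite -B0 mulr0 mul0r.
  by apply: le_trans X0 _; rewrite mulr_ge0// powR_ge0.
rewrite -mulrA; apply: (absorb pq _ Nf0 main); exact: mulr_gt0.
Unshelve. all: by end_near.
Qed.

Lemma dual_root_pow la x : 0 < la x -> (dual p la x `^ q^-1) `^ (- p) = la x.
Proof.
move=> l0; have [p1 q1 pq1] := pq.
rewrite /dual -!powRrM (conj_invB pq) -[RHS](powRr1 (ltW l0)); congr (_ `^ _).
have q0 : q != 0 by rewrite gt_eqF//; lra.
have e : (q - 1) * p = q by lra.
by transitivity ((q - 1) * p / q); [ring|rewrite e divff].
Qed.

(** The integrands at depth [m] converge almost everywhere to |k|^p la, by differentiation of [k]
    and of the dual weight v together with (v^(1/q))^(-p) = la; Fatou's lemma removes [m]. *)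
Lemma comm_top : exists2 C, 0 < C & forall mu la Q b f B,
  Ap1 p q A mu -> Ap1 p q A la -> measurable_fun setT b -> measurable_fun setT f ->
  intg (fun x => `|b x| `^ p * la x) Q -> intg (fun x => `|f x| `^ p * mu x) Q ->
  intg (fun x => `|f x| `^ q * dual p la x) Q ->
  intg (fun x => `|b x * f x| `^ p * la x) Q ->
  0 <= B -> bmo1 p q mu la Q b B ->
  (Lpint p la Q (fun x => Slim Q (fun x => b x * f x) x - b x * Slim Q f x)%R <=
   ((C * B) `^ p)%:E * Lpint p mu Q f)%E.
Proof.
have [C C0 HC] := dual_norm_top; exists C => //.
move=> mu la Q b f B muA laA mb mf bp fp fq bfp B0 hb.
have H m := HC mu la Q b f B m muA laA mb mf bp fp fq bfp B0 hb.
have [mmu mu0 imu idmu _] := muA; have [mla la0 ila idla _] := laA.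
have dla0 x : 0 < dual p la x by exact: dual_gt0.
have mbf : measurable_fun setT (fun x => b x * f x) by exact: measurable_funM.
have qp := conjugate_sym pq; have dlaA := Ap1_dual pq laA.
have [p1 q1 _] := pq.
have ibS : intg (fun x => b x * Slim Q f x) Q.
  exact: intg_mul pq laA mb (measurable_Slim Q f) bp (Slim_intg qp A1 dlaA mf fq).
have iS : intg (Slim Q (fun x => b x * f x)) Q.
  exact: Lp_intg pq laA (measurable_Slim _ _) (Slim_intg pq A1 laA mbf bfp).
set k := fun x => Slim Q (fun x => b x * f x) x - b x * Slim Q f x in H *.
have ik : intg k Q by exact: intgB.
have mk : measurable_fun setT k.
  by apply: measurable_funB; [exact: measurable_Slim|apply: measurable_funM => //; exact: measurable_Slim].
pose a s := (`|avg k (node Q s)| / rootavg q (dual p la) Q s) `^ p.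
have a0 s : 0 <= a s by exact: powR_ge0.
set K := ((C * B) `^ p * avg (fun x => `|f x| `^ p * mu x) Q) in H.
have bound m : (\int[lam]_(x in dyadic Q) (step Q m a [::] x)%:E <= (dlen Q * K)%:E)%E.
  by rewrite ave_integral// lee_fin ler_pM2l ?dlen_gt0//; exact: H.
have -> : (((C * B) `^ p)%:E * Lpint p mu Q f)%E = (dlen Q * K)%:E.
  rewrite /Lpint integral_avg//; last by move=> x _; exact: weighted_ge0.
  by rewrite -EFinM mulrCA.
have ms m : measurable_fun (dyadic Q) (fun x => (step Q m a [::] x)%:E).
  by apply/measurable_EFinP; apply: measurable_funTS; exact: measurable_step.
have s0 m x : dyadic Q x -> (0 <= (step Q m a [::] x)%:E)%E.
  move=> Qx; rewrite lee_fin; have [s sm sx] := node_exists m Qx.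
  by rewrite (stepE a sm sx).
have F := @fatou _ _ _ lam (dyadic Q) (measurable_dyadicR Q) (fun m x => (step Q m a [::] x)%:E) ms s0.
apply: le_trans (le_trans F _); last first.
  rewrite limn_einf_lim; apply: lime_le; first exact: is_cvg_einfs.
  apply: nearW => n; apply: le_trans (bound n); apply: ereal_inf_lbound; by exists n => /=.
apply: ae_ge0_le_integral => //.
- by move=> x _; rewrite lee_fin weighted_ge0.
- by apply/measurable_EFinP; apply: measurable_funTS; exact: measurable_Lp.
- move=> x Qx; rewrite limn_einf_lim; apply: lime_ge; first exact: is_cvg_einfs.
  by apply: nearW => n; apply: le_ereal_inf_tmp => _ [m _ <-]; exact: s0.
- have -> : (fun x => limn_einf (fun m => (step Q m a [::] x)%:E)) =
      (fun x => - limn_esup (fun m => - (step Q m a [::] x)%:E))%E.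
    by apply/funext => x; rewrite (limn_esupN (fun m => (step Q m a [::] x)%:E)) oppeK.
  apply: measurableT_comp => //; apply: measurable_fun_limn_esup => m.
  by apply/measurable_EFinP; apply: measurableT_comp => //; apply: measurable_funTS; exact: measurable_step.
have D1 := dyadic_differentiation ik.
have D2 := dyadic_differentiation (idla Q).
apply: ae_imp (ae_and D1 D2) => x [h1 h2] Qx.
have {}h1 := h1 Qx; have {}h2 := h2 Qx.
have lr : step Q m a [::] x @[m --> \oo] --> `|k x| `^ p * la x.
  have -> : (fun m => step Q m a [::] x) = (fun m =>
     `|step Q m (fun s => avg k (node Q s)) [::] x| `^ p *
     (step Q m (fun s => avg (dual p la) (node Q s)) [::] x `^ q^-1) `^ (- p)).
    apply/funext => m; have [s sm sx] := node_exists m Qx.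
    rewrite !(stepE _ sm sx) /a div_powR//.
    by rewrite powR_gt0// avg_gt0.
  rewrite -(dual_root_pow (la0 x)); apply: cvgM; first by apply: powR_cvg => //; exact: ltW.
  apply: powR_cvg_pos; first by rewrite powR_gt0.
  exact: powR_cvg_pos.
have lm : (step Q m a [::] x)%:E @[m --> \oo] --> (`|k x| `^ p * la x)%:E.
  by apply: cvg_EFin => //; apply: nearW.
by rewrite (cvg_limn_einf_sup lm).1.
Qed.
End Bound.
End CommutatorBound.

(** * The shift on the line *)

Section HaarSums.
Context {R : realType}.
Implicit Types (I J L P Q : dyadic_index) (s t : seq bool) (e : bool) (f g h : R -> R) (x : R).
Local Notation lam := (@lebesgue_measure R).
Hint Resolve measurable_dyadic measurable_dyadicR : core.

Lemma nested I J x : dyadic I x -> dyadic J x -> (I.1 <= J.1)%R -> exists s, I = node J s.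
Proof.
move=> Ix Jx IJ; have [s sn sx] := node_exists `|J.1 - I.1|%N Jx.
exists s; rewrite (dint_uniq Ix) (dint_uniq sx) node_scale sn; congr dint.
by rewrite gez0_abs ?subr_ge0//; ring.
Qed.

Lemma node_child Q s e : node Q (rcons s e) = node (child e Q) s.
Proof. by rewrite -cats1 node_cat. Qed.

(** [Outside] also records the child of [I] that contains [J], so it means strict inclusion;
    equality falls under [Inside]. *)
Variant dyadic_position I J : Prop :=
| Inside s of I = node J s
| Outside e s of J = node (child e I) s
| Disjoint of (forall x, dyadic I x -> ~ dyadic J x).

Lemma dyadicP I J : dyadic_position I J.
Proof.
have [[x [Ix Jx]]|H] := pselect (exists x : R, dyadic I x /\ dyadic J x); last first.
  by apply: Disjoint => x Ix Jx; apply: H; exists x.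
have [IJ|JI] := leP I.1 J.1; first by have [s] := nested Ix Jx IJ; exact: Inside.
have [s sE] := nested Jx Ix (ltW JI).
case/lastP: s sE => [E|s e E]; first by rewrite E ltxx in JI.
by apply: (@Outside _ _ e s); rewrite -node_child.
Qed.

Lemma haar_out L x : ~ dyadic L x -> haar L x = 0.
Proof.
move=> nL; have h e : \1_(dyadic (child e L)) x = 0 :> R.
  by rewrite indicE memNset// => /dyadic_childP[].
by rewrite /haar (h true) (h false) subrr mul0r.
Qed.

Lemma haar_in e L x : dyadic (child e L) x ->
  haar L x = (if e then 1 else -1) / Num.sqrt (dlen L).
Proof.
move=> ex; have [_ nx] := dyadic_childP ex; rewrite /haar; congr (_ / _).
by case: e ex nx => /= ex nx; rewrite !indicE (mem_set ex) (memNset nx); rewrite ?subr0 ?sub0r.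
Qed.

Lemma measurable_haar L : measurable_fun setT (haar L : R -> R).
Proof.
apply: measurable_funM => //; apply: measurable_funB;
  apply: measurable_indic; exact: measurable_dyadic.
Qed.

Lemma intg_haar L I : intg (haar L : R -> R) I.
Proof.
apply: (@le_integrable _ _ _ lam _ (measurable_dyadicR I) _
  (EFin \o (fun=> `|(Num.sqrt (dlen L : R))^-1|))).
- by apply/measurable_EFinP; apply: measurable_funTS; exact: measurable_haar.
- move=> x _; rewrite /= lee_fin normr_id.
  have [Lx|nLx] := pselect (dyadic L x); last by rewrite haar_out// normr0.
  by case: (dyadic_cover Lx) => /haar_in->; rewrite normrM ?normrN normr1 mul1r.
- exact: intg_cst.
Qed.

Lemma avg_haar_disjoint L I : (forall x, dyadic I x -> ~ dyadic L x) -> avg (haar L) I = 0 :> R.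
Proof.
move=> d; rewrite (@eq_avg _ _ (fun=> 0)) ?avg_cst// => x Ix.
by rewrite haar_out//; exact: d.
Qed.

Lemma avg_haar_inside e L s :
  avg (haar L) (node (child e L) s) = (if e then 1 else -1) / Num.sqrt (dlen L) :> R.
Proof.
rewrite (@eq_avg _ _ (fun=> (if e then 1 else -1) / Num.sqrt (dlen L))) ?avg_cst// => x Ix.
by rewrite (@haar_in e)//; exact: node_sub Ix.
Qed.

Lemma child_disjoint e I x : dyadic (child e I) x -> ~ dyadic (child (~~ e) I) x.
Proof. by case/dyadic_childP. Qed.

Lemma avg_haar_node I s : avg (haar (node I s)) I = 0 :> R.
Proof.
elim/last_ind: s I => [|s e IH] I /=.
  rewrite (avg_child (intg_haar I I)) (avg_haar_inside true I [::]).
  by rewrite (avg_haar_inside false I [::]); field; rewrite gt_eqF// sqrtr_gt0 dlen_gt0.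
have h J : avg (haar J : R -> R) I = (avg (haar J) (child e I) + avg (haar J) (child (~~ e) I)) / 2.
  by rewrite (avg_child (intg_haar J I)); case: e; rewrite //= addrC.
rewrite h node_child IH avg_haar_disjoint ?addr0 ?mul0r// => x xe /node_sub /child_disjoint.
exact.
Qed.

(** Twice a martingale difference. It is proportional to the Haar coefficient ([haar_coefE]) but
    free of square roots. *)
Definition diff f I := avg f (child true I) - avg f (child false I).

Lemma diffE f Q s : dif (dyadic_avg Q f) s = diff f (node Q s) / 2.
Proof. by []. Qed.

Lemma diff_child f e I : diff f I =
  (if e then 1 else -1) * (avg f (child e I) - avg f (child (~~ e) I)).
Proof. by case: e; rewrite /diff /= ?mul1r// mulN1r opprB. Qed.

Lemma diff_haar_same L : diff (haar L) L = 2 / Num.sqrt (dlen L) :> R.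
Proof.
by rewrite /diff (avg_haar_inside true L [::]) (avg_haar_inside false L [::]); field;
  rewrite gt_eqF// sqrtr_gt0 dlen_gt0.
Qed.

Lemma diff_haar_neq L I : L <> I -> diff (haar L) I = 0 :> R.
Proof.
move=> LI; case: (dyadicP L I) => [s|e s|d].
- case/lastP: s => [//|s e ->]; rewrite node_child (diff_child _ e) avg_haar_node.
  rewrite avg_haar_disjoint ?subrr ?mulr0// => x xe /node_sub /child_disjoint; exact.
- move=> ->; rewrite /diff.
  by rewrite (avg_haar_inside e L (true :: s)) (avg_haar_inside e L (false :: s)) subrr.
- rewrite /diff !avg_haar_disjoint ?subrr// => x /dyadic_childP[Ix _] Lx; exact: (d x).
Qed.

Lemma haar_coefE f L : intg f L -> haar_coef f L = Num.sqrt (dlen L) / 2 * diff f L.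
Proof.
move=> fL; have l0 := @dlen_gt0 R L.
have s0 : Num.sqrt (dlen L : R) != 0 by rewrite gt_eqF// sqrtr_gt0.
have E : haar_coef f L = Rintegral lam (dyadic L) (fun x => f x * haar L x).
  rewrite /haar_coef /Rintegral; congr fine; rewrite [RHS]integral_mkcond.
  apply: eq_lam => x _; rewrite patchE; case: ifPn => // /negP nL.
  by rewrite haar_out ?mulr0// => Lx; apply: nL; exact: mem_set.
have i : intg (fun x => f x * haar L x) L.
  apply: (@le_integrable _ _ _ lam _ (measurable_dyadicR L) _
    (EFin \o (fun x => (Num.sqrt (dlen L : R))^-1 * `|f x| + 0 * `|f x|))).
  - apply/measurable_EFinP; apply: measurable_funM.
      by move/measurable_EFinP: (measurable_int _ fL).
    by apply: measurable_funTS; exact: measurable_haar.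
  - move=> x Lx; rewrite /= lee_fin mul0r addr0 normrM [leRHS]ger0_norm ?mulr_ge0 ?invr_ge0 ?sqrtr_ge0//.
    rewrite mulrC; case: (dyadic_cover Lx) => /haar_in->;
    by rewrite normrM ?normrN normr1 mul1r ger0_norm// invr_ge0 sqrtr_ge0.
  - exact: (intg_lin _ _ (intg_norm fL) (intg_norm fL)).
have h e : avg (fun x => f x * haar L x) (child e L) =
    (if e then 1 else -1) / Num.sqrt (dlen L) * avg f (child e L).
  have fe := intg_child e fL.
  rewrite (@eq_avg _ _ (fun x => (if e then 1 else -1) / Num.sqrt (dlen L) * f x + 0 * f x)).
    by rewrite avg_lin// mul0r addr0.
  by move=> x xe; rewrite (haar_in xe) mul0r addr0 mulrC.
have E2 : Rintegral lam (dyadic L) (fun x => f x * haar L x) =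
    dlen L * avg (fun x => f x * haar L x) L by rewrite /avg mulrA divff ?gt_eqF// mul1r.
rewrite E E2 (avg_child i) !h /= /diff -{1}(sqr_sqrtr (ltW l0)).
by move: (Num.sqrt _) s0 => z z0; field.
Qed.

Lemma avg_shift_term f P I : avg (shift_term f P) I =
  haar_coef f (child true P) * avg (haar (child false P)) I
  - haar_coef f (child false P) * avg (haar (child true P)) I.
Proof.
rewrite -mulNr -(avg_lin _ _ (intg_haar _ I) (intg_haar _ I)).
by apply: eq_avg => x _; rewrite mulNr.
Qed.

Lemma intg_shift_term f P I : intg (shift_term f P) I.
Proof.
apply: (@eq_integrable _ _ _ lam _ (measurable_dyadicR I)
  (EFin \o (fun x => haar_coef f (child true P) * haar (child false P) x
  + (- haar_coef f (child false P)) * haar (child true P) x))).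
  by move=> x _ /=; rewrite mulNr.
apply: intg_lin; exact: intg_haar.
Qed.

Lemma child_inj e e' P P' : child e P = child e' P' -> e = e' /\ P = P'.
Proof.
by case: P P' e e' => [a b] [c d] [] [] /=; rewrite /right_half /left_half /= => -[] h1 h2;
  split=> //; try congr (_, _); lia.
Qed.

(** Siblings have equal length, so the two normalisations cancel and only a sign remains. *)
Lemma diff_shift_term f P e : intg f (child (~~ e) P) ->
  diff (shift_term f P) (child e P) = (if e then -1 else 1) * diff f (child (~~ e) P).
Proof.
move=> fi.
rewrite /diff !avg_shift_term.
have -> : forall a b x y z w : R, a * x - b * y - (a * z - b * w) = a * (x - z) - b * (y - w).
  by move=> *; ring.
rewrite -/(diff (haar (child false P)) _) -/(diff (haar (child true P)) _).
have cs b : intg f (child b P) ->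
    haar_coef f (child b P) * (2 / Num.sqrt (dlen (child (~~ b) P))) = diff f (child b P).
  move=> i; rewrite haar_coefE// !dlen_child; have := @dlen_gt0 R P => l0.
  have : Num.sqrt (dlen P / 2 : R) != 0 by rewrite gt_eqF// sqrtr_gt0 divr_gt0.
  by move: (Num.sqrt _) (diff f _) => z w z0; field.
case: e fi => fi.
  rewrite (@diff_haar_neq (child false P)); last by move=> h; have [] := @child_inj false true P P h.
  by rewrite diff_haar_same mulr0 sub0r mulN1r; congr (- _); exact: (cs false).
rewrite (@diff_haar_neq (child true P)); last by move=> h; have [] := @child_inj true false P P h.
by rewrite diff_haar_same mulr0 subr0 mul1r; exact: (cs true).
Qed.

Lemma diff_shift_term_neq f P P' e : P <> P' -> diff (shift_term f P) (child e P') = 0.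
Proof.
move=> PP'; rewrite /diff !avg_shift_term.
have -> : forall a b x y z w : R, a * x - b * y - (a * z - b * w) = a * (x - z) - b * (y - w).
  by move=> *; ring.
rewrite -/(diff (haar (child false P)) _) -/(diff (haar (child true P)) _).
have n b : child b P <> child e P' by move=> h; have [] := child_inj h.
by rewrite (diff_haar_neq (n false)) (diff_haar_neq (n true)) !mulr0 subrr.
Qed.

End HaarSums.

(** * Finite Haar sums as transforms with multipliers *)

Section FiniteHaarSums.
Context {R : realType}.
Implicit Types (I J L P Q : dyadic_index) (s t : seq bool) (e : bool) (f g h u : R -> R) (x : R)
  (r : seq dyadic_index) (p q A : R).
Local Notation lam := (@lebesgue_measure R).
Local Notation one := (fun=> 1 : R).
Hint Resolve measurable_dyadic measurable_dyadicR : core.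

Definition hsum f r x : R := \sum_(P <- r) shift_term f P x.

Lemma hsum_cons f P r : hsum f (P :: r) = (fun x => shift_term f P x + hsum f r x).
Proof. by apply/funext => x; rewrite /hsum big_cons. Qed.

Lemma intg_hsum f r I : intg (hsum f r) I.
Proof.
elim: r => [|P r IH].
  have -> : hsum f [::] = (fun=> 0) by apply/funext => x; rewrite /hsum big_nil.
  exact: intg_cst.
rewrite hsum_cons; apply: intgD => //; exact: intg_shift_term.
Qed.

Lemma measurable_hsum f r : measurable_fun setT (hsum f r).
Proof.
elim: r => [|P r IH].
  have -> : hsum f [::] = (fun=> 0) by apply/funext => x; rewrite /hsum big_nil.
  exact: measurable_cst.
rewrite hsum_cons; apply: measurable_funD => //; apply: measurable_funB;
  apply: measurable_funM => //; exact: measurable_haar.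
Qed.

Lemma avg_hsum f r I : avg (hsum f r) I = \sum_(P <- r) avg (shift_term f P) I.
Proof.
elim: r => [|P r IH].
  have -> : hsum f [::] = (fun=> 0) by apply/funext => x; rewrite /hsum big_nil.
  by rewrite avg_cst big_nil.
rewrite hsum_cons big_cons -IH.
rewrite (@eq_avg _ _ (fun x => 1 * shift_term f P x + 1 * hsum f r x)); last by move=> x _; rewrite !mul1r.
by rewrite (avg_lin _ _ (intg_shift_term f P I) (intg_hsum f r I)) !mul1r.
Qed.

Lemma diff_hsum f r e P : uniq r -> intg f (child (~~ e) P) ->
  diff (hsum f r) (child e P) =
  (P \in r)%:R * ((if e then -1 else 1) * diff f (child (~~ e) P)).
Proof.
move=> ur fi; rewrite /diff !avg_hsum -sumrB.
rewrite (eq_bigr (fun P' => if P' == P then (if e then -1 else 1) * diff f (child (~~ e) P) else 0)).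
  rewrite -big_mkcond /= -/(diff f (child (~~ e) P)); case: (boolP (P \in r)) => Pr.
    by rewrite -big_filter filter_pred1_uniq// big_seq1 mul1r.
  by rewrite big1_seq ?mul0r// => P' /andP[/eqP->]; rewrite (negPf Pr).
move=> P' _; case: eqP => [->|/eqP PP']; first exact: diff_shift_term.
by apply: diff_shift_term_neq; apply/eqP.
Qed.

Lemma parent I : exists e P, I = child e P.
Proof.
case: I => k m; exists ((m %% 2)%Z == 1), (k + 1, (m %/ 2)%Z).
have := divz_eq m 2; have := modz_ge0 m (isT : 2 != 0 :> int).
have := ltz_pmod m (isT : 0 < 2 :> int).
by case: eqP => /= h; rewrite /right_half /left_half /= => *; congr (_, _); lia.
Qed.

(* On such a [Q] the shift of [f] only involves the intervals contained in [Q]. *)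
Definition isolated f Q := forall P e s, Q = node (child e P) s ->
  forall x, dyadic (child (~~ e) P) x -> f x = 0.

Lemma diff_eq0 f L : (forall x, dyadic L x -> f x = 0) -> diff f L = 0.
Proof.
move=> f0; have a e : avg f (child e L) = 0.
  by rewrite (@eq_avg _ _ (fun=> 0)) ?avg_cst// => x /dyadic_childP[/f0].
by rewrite /diff !a subrr.
Qed.

(** Three positions of [P]. Inside [Q], its Haar functions have mean zero. Strictly above, one Haar
    function misses [Q] and the coefficient of the other vanishes by isolation. Otherwise nothing
    meets [Q]. *)
Lemma avg_shift_term_isolated f P Q : isolated f Q -> intg f (child true P) ->
  intg f (child false P) -> avg (shift_term f P) Q = 0.
Proof.
move=> fQ i1 i0; rewrite avg_shift_term; case: (@dyadicP R P Q) => [s|e s|d].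
- move=> ->; have h b : avg (haar (child b (node Q s))) Q = 0 :> R.
    exact: (avg_haar_node Q (b :: s)).
  by rewrite (h true) (h false) !mulr0 subrr.
- move=> E; have f0 := fQ _ _ _ E.
  have h0 : avg (haar (child (~~ e) P)) Q = 0 :> R.
    by apply: avg_haar_disjoint => x; rewrite E => /node_sub /child_disjoint.
  have c0 : haar_coef f (child (~~ e) P) = 0.
    by rewrite haar_coefE ?diff_eq0 ?mulr0//; case: (e).
  by case: e E f0 h0 c0 => /= _ _ h0 c0; rewrite h0 c0 !(mul0r, mulr0) subrr.
- rewrite !avg_haar_disjoint ?mulr0 ?subrr// => x Qx.
    by move=> /(@dyadic_childP _ true) [Px _]; exact: (d x).
  by move=> /(@dyadic_childP _ false) [Px _]; exact: (d x).
Qed.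

(** The difference at a child of a node comes only from the term indexed by that node, so the
    multiplier is the indicator of the summation set. At [Q] itself the difference is zero by
    isolation. *)
Lemma hsum_sproc f r Q s : uniq r -> isolated f Q -> (forall I, intg f I) ->
  dyadic_avg Q (hsum f r) s = sproc (fun s => (node Q s \in r)%:R) (dyadic_avg Q f) s.
Proof.
move=> ur fQ fi; elim: s => [|e s IH].
  rewrite /dyadic_avg /= avg_hsum big1// => P _; exact: avg_shift_term_isolated.
have m : mart (dyadic_avg Q (hsum f r)) by apply: mart_avg; exact: intg_hsum.
rewrite (mart_stepE s e m) IH [RHS]/=; congr (_ + _ * _).
rewrite diffE; case: s {IH} => [|e' s] /=.
  have [e0 [P E]] := parent Q.
  rewrite E diff_hsum// diff_eq0 ?mulr0 ?mul0r//.
  by apply: (fQ P e0 [::]).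
rewrite (diff_hsum ur) ?(fi _)//= diffE /=; ring.
Qed.

Lemma haar_node_const L Q s x y : (Q.1 - (size s)%:Z <= L.1 - 1)%R ->
  dyadic (node Q s) x -> dyadic (node Q s) y -> haar L x = haar L y.
Proof.
move=> h sx sy; case: (@dyadicP R (node Q s) L) => [t|e t|d].
- case/lastP: t => [E|t e].
    by move/(congr1 fst): E; rewrite node_scale /= => E; lia.
  by rewrite node_child => E; rewrite E in sx sy; rewrite (haar_in (node_sub sx)) (haar_in (node_sub sy)).
- move=> /(congr1 fst); rewrite node_scale => E.
  have c : (child e (node Q s)).1 = (node Q s).1 - 1 by case: (e).
  by move: h; rewrite E c node_scale; lia.
- by rewrite !haar_out//; apply: d.
Qed.

(** The term of [P] consists of Haar functions of its children, constant on dyadic intervals two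
    scales below [P]; hence the -2 in the proof. *)
Lemma hsum_step f r Q : exists n0, forall n x, (n0 <= n)%N -> dyadic Q x ->
  hsum f r x = step Q n (dyadic_avg Q (hsum f r)) [::] x.
Proof.
have [n0 hn] : exists n0 : nat, forall P, P \in r -> (Q.1 - n0%:Z <= P.1 - 2)%R.
  elim: r => [|P r [n0 IH]]; first by exists 0%N.
  exists (n0 + `|(Q.1 - P.1 + 2)%R|)%N => P'; rewrite inE => /predU1P[->|/IH]; lia.
exists n0 => n x nn Qx; have [s sn sx] := node_exists n Qx.
rewrite (stepE _ sn sx) /dyadic_avg.
rewrite (@eq_avg _ _ (fun=> hsum f r x)) ?avg_cst// => y sy.
rewrite /hsum [LHS]big_seq_cond [RHS]big_seq_cond; apply: eq_bigr => P; rewrite andbT => /hn hP.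
have c b : haar (child b P) y = haar (child b P) x.
  apply: (@haar_node_const _ Q s) => //; rewrite sn.
  by case: b; rewrite /= /right_half /left_half /=; lia.
by rewrite /shift_term (c true) (c false).
Qed.

Lemma nodes_fset Q m : exists F0 : {fset dyadic_index}, forall s, (size s < m)%N -> node Q s \in F0.
Proof.
elim: m Q => [|m IH] Q; first by exists fset0.
have [F1 H1] := IH (child true Q); have [F2 H2] := IH (child false Q).
exists (Q |` (F1 `|` F2))%fset => s; case/lastP: s => [|s e]; first by rewrite !inE eqxx.
rewrite size_rcons ltnS => sm; rewrite node_child !inE.
by case: e; rewrite ?(H1 _ sm) ?(H2 _ sm) ?orbT.
Qed.

Section Approximation.
Variables (p q A : R) (u : R -> R).
Hypotheses (pq : conjugate p q) (A1 : 1 <= A) (uA : Ap1 p q A u).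

(** Hoelder against the constant 1 in L^q of the dual weight; [tau] makes the dual term contribute
    eps/2. *)
Lemma L1_small Q (eps : R) : 0 < eps -> exists2 d, 0 < d & forall h, measurable_fun setT h ->
  (Lpint p u Q h <= d%:E)%E -> (\int[lam]_(x in dyadic Q) `|h x|%:E <= eps%:E)%E.
Proof.
move=> eps0; have [mu u0 iu iv _] := uA; have [p1 q1 pq1] := pq.
have v0 x : 0 < dual p u x by exact: dual_gt0.
have V0 : 0 < avg (dual p u) Q by exact: avg_gt0.
have l0 := @dlen_gt0 R Q.
pose z := eps / (2 * (dlen Q * avg (dual p u) Q)).
have z0 : 0 < z by rewrite divr_gt0// mulr_gt0// mulr_gt0.
pose tau := z `^ (- q^-1).
have t0 : 0 < tau by exact: powR_gt0.
have tq : tau `^ (- q) = z.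
  rewrite /tau -powRrM mulrNN mulVf ?powRr1 ?ltW//; lra.
exists (eps / 2 / tau `^ p) => [|h mh H].
  by rewrite !divr_gt0// powR_gt0.
have ih : intg (fun x => `|h x| `^ p * u x) Q.
  by apply: Lpint_intg => //; apply: le_lt_trans H _; rewrite ltry.
have ihh := Lp_intg pq uA mh ih.
rewrite integral_avg//; last exact: intg_norm.
have ione : intg (fun x => `|one x| `^ q * dual p u x) Q.
  by under eq_fun do rewrite normr1 powR1 mul1r; exact: iv.
have mnh : measurable_fun setT (fun x => `|h x|) by exact: measurableT_comp.
have ihn : intg (fun x => `| `|h x| | `^ p * u x) Q by under eq_fun do rewrite normr_id.
have := avg_mul_young pq uA t0 mnh (measurable_cst _) ihn ione.
have -> : avg (fun x => `|h x| * one x) Q = avg (fun x => `|h x|) Q.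
  by apply: eq_avg => x _; rewrite mulr1.
have -> : avg (fun x => `|one x| `^ q * dual p u x) Q = avg (dual p u) Q.
  by apply: eq_avg => x _; rewrite normr1 powR1 mul1r.
have -> : avg (fun x => `| `|h x| | `^ p * u x) Q = avg (fun x => `|h x| `^ p * u x) Q.
  by apply: eq_avg => x _; rewrite normr_id.
rewrite ger0_norm ?avg_ge0// tq => Y.
rewrite lee_fin; move: H; rewrite /Lpint integral_avg//; last by move=> x _; exact: weighted_ge0.
rewrite lee_fin ler_pdivlMr ?powR_gt0// => H.
apply: le_trans (ler_wpM2l (ltW l0) Y) _; rewrite mulrDr.
have -> : dlen Q * (z * avg (dual p u) Q) = eps / 2.
  rewrite /z; move: (avg (dual p u) Q) (dlen Q) V0 l0 => a b a0 b0; field.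
  by rewrite !gt_eqF.
move: H; move: (tau `^ p) (avg (fun x => `|h x| `^ p * u x) Q) (dlen Q) => a b c H; lra.
Qed.

(** Once [F] contains all nodes of depth below [m], its multipliers equal 1 there, and the second
    clause of [shift_limit] bounds the error whatever else [F] contains. *)
Lemma hsum_approx f Q (eps : R) : measurable_fun setT f -> (forall I, intg (fun x => `|f x| `^ p * u x) I) ->
  isolated f Q -> 0 < eps -> exists F0 : {fset dyadic_index}, forall F : {fset dyadic_index},
  (F0 `<=` F)%fset ->
  (\int[lam]_(x in dyadic Q) `|Slim Q f x - hsum f F x|%:E <= eps%:E)%E.
Proof.
move=> mf fp fQ eps0; have [d d0 Hd] := L1_small Q eps0.
have [C C0 HC] := shift_limit pq A1; have [_ h _] := HC u Q f uA mf (fp Q).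
have fi I : intg f I by exact: Lp_intg pq uA mf (fp I).
have dc := defect_cvg0 pq A1 uA mf (fp Q).
have [mu u0 iu iv _] := uA.
have {}dc : (C%:E * Lpint p u Q (defect Q f n))%E @[n --> \oo] --> 0%E.
  by rewrite -[X in _ --> X](mule0 C%:E); apply: cvgeZl.
have [m _ /(_ m (leqnn m)) /= hm] : \forall n \near \oo, (C%:E * Lpint p u Q (defect Q f n) <= d%:E)%E.
  have := dc; move=> /fine_cvgP[fn /cvgrPdist_le /(_ _ d0) H].
  near=> n; rewrite -[X in (X <= _)%E]fineK; last by near: n.
  rewrite lee_fin; apply: le_trans (ler_norm _) _; rewrite -normrN -sub0r; near: n; exact: H.
have [F0 HF0] := nodes_fset Q m; exists F0 => F F0F; apply: Hd.
  apply: measurable_funB; first exact: measurable_Slim.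
  exact: measurable_hsum.
have [n0 hn0] := hsum_step f F Q.
have mn : (m <= maxn m n0)%N by rewrite leq_maxl.
have c1 s : `|(node Q s \in F)%:R : R| <= 1 by rewrite ger0_norm// lern1 leq_b1.
have c2 s : (size s < m)%N -> (node Q s \in F)%:R = 1 :> R.
  by move=> sm; rewrite (fsubsetP F0F)// HF0.
apply: le_trans hm; apply: le_trans (h m (maxn m n0) _ mn c1 c2).
have -> : Lpint p u Q (fun x => Slim Q f x - hsum f F x) =
   Lpint p u Q (fun x => Slim Q f x - step Q (maxn m n0) (sproc (fun s => (node Q s \in F)%:R) (dyadic_avg Q f)) [::] x); last by [].
apply: eq_lam => x Qx; rewrite (hn0 (maxn m n0) x)//; last by rewrite leq_maxr.
by have -> : dyadic_avg Q (hsum f F) = sproc (fun s => (node Q s \in F)%:R) (dyadic_avg Q f)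
  by apply/funext => s; rewrite hsum_sproc// fset_uniq.
Unshelve. all: by end_near.
Qed.

End Approximation.
End FiniteHaarSums.

(** * The shift of a compactly supported function on the line *)

Section GlobalShift.
Context {R : realType}.
Implicit Types (I J L P Q : dyadic_index) (s t r : seq bool) (e : bool) (f g h u : R -> R) (x : R)
  (n m N k : nat) (p q A : R).
Local Notation lam := (@lebesgue_measure R).
Local Notation one := (fun=> 1 : R).
Hint Resolve measurable_dyadic measurable_dyadicR : core.

(** No dyadic interval crosses 0, so two increasing families are needed to exhaust the line. *)
Definition top n e : dyadic_index := (n%:Z, if e then -1 else 0).

Lemma dyadic_top n e x : dyadic (top n e) x =
  (if e then (- 2 ^+ n <= x) && (x < 0) else (0 <= x) && (x < 2 ^+ n)) :> Prop.
Proof.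
rewrite dyadicE /dlen /top /= -exprnP; case: e => /=.
  by rewrite addNr mul0r mulN1r.
by rewrite add0r mul0r mul1r.
Qed.

Lemma top_disjoint n m e x : dyadic (top n e) x -> ~ dyadic (top m (~~ e)) x.
Proof. by case: e; rewrite !dyadic_top /= => /andP[h1 h2] /andP[h3 h4]; lra. Qed.

Lemma top_le n m e x : (n <= m)%N -> dyadic (top n e) x -> dyadic (top m e) x.
Proof.
move=> nm; have le : 2 ^+ n <= 2 ^+ m :> R by rewrite ler_eXn2l// ltr1n.
by case: e; rewrite !dyadic_top /= => /andP[h1 h2]; apply/andP; split => //; lra.
Qed.

Lemma top_exists x : exists n, exists e, dyadic (top n e) x.
Proof.
have [n hn] : exists n, `|x| < 2 ^+ n.
  exists (Num.bound x); apply: lt_trans (archi_boundP (normr_ge0 x)) _.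
  have -> : Num.bound `|x| = Num.bound x by rewrite /Num.bound normr_id.
  by rewrite -natrX ltr_nat ltn_expl.
exists n; have [x0|x0] := leP 0 x.
  by exists false; rewrite dyadic_top x0 (le_lt_trans (ler_norm _) hn).
by exists true; rewrite dyadic_top x0 andbT; move: hn; rewrite ltr_norml => /andP[/ltW].
Qed.

Definition supported N f := forall x, (forall e, ~ dyadic (top N e) x) -> f x = 0.

(** Indices 0 and -1 are those of the intervals with an endpoint at 0; the ancestors of such an
    interval touch 0 from the same side. *)
Lemma node_edge J s : (node J s).2 = 0 \/ (node J s).2 = -1 -> J.2 = (node J s).2.
Proof.
elim: s => [//|e s IH] /=; move: IH; case: (node J s) => a b.
by case: e; rewrite /right_half /left_half /= => IH [] h; have : J.2 = b; try (apply: IH; lia); lia.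
Qed.

(** The half of an ancestor that does not contain the top lies at distance at least 2^n from 0,
    whereas [f] lives within distance 2^N. *)
Lemma isolated_top N n e f : supported N f -> (N <= n)%N -> isolated f (top n e).
Proof.
move=> fN Nn P e' s E x xP; apply: fN => e2 /(top_le Nn) {Nn}xn.
have := @node_edge (child e' P) s; rewrite -E => h.
have {}h : (child e' P).2 = (top n e).2 by apply: h; rewrite /top /=; case: (e); [right|left].
have sc : (top n e).1 = (child e' P).1 - (size s)%:Z by rewrite E node_scale.
have ee : e' = e /\ P.2 = (top n e).2.
  by move: h; case: (P) => a b; case: (e'); case: (e); rewrite /= => h; split=> //; lia.
have [h1 h2] := ee; rewrite {e' ee}h1 in E h sc xP *.
have len : 2 ^+ n <= dlen (child (~~ e) P) :> R.
  rewrite /dlen; have -> : (child (~~ e) P).1 = (n + size s)%:Z.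
    by move: sc; case: (P) => a b; case: (e) => /=; lia.
  by rewrite -exprnP ler_eXn2l ?ltr1n// leq_addr.
have p0 : 0 < 2 ^+ n :> R by rewrite exprn_gt0.
move: xP; rewrite dyadicE; move: len; move: (dlen _) => d len.
move: xn; rewrite dyadic_top.
move: h2; rewrite {h sc E}; case: P => a b; case: e => /= ->; rewrite ?mulN1r ?mul0r ?add0r /=;
case: e2 => /andP[h1' h2'] /andP[]; rewrite ?mul1r; lra.
Qed.

Lemma sproc_cat (a : seq bool -> R) r s : sproc one a r = 0 -> epend one a r = 0 ->
  sproc one a (s ++ r) = sproc one (fun t => a (t ++ r)) s.
Proof.
move=> s0 e0; elim: s => [//|e s IH] /=; rewrite IH; congr (_ + _ * _).
by case: s {IH} => [|e' s].
Qed.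

(** Every coefficient met on the way down to the node comes from a half on which [f] vanishes. *)
Lemma isolated_node f Q r : isolated f (node Q r) ->
  sproc one (dyadic_avg Q f) r = 0 /\ epend one (dyadic_avg Q f) r = 0.
Proof.
elim: r => [//|e r IH] fr.
have fr' : isolated f (node Q r).
  by move=> P e' s E; apply: (fr P e' (e :: s)); rewrite /= -E.
have [s0 e0] := IH fr'; split; first by rewrite /= s0 e0 mulr0 addr0.
rewrite /= diffE diff_eq0 ?mul0r ?mulr0//.
exact: (fr (node Q r) e [::]).
Qed.

Lemma sseq_node f Q r n x : isolated f (node Q r) -> dyadic (node Q r) x ->
  sseq Q f (n + size r) x = sseq (node Q r) f n x.
Proof.
move=> fr rx; have [s sn sx] := node_exists n rx; have [s0 e0] := isolated_node fr.
have sx' : dyadic (node Q (s ++ r)) x by rewrite node_cat.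
rewrite /sseq (stepE _ sn sx) (stepE _ _ sx') ?size_cat ?sn//.
rewrite sproc_cat//; congr (sproc _ _ _).
by apply/funext => t; rewrite /dyadic_avg node_cat.
Qed.

Lemma top_node n e k : exists2 r, size r = k & top n e = node (top (n + k) e) r.
Proof.
elim: k => [|k [r rk E]]; first by exists [::]; rewrite ?addn0.
exists (rcons r e); first by rewrite size_rcons rk.
rewrite node_child {}E; congr node.
by rewrite addnS /top; case: e; rewrite /= /right_half /left_half /=; congr (_, _); lia.
Qed.

(** Depth [n.*2] gives mesh 2^-n: on a fixed top of scale n0 there remain n + n0 generations, a
    number that tends to infinity. *)
Definition sterm f n x := sseq (top n false) f n.*2 x + sseq (top n true) f n.*2 x.

(* The tops [2^n (m, m + 1)], m = -1, 0, only see part of the Haar expansion, but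
   for a compactly supported function larger tops bring no new term on a smaller one. *)
Definition Sop f x : R := fine (limn_esup (fun n => (sterm f n x)%:E)).

Lemma sterm_top f n m e x : dyadic (top n e) x -> isolated f (top n e) -> (n <= m)%N ->
  sterm f m x = sseq (top n e) f (m + n) x.
Proof.
move=> nx fn nm; have -> : sterm f m x = sseq (top m e) f m.*2 x.
  have := top_disjoint (m := m) nx; rewrite /sterm; case: (e) => /= h.
    by rewrite [X in X + _]step_out ?add0r.
  by rewrite [X in _ + X]step_out ?addr0.
have [r rk E] := top_node n e (m - n); rewrite subnKC// in E.
have := @sseq_node f (top m e) r (m + n) x; rewrite -E rk => <- //; congr sseq; lia.
Qed.

Lemma Sop_Slim f n e x : dyadic (top n e) x -> isolated f (top n e) ->
  cvgn (fun n' => sseq (top n e) f n' x) -> Sop f x = Slim (top n e) f x.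
Proof.
move=> nx fn /Slim_cvg h.
have {}h : sterm f m x @[m --> \oo] --> Slim (top n e) f x.
  rewrite -(cvg_shiftn n) in h; apply: cvg_trans h; apply: near_eq_cvg; near=> m.
  by rewrite (sterm_top nx fn)//; near: m; exact: nbhs_infty_ge.
have h' : (sterm f m x)%:E @[m --> \oo] --> (Slim (top n e) f x)%:E.
  by apply: cvg_EFin => //; apply: nearW.
by rewrite /Sop (cvg_limn_einf_sup h').2.
Unshelve. all: by end_near.
Qed.

Lemma measurable_Sop f : measurable_fun setT (Sop f).
Proof.
apply: (measurableT_comp (@fine_measurable R setT measurableT)) => //.
apply: measurable_fun_limn_esup => n; apply/measurable_EFinP.
by apply: measurable_funD; exact: measurable_step.
Qed.

Definition tops n : set R := dyadic (top n false) `|` dyadic (top n true).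

Lemma integral_tops (g : R -> \bar R) n : measurable_fun setT g -> (forall x, (0 <= g x)%E) ->
  (\int[lam]_(x in tops n) g x =
   \int[lam]_(x in dyadic (top n false)) g x + \int[lam]_(x in dyadic (top n true)) g x)%E.
Proof.
move=> mg g0; apply: ge0_integral_setU => //.
- by apply: measurable_funTS.
- by apply/disj_setPLR => x h1 h2; exact: (@top_disjoint n n false x).
Qed.

Lemma measurable_tops n : measurable (tops n).
Proof. by apply: measurableU; exact: measurable_dyadic. Qed.

Lemma tops_le (g : R -> \bar R) n : measurable_fun setT g -> (forall x, (0 <= g x)%E) ->
  (\int[lam]_(x in tops n) g x <= \int[lam]_x g x)%E.
Proof.
by move=> mg g0; apply: ge0_subset_integral => //; exact: measurable_tops.
Qed.

Lemma integral_le_tops (g : R -> \bar R) K : measurable_fun setT g -> (forall x, (0 <= g x)%E) ->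
  (exists N, forall n, (N <= n)%N -> (\int[lam]_(x in tops n) g x <= K)%E) ->
  (\int[lam]_x g x <= K)%E.
Proof.
move=> mg g0 [N h].
have H : {homo tops : n m / (n <= m)%N >-> (n <= m)%O}.
  by move=> n m nm; apply/subsetPset => x [] /(top_le nm) ?; [left|right].
have := @ge0_nondecreasing_set_cvg_integral _ (measurableTypeR R) R tops g lam H measurable_tops
  (fun i => measurable_funTS mg) (fun i x _ => g0 x).
have -> : \bigcup_i tops i = [set: R].
  apply/seteqP; split=> // x _; have [n [e xe]] := top_exists x.
  by exists n => //; case: e xe; [right|left].
move=> c; rewrite -(cvg_lim _ c)//; apply: lime_le; first by apply/cvg_ex; eexists; exact: c.
by near=> n; apply: h; near: n; exact: nbhs_infty_ge.
Unshelve. all: by end_near.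
Qed.

Lemma compact_tops (K : set R) : compact K -> exists N, K `<=` tops N.
Proof.
move=> /compact_bounded [M [Mr HM]].
have [n hn] : exists n, `|M| + 1 < 2 ^+ n.
  exists (Num.bound (`|M| + 1)); apply: lt_trans (archi_boundP _) _; first by rewrite addr_ge0.
  by rewrite -natrX ltr_nat ltn_expl.
exists n => x Kx; have h : `|x| <= `|M| + 1.
  by apply: (HM (`|M| + 1)) => //; rewrite (le_lt_trans (ler_norm _))// ltrDl.
have {h}hn := le_lt_trans h hn; move: hn; rewrite ltr_norml => /andP[h1 h2].
have [x0|x0] := leP 0 x.
  by left; rewrite dyadic_top x0.
by right; rewrite dyadic_top x0 andbT; exact: ltW.
Qed.

End GlobalShift.

(** * Weighted bounds on the line *)

Section GlobalBounds.
Context {R : realType}.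
Implicit Types (I J L P Q : dyadic_index) (s t r : seq bool) (e : bool) (f g h u b mu la : R -> R) (x : R)
  (n m N k : nat) (p q A B : R).
Local Notation lam := (@lebesgue_measure R).
Local Notation one := (fun=> 1 : R).
Hint Resolve measurable_dyadic measurable_dyadicR : core.

Lemma eq_lam_ae (D : set R) (f g : R -> \bar R) : measurable D ->
  measurable_fun D f -> measurable_fun D g -> {ae lam, forall x, D x -> f x = g x} ->
  (\int[lam]_(x in D) f x = \int[lam]_(x in D) g x)%E.
Proof. by move=> mD mf mg fg; apply: ae_eq_integral. Qed.

Lemma mart_sum_step (F G : seq bool -> R) Q n x : dyadic Q x ->
  step Q n F [::] x + step Q n G [::] x = step Q n (fun s => F s + G s) [::] x.
Proof. by move=> Qx; have [s sn sx] := node_exists n Qx; rewrite !(stepE _ sn sx). Qed.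

Lemma sprocD (c a a' : seq bool -> R) s :
  sproc c (fun t => a t + a' t) s = sproc c a s + sproc c a' s.
Proof.
elim: s => [|e s /= ->]; first by rewrite addr0.
case: s => [|e' s] /=; first by ring.
by rewrite /dif; ring.
Qed.

Lemma sseqD f g Q n x : intg f Q -> intg g Q -> dyadic Q x ->
  sseq Q (fun x => f x + g x) n x = sseq Q f n x + sseq Q g n x.
Proof.
move=> fi gi Qx; rewrite /sseq mart_sum_step//; congr step; apply/funext => s.
rewrite -sprocD; congr sproc; apply/funext => t.
rewrite /dyadic_avg (@eq_avg _ _ (fun x => 1 * f x + 1 * g x)); last by move=> y _; rewrite !mul1r.
by rewrite (avg_lin _ _ (intg_node t fi) (intg_node t gi)) !mul1r.
Qed.

Lemma tops_bound (F G : R -> R) (K : R) : measurable_fun setT F -> measurable_fun setT G ->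
  (forall x, 0 <= F x) -> (forall x, 0 <= G x) -> 0 <= K ->
  (exists N, forall n e, (N <= n)%N -> (\int[lam]_(x in dyadic (top n e)) (F x)%:E <=
     K%:E * \int[lam]_(x in dyadic (top n e)) (G x)%:E)%E) ->
  (\int[lam]_x (F x)%:E <= K%:E * \int[lam]_x (G x)%:E)%E.
Proof.
move=> mF mG F0 G0 K0 [N H].
have mF' : measurable_fun setT (EFin \o F) by apply/measurable_EFinP.
have mG' : measurable_fun setT (EFin \o G) by apply/measurable_EFinP.
have F0' x : (0 <= (EFin \o F) x)%E by rewrite lee_fin.
have G0' x : (0 <= (EFin \o G) x)%E by rewrite lee_fin.
apply: (@integral_le_tops _ (EFin \o F)) => //; exists N => n Nn.
apply: (@le_trans _ _ (K%:E * \int[lam]_(x in tops n) (EFin \o G) x)%E); last first.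
  by apply: lee_wpmul2l; [rewrite lee_fin|exact: tops_le].
rewrite !integral_tops// ge0_muleDr; last 2 first.
- by apply: integral_ge0 => x _; exact: G0'.
- by apply: integral_ge0 => x _; exact: G0'.
by apply: leeD; exact: H.
Qed.

Section Bounds.
Variables (p q A : R).
Hypotheses (pq : conjugate p q) (A1 : 1 <= A).

Definition Lp_on u f := forall I, intg (fun x => `|f x| `^ p * u x) I.

Lemma Sop_ae u f N n e : Ap1 p q A u -> measurable_fun setT f -> Lp_on u f ->
  supported N f -> (N <= n)%N ->
  {ae lam, forall x, dyadic (top n e) x ->
     (sseq (top n e) f k x @[k --> \oo] --> Slim (top n e) f x) /\ Sop f x = Slim (top n e) f x}.
Proof.
move=> uA mf fp fN Nn; have [C C0 HC] := shift_limit pq A1.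
have [h _ _] := HC u (top n e) f uA mf (fp _).
apply: ae_imp h => x h nx; have {}h := h nx; split=> //.
apply: Sop_Slim => //; first exact: isolated_top Nn.
by apply/cvg_ex; eexists; exact: h.
Qed.

Lemma Sop_bound : exists2 C, 0 < C & forall u f N, Ap1 p q A u -> measurable_fun setT f ->
  Lp_on u f -> supported N f ->
  (\int[lam]_x (`|Sop f x| `^ p * u x)%:E <= C%:E * \int[lam]_x (`|f x| `^ p * u x)%:E)%E.
Proof.
have [C C0 HC] := shift_limit pq A1; exists C; first exact: C0.
move=> u f N uA mf fp fN; have [mu u0 iu iv _] := uA.
apply: tops_bound => [| |x|x| |].
- by apply: measurable_Lp => //; exact: measurable_Sop.
- exact: measurable_Lp.
- exact: weighted_ge0.
- exact: weighted_ge0.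
- exact: ltW.
exists N => n e Nn; have [_ _ h] := HC u (top n e) f uA mf (fp _).
apply: le_trans h; rewrite le_eqVlt; apply/orP; left; apply/eqP.
apply: eq_lam_ae => //.
- by apply/measurable_EFinP; apply: measurable_funTS; apply: measurable_Lp => //; exact: measurable_Sop.
- by apply/measurable_EFinP; apply: measurable_funTS; apply: measurable_Lp => //; exact: measurable_Slim.
- by apply: ae_imp (Sop_ae e uA mf fp fN Nn) => x h nx; rewrite (h nx).2.
Qed.

(** Upper limits are not additive; equality is obtained at the points where all three sequences
    converge. *)
Lemma Sop_add u f g N : Ap1 p q A u -> measurable_fun setT f -> measurable_fun setT g ->
  Lp_on u f -> Lp_on u g -> Lp_on u (fun x => f x + g x) -> supported N f -> supported N g ->
  {ae lam, forall x, Sop (fun x => f x + g x) x = Sop f x + Sop g x}.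
Proof.
move=> uA mf mg fp gp fgp fN gN.
have mfg : measurable_fun setT (fun x => f x + g x) by exact: measurable_funD.
have fgN : supported N (fun x => f x + g x) by move=> x h; rewrite fN// gN// addr0.
have fi I : intg f I by exact: Lp_intg pq uA mf (fp I).
have gi I : intg g I by exact: Lp_intg pq uA mg (gp I).
have h : {ae lam, forall x, forall ne : nat * bool, (N <= ne.1)%N -> dyadic (top ne.1 ne.2) x ->
    Sop (fun x => f x + g x) x = Sop f x + Sop g x}.
  apply: ae_all => -[n e] /=.
  have [Nn|nN] := leqP N n; last by apply: ae_true => x Nn; lia.
  apply: ae_imp (ae_and (Sop_ae e uA mfg fgp fgN Nn)
     (ae_and (Sop_ae e uA mf fp fN Nn) (Sop_ae e uA mg gp gN Nn))) => x [h1 [h2 h3]] _ nx.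
  have [c1 ->] := h1 nx; have [c2 ->] := h2 nx; have [c3 ->] := h3 nx.
  apply: (cvg_unique _ c1); first exact: norm_hausdorff.
  apply: cvg_trans (cvgD c2 c3); apply: near_eq_cvg; apply: nearW => k.
  by rewrite sseqD.
apply: ae_imp h => x h; have [n [e xe]] := top_exists x.
by apply: (h (maxn N n, e)); rewrite ?leq_maxl//=; apply: top_le xe; exact: leq_maxr.
Qed.

Lemma L1_tops (K : set R) N h (eps : R) : measurable K -> K `<=` tops N -> measurable_fun setT h ->
  (forall e, (\int[lam]_(x in dyadic (top N e)) `|h x|%:E <= (eps / 2)%:E)%E) ->
  (\int[lam]_(x in K) `|h x|%:E <= eps%:E)%E.
Proof.
move=> mK KN mh H; have mh' : measurable_fun setT (fun x => `|h x|%:E).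
  by apply/measurable_EFinP; exact: measurableT_comp.
apply: (@le_trans _ _ (\int[lam]_(x in tops N) `|h x|%:E)%E).
  apply: ge0_subset_integral => //; first exact: measurable_tops.
  by apply: measurable_funTS.
rewrite integral_tops//.
by have -> : eps = eps / 2 + eps / 2 by [lra]; rewrite EFinD; apply: leeD; exact: H.
Qed.

Lemma loc_integrable_intg f : measurable_fun setT f -> (forall I, intg f I) ->
  locally_integrable setT f.
Proof.
move=> mf fi; split => //; first exact: openT.
move=> K _ cK; have [N KN] := compact_tops cK.
pose M e := dlen (top N e) * avg (fun x => `|f x|) (top N e).
have h e : (\int[lam]_(x in dyadic (top N e)) `|f x|%:E = (M e)%:E)%E.
  by rewrite integral_avg//; exact: intg_norm.
apply: le_lt_trans (_ : (_ <= (2 * (M false + M true))%:E)%E) _; last by rewrite ltry.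
have M0 e : 0 <= M e by apply: mulr_ge0; [exact: ltW (dlen_gt0 _)|exact: avg_ge0].
apply: (L1_tops (compact_measurable cK) KN mf) => e.
rewrite h lee_fin; have := M0 true; have := M0 false; case: e; lra.
Qed.

Lemma Lp_supported u f N : Ap1 p q A u -> measurable_fun setT f -> Lp_on u f ->
  supported N f -> (\int[lam]_x (`|f x| `^ p * u x)%:E < +oo)%E.
Proof.
move=> uA mf fp fN; have [mu u0 iu iv _] := uA; have [p1 _ _] := pq.
have -> : (\int[lam]_x (`|f x| `^ p * u x)%:E = \int[lam]_(x in tops N) (`|f x| `^ p * u x)%:E)%E.
  rewrite [RHS]integral_mkcond; apply: eq_lam => x _; rewrite patchE; case: ifPn => // /negP nT.
  rewrite fN ?normr0 ?powR0 ?mul0r//; first by rewrite gt_eqF//; lra.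
  by move=> e xe; apply: nT; apply: mem_set; case: e xe; [right|left].
have mfu : measurable_fun setT (fun x => (`|f x| `^ p * u x)%:E).
  by apply/measurable_EFinP; exact: measurable_Lp.
rewrite integral_tops//; last by move=> x; rewrite lee_fin weighted_ge0.
by apply: lte_add_pinfty; exact: Lpint_fin.
Qed.

Lemma Lp_on_Sop u f N : Ap1 p q A u -> measurable_fun setT f -> Lp_on u f ->
  supported N f -> Lp_on u (Sop f).
Proof.
move=> uA mf fp fN I; have [mu u0 iu iv _] := uA.
have [C C0 HC] := Sop_bound.
have mS := measurable_Sop f.
have mSu : measurable_fun setT (fun x => (`|Sop f x| `^ p * u x)%:E).
  by apply/measurable_EFinP; exact: measurable_Lp.
apply: Lpint_intg => //.
apply: (@le_lt_trans _ _ (\int[lam]_x (`|Sop f x| `^ p * u x)%:E)%E).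
  by apply: ge0_subset_integral => // x _; rewrite lee_fin weighted_ge0.
apply: le_lt_trans (HC u f N uA mf fp fN) _.
by apply: lte_mul_pinfty; [rewrite lee_fin ltW| |exact: (Lp_supported uA mf fp fN)].
Qed.

(** A compact set is covered by the two tops of one scale, chosen past the support so as to be
    isolated; each may cost eps/2, and the finite sets found for them are united. *)
Lemma Sop_is_shift u f N : Ap1 p q A u -> measurable_fun setT f -> Lp_on u f ->
  supported N f -> is_shift f (Sop f).
Proof.
move=> uA mf fp fN; have [mu u0 iu iv _] := uA.
have fi I : intg f I by exact: Lp_intg pq uA mf (fp I).
have mS := measurable_Sop f.
have Si I : intg (Sop f) I by exact: (Lp_intg pq uA mS (Lp_on_Sop uA mf fp fN I)).
split; [exact: loc_integrable_intg|exact: loc_integrable_intg|].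
move=> K eps cK e0; have [n KN] := compact_tops cK.
pose m := maxn N n.
have Km : K `<=` tops m.
  by apply: subset_trans KN _ => x []/(@top_le _ n m _ _ (leq_maxr _ _)); [left|right].
have e2 : 0 < eps / 2 by rewrite divr_gt0.
have Nm : (N <= m)%N by exact: leq_maxl.
have H e := hsum_approx pq A1 uA mf fp (@isolated_top R N m e f fN Nm) e2.
have [F1 H1] := H true; have [F0 H0] := H false.
exists (F1 `|` F0)%fset => F /fsubUsetP[F1F F0F].
apply: (@L1_tops K m (fun x => Sop f x - hsum f F x)) => //.
- exact: compact_measurable.
- by apply: measurable_funB => //; exact: measurable_hsum.
move=> e; have HF : (\int[lam]_(x in dyadic (top m e)) `|Slim (top m e) f x - hsum f F x|%:E <= (eps/2)%:E)%E.
  by case: e; [exact: H1|exact: H0].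
apply: le_trans HF; rewrite le_eqVlt; apply/orP; left; apply/eqP.
have mm (F' : R -> R) : measurable_fun setT F' ->
    measurable_fun (dyadic (top m e)) (fun x => `|F' x - hsum f F x|%:E).
  move=> mF'; apply/measurable_EFinP; apply: measurable_funTS; apply: measurableT_comp => //.
  by apply: measurable_funB => //; exact: measurable_hsum.
apply: eq_lam_ae => //; [exact: mm|apply: mm; exact: measurable_Slim|].
by apply: ae_imp (Sop_ae e uA mf fp fN Nm) => x h nx; rewrite (h nx).2.
Qed.

(** On tops past the support both shifts are the local ones, with a constant common to all tops, and
    these exhaust the line. The condition on [f] for the dual of [la] makes the pairing of [b] with
    the shift of [f] integrable. *)
Lemma Sop_commutator : exists2 C, 0 < C & forall mu la b f B N,
  Ap1 p q A mu -> Ap1 p q A la -> measurable_fun setT b -> measurable_fun setT f ->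
  Lp_on la b -> Lp_on mu f -> (forall I, intg (fun x => `|f x| `^ q * dual p la x) I) ->
  Lp_on la (fun x => b x * f x) -> supported N f -> 0 <= B ->
  (forall Q, avg (fun x => `|b x - avg b Q|) Q <=
     B * (avg mu Q `^ p^-1 * avg (dual p la) Q `^ q^-1)) ->
  (\int[lam]_x (`|Sop (fun x => b x * f x) x - b x * Sop f x| `^ p * la x)%:E <=
   ((C * B) `^ p)%:E * \int[lam]_x (`|f x| `^ p * mu x)%:E)%E.
Proof.
have [C C0 HC] := comm_top pq A1; exists C; first exact: C0.
move=> mu la b f B N muA laA mb mf bp fp fq bfp fN B0 hb.
have [mmu mu0 _ _ _] := muA; have [mla la0 _ _ _] := laA.
have mbf : measurable_fun setT (fun x => b x * f x) by exact: measurable_funM.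
have mc (F G : R -> R) : measurable_fun setT F -> measurable_fun setT G ->
    measurable_fun setT (fun x => `|F x - b x * G x| `^ p * la x).
  move=> mF mG; apply: (measurable_Lp p (f := fun x => F x - b x * G x)) => //.
  by apply: measurable_funB => //; exact: measurable_funM.
have bfN : supported N (fun x => b x * f x) by move=> x h; rewrite fN// mulr0.
apply: tops_bound => [| |x|x| |].
- by apply: mc; exact: measurable_Sop.
- exact: measurable_Lp.
- by rewrite mulr_ge0 ?powR_ge0// ltW.
- exact: weighted_ge0.
- exact: powR_ge0.
exists N => n e Nn; have := HC mu la (top n e) b f B muA laA mb mf (bp _) (fp _) (fq _) (bfp _) B0
  (fun s => hb (node (top n e) s)).
apply: le_trans; rewrite le_eqVlt; apply/orP; left; apply/eqP.
apply: eq_lam_ae => //.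
- by apply/measurable_EFinP; apply: measurable_funTS; apply: mc; exact: measurable_Sop.
- by apply/measurable_EFinP; apply: measurable_funTS; apply: mc; exact: measurable_Slim.
have dlaA := Ap1_dual pq laA.
have qp := conjugate_sym pq.
have [C' C'0 HC'] := shift_limit qp A1; have [h1 _ _] := HC' _ (top n e) f dlaA mf (fq _).
apply: ae_imp (ae_and h1 (Sop_ae e laA mbf bfp bfN Nn)) => x [h2 h3] nx.
have E : Sop f x = Slim (top n e) f x.
  apply: Sop_Slim => //; first exact: isolated_top Nn.
  by apply/cvg_ex; eexists; exact: h2.
by rewrite (h3 nx).2 E.
Qed.

End Bounds.
End GlobalBounds.

(** * Fibres in the plane and the upper bound *)

Section Fibers.
Context {R : realType}.
Implicit Types (I J P : dyadic_index) (Q : dyadic_index * dyadic_index) (s t : seq bool) (x y : R)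
  (n m N k : nat) (p q A B : R).
Local Notation lam := (@lebesgue_measure R).
Local Notation borelR2 := (measurableTypeR R * measurableTypeR R)%type.
Implicit Types (w f g F G b : R * R -> R).
Hint Resolve measurable_dyadic measurable_dyadicR : core.

Definition mfun w := measurable_fun [set: borelR2] w.

Lemma measurable_drect Q : measurable (drect Q : set borelR2).
Proof. by apply: measurableX; exact: measurable_dyadicR. Qed.

Lemma fiber1 w y : mfun w -> measurable_fun setT (fun x => w (x, y)).
Proof. by move=> mw; apply: (measurableT_comp mw); exact: pair2_measurable. Qed.

Lemma fiber2 w x : mfun w -> measurable_fun setT (fun y => w (x, y)).
Proof. by move=> mw; apply: (measurableT_comp mw); exact: pair1_measurable. Qed.

Definition swap w : R * R -> R := fun z => w (z.2, z.1).

Lemma mfun_swap w : mfun w -> mfun (swap w).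
Proof. by move=> mw; apply: (measurableT_comp mw); apply: measurable_fun_pair. Qed.

Lemma tonelli2 F : mfun F -> (forall z, 0 <= F z) ->
  (\int[leb2]_z (F z)%:E = \int[lam]_y \int[lam]_x (F (x, y))%:E)%E.
Proof.
move=> mF F0; rewrite /leb2.
by apply: (@fubini_tonelli2 _ _ _ _ _ lam lam (EFin \o F)) => [|x];
  [exact/measurable_EFinP|rewrite lee_fin].
Qed.

Lemma tonelli1 F : mfun F -> (forall z, 0 <= F z) ->
  (\int[leb2]_z (F z)%:E = \int[lam]_x \int[lam]_y (F (x, y))%:E)%E.
Proof.
move=> mF F0; rewrite /leb2.
by apply: (@fubini_tonelli1 _ _ _ _ _ lam lam (EFin \o F)) => [|x];
  [exact/measurable_EFinP|rewrite lee_fin].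
Qed.

Lemma integral_swap F : mfun F -> (forall z, 0 <= F z) ->
  (\int[leb2]_z (swap F z)%:E = \int[leb2]_z (F z)%:E)%E.
Proof.
move=> mF F0; rewrite (tonelli1 mF F0) tonelli2//; first exact: mfun_swap.
by move=> z; exact: F0.
Qed.

Lemma measurable_fiber_integral F : mfun F -> (forall z, 0 <= F z) ->
  measurable_fun setT (fun y => \int[lam]_x (F (x, y))%:E)%E.
Proof.
move=> mF F0; apply: (@measurable_fun_fubini_tonelli_G _ _ _ _ _ lam (EFin \o F)) => [|x].
  exact/measurable_EFinP.
by rewrite lee_fin.
Qed.

Definition cut w Q z := w z * \1_(drect Q) z.

Lemma cutE w I J x y : cut w (I, J) (x, y) = w (x, y) * \1_(dyadic I) x * \1_(dyadic J) y.
Proof.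
rewrite /cut -mulrA; congr (_ * _).
rewrite !indicE; have [Ix|nIx] := pselect (dyadic I x); last first.
  by rewrite (memNset nIx) mul0r memNset// => -[/nIx].
have [Jy|nJy] := pselect (dyadic J y); last first.
  by rewrite (memNset nJy) mulr0 memNset// => -[_ /nJy].
by rewrite (mem_set Ix) (mem_set Jy) mulr1 mem_set.
Qed.

Lemma mfun_cut w Q : mfun w -> mfun (cut w Q).
Proof.
move=> mw; apply: measurable_funM => //; apply: measurable_indic; exact: measurable_drect.
Qed.

Lemma cut_ge0 F Q z : (forall z, 0 <= F z) -> 0 <= cut F Q z.
Proof. by move=> F0; rewrite mulr_ge0// indicE. Qed.

Lemma integral_cut F Q : (\int[leb2]_(z in drect Q) (F z)%:E = \int[leb2]_z (cut F Q z)%:E)%E.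
Proof.
rewrite integral_mkcond; apply: eq_integral => z _; rewrite patchE /cut indicE.
by case: (z \in _); rewrite ?mulr1 ?mulr0.
Qed.

Lemma lam_cut I (h : R -> R) :
  (\int[lam]_(x in dyadic I) (h x)%:E = \int[lam]_x (h x * \1_(dyadic I) x)%:E)%E.
Proof.
rewrite integral_mkcond; apply: eq_lam => x _; rewrite patchE indicE.
by case: (x \in _); rewrite ?mulr1 ?mulr0.
Qed.

Lemma measurable_fiber_int F I : mfun F -> (forall z, 0 <= F z) ->
  measurable_fun setT (fun y => \int[lam]_(x in dyadic I) (F (x, y))%:E)%E.
Proof.
move=> mF F0.
have -> : (fun y => \int[lam]_(x in dyadic I) (F (x, y))%:E)%E =
    (fun y => \int[lam]_x ((fun z : R * R => F z * \1_(dyadic I) z.1) (x, y))%:E)%E.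
  by apply/funext => y; rewrite lam_cut.
apply: (@measurable_fiber_integral (fun z => F z * \1_(dyadic I) z.1)).
  apply: measurable_funM => //.
  apply: (@measurableT_comp _ _ _ _ _ _ (\1_(dyadic I) : measurableTypeR R -> R)) => //.
by move=> z; rewrite mulr_ge0// indicE.
Qed.

(** Tonelli's measurability concerns nonnegative functions, hence the positive and negative
    parts. *)
Lemma measurable_fiber_avg w I : mfun w -> measurable_fun setT (fun y => avg (fun x => w (x, y)) I).
Proof.
move=> mw; apply: measurable_funM => //.
rewrite /Rintegral; apply: (measurableT_comp (@fine_measurable R setT measurableT)) => //.
have mabs : mfun (fun z => Num.max (w z) 0) by apply: measurable_maxr.
have mabs' : mfun (fun z => Num.max (- w z) 0) by apply: measurable_maxr => //; exact: measurableT_comp.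
have -> : (fun y => \int[lam]_(x in dyadic I) (w (x, y))%:E)%E = (fun y =>
   \int[lam]_(x in dyadic I) (Num.max (w (x, y)) 0)%:E -
   \int[lam]_(x in dyadic I) (Num.max (- w (x, y)) 0)%:E)%E.
  apply/funext => y; rewrite [LHS]integralE; congr (_ - _)%E; apply: eq_lam => x _.
    by rewrite funeposE EFin_max.
  by rewrite funenegE EFin_max.
have p0 (v : R * R -> R) z : 0 <= Num.max (v z) 0 by rewrite le_max lexx orbT.
apply: emeasurable_funB.
  exact: (@measurable_fiber_int (fun z => Num.max (w z) 0) I mabs (p0 w)).
exact: (@measurable_fiber_int (fun z => Num.max (- w z) 0) I mabs' (p0 (fun z => - w z))).
Qed.

Definition intg2 w Q := leb2.-integrable (drect Q) (EFin \o w).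

Lemma intg2_cut w Q : mfun w -> intg2 w Q -> leb2.-integrable setT (EFin \o cut w Q).
Proof.
move=> mw /integrableP[_ h]; apply/integrableP; split.
  by apply/measurable_EFinP; exact: mfun_cut.
apply: le_lt_trans h.
have := integral_cut (fun z => `|w z|) Q; rewrite /= => ->.
rewrite le_eqVlt; apply/orP; left; apply/eqP; apply: eq_integral => z _ /=.
by rewrite /cut normrM; congr (_ * _)%:E; rewrite ger0_norm// indicE.
Qed.

Lemma fiber_intg w I J : mfun w -> intg2 w (I, J) ->
  {ae lam, forall y, dyadic J y -> intg (fun x => w (x, y)) I}.
Proof.
move=> mw wi; have := @ae_integrable2 _ _ _ _ _ lam lam _ (intg2_cut mw wi).
move=> h; apply: ae_imp h => y h Jy; rewrite /intg integrable_mkcond//.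
apply: (@eq_integrable _ _ _ lam _ measurableT _ _ _ h) => x _.
rewrite /= patchE cutE !indicE (mem_set Jy) mulr1.
by case: (x \in _); rewrite ?mulr1 ?mulr0.
Qed.

Lemma integrable_swap w : mfun w -> leb2.-integrable setT (EFin \o w) ->
  leb2.-integrable setT (EFin \o swap w).
Proof.
move=> mw /integrableP[_ h]; apply/integrableP; split.
  by apply/measurable_EFinP; exact: mfun_swap.
have mn : mfun (fun z => `|w z|) by exact: measurableT_comp.
by have := integral_swap mn (fun z => normr_ge0 _); rewrite /swap /= => ->.
Qed.

(** Fubini for the function cut to the rectangle; [fine] changes nothing because almost every fibre
    integral is finite. *)
Lemma fiber_avg w I J : mfun w -> intg2 w (I, J) ->
  intg (fun y => avg (fun x => w (x, y)) I) J /\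
  avg (fun y => avg (fun x => w (x, y)) I) J = rect_avg w (I, J).
Proof.
move=> mw wi; have wc := intg2_cut mw wi.
pose G y := (\int[lam]_x (cut w (I, J) (x, y))%:E)%E.
have iG : lam.-integrable setT G.
  exact: (@integrable_fubini_F _ _ _ _ _ lam lam _ (integrable_swap (mfun_cut (I, J) mw) wc)).
have eG : (\int[lam]_y G y = \int[leb2]_z (cut w (I, J) z)%:E)%E.
  exact: (@integral21_prod_meas1 _ _ _ _ _ lam lam _ wc).
have GE y : dyadic J y -> G y = (\int[lam]_(x in dyadic I) (w (x, y))%:E)%E.
  move=> Jy; rewrite lam_cut; apply: eq_lam => x _.
  by rewrite cutE (indicE _ (dyadic J)) (mem_set Jy) mulr1.
have G0 y : ~ dyadic J y -> G y = 0%E.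
  move=> nJ; rewrite -[RHS](integral0 lam setT); apply: eq_lam => x _.
  by rewrite cutE (indicE _ (dyadic J)) memNset// mulr0.
have iGJ : lam.-integrable (dyadic J) G by apply: integrableS iG.
have mG : measurable_fun (dyadic J) G by exact: measurable_int iGJ.
have ifG : lam.-integrable (dyadic J) (EFin \o (fine \o G)).
  apply: (le_integrable _ _ _ iGJ) => //.
    by apply/measurable_EFinP; apply: (measurableT_comp (@fine_measurable R setT measurableT)).
  move=> y _ /=; case: (G y) => [r| |] //=; by rewrite ?normr0 ?leey.
have avgE y : dyadic J y -> avg (fun x => w (x, y)) I = (dlen I)^-1 * fine (G y).
  by move=> Jy; rewrite GE.
split.
  apply: (@eq_integrable _ _ _ lam _ (measurable_dyadicR J)
    (EFin \o (fun y => (dlen I)^-1 * (fine \o G) y + 0 * (fine \o G) y))).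
    by move=> y; rewrite inE => Jy; rewrite /= mul0r addr0 avgE.
  exact: intg_lin.
have -> : rect_avg w (I, J) = (dlen I * dlen J)^-1 * fine (\int[lam]_y G y)%E.
  by rewrite eG /rect_avg /Rintegral integral_cut.
rewrite (@eq_avg _ _ (fun y => (dlen I)^-1 * (fine \o G) y + 0 * (fine \o G) y)); last first.
  by move=> y Jy; rewrite avgE// mul0r addr0.
rewrite avg_lin// mul0r addr0 invfM -mulrA; congr (_ * _).
rewrite /avg /Rintegral; congr (_ * fine _).
have -> : (\int[lam]_y G y = \int[lam]_(y in dyadic J) G y)%E.
  rewrite [RHS]integral_mkcond; apply: eq_lam => y _; rewrite patchE; case: ifPn => // /negP nJ.
  by apply: G0 => Jy; apply: nJ; exact: mem_set.
apply: eq_lam_ae => //; first exact: measurable_int ifG.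
apply: ae_imp (integrable_ae (measurable_dyadicR J) iGJ) => y h Jy.
by rewrite /= fineK//; exact: h.
Qed.

Definition loc_intg2 w := mfun w /\ forall Q, intg2 w Q.

Lemma fiber_loc w : loc_intg2 w -> {ae lam, forall y, forall I, intg (fun x => w (x, y)) I}.
Proof.
move=> [mw wi]; have h : {ae lam, forall y, forall i : dyadic_index * (nat * bool),
    dyadic (top i.2.1 i.2.2) y -> intg (fun x => w (x, y)) i.1}.
  by apply: ae_all => -[I [n e]] /=; exact: fiber_intg.
by apply: ae_imp h => y h I; have [n [e ny]] := top_exists y; exact: (h (I, (n, e))).
Qed.

(** Fibre averages are differentiated in [y]; their own averages are rectangle averages. Intervals
    and tops are countably many, so one null set serves all. *)
Lemma fiber_limit w : loc_intg2 w -> {ae lam, forall y, forall I n e, dyadic (top n e) y ->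
  step (top n e) m (fun s => rect_avg w (I, node (top n e) s)) [::] y @[m --> \oo]
    --> avg (fun x => w (x, y)) I}.
Proof.
move=> [mw wi]; have h : {ae lam, forall y, forall i : dyadic_index * (nat * bool),
    dyadic (top i.2.1 i.2.2) y -> step (top i.2.1 i.2.2) m
      (fun s => rect_avg w (i.1, node (top i.2.1 i.2.2) s)) [::] y @[m --> \oo]
    --> avg (fun x => w (x, y)) i.1}.
  apply: ae_all => -[I [n e]] /=.
  have iw J := fiber_avg mw (wi (I, J)).
  have := dyadic_differentiation (iw (top n e)).1.
  have -> : (fun s => avg (fun y => avg (fun x => w (x, y)) I) (node (top n e) s)) =
     (fun s => rect_avg w (I, node (top n e) s)) by apply/funext => s; rewrite (iw _).2.
  by [].
by apply: ae_imp h => y h I n e; exact: (h (I, (n, e))).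
Qed.

End Fibers.

(** * The A_p and bmo conditions on fibres *)

Section PlaneWeights.
Context {R : realType}.
Implicit Types (I J P : dyadic_index) (Q : dyadic_index * dyadic_index) (s t : seq bool) (x y : R)
  (n m N k : nat) (p q A B : R).
Local Notation lam := (@lebesgue_measure R).
Local Notation borelR2 := (measurableTypeR R * measurableTypeR R)%type.
Implicit Types (w f g F G b mu la : R * R -> R).
Hint Resolve measurable_dyadic measurable_dyadicR measurable_drect : core.

Lemma leb2_drect Q : leb2 (drect Q : set borelR2) = (darea Q)%:E.
Proof.
transitivity (lam (dyadic Q.1) * lam (dyadic Q.2))%E.
  by apply: (@product_measure1E _ _ _ _ R lam lam); exact: measurable_dyadicR.
by rewrite !lebesgue_dyadic -EFinM.
Qed.

Lemma darea_gt0 Q : 0 < darea Q :> R.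
Proof. by rewrite mulr_gt0// dlen_gt0. Qed.

Lemma intg2_cst (c : R) Q : intg2 (fun=> c) Q.
Proof.
apply: (@measurable_bounded_integrable _ _ _ leb2 (fun=> c) (drect Q) (measurable_drect Q)).
- by rewrite leb2_drect ltry.
- exact: measurable_cst.
- exact: bounded_cst.
Qed.

Lemma rect_avg_le_addc f g Q (c : R) : intg2 f Q -> intg2 g Q ->
  (forall z, drect Q z -> f z <= c + g z) -> rect_avg f Q <= c + rect_avg g Q.
Proof.
move=> fi gi fg; have a0 := darea_gt0 Q; have ci := intg2_cst c Q.
have cgi : intg2 (fun z => c + g z) Q.
  apply: (@eq_integrable _ _ _ leb2 _ (measurable_drect Q)
    ((EFin \o (fun=> c)) \+ (EFin \o g))%E) => //; exact: integrableD.
have -> : c + rect_avg g Q = (darea Q)^-1 * Rintegral leb2 (drect Q) (fun z => c + g z).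
  rewrite RintegralD// mulrDr; congr (_ + _).
  by rewrite Rintegral_cst// leb2_drect /= mulrCA mulVf ?mulr1// gt_eqF.
rewrite /rect_avg ler_pM2l ?invr_gt0//; exact: le_Rintegral.
Qed.

Lemma intg2_swap w I J : intg2 w (I, J) -> mfun w -> intg2 (swap w) (J, I).
Proof.
move=> wi mw; have := integrable_swap (mfun_cut (I, J) mw) (intg2_cut mw wi).
move=> h; rewrite /intg2 integrable_mkcond//; apply: (@eq_integrable _ _ _ leb2 _ measurableT _ _ _ h).
move=> -[x y] _; rewrite /= patchE /swap /= cutE mulrAC -(cutE (swap w) J I x y) /cut indicE.
by case: (_ \in _); rewrite ?mulr1 ?mulr0.
Qed.

Lemma rect_avg_swap w I J : mfun w -> rect_avg (swap w) (J, I) = rect_avg w (I, J).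
Proof.
move=> mw; rewrite /rect_avg /darea /= [dlen J * _]mulrC; congr (_ * fine _).
have H F : mfun F -> (forall z, 0 <= F z) ->
    (\int[leb2]_(z in drect (J, I)) (swap F z)%:E = \int[leb2]_(z in drect (I, J)) (F z)%:E)%E.
  move=> mF F0; rewrite !integral_cut -[RHS]integral_swap; last 2 first.
  - exact: mfun_cut.
  - by move=> z; exact: cut_ge0.
  apply: eq_integral => -[x y] _; congr (_%:E).
  by rewrite {2}/swap /= !cutE mulrAC.
have m1 : mfun (fun z => Num.max (w z) 0) by apply: measurable_maxr.
have m2 : mfun (fun z => Num.max (- w z) 0) by apply: measurable_maxr => //; exact: measurableT_comp.
have p0 (v : R * R -> R) z : 0 <= Num.max (v z) 0 by rewrite le_max lexx orbT.
rewrite [LHS]integralE [RHS]integralE; congr (_ - _)%E.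
  under eq_integral do rewrite funeposE -EFin_max.
  under [RHS]eq_integral do rewrite funeposE -EFin_max.
  exact: (H _ m1 (p0 w)).
under eq_integral do rewrite funenegE -EFin_max.
under [RHS]eq_integral do rewrite funenegE -EFin_max.
exact: (H _ m2 (p0 (fun z => - w z))).
Qed.

Lemma loc_swap w : loc_intg2 w -> loc_intg2 (swap w).
Proof.
by move=> [mw wi]; split; [exact: mfun_swap|move=> [I J]; exact: intg2_swap (wi _) mw].
Qed.

Definition dual2 p w : R * R -> R := fun z => w z `^ (- (p - 1)^-1).

(* A bi-parameter dyadic [A_p] weight, normalised to be positive everywhere. *)
Definition Ap2 p q A w := [/\ loc_intg2 w, forall z, 0 < w z, loc_intg2 (dual2 p w) &
  forall Q, rect_avg w Q `^ p^-1 * rect_avg (dual2 p w) Q `^ q^-1 <= A].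

Lemma Ap2_swap p q A w : Ap2 p q A w -> Ap2 p q A (swap w).
Proof.
move=> [wi w0 di h]; split; [exact: loc_swap|by move=> z; exact: w0|exact: (loc_swap di)|].
move=> [I J]; rewrite (rect_avg_swap J I wi.1).
by have := rect_avg_swap J I di.1; rewrite /swap => ->; exact: h.
Qed.

Lemma Ap2_dual p q A w : conjugate p q -> Ap2 p q A w -> Ap2 q p A (dual2 p w).
Proof.
move=> pq [wi w0 di h].
have E : dual2 q (dual2 p w) = w.
  by apply/funext => z; exact: (dualK (u := fun=> w z) (x := 0) pq (w0 z)).
split; [exact: di|by move=> z; rewrite powR_gt0|by rewrite E|].
by move=> Q; rewrite E mulrC.
Qed.

Lemma fiber_gt0 w y I : (forall z, 0 < w z) -> intg (fun x => w (x, y)) I ->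
  0 < avg (fun x => w (x, y)) I.
Proof. by move=> w0 wi; apply: avg_gt0. Qed.

(** The condition on I x J passes to the limit as [J] shrinks to [y]. *)
Lemma fiber_Ap p q A w : Ap2 p q A w -> {ae lam, forall y, Ap1 p q A (fun x => w (x, y))}.
Proof.
move=> [wi w0 di h].
apply: ae_imp (ae_and (ae_and (fiber_loc wi) (fiber_loc di)) (ae_and (fiber_limit wi) (fiber_limit di))).
move=> y [[i1 i2] [l1 l2]]; split=> //; first exact: (fiber1 y wi.1).
move=> I; have [n [e ny]] := top_exists y.
have c1 := @powR_cvg_pos R _ _ (p^-1) (fiber_gt0 w0 (i1 I)) (l1 I n e ny).
have d0 z : 0 < dual2 p w z by rewrite powR_gt0.
have c2 := @powR_cvg_pos R _ _ (q^-1) (fiber_gt0 d0 (i2 I)) (l2 I n e ny).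
apply: (ler_cvg_to (cvgM c1 c2) (@cvg_cst _ A _ _ _)); apply: nearW => m.
by have [s sm sy] := node_exists m ny; rewrite /= !(stepE _ sm sy); exact: h.
Qed.

Definition bmo2 p q mu la b B := forall Q,
  rect_avg (fun z => `|b z - rect_avg b Q|) Q <=
    B * (rect_avg mu Q `^ p^-1 * rect_avg (dual2 p la) Q `^ q^-1).

Lemma loc_absB b (c : R) : loc_intg2 b -> loc_intg2 (fun z => `|b z - c|).
Proof.
move=> [mb bi]; split; first by apply: measurableT_comp => //; exact: measurable_funB.
move=> Q; have h : leb2.-integrable (drect Q) ((EFin \o b) \- (EFin \o (fun=> c)))%E.
  by apply: integrableB => //; [exact: bi|exact: intg2_cst].
exact: (integrable_abse h).
Qed.

Lemma bmo2_swap p q A mu la b B : Ap2 p q A mu -> Ap2 p q A la -> loc_intg2 b ->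
  bmo2 p q mu la b B -> bmo2 p q (swap mu) (swap la) (swap b) B.
Proof.
move=> [mi _ _ _] [_ _ di _] bi h [I J].
rewrite (rect_avg_swap J I mi.1) (rect_avg_swap J I bi.1).
have := rect_avg_swap J I di.1; rewrite /swap => ->.
have := rect_avg_swap J I (loc_absB (rect_avg b (J, I)) bi).1; rewrite /swap => ->.
exact: h.
Qed.

(** The constant subtracted on a rectangle varies with the rectangle, so differentiation does not
    apply directly. It is applied to |b - r| for the countably many rational r, at the cost of the
    distance from r to the rectangle average; at the end r approaches the fibre average. *)
Lemma fiber_bmo p q A mu la b B : Ap2 p q A mu -> Ap2 p q A la -> loc_intg2 b ->
  bmo2 p q mu la b B -> {ae lam, forall y, forall I,
    avg (fun x => `|b (x, y) - avg (fun x => b (x, y)) I|) I <=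
    B * (avg (fun x => mu (x, y)) I `^ p^-1 * avg (dual p (fun x => la (x, y))) I `^ q^-1)}.
Proof.
move=> [mi mu0 _ _] [_ la0 di _] bi h.
have d0 z : 0 < dual2 p la z by rewrite powR_gt0.
have hr : {ae lam, forall y, forall r : rat,
   (forall I, intg (fun x => `|b (x, y) - ratr r|) I) /\
   forall I n e, dyadic (top n e) y ->
   step (top n e) m (fun s => rect_avg (fun z => `|b z - ratr r|) (I, node (top n e) s)) [::] y
     @[m --> \oo] --> avg (fun x => `|b (x, y) - ratr r|) I}.
  apply: ae_all => r; have br := loc_absB (ratr r) bi.
  exact: ae_imp (ae_and (fiber_loc br) (fiber_limit br)).
apply: ae_imp (ae_and hr (ae_and (ae_and (fiber_loc bi) (fiber_limit bi))
  (ae_and (ae_and (fiber_loc mi) (fiber_limit mi)) (ae_and (fiber_loc di) (fiber_limit di))))).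
clear hr; move=> y [hr [[ib lb] [[im lm] [id ld]]]] I; have [n [e ny]] := top_exists y.
set K := B * _.
set bI := avg (fun x => b (x, y)) I.
have step1 (r : rat) : avg (fun x => `|b (x, y) - ratr r|) I <= `|bI - ratr r| + K.
  have [_ lr] := hr r.
  have c1 := @powR_cvg_pos R _ _ (p^-1) (fiber_gt0 mu0 (im I)) (lm I n e ny).
  have c2 := @powR_cvg_pos R _ _ (q^-1) (fiber_gt0 d0 (id I)) (ld I n e ny).
  have cB : (fun=> B : R) k @[k --> \oo] --> B by exact: cvg_cst.
  have cr : (fun=> ratr r : R) k @[k --> \oo] --> (ratr r : R) by exact: cvg_cst.
  have c3 := cvgM cB (cvgM c1 c2).
  have c4 := cvg_norm (cvgB (lb I n e ny) cr).
  have Fi : Filter (\oo : set_system nat) by exact: filter_filter.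
  have X := ler_cvg_to (lr I n e ny) (cvgD (c4 Fi Fi) (c3 Fi Fi)).
  apply: X; apply: nearW => m.
  have [s sm sy] := node_exists m ny.
  rewrite [leRHS](_ : _ =
    `|step (top n e) m (fun s => rect_avg b (I, node (top n e) s)) [::] y - ratr r| +
    B * (step (top n e) m (fun s => rect_avg mu (I, node (top n e) s)) [::] y `^ p^-1 *
    step (top n e) m (fun s => rect_avg (dual2 p la) (I, node (top n e) s)) [::] y `^ q^-1)) //.
  rewrite !(stepE _ sm sy).
  set QQ := (I, node (top n e) s).
  apply: le_trans (rect_avg_le_addc (c := `|rect_avg b QQ - ratr r|)
    ((loc_absB (ratr r) bi).2 QQ) ((loc_absB (rect_avg b QQ) bi).2 QQ) _) _.
    by move=> z _; rewrite [leRHS]addrC; exact: ler_distD.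
  by rewrite lerD2l; exact: h.
apply/ler_addgt0Pr => eps e0.
have [r hrr] : exists r : rat, bI - eps / 2 < ratr r < bI + eps / 2.
  have [r] := @rat_in_itvoo R (bI - eps / 2) (bI + eps / 2) ltac:(lra).
  by rewrite in_itv /= => hr'; exists r.
have near_r : `|bI - ratr r| <= eps / 2 by rewrite ler_norml; move/andP: hrr => [? ?]; lra.
have ibb : intg (fun x => `|b (x, y) - bI|) I by apply: intg_norm; apply: intgB => //; exact: intg_cst.
have irr := (hr r).1 I.
have : avg (fun x => `|b (x, y) - bI|) I <=
    avg (fun x => 1 * `|b (x, y) - ratr r| + `|bI - ratr r| * 1) I.
  apply: avg_le => //; first by apply: intg_lin => //; exact: intg_cst.
  move=> x _; rewrite mul1r mulr1 (distrC bI); exact: ler_distD.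
rewrite avg_lin//; last exact: intg_cst.
rewrite avg_cst mul1r mulr1; have := step1 r; lra.
Qed.

End PlaneWeights.

(** * The shift in one variable of the plane *)

Section PlaneShift.
Context {R : realType}.
Implicit Types (I J P : dyadic_index) (Q : dyadic_index * dyadic_index) (s t : seq bool) (x y : R)
  (n m N k : nat) (p q A B : R).
Local Notation lam := (@lebesgue_measure R).
Local Notation borelR2 := (measurableTypeR R * measurableTypeR R)%type.
Implicit Types (w f g F G b mu la : R * R -> R).
Hint Resolve measurable_dyadic measurable_dyadicR measurable_drect : core.

Definition S1 f : R * R -> R := fun z => Sop (fun x => f (x, z.2)) z.1.
Definition S2 f : R * R -> R := fun z => Sop (fun y => f (z.1, y)) z.2.

Lemma S2E f : S2 f = swap (S1 (swap f)).
Proof. by apply/funext => -[x y]. Qed.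

Lemma mfun_fst (h : R -> R) : measurable_fun setT h -> mfun (fun z => h z.1).
Proof.
by move=> mh; apply: (@measurableT_comp _ _ _ _ _ _ (h : measurableTypeR R -> R)).
Qed.

Lemma mfun_snd (h : R -> R) : measurable_fun setT h -> mfun (fun z => h z.2).
Proof.
by move=> mh; apply: (@measurableT_comp _ _ _ _ _ _ (h : measurableTypeR R -> R)).
Qed.

Lemma mfun_step I k (a : R -> seq bool -> R) s :
  (forall s, measurable_fun setT (fun y => a y s)) -> mfun (fun z => step I k (a z.2) s z.1).
Proof.
move=> ma; elim: k s => [|k IH] s /=; last by apply: measurable_funD; exact: IH.
apply: measurable_funM; first exact: (mfun_snd (ma s)).
apply: (mfun_fst (h := \1_(dyadic (node I s)))).
by apply: measurable_indic; exact: measurable_dyadic.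
Qed.

Lemma measurable_sproc (a : R -> seq bool -> R) s :
  (forall s, measurable_fun setT (fun y => a y s)) ->
  measurable_fun setT (fun y => sproc (fun=> 1) (a y) s).
Proof.
move=> ma; elim: s => [|e s IH] /=; first exact: measurable_cst.
apply: measurable_funD => //; apply: measurable_funM => //.
case: s {IH} => [|e' s] /=; first exact: measurable_cst.
by apply: measurable_funM => //; apply: measurable_funM => //; apply: measurable_funB.
Qed.

(** Joint measurability is read off the explicit upper limit: coefficients measurable in [y], fixed
    intervals in [x]. *)
Lemma mfun_S1 f : mfun f -> mfun (S1 f).
Proof.
move=> mf; apply: (measurableT_comp (@fine_measurable R setT measurableT)) => //.
apply: measurable_fun_limn_esup => n; apply/measurable_EFinP.
have h e : mfun (fun z => sseq (top n e) (fun x => f (x, z.2)) n.*2 z.1).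
  apply: (@mfun_step _ _ (fun y => sproc (fun=> 1) (dyadic_avg (top n e) (fun x => f (x, y))))) => s.
  by apply: measurable_sproc => t; exact: measurable_fiber_avg.
by apply: measurable_funD; exact: h.
Qed.

Lemma mfun_S2 f : mfun f -> mfun (S2 f).
Proof. by move=> mf; rewrite S2E; apply: mfun_swap; apply: mfun_S1; exact: mfun_swap. Qed.

(** Valid at every point, so that [S2] preserves the support in [x] exactly and not only up to null
    sets. *)
Lemma Sop0 x : Sop (fun=> 0 : R) x = 0.
Proof.
have a0 I : avg (fun=> 0 : R) I = 0 by rewrite avg_cst.
have s0 I s : sproc (fun=> 1) (dyadic_avg I (fun=> 0 : R)) s = 0.
  elim: s => [//|e s /= ->]; rewrite add0r; case: s => [|e' s] /=; first by rewrite mulr0.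
  by rewrite /dif /dyadic_avg !a0 subrr mul0r !mulr0.
have st n s I : step I n (sproc (fun=> 1) (dyadic_avg I (fun=> 0 : R))) s x = 0.
  by elim: n s => [|n IH] s /=; rewrite ?s0 ?mul0r// !IH addr0.
have c : (sterm (fun=> 0) n x)%:E @[n --> \oo] --> (0%R : R)%:E.
  have -> : (fun n => (sterm (fun=> 0) n x)%:E) = (fun=> (0 : R)%:E).
    by apply/funext => n; rewrite /sterm /sseq !st addr0.
  exact: cvg_cst.
by rewrite /Sop (cvg_limn_einf_sup c).2.
Qed.

Definition wpow p w f : R * R -> R := fun z => `|f z| `^ p * w z.

Definition fin2 p w f := (\int[leb2]_z (wpow p w f z)%:E < +oo)%E.

Lemma mfun_wpow p w f : mfun w -> mfun f -> mfun (wpow p w f).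
Proof.
move=> mw mf; apply: measurable_funM => //.
by apply: (measurableT_comp (measurable_powR p)); exact: measurableT_comp.
Qed.

Lemma wpow_ge0 p w f z : (forall z, 0 < w z) -> 0 <= wpow p w f z.
Proof. by move=> w0; rewrite mulr_ge0 ?powR_ge0// ltW. Qed.

Lemma loc_of_fin F : mfun F -> (forall z, 0 <= F z) -> (\int[leb2]_z (F z)%:E < +oo)%E ->
  loc_intg2 F.
Proof.
move=> mF F0 h; split=> // Q; apply: (@integrableS _ _ _ leb2 setT (drect Q)) => //.
apply/integrableP; split; first exact/measurable_EFinP.
apply: le_lt_trans h; rewrite le_eqVlt; apply/orP; left; apply/eqP.
by apply: eq_integral => z _; rewrite /= ger0_norm.
Qed.

Lemma loc_wpow p w f : mfun w -> (forall z, 0 < w z) -> mfun f -> fin2 p w f ->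
  loc_intg2 (wpow p w f).
Proof.
move=> mw w0 mf; apply: loc_of_fin; first exact: mfun_wpow.
by move=> z; exact: wpow_ge0.
Qed.

Definition box N (z : R * R) := (exists e, dyadic (top N e) z.1) /\ (exists e, dyadic (top N e) z.2).

Lemma fin_box N F G : mfun F -> (forall z, 0 <= F z) -> loc_intg2 G ->
  (forall z, box N z -> F z <= G z) -> (forall z, ~ box N z -> F z = 0) ->
  (\int[leb2]_z (F z)%:E < +oo)%E.
Proof.
move=> mF F0 [mG iG] FG FN.
pose T e e' : dyadic_index * dyadic_index := (top N e, top N e').
pose nG z := `|G z|.
have mnG : mfun nG by exact: measurableT_comp.
have inG Q : intg2 nG Q by exact: (integrable_abse (iG Q)).
have ic e e' : leb2.-integrable setT (EFin \o cut nG (T e e')) by exact: intg2_cut.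
have iS := integrableD measurableT (integrableD measurableT (ic false false) (ic false true))
             (integrableD measurableT (ic true false) (ic true true)).
have c0 e e' z : 0 <= cut nG (T e e') z by apply: cut_ge0 => z'; exact: normr_ge0.
have : leb2.-integrable setT (EFin \o F).
  apply: (le_integrable _ _ _ iS) => //; first exact/measurable_EFinP.
  move=> z _; rewrite [leRHS](_ : _ = `|cut nG (T false false) z + cut nG (T false true) z +
    (cut nG (T true false) z + cut nG (T true true) z)|%:E)//.
  rewrite /= lee_fin ger0_norm// ger0_norm ?addr_ge0//.
  have [[[e ze] [e' ze']]|nb] := pselect (box N z); last by rewrite FN// !addr_ge0.
  have ce : cut nG (T e e') z = nG z.
    by rewrite /cut indicE mem_set ?mulr1.
  have : F z <= nG z by apply: le_trans (FG z _) (ler_norm _); split; [exists e|exists e'].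
  rewrite -ce; have := c0 false false z; have := c0 false true z; have := c0 true false z.
  by have := c0 true true z; case: e {ce ze}; case: e' {ze'}; lra.
move=> /integrableP[_]; apply: le_lt_trans; rewrite le_eqVlt; apply/orP; left; apply/eqP.
by apply: eq_integral => z _; rewrite /= ger0_norm.
Qed.

Definition xsupp N f := forall y, supported N (fun x => f (x, y)).

Lemma fiber_Lp p w f : mfun w -> (forall z, 0 < w z) -> mfun f -> fin2 p w f ->
  {ae lam, forall y, Lp_on p (fun x => w (x, y)) (fun x => f (x, y))}.
Proof. by move=> mw w0 mf ff; exact: (fiber_loc (loc_wpow mw w0 mf ff)). Qed.

Lemma integral_fiber_le F G (K : R) : mfun F -> mfun G -> (forall z, 0 <= F z) ->
  (forall z, 0 <= G z) -> 0 <= K ->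
  {ae lam, forall y, (\int[lam]_x (F (x, y))%:E <= K%:E * \int[lam]_x (G (x, y))%:E)%E} ->
  (\int[leb2]_z (F z)%:E <= K%:E * \int[leb2]_z (G z)%:E)%E.
Proof.
move=> mF mG F0 G0 K0 h; rewrite !tonelli2//.
have mFy := measurable_fiber_integral mF F0; have mGy := measurable_fiber_integral mG G0.
have i0 H y : (forall z : R * R, 0 <= H z) -> (0 <= \int[lam]_x (H (x, y))%:E)%E.
  by move=> H0; apply: integral_ge0 => x _; rewrite lee_fin.
rewrite -ge0_integralZl//; last first.
  by move=> y _; exact: i0.
apply: ae_ge0_le_integral => //.
- by move=> y _; exact: i0.
- by move=> y _; apply: mule_ge0; [rewrite lee_fin|exact: i0].
- exact: measurable_funeM.
- by apply: ae_imp h => y h _.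
Qed.

Section Bounds.
Variables (p q A : R).
Hypotheses (pq : conjugate p q) (A1 : 1 <= A).

Lemma S1_bound : exists2 C, 0 < C & forall w f N, Ap2 p q A w -> mfun f -> fin2 p w f ->
  xsupp N f -> (\int[leb2]_z (wpow p w (S1 f) z)%:E <= C%:E * \int[leb2]_z (wpow p w f z)%:E)%E.
Proof.
have [C C0 HC] := Sop_bound pq A1; exists C; first exact: C0.
move=> w f N wA mf ff fN; have [[mw iw] w0 _ _] := wA.
apply: integral_fiber_le => [| |z|z| |].
- by apply: mfun_wpow => //; exact: mfun_S1.
- exact: mfun_wpow.
- exact: wpow_ge0.
- exact: wpow_ge0.
- exact: ltW.
apply: ae_imp (ae_and (fiber_Ap wA) (fiber_Lp mw w0 mf ff)) => y [h1 h2].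
exact: (HC _ _ N h1 (fiber1 y mf) h2 (fN y)).
Qed.

Lemma S1_is_shift w f N : Ap2 p q A w -> mfun f -> fin2 p w f -> xsupp N f -> is_shift1 f (S1 f).
Proof.
move=> wA mf ff fN; have [[mw iw] w0 _ _] := wA; split; first exact: mfun_S1.
apply: ae_imp (ae_and (fiber_Ap wA) (fiber_Lp mw w0 mf ff)) => y [h1 h2].
exact: (Sop_is_shift pq A1 h1 (fiber1 y mf) h2 (fN y)).
Qed.

Lemma S1_add w f g N : Ap2 p q A w -> mfun f -> mfun g -> fin2 p w f -> fin2 p w g ->
  fin2 p w (fun z => f z + g z) -> xsupp N f -> xsupp N g ->
  {ae lam, forall y, {ae lam, forall x, S1 (fun z => f z + g z) (x, y) = S1 f (x, y) + S1 g (x, y)}}.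
Proof.
move=> wA mf mg ff gg fg fN gN; have [[mw iw] w0 _ _] := wA.
have mfg : mfun (fun z => f z + g z) by exact: measurable_funD.
apply: ae_imp (ae_and (fiber_Ap wA) (ae_and (fiber_Lp mw w0 mfg fg)
  (ae_and (fiber_Lp mw w0 mf ff) (fiber_Lp mw w0 mg gg)))) => y [h1 [h2 [h3 h4]]].
exact: (Sop_add pq A1 h1 (fiber1 y mf) (fiber1 y mg) h3 h4 h2 (fN y) (gN y)).
Qed.

Lemma S1_commutator : exists2 C, 0 < C & forall mu la b f B N,
  Ap2 p q A mu -> Ap2 p q A la -> loc_intg2 b -> mfun f ->
  loc_intg2 (wpow p la b) -> fin2 p mu f -> fin2 q (dual2 p la) f ->
  fin2 p la (fun z => b z * f z) -> xsupp N f -> 0 <= B -> bmo2 p q mu la b B ->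
  (\int[leb2]_z (wpow p la (fun z => S1 (fun z => b z * f z) z - b z * S1 f z)%R z)%:E <=
   ((C * B) `^ p)%:E * \int[leb2]_z (wpow p mu f z)%:E)%E.
Proof.
have [C C0 HC] := Sop_commutator pq A1; exists C; first exact: C0.
move=> mu la b f B N muA laA bi mf bp fp fq bfp fN B0 hb.
have [[mmu imu] mu0 _ _] := muA; have [[mla ila] la0 [md id] _] := laA.
have d0 z : 0 < dual2 p la z by rewrite powR_gt0.
have mbf : mfun (fun z => b z * f z) by apply: measurable_funM => //; exact: bi.1.
apply: integral_fiber_le => [| |z|z| |].
- apply: mfun_wpow => //; apply: measurable_funB; first exact: mfun_S1.
  by apply: measurable_funM; [exact: bi.1|exact: mfun_S1].
- exact: mfun_wpow.
- exact: wpow_ge0.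
- exact: wpow_ge0.
- exact: powR_ge0.
apply: ae_imp (ae_and (ae_and (fiber_Ap muA) (fiber_Ap laA)) (ae_and (fiber_bmo muA laA bi hb)
  (ae_and (ae_and (fiber_loc bp) (fiber_Lp mmu mu0 mf fp))
    (ae_and (fiber_Lp md d0 mf fq) (fiber_Lp mla la0 mbf bfp))))) => y
  [[h1 h2] [h3 [[h4 h5] [h6 h7]]]].
exact: (HC _ _ _ _ B N h1 h2 (fiber1 y bi.1) (fiber1 y mf) h4 h5 h6 h7 (fN y) B0 h3).
Qed.

End Bounds.
End PlaneShift.

(** * The upper bound for test functions *)

Section UpperBound.
Context {R : realType}.
Implicit Types (I J P : dyadic_index) (Q : dyadic_index * dyadic_index) (s t : seq bool) (x y : R)
  (n m N k : nat).
Local Notation lam := (@lebesgue_measure R).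
Implicit Types (w f g F G b mu la : R * R -> R).
Hint Resolve measurable_dyadic measurable_dyadicR measurable_drect : core.
Variables (p q A : R).
Hypotheses (pq : conjugate p q) (A1 : 1 <= A).

Lemma fin2_swap w f : mfun w -> (forall z, 0 < w z) -> mfun f -> fin2 p w f ->
  fin2 p (swap w) (swap f).
Proof.
move=> mw w0 mf; rewrite /fin2.
by rewrite -(integral_swap (mfun_wpow p mw mf) (fun z => wpow_ge0 p f z w0)).
Qed.

Lemma S2_bound : exists2 C, 0 < C & forall w f N, Ap2 p q A w -> mfun f -> fin2 p w f ->
  xsupp N (swap f) ->
  (\int[leb2]_z (wpow p w (S2 f) z)%:E <= C%:E * \int[leb2]_z (wpow p w f z)%:E)%E.
Proof.
have [C C0 HC] := S1_bound pq A1; exists C; first exact: C0.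
move=> w f N wA mf ff fN; have [[mw iw] w0 _ _] := wA.
rewrite -(integral_swap (mfun_wpow p mw mf) (fun z => wpow_ge0 p f z w0)).
rewrite -(integral_swap (mfun_wpow p mw (mfun_S2 mf)) (fun z => wpow_ge0 p _ z w0)).
exact: (HC _ _ N (Ap2_swap wA) (mfun_swap mf) (fin2_swap mw w0 mf ff) fN).
Qed.

Lemma S2_is_shift w f N : Ap2 p q A w -> mfun f -> fin2 p w f -> xsupp N (swap f) ->
  is_shift2 f (S2 f).
Proof.
move=> wA mf ff fN; have [[mw iw] w0 _ _] := wA; split; first exact: mfun_S2.
exact: (S1_is_shift pq A1 (Ap2_swap wA) (mfun_swap mf) (fin2_swap mw w0 mf ff) fN).2.
Qed.

Lemma xsupp_S2 N f : xsupp N f -> xsupp N (S2 f).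
Proof.
move=> fN y x h; rewrite /S2 /=.
have -> : (fun y => f (x, y)) = (fun=> 0) by apply/funext => y'; exact: (fN y' x h).
exact: Sop0.
Qed.

Lemma fin2_le2 w f g h : mfun w -> (forall z, 0 < w z) -> mfun f -> mfun g -> mfun h ->
  (forall z, f z = g z + h z) ->
  (\int[leb2]_z (wpow p w f z)%:E <= (2 `^ p)%:E *
    (\int[leb2]_z (wpow p w g z)%:E + \int[leb2]_z (wpow p w h z)%:E))%E.
Proof.
move=> mw w0 mf mg mh fgh; have [p1 _ _] := pq; have p0 : 0 < p by lra.
have m F : mfun F -> measurable_fun setT (fun z => (wpow p w F z)%:E).
  by move=> mF; apply/measurable_EFinP; exact: mfun_wpow.
have ge F z : (0 <= (wpow p w F z)%:E)%E by rewrite lee_fin wpow_ge0.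
rewrite -ge0_integralD//; [|exact: m|exact: m].
rewrite -ge0_integralZl; try solve [done | by move=> z _; rewrite adde_ge0
  | by rewrite lee_fin powR_ge0 | by apply: emeasurable_funD; exact: m].
apply: ge0_le_integral => //.
- exact: m.
- by apply: measurable_funeM; apply: emeasurable_funD; exact: m.
move=> z _; rewrite -EFinD -EFinM lee_fin /wpow -mulrDl mulrA ler_pM2r//.
by apply: powR_sum_le => //; rewrite fgh; exact: ler_normD.
Qed.

End UpperBound.

Section UpperBound.
Context {R : realType}.
Implicit Types (I J P : dyadic_index) (Q : dyadic_index * dyadic_index) (s t : seq bool) (x y : R)
  (n m N k : nat).
Local Notation lam := (@lebesgue_measure R).
Implicit Types (w f g F G b mu la : R * R -> R).
Hint Resolve measurable_dyadic measurable_dyadicR measurable_drect : core.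
Variables (p q A : R).
Hypotheses (pq : conjugate p q) (A1 : 1 <= A).

(** [k] is the commutator in the second variable. The splitting relies on additivity of [S1], so it
    holds only almost everywhere on almost every fibre, which is enough for the integrals. *)
Lemma upper_core : exists2 C, 0 < C & forall mu la b f B, Ap2 p q A mu -> Ap2 p q A la ->
  loc_intg2 b -> loc_intg2 (wpow p la b) -> 0 <= B -> bmo2 p q mu la b B ->
  mfun f -> (exists M : R, forall z, `|f z| <= M) -> (exists N, forall z, ~ box N z -> f z = 0) ->
  exists g, [/\ is_commutator b f g, mfun g &
    (\int[leb2]_z (wpow p la g z)%:E <= ((C * B) `^ p)%:E * \int[leb2]_z (wpow p mu f z)%:E)%E].
Proof.
have qp := conjugate_sym pq.
have [p1 q1 _] := pq; have p0 : 0 < p by lra. have q0 : 0 < q by lra.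
have [C1 C10 HS] := S1_bound pq A1; have [C2 C20 HC] := S1_commutator pq A1.
have [D1 D10 HS2] := S2_bound pq A1; have [D2 D20 HS2'] := S2_bound qp A1.
(* First summand: [S1] applied to the commutator in the second variable. Second: the commutator in
   the first variable applied to [S2 f]. Adding two p-th powers costs 2^p. *)
pose KK := 2 `^ p * (C1 * C2 `^ p + C2 `^ p * D1).
have KK0 : 0 < KK.
  by rewrite mulr_gt0 ?powR_gt0// addr_gt0// mulr_gt0 ?powR_gt0.
exists (KK `^ p^-1); first by rewrite powR_gt0.
move=> mu la b f B muA laA bi bp B0 hb mf [M fM] [N fN].
have -> : (KK `^ p^-1 * B) `^ p = KK * B `^ p.
  rewrite powRM ?powR_ge0// -powRrM mulVf ?powRr1 ?ltW//; lra.
have M0 : 0 <= M by apply: le_trans (fM (0, 0)).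
have [[mmu imu] mu0 _ _] := muA; have [[mla ila] la0 [md id] _] := laA.
have d0 z : 0 < dual2 p la z by rewrite powR_gt0.
have dA := Ap2_dual pq laA.
have mb := bi.1.
have mbf : mfun (fun z => b z * f z) by exact: measurable_funM.
have scale (r : R) G : loc_intg2 G -> loc_intg2 (fun z => r * G z).
  move=> [mG iG]; split; first exact: measurable_funM.
  by move=> Q; have := integrableZl (measurable_drect Q) r (iG Q).
have fpow (r : R) : 0 < r -> forall z, `|f z| `^ r <= M `^ r.
  by move=> r0 z; apply: powR_mono.
have finf (r : R) w : 0 < r -> mfun w -> (forall z, 0 < w z) -> (forall Q, intg2 w Q) -> fin2 r w f.
  move=> r0 mw w0 iw; apply: (@fin_box _ N (wpow r w f) (fun z => M `^ r * w z)).
  - exact: mfun_wpow.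
  - by move=> z; exact: wpow_ge0.
  - exact: scale.
  - by move=> z _; rewrite /wpow ler_pM2r// fpow.
  - by move=> z h; rewrite /wpow fN// normr0 powR0 ?mul0r// gt_eqF.
have fmu : fin2 p mu f by exact: finf.
have fdu : fin2 q (dual2 p la) f by exact: finf.
have fbf : fin2 p la (fun z => b z * f z).
  apply: (@fin_box _ N (wpow p la (fun z => b z * f z)) (fun z => M `^ p * wpow p la b z)).
  - exact: mfun_wpow.
  - by move=> z; exact: wpow_ge0.
  - exact: scale.
  - move=> z _; rewrite /wpow normrM powRM//.
    rewrite [leLHS](_ : _ = `|f z| `^ p * (`|b z| `^ p * la z)); last by ring.
    by apply: ler_wpM2r; [rewrite mulr_ge0 ?powR_ge0// ltW|exact: fpow].
  - by move=> z h; rewrite /wpow fN// mulr0 normr0 powR0 ?mul0r// gt_eqF.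
have fx : xsupp N f by move=> y x h; apply: fN => -[[e xe] _]; exact: (h e).
have fy : xsupp N (swap f) by move=> y x h; apply: fN => -[_ [e xe]]; exact: (h e).
have bfx : xsupp N (fun z => b z * f z) by move=> y x h; rewrite (fx y x h) mulr0.
have bfy : xsupp N (swap (fun z => b z * f z)).
  by move=> y x h; rewrite /swap /=; have := fy y x h; rewrite /swap /= => ->; rewrite mulr0.
pose u2 := S2 (fun z => b z * f z); pose v2 := S2 f.
have mu2 : mfun u2 by exact: mfun_S2.
have mv2 : mfun v2 by exact: mfun_S2.
have u2x : xsupp N u2 by exact: xsupp_S2.
have v2x : xsupp N v2 by exact: xsupp_S2.
have su2 := S2_is_shift pq A1 laA mbf fbf bfy.
have sv2 := S2_is_shift pq A1 muA mf fmu fy.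
have mbv2 : mfun (fun z => b z * v2 z) := measurable_funM mb mv2.
have mk0 : mfun (fun z => u2 z - b z * v2 z) := measurable_funB mu2 mbv2.
have Ik : (\int[leb2]_z (wpow p la (fun z => u2 z - b z * v2 z)%R z)%:E <=
    ((C2 * B) `^ p)%:E * \int[leb2]_z (wpow p mu f z)%:E)%E.
  rewrite -(integral_swap (mfun_wpow p mla mk0) (fun z => wpow_ge0 p _ z la0)).
  rewrite -(integral_swap (mfun_wpow p mmu mf) (fun z => wpow_ge0 p f z mu0)).
  have -> : (fun z => (swap (wpow p la (fun z => u2 z - b z * v2 z)) z)%:E) = (fun z => (wpow p (swap la) (fun z =>
      S1 (fun z => swap b z * swap f z) z - swap b z * S1 (swap f) z) z)%:E).
    by apply/funext => z; rewrite /wpow /u2 /v2 /S2 /S1 /swap.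
  have fds : fin2 q (dual2 p (swap la)) (swap f) by exact: (fin2_swap md d0 mf fdu).
  exact: (HC _ _ _ _ B N (Ap2_swap muA) (Ap2_swap laA) (loc_swap bi) (mfun_swap mf) (loc_swap bp)
    (fin2_swap mmu mu0 mf fmu) fds (fin2_swap mla la0 mbf fbf) fy B0 (bmo2_swap muA laA bi hb)).
have finC (X Y : \bar R) (r : R) : (X <= r%:E * Y)%E -> 0 <= r -> (Y < +oo)%E -> (X < +oo)%E.
  by move=> XY r0 Y0; apply: le_lt_trans XY _; rewrite lte_mul_pinfty ?lee_fin.
have fv : fin2 p mu v2 := finC _ _ _ (HS2 _ _ N muA mf fmu fy) (ltW D10) fmu.
have Iv : (\int[leb2]_z (wpow p mu v2 z)%:E <= D1%:E * \int[leb2]_z (wpow p mu f z)%:E)%E :=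
  HS2 _ _ N muA mf fmu fy.
have fdv : fin2 q (dual2 p la) v2 := finC _ _ _ (HS2' _ _ N dA mf fdu fy) (ltW D20) fdu.
have fu2 : fin2 p la u2 := finC _ _ _ (HS2 _ _ N laA mbf fbf bfy) (ltW D10) fbf.
rewrite -/u2 in su2; rewrite -/v2 in sv2.
clearbody u2 v2.
have [k kE] : exists h, h = (fun z => u2 z - b z * v2 z) by eexists.
rewrite -kE in mk0 Ik.
have kz z : k z = u2 z - b z * v2 z by rewrite kE.
clear kE.
have bv2x : xsupp N (fun z => b z * v2 z) by move=> y x h; rewrite (v2x y x h) mulr0.
have kx : xsupp N k by move=> y x h; rewrite kz (v2x y x h) (u2x y x h) mulr0 subrr.
have fk : fin2 p la k := finC _ _ _ Ik (powR_ge0 _ _) fmu.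
(* [S2 f] need not be bounded, so integrability of its product with [b] is deduced from that of [u2]
   and [k]. *)
have fbv : fin2 p la (fun z => b z * v2 z).
  have mnk : mfun (fun z => - k z) by exact: measurableT_comp.
  have fnk : (\int[leb2]_z (wpow p la (fun z => - k z)%R z)%:E < +oo)%E.
    have -> : (fun z => (wpow p la (fun z => - k z) z)%:E) = (fun z => (wpow p la k z)%:E).
      by apply/funext => z; rewrite /wpow normrN.
    exact: fk.
  have e z : b z * v2 z = u2 z + - k z by rewrite kz; ring.
  exact: (finC _ _ _ (fin2_le2 (h := fun z => - k z) pq mla la0 mbv2 mu2 mnk e) (powR_ge0 _ _)
    (lte_add_pinfty fu2 fnk)).
have u2E : (fun z => k z + b z * v2 z) = u2 by apply/funext => z; rewrite kz subrK.
have S1kz := S1_add pq A1 laA mk0 mbv2 fk fbv.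
rewrite u2E in S1kz; have {}S1kz := S1kz N fu2 kx bv2x.
have su1 := S1_is_shift pq A1 laA mu2 fu2 u2x.
have sv1 := S1_is_shift pq A1 muA mv2 fv v2x.
have IG1 := HS _ _ N laA mk0 fk kx.
have IG2 := HC mu la b v2 B N muA laA bi mv2 bp fv fdv fbv v2x B0 hb.
have mG1 := mfun_S1 mk0; have m1u := mfun_S1 mu2; have m1v := mfun_S1 mv2.
have m1bv := mfun_S1 mbv2.
have mG2 := measurable_funB m1bv (measurable_funM mb m1v).
have mg := measurable_funB m1u (measurable_funM mb m1v).
move: S1kz su1 sv1 IG1 IG2 mG1 m1u m1v m1bv mG2 mg.
move: (S1 u2) (S1 v2) (S1 k) (S1 (fun z => b z * v2 z)) => U V G1 W.
move=> UE su1 sv1 IG1 IG2 mG1 m1u m1v m1bv mG2 mg.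
exists (fun z => U z - b z * V z); split; [|exact: mg|].
  by exists U, V; split=> //; [exists u2|exists v2].
have mG : mfun (fun z => G1 z + (W z - b z * V z)) := measurable_funD mG1 mG2.
set g := (fun z => U z - b z * V z) in mg *.
set G := (fun z => G1 z + (W z - b z * V z)) in mG.
have Ig : (\int[leb2]_z (wpow p la g z)%:E <= 1%:E * \int[leb2]_z (wpow p la G z)%:E)%E.
  have mwg := mfun_wpow p mla mg; have mwG := mfun_wpow p mla mG.
  apply: (integral_fiber_le mwg mwG (fun z => wpow_ge0 p g z la0) (fun z => wpow_ge0 p G z la0) ler01).
  apply: ae_imp UE => y H; rewrite mul1e le_eqVlt; apply/orP; left; apply/eqP.
  apply: eq_lam_ae => //.
  - by apply/measurable_EFinP; exact: (fiber1 y mwg).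
  - by apply/measurable_EFinP; exact: (fiber1 y mwG).
  apply: ae_imp H => x H _; have e : U (x, y) - b (x, y) * V (x, y) = G1 (x, y) + (W (x, y) - b (x, y) * V (x, y)).
    by rewrite addrA; congr (_ - _).
  exact: (congr1 (fun r => (`|r| `^ p * la (x, y))%:E) e).
apply: le_trans Ig _; rewrite mul1e.
apply: le_trans (fin2_le2 (f := G) pq mla la0 mG mG1 mG2 (fun z => erefl)) _.
have IG1' := le_trans IG1 (lee_wpmul2l (ltW C10 : (0 <= C1%:E)%E) Ik).
have IG2' := le_trans IG2 (lee_wpmul2l (powR_ge0 _ _ : (0 <= ((C2 * B) `^ p)%:E)%E) Iv).
apply: le_trans (lee_wpmul2l _ (leeD IG1' IG2')) _; first by rewrite lee_fin powR_ge0.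
rewrite (powRM _ (ltW C20) B0).
have I0 : (0 <= \int[leb2]_z (wpow p mu f z)%:E)%E by apply: integral_ge0 => z _; rewrite lee_fin wpow_ge0.
move: fmu I0; rewrite /fin2; case: (\int[leb2]_z (wpow p mu f z)%:E)%E => // X _ _.
rewrite -!EFinM lee_fin le_eqVlt; apply/orP; left; apply/eqP.
rewrite /KK; ring.
Qed.
End UpperBound.

(** * The lower bound *)

Section ShiftInversion.
Context {R : realType}.
Implicit Types (I J L P Q : dyadic_index) (s t : seq bool) (e : bool) (f g h u w : R -> R) (x : R)
  (p q A : R).
Local Notation lam := (@lebesgue_measure R).
Local Notation one := (fun=> 1 : R).
Hint Resolve measurable_dyadic measurable_dyadicR : core.

Lemma compact_dyadic I : exists2 K : set R, compact K & dyadic I `<=` K.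
Proof.
exists `[I.2%:~R * dlen I, (I.2 + 1)%:~R * dlen I]; first exact: segment_compact.
by apply: subset_itv; rewrite bnd_simp.
Qed.

Lemma locally_integrable_intg f I : locally_integrable setT f -> intg f I.
Proof.
move=> [mf _ h]; have [K cK IK] := compact_dyadic I.
have mn : measurable_fun setT (fun x => `|f x|%:E).
  by apply/measurable_EFinP; exact: measurableT_comp.
apply/integrableP; split; first by apply/measurable_EFinP; apply: measurable_funTS.
apply: le_lt_trans (h K (@subsetT _ _) cK); apply: ge0_subset_integral => //.
  exact: compact_measurable.
by apply: measurable_funTS.
Qed.

Lemma avg_child_le f e I : (forall x, 0 <= f x) -> intg f I -> avg f (child e I) <= 2 * avg f I.
Proof.
move=> f0 fi; rewrite (avg_child fi).
have h b : 0 <= avg f (child b I) by apply: avg_ge0.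
by have := h true; have := h false; case: e; lra.
Qed.

Lemma diff_norm f I : intg f I -> `|diff f I| <= 2 * avg (fun x => `|f x|) I.
Proof.
move=> fi; rewrite (avg_child (intg_norm fi)) /diff.
have h e := avg_norm (intg_child e fi).
apply: le_trans (ler_normB _ _) _; have := h true; have := h false; lra.
Qed.

Lemma diffB f g I : intg f I -> intg g I -> diff (fun x => f x - g x) I = diff f I - diff g I.
Proof.
by move=> fi gi; rewrite /diff !avgB; try exact: intg_child; ring.
Qed.

(** Over a fixed interval [diff] is continuous in the L^1 norm, and every finite Haar sum containing
    [P] already has this difference. *)
Lemma is_shift_diff f g e P : is_shift f g ->
  diff g (child e P) = (if e then -1 else 1) * diff f (child (~~ e) P).
Proof.
move=> [lf lg h]; set I := child e P; set r := RHS.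
have gi := locally_integrable_intg I lg; have fi := locally_integrable_intg (child (~~ e) P) lf.
apply/eqP; rewrite -subr_eq0 -normr_le0; apply/ler_addgt0Pr => eps e0.
have l0 := @dlen_gt0 R I.
have [K cK IK] := compact_dyadic I.
have d0 : 0 < eps / 2 * dlen I by rewrite mulr_gt0// divr_gt0.
have [F0 /(_ (P |` F0)%fset) H] := h K _ cK d0.
have {}H := H (fsubsetUr _ _).
have E : r = diff (hsum f (P |` F0)%fset) I.
  by rewrite /I diff_hsum// ?fset_uniq// !inE eqxx mul1r.
have hi : intg (hsum f (P |` F0)%fset) I by exact: intg_hsum.
rewrite E -diffB//; apply: le_trans (diff_norm (intgB gi hi)) _.
have mgh : measurable_fun setT (fun x => `|g x - hsum f (P |` F0)%fset x|%:E).
  apply/measurable_EFinP; apply: measurableT_comp => //.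
  by apply: measurable_funB; [case: lg|exact: measurable_hsum].
have : (\int[lam]_(x in dyadic I) `|g x - hsum f (P |` F0)%fset x|%:E <= (eps / 2 * dlen I)%:E)%E.
  apply: le_trans H; apply: ge0_subset_integral => //; first exact: compact_measurable.
  by apply: measurable_funTS.
rewrite integral_avg//; last by apply: intg_norm; exact: intgB.
rewrite lee_fin mulrC ler_pM2r// add0r; lra.
Qed.

Lemma is_shift_close f g Q (eps : R) : is_shift f g -> 0 < eps ->
  exists F0 : {fset dyadic_index}, forall F : {fset dyadic_index}, (F0 `<=` F)%fset ->
  (\int[lam]_(x in dyadic Q) `|g x - hsum f F x|%:E <= eps%:E)%E.
Proof.
move=> [lf lg h] e0; have [K cK QK] := compact_dyadic Q.
have [F0 H] := h K eps cK e0; exists F0 => F /H; apply: le_trans.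
have mgh : measurable_fun setT (fun x => `|g x - hsum f F x|%:E).
  apply/measurable_EFinP; apply: measurableT_comp => //.
  by apply: measurable_funB; [case: lg|exact: measurable_hsum].
apply: ge0_subset_integral => //; first exact: compact_measurable.
by apply: measurable_funTS.
Qed.

Lemma ae_eq0 (h : R -> R) Q : measurable_fun setT h ->
  (forall eps, 0 < eps -> (\int[lam]_(x in dyadic Q) `|h x|%:E <= eps%:E)%E) ->
  {ae lam, forall x, dyadic Q x -> h x = 0}.
Proof.
move=> mh H.
have mn : measurable_fun (dyadic Q) (fun x => `|h x|%:E).
  by apply/measurable_EFinP; apply: measurable_funTS; exact: measurableT_comp.
have le0 : (\int[lam]_(x in dyadic Q) `|h x|%:E <= 0)%E.
  by apply/lee_addgt0Pr => eps e0; rewrite add0e; exact: H.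
have := @integral_eq0_ae _ _ _ lam _ _ (measurable_dyadicR Q) mn _ le0.
move=> /(_ (fun x _ => normr_ge0 _)) h'; apply: ae_imp h' => x h' Qx.
by have /eqP := h' Qx; rewrite eqe normr_eq0 => /eqP.
Qed.

Lemma ae_tops (S : R -> Prop) : (forall n e, {ae lam, forall x, dyadic (top n e) x -> S x}) ->
  {ae lam, forall x, S x}.
Proof.
move=> h; have H : {ae lam, forall x, forall ne : nat * bool, dyadic (top ne.1 ne.2) x -> S x}.
  by apply: ae_all => -[n e]; exact: h.
by apply: ae_imp H => x H; have [n [e xe]] := top_exists x; exact: (H (n, e)).
Qed.

Lemma is_shift_unique f g h : is_shift f g -> is_shift f h -> {ae lam, forall x, g x = h x}.
Proof.
move=> fg fh; apply: ae_tops => n e; have [_ [mg _ _] _] := fg; have [_ [mh _ _] _] := fh.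
have mgh : measurable_fun setT (fun x => g x - h x) by exact: measurable_funB.
suff H : {ae lam, forall x, dyadic (top n e) x -> g x - h x = 0}.
  by apply: ae_imp H => x H xe; apply/eqP; rewrite -subr_eq0; apply/eqP; exact: H.
apply: ae_eq0 => // eps e0; have e2 : 0 < eps / 2 by rewrite divr_gt0.
have [F1 H1] := is_shift_close (top n e) fg e2; have [F2 H2] := is_shift_close (top n e) fh e2.
have {}H1 := H1 _ (fsubsetUl F1 F2); have {}H2 := H2 _ (fsubsetUr F1 F2).
set F := (F1 `|` F2)%fset in H1 H2.
have m (k : R -> R) : measurable_fun setT k -> measurable_fun (dyadic (top n e)) (fun x => `|k x - hsum f F x|%:E).
  move=> mk; apply/measurable_EFinP; apply: measurable_funTS; apply: measurableT_comp => //.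
  by apply: measurable_funB => //; exact: measurable_hsum.
apply: le_trans (_ : (_ <= (eps / 2)%:E + (eps / 2)%:E)%E) _; last by rewrite -EFinD -splitr.
apply: le_trans (leeD H1 H2); rewrite -ge0_lamD => //; [|exact: m|exact: m].
apply: le_lam => //.
- by apply/measurable_EFinP; apply: measurable_funTS; exact: measurableT_comp.
- by apply: emeasurable_funD; exact: m.
move=> x _; rewrite -EFinD lee_fin (distrC (h x)).
by rewrite (_ : g x - h x = (g x - hsum f F x) + (hsum f F x - h x)) ?ler_normD//; ring.
Qed.

Lemma is_shift_eq0 f g Q : is_shift f g -> (forall P x, dyadic Q x -> shift_term f P x = 0) ->
  {ae lam, forall x, dyadic Q x -> g x = 0}.
Proof.
move=> fg h; have [_ [mg _ _] _] := fg; apply: ae_eq0 => // eps e0.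
have [F0 /(_ F0 (fsubset_refl _))] := is_shift_close Q fg e0; apply: le_trans.
rewrite le_eqVlt; apply/orP; left; apply/eqP; apply: eq_lam => x Qx.
by rewrite /hsum big1 ?subr0// => P _; exact: h.
Qed.

(* Up to a constant, only the Haar functions of the strict ancestors of [J] meet
   the indicator of [J], and the shift moves them off the parent of [J]. *)
Lemma shift_term_indic f (c : R) e Q P x : intg f (child true P) -> intg f (child false P) ->
  (forall L, avg f L = c * avg (\1_(dyadic (child e Q))) L) ->
  dyadic Q x -> shift_term f P x = 0.
Proof.
move=> i1 i0 fE Qx.
pose J := child e Q.
have cJ L : dyadic_position (R := R) L J -> (exists e' s, J = node (child e' L) s) \/ diff f L = 0.
  case=> [s LE|e' s JE|d]; [right|by left; exists e', s|right].
  - rewrite /diff !fE; suff h b : avg (\1_(dyadic J)) (child b L) = 1 :> R by rewrite !h subrr.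
    rewrite (@eq_avg _ _ (fun=> 1)) ?avg_cst// => y yL; rewrite indicE mem_set//.
    by have [Ly _] := dyadic_childP yL; rewrite LE in Ly; exact: node_sub Ly.
  - rewrite /diff !fE; suff h b : avg (\1_(dyadic J)) (child b L) = 0 :> R by rewrite !h subrr.
    rewrite (@eq_avg _ _ (fun=> 0)) ?avg_cst// => y yL; rewrite indicE memNset//.
    by have [Ly _] := dyadic_childP yL; exact: d.
have key b : intg f (child b P) -> haar_coef f (child b P) * haar (child (~~ b) P) x = 0.
  move=> ib; case: (cJ _ (@dyadicP R (child b P) J)) => [[e' [s JE]]|d0]; last first.
    by rewrite haar_coefE// d0 mulr0 mul0r.
  rewrite [haar _ x]haar_out ?mulr0// => xb; apply: (child_disjoint (I := P) (e := ~~ b) xb).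
  rewrite negbK; case: s JE => [|e2 s]; first by move=> /child_inj[_ <-].
  move=> /child_inj[_ QE]; move: Qx; rewrite QE => /node_sub /dyadic_childP[].
  by [].
have k1 := key true i1; have k0 := key false i0.
by rewrite /shift_term; move: k1 k0 => /= -> ->; rewrite subrr.
Qed.

(** All that the inversion retains of the shift: a linear relation free of series, which survives
    averaging in the other variable. *)
Definition shifted f g := forall e P, diff g (child e P) = (if e then -1 else 1) * diff f (child (~~ e) P).

Section Inversion.
Variables (p q A : R).
Hypotheses (pq : conjugate p q) (A1 : 1 <= A).

(** Exchanging siblings twice changes the sign of a coefficient. Within [Q] this is available at the
    nodes contained in a child, so the recovered martingale starts from the average over that
    child. *)
Lemma sproc_shifted f g Q s e : intg f Q -> shifted f g ->
  sproc one (dyadic_avg Q g) (rcons s e) = avg f (child e Q) - dyadic_avg Q f (rcons s e).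
Proof.
move=> fi fg; elim: s => [|e1 s IH]; first by rewrite /= /dyadic_avg /= mulr0 addr0 subrr.
have mf : mart (dyadic_avg Q f) by exact: mart_avg.
have key : epend one (dyadic_avg Q g) (rcons s e) = - dif (dyadic_avg Q f) (rcons s e).
  have : rcons s e <> [::] by case: (s).
  case: (rcons s e) => // e2 s2 _; rewrite /= !diffE /= fg negbK.
  by case: e2; rewrite /=; ring.
by rewrite rcons_cons [LHS]/= IH (mart_stepE _ e1 mf) key mulrN opprD addrA.
Qed.

(** On the child [e], the shift of [g] inside [Q] is the average minus [f], by [sproc_shifted] and
    differentiation; boundedness of the shift concludes. An infinite right side is trivial. *)
Lemma shift_inversion : exists2 C, 0 < C & forall w f g Q e, Ap1 p q A w -> intg f Q ->
  measurable_fun setT f -> measurable_fun setT g -> shifted f g ->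
  (Lpint p w (child e Q) (fun x => f x - avg f (child e Q))%R <= C%:E * Lpint p w Q g)%E.
Proof.
have [C C0 HC] := shift_limit pq A1; exists C; first exact: C0.
move=> w f g Q e wA fi mf mg fg; have [mw w0 iw _ _] := wA.
have [goo|] := ltP (Lpint p w Q g) (+oo)%E; last first.
  by rewrite leye_eq => /eqP ->; rewrite mulry gtr0_sg// mul1e leey.
have gi : intg (fun x => `|g x| `^ p * w x) Q by exact: Lpint_intg.
have [cv _ bd] := HC w Q g wA mg gi; apply: le_trans bd.
have mc : measurable_fun setT (fun x => f x - avg f (child e Q)) by exact: measurable_funB.
have mSl := measurable_Slim Q g.
apply: (@le_trans _ _ (Lpint p w (child e Q) (Slim Q g))); last first.
  apply: ge0_subset_integral => //.
  - by apply/measurable_EFinP; apply: measurable_funTS; exact: measurable_Lp.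
  - by move=> x _; rewrite lee_fin weighted_ge0.
  - by move=> x /dyadic_childP[].
rewrite le_eqVlt; apply/orP; left; apply/eqP; apply: eq_lam_ae => //.
- by apply/measurable_EFinP; apply: measurable_funTS; exact: measurable_Lp.
- by apply/measurable_EFinP; apply: measurable_funTS; exact: measurable_Lp.
apply: ae_imp (ae_and cv (dyadic_differentiation fi)) => x [h1 h2] xe.
have [Qx _] := dyadic_childP xe; have {}h1 := h1 Qx; have {}h2 := h2 Qx.
suff -> : Slim Q g x = avg f (child e Q) - f x by rewrite distrC.
apply: (cvg_unique _ h1); first exact: norm_hausdorff.
have c : (fun=> avg f (child e Q)) n @[n --> \oo] --> avg f (child e Q) by exact: cvg_cst.
have Fi : Filter (\oo : set_system nat) by exact: filter_filter.
have cc : avg f (child e Q) - step Q n (fun s => avg f (node Q s)) [::] x @[n --> \oo] -->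
    avg f (child e Q) - f x by exact: cvgB c h2.
apply: cvg_trans cc; apply: near_eq_cvg; near=> n.
have n0 : (0 < n)%N by near: n; exact: nbhs_infty_gt.
have [s sn sx] := node_exists n.-1 xe.
have sx' : dyadic (node Q (rcons s e)) x by rewrite node_child.
have sn' : size (rcons s e) = n by rewrite size_rcons sn prednK.
by rewrite /sseq (stepE _ sn' sx') /= (stepE _ sn' sx') (sproc_shifted s e fi fg).
Unshelve. all: by end_near.
Qed.

(** Since [f] vanishes on the sibling, its average is up to sign a difference of [f], hence a
    difference of [g] on the other half of [Q]. The A_p condition on [Q] transfers the weight from
    one half to the other. *)
Lemma shift_average : exists2 C, 0 < C & forall w f g Q e e', Ap1 p q A w ->
  measurable_fun setT g -> intg f (child e' Q) -> shifted f g ->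
  (forall x, dyadic (child (~~ e) (child e' Q)) x -> f x = 0) ->
  ((`|avg f (child e (child e' Q))| `^ p)%:E *
     \int[lam]_(x in dyadic (child e (child e' Q))) (w x)%:E <=
   C%:E * Lpint p w (child (~~ e') Q) g)%E.
Proof.
have [p1 q1 pq1] := pq; have p0 : 0 < p by lra. have q0 : 0 < q by lra.
(* In 4A, one factor 2 bounds a difference by an average of |g| and one passes from [L] to [Q] in
   the dual average; the outer 2 is |Q| / |L|. *)
exists (2 * (4 * A) `^ p); first by rewrite mulr_gt0// powR_gt0//; have := A1; lra.
move=> w f g Q e e' wA mg fi fg f0; have [mw w0 iw id hA] := wA.
set J := child e _; set L := child (~~ e') Q.
have d0 x : 0 < dual p w x by exact: dual_gt0.
have C0 : 0 < 2 * (4 * A) `^ p by rewrite mulr_gt0// powR_gt0//; have := A1; lra.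
have [goo|] := ltP (Lpint p w L g) (+oo)%E; last first.
  by rewrite leye_eq => /eqP ->; rewrite mulry gtr0_sg// mul1e leey.
have gi : intg (fun x => `|g x| `^ p * w x) L by exact: Lpint_intg.
have giL : intg g L by exact: Lp_intg pq wA mg gi.
have a0 : avg f (child (~~ e) (child e' Q)) = 0.
  by rewrite (@eq_avg _ _ (fun=> 0)) ?avg_cst.
have dE : `|diff g L| = `|avg f J|.
  rewrite /L fg negbK (diff_child _ e) a0 subr0 !normrM -/J.
  by case: (e'); case: (e); rewrite ?normrN !normr1 !mul1r.
pose X := avg (fun x => `|g x|) L.
have X0 : 0 <= X by apply: avg_ge0.
have h1 : `|avg f J| <= 2 * X by rewrite -dE; exact: diff_norm.
pose S := rootavg q (dual p w) L [::].
have V0 : 0 < avg (dual p w) L by exact: avg_gt0.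
have S0 : 0 < S by rewrite powR_gt0.
have h2 : (X / S) `^ p <= avg (fun x => `|g x| `^ p * w x) L.
  exact: (Lp_majorant [::] pq wA giL gi).
have W0 : 0 < avg w Q by exact: avg_gt0.
have hS : S <= 2 * avg (dual p w) Q `^ q^-1.
  apply: (@le_trans _ _ ((2 * avg (dual p w) Q) `^ q^-1)).
    apply: powR_mono; [by rewrite invr_gt0|exact: ltW V0|].
    by apply: avg_child_le => // x; exact: ltW.
  rewrite powRM//; last by apply: avg_ge0 => x _; exact: ltW.
  apply: ler_wpM2r; first exact: powR_ge0.
  by rewrite -[leRHS](powRr1 (ler0n _ 2)); apply: ler_powR; [lra|rewrite invf_le1//; lra].
have hW : (\int[lam]_(x in dyadic J) (w x)%:E <= (dlen Q * avg w Q)%:E)%E.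
  rewrite -integral_avg//; last by move=> x _; exact: ltW.
  apply: ge0_subset_integral => //.
  - by apply/measurable_EFinP; apply: measurable_funTS.
  - by move=> x _; rewrite lee_fin ltW.
  - by move=> x /dyadic_childP[] /dyadic_childP[].
have := lee_wpmul2l (powR_ge0 `|avg f J| p : (0 <= (_ `^ p)%:E)%E) hW.
move=> /le_trans; apply; rewrite -EFinM.
rewrite /Lpint integral_avg//; last by move=> x _; exact: weighted_ge0.
rewrite -EFinM lee_fin.
have lL : dlen L = dlen Q / 2 :> R by rewrite dlen_child.
rewrite lL; have l0 := @dlen_gt0 R Q.
set Y := avg _ L in h2 *.
have Y0 : 0 <= Y by apply: avg_ge0 => x _; exact: weighted_ge0.
suff H : `|avg f J| `^ p * avg w Q <= (4 * A) `^ p * Y.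
  rewrite mulrCA [leRHS](_ : _ = dlen Q * ((4 * A) `^ p * Y)); last by field.
  by rewrite ler_pM2l.
apply: (@le_trans _ _ ((4 * A) `^ p * (X / S) `^ p)); last by rewrite ler_wpM2l// powR_ge0.
have A40 : 0 <= 4 * A by have := A1; lra.
have XS0 : 0 <= X / S by apply: divr_ge0; [exact: X0|exact: ltW S0].
rewrite -(powRM _ A40 XS0).
rewrite -(pow_root p1 (normr_ge0 _) (ltW W0)).
apply: powR_mono; [exact: p0|by rewrite mulr_ge0// powR_ge0|].
have hAQ := hA Q.
rewrite mulrA ler_pdivlMr//.
have r0 := powR_ge0 (avg w Q) p^-1; have n0 := normr_ge0 (avg f J).
apply: (@le_trans _ _ ((2 * X * avg w Q `^ p^-1) * (2 * avg (dual p w) Q `^ q^-1))).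
  apply: ler_pM; [by rewrite mulr_ge0|exact: ltW S0|exact: ler_wpM2r|exact: hS].
have := ler_wpM2l X0 hAQ; set a := _ `^ p^-1; set c := _ `^ q^-1; lra.
Qed.

End Inversion.
End ShiftInversion.

(** * Exchange of null sets and estimates on strips *)

Section PlaneTools.
Context {R : realType}.
Implicit Types (I J L P : dyadic_index) (Q : dyadic_index * dyadic_index) (x y : R)
  (n m N k : nat) (p q A : R).
Local Notation lam := (@lebesgue_measure R).
Implicit Types (w f g F G b mu la : R * R -> R).
Hint Resolve measurable_dyadic measurable_dyadicR measurable_drect : core.

Lemma lam_eq0 (f : R -> \bar R) : measurable_fun setT f -> {ae lam, forall x, f x = 0%E} ->
  (\int[lam]_x f x = 0)%E.
Proof.
move=> mf f0; rewrite -[RHS](integral0 lam setT); apply: eq_lam_ae => //.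
by apply: ae_imp f0.
Qed.

Lemma integral_lam_eq0 (f : R -> \bar R) : measurable_fun setT f -> (forall x, (0 <= f x)%E) ->
  (\int[lam]_x f x = 0)%E -> {ae lam, forall x, f x = 0%E}.
Proof.
move=> mf f0 h; have := @integral_eq0_ae _ _ _ lam _ _ measurableT mf (fun x _ => f0 x).
by rewrite h => /(_ (lexx _)) H; apply: ae_imp H => x; apply.
Qed.

(** Tonelli for |h|: its two iterated integrals vanish together. *)
Lemma ae_fubini h : mfun h -> {ae lam, forall x, {ae lam, forall y, h (x, y) = 0}} ->
  {ae lam, forall y, {ae lam, forall x, h (x, y) = 0}}.
Proof.
move=> mh H; pose F z := `|h z|.
have mF : mfun F by exact: measurableT_comp.
have F0 z : 0 <= F z by exact: normr_ge0.
have m1 x : measurable_fun setT (fun y => (F (x, y))%:E) by apply/measurable_EFinP; exact: fiber2.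
have m2 y : measurable_fun setT (fun x => (F (x, y))%:E) by apply/measurable_EFinP; exact: fiber1.
have I0 : (\int[leb2]_z (F z)%:E = 0)%E.
  rewrite tonelli1//; apply: lam_eq0.
    exact: (measurable_fiber_integral (mfun_swap mF) (fun z => F0 _)).
  apply: ae_imp H => x H; apply: lam_eq0 => //.
  by apply: ae_imp H => y; rewrite /F => ->; rewrite normr0.
rewrite tonelli2// in I0.
have := integral_lam_eq0 (measurable_fiber_integral mF F0) _ I0.
move=> H'; have ge y : (0 <= \int[lam]_x (F (x, y))%:E)%E by apply: integral_ge0 => x _; rewrite lee_fin.
have {}H' := H' ge.
apply: ae_imp H' => y H'; have ge2 x : (0 <= (F (x, y))%:E)%E by rewrite lee_fin.
have H2 := integral_lam_eq0 (m2 y) ge2 H'. apply: ae_imp H2 => x; rewrite /F => /eqP; rewrite eqe normr_eq0 => /eqP.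
by [].
Qed.

Lemma avg_ae (f g : R -> R) I : measurable_fun setT f -> measurable_fun setT g ->
  {ae lam, forall x, f x = g x} -> avg f I = avg g I.
Proof.
move=> mf mg fg; rewrite /avg /Rintegral; congr (_ * fine _).
apply: eq_lam_ae => //; try by apply/measurable_EFinP; apply: measurable_funTS.
by apply: ae_imp fg => x ->.
Qed.

Lemma integral_rect_swap F I J : mfun F -> (forall z, 0 <= F z) ->
  (\int[leb2]_(z in drect (J, I)) (swap F z)%:E = \int[leb2]_(z in drect (I, J)) (F z)%:E)%E.
Proof.
move=> mF F0; rewrite !integral_cut -[RHS]integral_swap; last 2 first.
- exact: mfun_cut.
- by move=> z; exact: cut_ge0.
apply: eq_integral => -[x y] _; congr (_%:E).
by rewrite {2}/swap /= !cutE mulrAC.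
Qed.

Lemma strip_le F G I L (K : R) : mfun F -> mfun G -> (forall z, 0 <= F z) -> (forall z, 0 <= G z) ->
  0 <= K -> {ae lam, forall y, dyadic L y ->
    (\int[lam]_(x in dyadic I) (F (x, y))%:E <= K%:E * \int[lam]_x (G (x, y))%:E)%E} ->
  (\int[leb2]_(z in drect (I, L)) (F z)%:E <= K%:E * \int[leb2]_z (G z)%:E)%E.
Proof.
move=> mF mG F0 G0 K0 h; rewrite integral_cut; apply: integral_fiber_le => //.
- exact: mfun_cut.
- by move=> z; exact: cut_ge0.
apply: ae_imp h => y h; have [Ly|nL] := pselect (dyadic L y).
  apply: le_trans (h Ly); rewrite lam_cut le_eqVlt; apply/orP; left; apply/eqP.
  by apply: eq_lam => x _; rewrite cutE (indicE _ (dyadic L)) mem_set// mulr1.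
have -> : (\int[lam]_x (cut F (I, L) (x, y))%:E = 0)%E.
  rewrite -[RHS](integral0 lam setT); apply: eq_lam => x _.
  by rewrite cutE (indicE _ (dyadic L)) memNset// mulr0.
by apply: mule_ge0; [rewrite lee_fin|apply: integral_ge0 => x _; rewrite lee_fin].
Qed.

Lemma rect_le F G I J J' (K : R) : mfun F -> mfun G -> (forall z, 0 <= F z) -> (forall z, 0 <= G z) ->
  0 <= K -> {ae lam, forall x,
    (\int[lam]_(y in dyadic J) (F (x, y))%:E <= K%:E * \int[lam]_(y in dyadic J') (G (x, y))%:E)%E} ->
  (\int[leb2]_(z in drect (I, J)) (F z)%:E <= K%:E * \int[leb2]_(z in drect (I, J')) (G z)%:E)%E.
Proof.
move=> mF mG F0 G0 K0 h.
rewrite -(integral_rect_swap I J mF F0) -(integral_rect_swap I J' mG G0) [X in (_ <= _ * X)%E]integral_cut.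
apply: strip_le => //.
- exact: mfun_swap.
- by apply: mfun_cut; exact: mfun_swap.
- by move=> z; exact: F0.
- by move=> z; apply: cut_ge0 => z'; exact: G0.
apply: ae_imp h => x h Ix; apply: le_trans h _; rewrite lam_cut le_eqVlt; apply/orP; left; apply/eqP.
congr (_ * _)%E; apply: eq_lam => y _; rewrite cutE (indicE _ (dyadic I)) mem_set// mulr1.
by [].
Qed.

Lemma avg_fiber_swap w I L : loc_intg2 w ->
  intg (fun x => avg (fun y => w (x, y)) L) I /\
  avg (fun y => avg (fun x => w (x, y)) I) L = avg (fun x => avg (fun y => w (x, y)) L) I.
Proof.
move=> wi; have [ms si] := loc_swap wi.
have [h1 h2] := fiber_avg ms (si (L, I)); have [_ h3] := fiber_avg wi.1 (wi.2 (I, L)).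
split; first exact: h1.
rewrite h3 -(rect_avg_swap I L wi.1); exact: esym h2.
Qed.

Lemma loc_Lp p q A w f : conjugate p q -> Ap2 p q A w -> mfun f -> loc_intg2 (wpow p w f) ->
  loc_intg2 f.
Proof.
move=> pq [[mw iw] w0 [md id] _] mf [mp ip]; split=> // Q; have [p1 _ _] := pq.
have h : leb2.-integrable (drect Q) ((EFin \o wpow p w f) \+ (EFin \o dual2 p w))%E.
  by apply: integrableD => //; [exact: ip|exact: id].
apply: (le_integrable _ _ _ h) => //.
  by apply/measurable_EFinP; exact: measurable_funTS.
move=> z _; rewrite [leRHS](_ : _ = `|wpow p w f z + dual2 p w z|%:E)//= lee_fin.
have d0 : 0 <= dual2 p w z by exact: powR_ge0.
have f0 : 0 <= wpow p w f z by exact: wpow_ge0.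
rewrite [leRHS]ger0_norm ?addr_ge0//; apply: le_trans (young_root pq f0 d0).
rewrite /wpow (root_pow p1 (normr_ge0 _) (ltW (w0 z))) -mulrA.
by have := @dual_root _ p q (fun=> w z) 0 pq (w0 z); rewrite /dual /dual2 => ->; rewrite mulr1.
Qed.

Lemma shift_term_ae0 (f : R -> R) : (forall I, intg f I) -> (forall L, avg f L = 0) ->
  forall P x, shift_term f P x = 0.
Proof.
move=> fi f0 P x; rewrite /shift_term !haar_coefE; try exact: fi.
by rewrite /diff !f0 !subrr !mulr0 !mul0r subrr.
Qed.

(** The constant weight, with which the shift of a one-dimensional indicator is built. *)
Lemma Ap1_one p q : conjugate p q -> Ap1 p q 1 (fun=> 1 : R).
Proof.
move=> pq; have d1 : dual p (fun=> 1 : R) = (fun=> 1) by apply/funext => x; rewrite /dual powR1.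
split; [exact: measurable_cst|by move=> x; exact: ltr01|exact: intg_cst| |].
  by rewrite d1; exact: intg_cst.
by move=> I; rewrite d1 avg_cst !powR1 mulr1.
Qed.

Lemma dyadic_tops I : exists N, (dyadic I : set R) `<=` tops N.
Proof.
have [K cK IK] := @compact_dyadic R I; have [N KN] := compact_tops cK.
by exists N; exact: subset_trans IK KN.
Qed.

Lemma supported_tops N (f : R -> R) I : (dyadic I : set R) `<=` tops N -> (forall x, ~ dyadic I x -> f x = 0) ->
  supported N f.
Proof.
by move=> IN f0 x h; apply: f0 => /IN []; [exact: (h false)|exact: (h true)].
Qed.

Lemma shiftedB (f g f' g' : R -> R) : (forall I, intg f I) -> (forall I, intg g I) ->
  (forall I, intg f' I) -> (forall I, intg g' I) -> shifted f g -> shifted f' g' ->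
  shifted (fun x => f x - f' x) (fun x => g x - g' x).
Proof.
by move=> fi gi fi' gi' h h' e P; rewrite !diffB// h h'; ring.
Qed.

(** By Fubini a difference in [y] of fibre averages is an average in [x] of differences, insensitive
    to a null set of [x]. *)
Lemma shifted_fiber_avg f g I : loc_intg2 f -> loc_intg2 g ->
  {ae lam, forall x, shifted (fun y => f (x, y)) (fun y => g (x, y))} ->
  shifted (fun y => avg (fun x => f (x, y)) I) (fun y => avg (fun x => g (x, y)) I).
Proof.
move=> fi gi h e P.
have D w L : loc_intg2 w -> diff (fun y => avg (fun x => w (x, y)) I) L =
    avg (fun x => diff (fun y => w (x, y)) L) I.
  move=> wi; rewrite /diff.
  have [i1 ->] := avg_fiber_swap I (child true L) wi.
  by have [i2 ->] := avg_fiber_swap I (child false L) wi; rewrite avgB.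
have M w L : loc_intg2 w -> measurable_fun setT (fun x => diff (fun y => w (x, y)) L).
  move=> wi; have [ms _] := loc_swap wi.
  by apply: measurable_funB; exact: (measurable_fiber_avg _ ms).
rewrite !D//.
rewrite (@avg_ae _ (fun x => (if e then -1 else 1) * diff (fun y => f (x, y)) (child (~~ e) P))).
- have [i1 _] := avg_fiber_swap I (child true (child (~~ e) P)) fi.
  have [i2 _] := avg_fiber_swap I (child false (child (~~ e) P)) fi.
  have i : intg (fun x => diff (fun y => f (x, y)) (child (~~ e) P)) I by exact: intgB.
  rewrite (@eq_avg _ _ (fun x => (if e then -1 else 1) * diff (fun y => f (x, y)) (child (~~ e) P)
    + 0 * diff (fun y => f (x, y)) (child (~~ e) P))); last by move=> x _; rewrite mul0r addr0.
  by rewrite avg_lin// mul0r addr0.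
- exact: M.
- by apply: measurable_funM => //; exact: M.
by apply: ae_imp h => x; exact.
Qed.

End PlaneTools.

(** * Identification of the shifts and vanishing for indicators *)

Section LowerBound.
Context {R : realType}.
Implicit Types (I J L P : dyadic_index) (Q : dyadic_index * dyadic_index) (x y : R)
  (n m N : nat) (e : bool).
Local Notation lam := (@lebesgue_measure R).
Implicit Types (w f g F G b mu la u v : R * R -> R).
Hint Resolve measurable_dyadic measurable_dyadicR measurable_drect : core.
Variables (p q A : R).
Hypotheses (pq : conjugate p q) (A1 : 1 <= A).

(** The shift is unique on almost every vertical line; exchanging null sets carries the equality to
    almost every horizontal line, where the other shift acts. *)
Lemma is_shift2_S2 la f u N : Ap2 p q A la -> mfun f -> fin2 p la f -> xsupp N (swap f) ->
  is_shift2 f u -> {ae lam, forall y, {ae lam, forall x, u (x, y) = S2 f (x, y)}}.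
Proof.
move=> laA mf ff fN [mu hu]; have [mS hS] := S2_is_shift pq A1 laA mf ff fN.
have h : {ae lam, forall y, {ae lam, forall x, (fun z => u z - S2 f z) (x, y) = 0}}.
  apply: (@ae_fubini R (fun z => u z - S2 f z)); first exact: measurable_funB.
  apply: ae_imp (ae_and hu hS) => x [h1 h2].
  by apply: ae_imp (is_shift_unique h1 h2) => y ->; rewrite subrr.
apply: ae_imp h => y h; apply: ae_imp h => x /eqP.
by rewrite subr_eq0 => /eqP.
Qed.

Lemma shifted_S2 la f u v N : Ap2 p q A la -> mfun f -> fin2 p la f -> xsupp N (swap f) ->
  is_shift2 f u -> is_shift1 u v ->
  {ae lam, forall y, shifted (fun x => S2 f (x, y)) (fun x => v (x, y))}.
Proof.
move=> laA mf ff fN hu [_ hv]; have mS := mfun_S2 mf; have mu := hu.1.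
apply: ae_imp (ae_and (is_shift2_S2 laA mf ff fN hu) hv) => y [h1 h2] e P.
rewrite (is_shift_diff e P h2); congr (_ * _).
by rewrite /diff; congr (_ - _); apply: avg_ae => //; exact: fiber1.
Qed.

(** The shift in y produces 1_I(x) phi(y), where phi is the shift of 1_J and vanishes on [PJ]. On
    each fibre the shift in x then acts on a multiple of 1_I: it gives 0 on [PI], and everywhere
    when phi(y) = 0. *)
Lemma shift_indic_eq0 eI PI eJ PJ v :
  is_shift12 (\1_(drect (child eI PI, child eJ PJ))) v ->
  {ae lam, forall y, {ae lam, forall x, dyadic PI x \/ dyadic PJ y -> v (x, y) = 0}}.
Proof.
move=> [v2 [h2 h1]]; set I := child eI PI; set J := child eJ PJ.
have [N JN] := @dyadic_tops R J.
have one := @Ap1_one R p q pq; have [p1 q1 _] := pq.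
have mJ : measurable_fun setT (\1_(dyadic J) : R -> R) by apply: measurable_indic; exact: measurable_dyadic.
pose phi : R -> R := Sop (\1_(dyadic J)).
have sJ : is_shift (\1_(dyadic J)) phi.
  apply: (Sop_is_shift pq (lexx 1) one mJ (N := N)).
    move=> L; apply: (@le_integrable _ _ _ lam _ (measurable_dyadicR L) _ (EFin \o (fun=> 1))).
    - by apply/measurable_EFinP; apply: measurable_funTS; exact: measurable_Lp.
    - move=> x _; rewrite /= mulr1 lee_fin normr1 indicE.
      by case: (x \in _); rewrite ?normr1 ?normr0 ?powR1 ?normr1// powR0 ?normr0//; lra.
    - exact: intg_cst.
  by apply: (supported_tops JN) => x nx; rewrite indicE memNset.
have phi0 : {ae lam, forall y, dyadic PJ y -> phi y = 0}.
  apply: (is_shift_eq0 sJ) => P x xP; apply: (@shift_term_indic _ _ 1 eJ PJ) => //.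
  - apply: locally_integrable_intg; by case: sJ.
  - apply: locally_integrable_intg; by case: sJ.
  - by move=> L; rewrite mul1r.
have [[mv2 hv2] [mv hv]] := (h2, h1).
have ml : mfun (fun z => \1_(dyadic I) z.1 * phi z.2).
  apply: measurable_funM.
    by apply: (mfun_fst (h := \1_(dyadic I))); apply: measurable_indic; exact: measurable_dyadic.
  by apply: (mfun_snd (h := phi)); exact: measurable_Sop.
have is0 : is_shift (fun=> 0) (fun=> 0 : R).
  have s0 : forall f : R -> R, f = (fun=> 0) -> is_shift f (Sop f).
    move=> f ->; apply: (Sop_is_shift pq (lexx 1) one (measurable_cst _) (N := 0)) => //.
    have pn0 : p != 0 by rewrite gt_eqF//; lra.
    move=> L; under eq_fun do rewrite normr0 powR0// mul0r.
    exact: intg_cst.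
  have := s0 (fun=> 0) erefl; have -> // : Sop (fun=> 0 : R) = (fun=> 0).
  by apply/funext => x; exact: Sop0.
have v2E : {ae lam, forall y, {ae lam, forall x, v2 (x, y) = phi y * \1_(dyadic I) x}}.
  have h : {ae lam, forall y, {ae lam, forall x, (fun z => v2 z - \1_(dyadic I) z.1 * phi z.2) (x, y) = 0}}.
    apply: (@ae_fubini R (fun z => v2 z - \1_(dyadic I) z.1 * phi z.2)); first exact: measurable_funB.
    apply: ae_imp hv2 => x h; have [Ix|nI] := pselect (dyadic I x).
      have E : (fun y => \1_(drect (I, J)) (x, y)) = \1_(dyadic J) :> (R -> R).
        apply/funext => y; have := cutE (fun=> 1) I J x y.
        by rewrite /cut !mul1r (indicE _ (dyadic I)) (mem_set Ix) mul1r.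
      rewrite E in h; apply: ae_imp (is_shift_unique h sJ) => y ->.
      by rewrite (indicE _ (dyadic I)) (mem_set Ix) mul1r subrr.
    have E : (fun y => \1_(drect (I, J)) (x, y)) = (fun=> 0) :> (R -> R).
      apply/funext => y; have := cutE (fun=> 1) I J x y.
      by rewrite /cut !mul1r (indicE _ (dyadic I)) (memNset nI) mul0r.
    rewrite E in h; apply: ae_imp (is_shift_unique h is0) => y ->.
    by rewrite (indicE _ (dyadic I)) (memNset nI) mul0r subrr.
  apply: ae_imp h => y h; apply: ae_imp h => x /eqP.
  by rewrite subr_eq0 mulrC => /eqP.
apply: ae_imp (ae_and v2E (ae_and hv phi0)) => y [hE [hs h0]].
have mi : measurable_fun setT (fun x => phi y * \1_(dyadic I) x).
  by apply: measurable_funM => //; apply: measurable_indic; exact: measurable_dyadic.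
have i1 L : intg (\1_(dyadic I) : R -> R) L.
  apply: (@le_integrable _ _ _ lam _ (measurable_dyadicR L) _ (EFin \o (fun=> 1))).
  - apply/measurable_EFinP; apply: measurable_funTS; apply: measurable_indic; exact: measurable_dyadic.
  - by move=> x _; rewrite /= lee_fin normr1 indicE; case: (x \in _); rewrite ?normr1 ?normr0.
  - exact: intg_cst.
have avE L : avg (fun x => v2 (x, y)) L = phi y * avg (\1_(dyadic I)) L.
  rewrite (avg_ae _ (fiber1 y mv2) mi hE).
  rewrite (@eq_avg _ _ (fun x => phi y * \1_(dyadic I) x + 0 * \1_(dyadic I) x)).
    by rewrite avg_lin// mul0r addr0.
  by move=> x _; rewrite mul0r addr0.
have vi L : intg (fun x => v2 (x, y)) L by apply: locally_integrable_intg; case: hs.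
have z1 : {ae lam, forall x, dyadic PI x -> v (x, y) = 0}.
  by apply: (is_shift_eq0 hs) => P x; exact: (shift_term_indic (vi _) (vi _) avE).
have [yJ|nJ] := pselect (dyadic PJ y); last first.
  by apply: ae_imp z1 => x h []//.
have z2 : {ae lam, forall x, v (x, y) = 0}.
  apply: ae_tops => n e; apply: (is_shift_eq0 hs) => P x _; apply: shift_term_ae0 => // L.
  by rewrite avE (h0 yJ) mul0r.
by apply: ae_imp z2 => x h _.
Qed.

End LowerBound.

(** * Recovering the oscillation on a rectangle *)

Section LowerBound.
Context {R : realType}.
Implicit Types (I J L P : dyadic_index) (Q : dyadic_index * dyadic_index) (x y : R)
  (n m N : nat) (e : bool).
Local Notation lam := (@lebesgue_measure R).
Implicit Types (w f g F G b mu la u v : R * R -> R).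
Hint Resolve measurable_dyadic measurable_dyadicR measurable_drect : core.
Variables (p q A : R).
Hypotheses (pq : conjugate p q) (A1 : 1 <= A).

(** Splitting the p-th power of a sum twice costs 2^p each time, hence 4^p. *)
Lemma rect_add3 la f1 f2 f3 f Q (K1 K2 K3 : R) (X : \bar R) : mfun la -> (forall z, 0 < la z) ->
  mfun f1 -> mfun f2 -> mfun f3 -> mfun f -> (forall z, f z = f1 z + (f2 z + f3 z)) ->
  0 <= K1 -> 0 <= K2 -> 0 <= K3 -> (0 <= X)%E ->
  (\int[leb2]_(z in drect Q) (wpow p la f1 z)%:E <= K1%:E * X)%E ->
  (\int[leb2]_(z in drect Q) (wpow p la f2 z)%:E <= K2%:E * X)%E ->
  (\int[leb2]_(z in drect Q) (wpow p la f3 z)%:E <= K3%:E * X)%E ->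
  (\int[leb2]_(z in drect Q) (wpow p la f z)%:E <=
     (4 `^ p * (K1 + (K2 + K3)))%:E * X)%E.
Proof.
move=> ml l0 m1 m2 m3 m fE K10 K20 K30 X0 h1 h2 h3; have [p1 _ _] := pq; have p0 : 0 < p by lra.
have mm F : mfun F -> measurable_fun (drect Q) (fun z => (wpow p la F z)%:E).
  by move=> mF; apply/measurable_EFinP; apply: measurable_funTS; exact: mfun_wpow.
have ge F z : (0 <= (wpow p la F z)%:E)%E by rewrite lee_fin wpow_ge0.
apply: (@le_trans _ _ ((4 `^ p)%:E * (\int[leb2]_(z in drect Q) (wpow p la f1 z)%:E +
   (\int[leb2]_(z in drect Q) (wpow p la f2 z)%:E + \int[leb2]_(z in drect Q) (wpow p la f3 z)%:E)))%E).
  have m23 : measurable_fun (drect Q) (fun z => ((wpow p la f2 z)%:E + (wpow p la f3 z)%:E)%E).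
    by apply: emeasurable_funD; exact: mm.
  have m123 : measurable_fun (drect Q) (fun z => ((wpow p la f1 z)%:E + ((wpow p la f2 z)%:E + (wpow p la f3 z)%:E))%E).
    by apply: emeasurable_funD => //; exact: mm.
  rewrite -(ge0_integralD leb2 (measurable_drect Q) (fun z _ => ge f2 z) (mm _ m2) (fun z _ => ge f3 z) (mm _ m3)).
  rewrite -(ge0_integralD leb2 (measurable_drect Q) (fun z _ => ge f1 z) (mm _ m1) (fun z _ => adde_ge0 (ge f2 z) (ge f3 z)) m23).
  rewrite -(ge0_integralZl leb2 (measurable_drect Q) m123); last 2 first.
  - by move=> z _; rewrite !adde_ge0.
  - by rewrite lee_fin powR_ge0.
  apply: ge0_le_integral => //; first exact: mm.
    by apply: measurable_funeM.
  move=> z _; rewrite -!EFinD -EFinM lee_fin /wpow -!mulrDl mulrA ler_pM2r//.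
  rewrite (_ : 4 `^ p = 2 `^ p * 2 `^ p); last by rewrite -powRM//; congr (_ `^ _); lra.
  have t1 : `|f z| `^ p <= 2 `^ p * (`|f1 z| `^ p + `|f2 z + f3 z| `^ p).
    by apply: powR_sum_le => //; rewrite fE; exact: ler_normD.
  have t2 : `|f2 z + f3 z| `^ p <= 2 `^ p * (`|f2 z| `^ p + `|f3 z| `^ p).
    by apply: powR_sum_le => //; exact: ler_normD.
  have two1 : 1 <= 2 `^ p :> R by have e : 1 `^ p = 1 :> R by [rewrite powR1]; rewrite -{1}e; apply: powR_mono => //; lra.
  have a1 := powR_ge0 `|f1 z| p.
  apply: le_trans t1 _; rewrite -mulrA; apply: ler_wpM2l; first exact: powR_ge0.
  rewrite mulrDr; apply: lerD => //; rewrite ler_peMl//.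
rewrite EFinM -muleA; apply: lee_wpmul2l; first by rewrite lee_fin powR_ge0.
rewrite !EFinD !ge0_muleDl ?lee_fin ?addr_ge0//.
by apply: leeD => //; exact: leeD.
Qed.

(** With M(y) and m(y) the averages over I of b and w, the oscillation of b is the sum of b - M
    minus its average over J, of that average, and of M minus its average over J. Arguments in y
    reduce these to w - m and m; arguments in x reduce the latter to u. The average m is recovered
    from the sibling of [child eI' PPI], where [u] is controlled only for y in [child eJ' PPJ]:
    hence the alternative in the last hypothesis. *)
Lemma lower_stage : exists2 C, 0 < C & forall la b w u g eI eI' PPI eJ eJ' PPJ,
  Ap2 p q A la -> loc_intg2 b -> loc_intg2 w -> mfun u -> mfun g ->
  {ae lam, forall x, shifted (fun y => b (x, y)) (fun y => w (x, y))} ->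
  {ae lam, forall y, shifted (fun x => w (x, y)) (fun x => u (x, y))} ->
  (forall x y, ~ dyadic (child eI (child eI' PPI)) x -> w (x, y) = 0) ->
  (forall x y, ~ dyadic (child eJ (child eJ' PPJ)) y -> b (x, y) = 0) ->
  {ae lam, forall y, forall L, L = child eI' PPI \/ dyadic (child eJ' PPJ) y ->
    (\int[lam]_(x in dyadic L) (wpow p la u (x, y))%:E <= \int[lam]_x (wpow p la g (x, y))%:E)%E} ->
  (\int[leb2]_(z in drect (child eI (child eI' PPI), child eJ (child eJ' PPJ)))
     (wpow p la (fun z => b z - rect_avg b (child eI (child eI' PPI), child eJ (child eJ' PPJ))) z)%:E
   <= C%:E * \int[leb2]_z (wpow p la g z)%:E)%E.
Proof.
have [C5 C50 H5] := shift_inversion pq A1; have [C6 C60 H6] := shift_average pq A1.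
(* One constant per piece: inversion in y then in x; average in y then inversion in x; inversion in
   y then average in x. *)
pose K1 := C5 * C5; pose K2 := C6 * C5; pose K3 := C5 * C6.
exists (4 `^ p * (K1 + (K2 + K3))).
  by rewrite mulr_gt0 ?powR_gt0// !addr_gt0// mulr_gt0.
move=> la b w u g eI eI' PPI eJ eJ' PPJ laA bi wi mU mg hbw hwu w0 b0 hg.
set PI := child eI' PPI; set PJ := child eJ' PPJ; set I := child eI PI; set J := child eJ PJ.
have [[ml il] l0 _ _] := laA; have mb := bi.1; have mw := wi.1.
have laAs := Ap2_swap laA.
have hx := fiber_Ap laAs; have hy := fiber_Ap laA.
have bx := fiber_loc (loc_swap bi); have wx := fiber_loc (loc_swap wi); have wy := fiber_loc wi.
have by' := fiber_loc bi.
have [M ME] : exists M : R -> R, forall y, M y = avg (fun x => b (x, y)) I by exists (fun y => avg (fun x => b (x, y)) I).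
have [m mE] : exists m : R -> R, forall y, m y = avg (fun x => w (x, y)) I by exists (fun y => avg (fun x => w (x, y)) I).
have Mfun : M = (fun y => avg (fun x => b (x, y)) I) by apply/funext.
have mfun' : m = (fun y => avg (fun x => w (x, y)) I) by apply/funext.
have mM : measurable_fun setT M by rewrite Mfun; exact: measurable_fiber_avg.
have mm : measurable_fun setT m by rewrite mfun'; exact: measurable_fiber_avg.
have Mm : shifted M m by rewrite Mfun mfun'; exact: shifted_fiber_avg.
have Mi L : intg M L by rewrite Mfun; exact: (fiber_avg mb (bi.2 (I, L))).1.
have mi L : intg m L by rewrite mfun'; exact: (fiber_avg mw (wi.2 (I, L))).1.
have avM : avg M J = rect_avg b (I, J) by rewrite Mfun; exact: (fiber_avg mb (bi.2 (I, J))).2.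
clear Mfun mfun'.
have mM2 : mfun (fun z => M z.2) := mfun_snd mM.
have mm2 : mfun (fun z => m z.2) := mfun_snd mm.
have mk : mfun (fun z => b z - M z.2) := measurable_funB mb mM2.
have mk2 : mfun (fun z => w z - m z.2) := measurable_funB mw mm2.
have pk2 := mfun_wpow p ml mk2; have pg := mfun_wpow p ml mg.
have ge F z : 0 <= wpow p la F z := wpow_ge0 p F z l0.
have E1 L : (\int[leb2]_(z in drect (I, L)) (wpow p la (fun z => w z - m z.2) z)%:E <=
    C5%:E * \int[leb2]_z (wpow p la g z)%:E)%E.
  apply: (strip_le pk2 pg (ge _) (ge _) (ltW C50)).
  apply: ae_imp (ae_and (ae_and hy wy) (ae_and hwu hg)) => y [[h1 h2] [h3 h4]] _.
  have := H5 _ _ _ _ eI h1 (h2 PI) (fiber1 y mw) (fiber1 y mU) h3.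
  have -> : avg (fun x => w (x, y)) (child eI PI) = m y by rewrite mE.
  move=> /le_trans; apply; apply: lee_wpmul2l; first by rewrite lee_fin ltW.
  by apply: h4; left.
have hk : {ae lam, forall x, (forall L, intg (fun y => b (x, y) - M y) L) /\
    shifted (fun y => b (x, y) - M y) (fun y => w (x, y) - m y)}.
  apply: ae_imp (ae_and hbw (ae_and bx wx)) => x [h1 [h2 h3]]; split.
    by move=> L; apply: intgB => //; exact: h2.
  by apply: shiftedB.
have mav : mfun (fun z => avg (fun y => b (z.1, y) - M y) J).
  apply: (mfun_fst (h := fun x => avg (fun y => b (x, y) - M y) J)).
  exact: (@measurable_fiber_avg R (swap (fun z => b z - M z.2)) J (mfun_swap mk)).
have T1 : (\int[leb2]_(z in drect (I, J)) (wpow p la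
    (fun z => (b z - M z.2) - avg (fun y => b (z.1, y) - M y) J) z)%:E <=
    K1%:E * \int[leb2]_z (wpow p la g z)%:E)%E.
  have pf := mfun_wpow p ml (measurable_funB mk mav).
  have := @rect_le R _ _ I J PJ C5 pf pk2 (ge _) (ge _) (ltW C50).
  rewrite EFinM -muleA => H; apply: le_trans (H _) _; last first.
    by apply: lee_wpmul2l; [rewrite lee_fin ltW|exact: E1].
  apply: ae_imp (ae_and hx hk) => x [h1 [h2 h3]].
  exact: (H5 _ _ _ _ eJ h1 (h2 PJ) (fiber2 x mk) (fiber2 x mk2) h3).
have T2 : (\int[leb2]_(z in drect (I, J)) (wpow p la (fun z => avg (fun y => b (z.1, y) - M y) J) z)%:E <=
    K2%:E * \int[leb2]_z (wpow p la g z)%:E)%E.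
  have pf := mfun_wpow p ml mav.
  have := @rect_le R _ _ I J (child (~~ eJ') PPJ) C6 pf pk2 (ge _) (ge _) (ltW C60).
  rewrite EFinM -muleA => H; apply: le_trans (H _) _; last first.
    by apply: lee_wpmul2l; [rewrite lee_fin ltW|exact: E1].
  apply: ae_imp (ae_and hx hk) => x [h1 [h2 h3]].
  have z0 y : dyadic (child (~~ eJ) (child eJ' PPJ)) y -> b (x, y) - M y = 0.
    move=> yJ; have nJ : ~ dyadic J y.
      by move=> /child_disjoint; exact.
    rewrite b0// ME (@eq_avg _ _ (fun=> 0)) ?avg_cst ?subrr// => x' _.
    exact: b0.
  have := H6 _ _ _ PPJ eJ eJ' h1 (fiber2 x mk2) (h2 _) h3 z0.
  have mlx : measurable_fun (dyadic J) (fun y => (la (x, y))%:E).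
    by apply/measurable_EFinP; apply: measurable_funTS; exact: (fiber2 x ml).
  have l0x y : dyadic J y -> (0 <= (la (x, y))%:E)%E by move=> _; rewrite lee_fin ltW.
  rewrite -(ge0_lamZl (powR_ge0 _ _) mlx l0x).
  by apply: le_trans; rewrite le_eqVlt; apply/orP; left; apply/eqP; apply: eq_lam.
have E3 : (\int[leb2]_(z in drect (I, PJ)) (wpow p la (fun z => m z.2) z)%:E <=
    C6%:E * \int[leb2]_z (wpow p la g z)%:E)%E.
  apply: (strip_le (mfun_wpow p ml mm2) pg (ge _) (ge _) (ltW C60)).
  apply: ae_imp (ae_and (ae_and hy wy) (ae_and hwu hg)) => y [[h1 h2] [h3 h4]] yP.
  have z0 x : dyadic (child (~~ eI) (child eI' PPI)) x -> w (x, y) = 0.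
    by move=> xI; apply: w0 => /child_disjoint; exact.
  apply: le_trans (lee_wpmul2l (ltW C60 : (0 <= C6%:E)%E) (h4 (child (~~ eI') PPI) (or_intror yP))).
  have := H6 _ _ _ PPI eI eI' h1 (fiber1 y mU) (h2 _) h3 z0.
  have mly : measurable_fun (dyadic I) (fun x => (la (x, y))%:E).
    by apply/measurable_EFinP; apply: measurable_funTS; exact: (fiber1 y ml).
  have l0y x : dyadic I x -> (0 <= (la (x, y))%:E)%E by move=> _; rewrite lee_fin ltW.
  rewrite -(ge0_lamZl (powR_ge0 _ _) mly l0y).
  apply: le_trans; rewrite le_eqVlt; apply/orP; left; apply/eqP; apply: eq_lam => x _.
  by rewrite /wpow /= mE.
have T3 : (\int[leb2]_(z in drect (I, J)) (wpow p la (fun z => M z.2 - avg M J) z)%:E <=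
    K3%:E * \int[leb2]_z (wpow p la g z)%:E)%E.
  have mc : mfun (fun z => M z.2 - avg M J) by exact: measurable_funB.
  have := @rect_le R _ _ I J PJ C5 (mfun_wpow p ml mc) (mfun_wpow p ml mm2) (ge _) (ge _) (ltW C50).
  rewrite EFinM -muleA => H; apply: le_trans (H _) _; last first.
    by apply: lee_wpmul2l; [rewrite lee_fin ltW|exact: E3].
  apply: ae_imp hx => x h1.
  exact: (H5 _ _ _ _ eJ h1 (Mi PJ) mM mm Mm).
have mT1 : mfun (fun z => (b z - M z.2) - avg (fun y => b (z.1, y) - M y) J) := measurable_funB mk mav.
have mT3 : mfun (fun z => M z.2 - avg M J) by exact: measurable_funB.
have mT : mfun (fun z => b z - rect_avg b (I, J)) by exact: measurable_funB.
have X0 : (0 <= \int[leb2]_z (wpow p la g z)%:E)%E by apply: integral_ge0 => z _; rewrite lee_fin.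
apply: (rect_add3 ml l0 mT1 mav mT3 mT _ _ _ _ X0 T1 T2 T3); try by rewrite mulr_ge0// ltW.
by move=> z; rewrite avM addrA subrK addrA subrK.
Qed.

End LowerBound.

(** * The lower bound on one rectangle *)

Section LowerCore.
Context {R : realType}.
Implicit Types (I J L P : dyadic_index) (Q : dyadic_index * dyadic_index) (x y : R)
  (n m N : nat) (e : bool).
Local Notation lam := (@lebesgue_measure R).
Implicit Types (w f g F G b mu la u v : R * R -> R).
Hint Resolve measurable_dyadic measurable_dyadicR measurable_drect : core.
Variables (p q A : R).
Hypotheses (pq : conjugate p q) (A1 : 1 <= A).

Lemma rect_avg_cut b Q : rect_avg (cut b Q) Q = rect_avg b Q.
Proof.
rewrite /rect_avg /Rintegral; congr (_ * fine _); apply: eq_integral => z Qz.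
by rewrite /cut indicE Qz mulr1.
Qed.

Lemma mfun_commutator b f g : mfun b -> is_commutator b f g -> mfun g.
Proof.
move=> mb [u [v [[u2 [_ [mu _]]] [v2 [_ [mv _]]] gE]]].
have -> : g = (fun z => u z - b z * v z) by apply/funext.
by apply: measurable_funB => //; exact: measurable_funM.
Qed.

(** [b] is cut to the rectangle and two generations of ancestors are introduced in each variable:
    parents, where v vanishes so that g = u, and grandparents, whose other halves serve to recover
    averages. *)
Lemma lower_core : exists2 C, 0 < C & forall la b Q g,
  Ap2 p q A la -> loc_intg2 b -> loc_intg2 (wpow p la b) -> is_commutator b (\1_(drect Q)) g ->
  (\int[leb2]_(z in drect Q) (wpow p la (fun z => b z - rect_avg b Q) z)%:E <=
   C%:E * \int[leb2]_z (wpow p la g z)%:E)%E.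
Proof.
have [C C0 HC] := lower_stage pq A1; exists C; first exact: C0.
move=> la b [I0 J0] g laA bi bp comm; have mb := bi.1.
have mg := mfun_commutator mb comm.
have [eI [PI EI]] := parent I0; have [eI' [PPI EI']] := parent PI.
have [eJ [PJ EJ]] := parent J0; have [eJ' [PPJ EJ']] := parent PJ.
subst I0 PI J0 PJ.
set I := child eI (child eI' PPI); set J := child eJ (child eJ' PPJ).
move: comm => [u [v [hu hv gE]]].
have [D D0 HD] := S2_bound pq A1.
have [[ml il] l0 _ _] := laA; have [p1 _ _] := pq.
have mB : mfun (cut b (I, J)) by exact: mfun_cut.
have fB : fin2 p la (cut b (I, J)).
  rewrite /fin2.
  have -> : (\int[leb2]_z (wpow p la (cut b (I, J)) z)%:E =
     \int[leb2]_(z in drect (I, J)) (wpow p la b z)%:E)%E.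
    rewrite integral_cut; apply: eq_integral => z _; rewrite /wpow /cut indicE.
    case: (_ \in _); rewrite ?mulr1// !mulr0 normr0 powR0 ?mul0r//; rewrite gt_eqF//; lra.
  have /integrableP[_] := bp.2 (I, J); apply: le_lt_trans.
  rewrite le_eqVlt; apply/orP; left; apply/eqP; apply: eq_integral => z _.
  by rewrite /= ger0_norm// wpow_ge0.
have [N JN] := @dyadic_tops R J.
have Bz x y : ~ dyadic I x \/ ~ dyadic J y -> cut b (I, J) (x, y) = 0.
  by rewrite cutE; case=> h; rewrite !indicE (memNset h) ?(mulr0, mul0r).
have By : xsupp N (swap (cut b (I, J))).
  by move=> x; apply: (supported_tops JN) => y nJ; apply: Bz; right.
have [u2 [hu2 hu1]] := hu.
have mU : mfun u := hu1.1.
have sy := shifted_S2 pq A1 laA mB fB By hu2 hu1.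
have sx : {ae lam, forall x, shifted (fun y => cut b (I, J) (x, y)) (fun y => S2 (cut b (I, J)) (x, y))}.
  have [_ h] := S2_is_shift pq A1 laA mB fB By.
  by apply: ae_imp h => x h e P; exact: is_shift_diff.
have mw := mfun_S2 mB.
have fw : fin2 p la (S2 (cut b (I, J))).
  by apply: le_lt_trans (HD _ _ N laA mB fB By) _; rewrite lte_mul_pinfty ?lee_fin// ltW.
have wi := loc_Lp pq laA mw (loc_wpow ml l0 mw fw).
have Bi := loc_Lp pq laA mB (loc_wpow ml l0 mB fB).
have w0 x y : ~ dyadic I x -> S2 (cut b (I, J)) (x, y) = 0.
  move=> nI; rewrite /S2 /=.
  have -> : (fun y => cut b (I, J) (x, y)) = (fun=> 0) by apply/funext => y'; apply: Bz; left.
  exact: Sop0.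
have vz := shift_indic_eq0 pq hv.
have hg : {ae lam, forall y, forall L, L = child eI' PPI \/ dyadic (child eJ' PPJ) y ->
    (\int[lam]_(x in dyadic L) (wpow p la u (x, y))%:E <= \int[lam]_x (wpow p la g (x, y))%:E)%E}.
  have mwu := mfun_wpow p ml mU; have mwg := mfun_wpow p ml mg.
  apply: ae_imp vz => y h L hL.
  apply: (@le_trans _ _ (\int[lam]_(x in dyadic L) (wpow p la g (x, y))%:E)%E); last first.
    apply: ge0_subset_integral => //.
    - by apply/measurable_EFinP; exact: (fiber1 y mwg).
    - by move=> x _; rewrite lee_fin wpow_ge0.
  rewrite le_eqVlt; apply/orP; left; apply/eqP; apply: eq_lam_ae => //.
  - by apply/measurable_EFinP; apply: measurable_funTS; exact: (fiber1 y mwu).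
  - by apply/measurable_EFinP; apply: measurable_funTS; exact: (fiber1 y mwg).
  apply: ae_imp h => x h xL; have v0 : v (x, y) = 0.
    by apply: h; case: hL => [LE|]; [left; rewrite -LE|right].
  by rewrite /wpow gE v0 mulr0 subr0.
have := HC la _ _ u g eI eI' PPI eJ eJ' PPJ laA Bi wi mU mg sx sy w0
   (fun x y nJ => Bz x y (or_intror nJ)) hg.
apply: le_trans; rewrite le_eqVlt; apply/orP; left; apply/eqP.
apply: eq_integral => z Qz; rewrite /wpow rect_avg_cut.
by rewrite /cut indicE Qz mulr1.
Qed.

End LowerCore.

(** * Roots of integrals and normalisation of weights *)

Section Normalisation.
Context {R : realType}.
Implicit Types (Q : dyadic_index * dyadic_index) (p q A : R) (X Y : \bar R).
Local Notation lam := (@lebesgue_measure R).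
Local Notation borelR2 := (measurableTypeR R * measurableTypeR R)%type.
Implicit Types (w f g F G b mu la : R * R -> R).
Hint Resolve measurable_dyadic measurable_dyadicR measurable_drect : core.

Lemma root_le p X Y (K : R) : 1 < p -> (0 <= X)%E -> (0 <= Y)%E -> 0 <= K ->
  (X <= (K `^ p)%:E * Y)%E -> (X `^ p^-1 <= K%:E * Y `^ p^-1)%E.
Proof.
move=> p1 X0 Y0 K0 h; have p0 : 0 < p by lra.
have pi0 : 0 <= p^-1 by rewrite invr_ge0 ltW.
have KY : (0 <= (K `^ p)%:E * Y)%E by rewrite mule_ge0 ?lee_fin ?powR_ge0.
have -> : (K%:E * Y `^ p^-1 = ((K `^ p)%:E * Y) `^ p^-1)%E.
  rewrite poweRM ?lee_fin ?powR_ge0// poweR_EFin -powRrM mulfV ?powRr1//.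
  by rewrite gt_eqF.
by apply: gt0_ler_poweR => //; rewrite in_itv /= ?X0 ?KY ?leey.
Qed.

Lemma pow_le p X Y (K : R) : 1 < p -> (0 <= X)%E -> (0 <= Y)%E -> 0 <= K ->
  (X `^ p^-1 <= K%:E * Y `^ p^-1)%E -> (X <= (K `^ p)%:E * Y)%E.
Proof.
move=> p1 X0 Y0 K0 h; have p0 : 0 < p by lra.
have pK Z : (0 <= Z)%E -> ((Z `^ p^-1) `^ p = Z)%E.
  by move=> Z0; rewrite -poweRrM mulVf ?poweRe1// gt_eqF.
rewrite -(pK X X0) -(pK Y Y0) -poweR_EFin -poweRM ?lee_fin ?poweR_ge0//.
by apply: gt0_ler_poweR; rewrite ?(ltW p0)// in_itv /= leey andbT ?mule_ge0 ?lee_fin ?poweR_ge0.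
Qed.

Lemma eq_leb2_ae (D : set borelR2) (f g : R * R -> \bar R) : measurable D ->
  measurable_fun D f -> measurable_fun D g -> {ae leb2, forall z, D z -> f z = g z} ->
  (\int[leb2]_(z in D) f z = \int[leb2]_(z in D) g z)%E.
Proof. by move=> mD mf mg fg; apply: ae_eq_integral. Qed.

Lemma drect_compact Q : exists2 K : set (R * R), compact K & drect Q `<=` K.
Proof.
have [K1 c1 h1] := @compact_dyadic R Q.1; have [K2 c2 h2] := @compact_dyadic R Q.2.
by exists (K1 `*` K2); [exact: compact_setX|move=> z [/h1 ? /h2 ?]].
Qed.

Lemma drect_compact_measurable Q : exists K : set borelR2, [/\ compact (K : set (R * R)),
  measurable K & drect Q `<=` K].
Proof.
have [K1 c1 h1] := @compact_dyadic R Q.1; have [K2 c2 h2] := @compact_dyadic R Q.2.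
exists (K1 `*` K2); split; [exact: compact_setX| |move=> z [/h1 ? /h2 ?]//].
by apply: measurableX; exact: compact_measurable.
Qed.

Lemma loc_integrable2_intg f : loc_integrable2 f -> loc_intg2 f.
Proof.
move=> [mf h]; split=> // Q; have [K [cK mK QK]] := drect_compact_measurable Q.
have mn : measurable_fun [set: borelR2] (fun z => `|f z|%:E).
  by apply/measurable_EFinP; exact: measurableT_comp.
apply/integrableP; split; first by apply/measurable_EFinP; apply: measurable_funTS.
apply: le_lt_trans (h K cK); apply: ge0_subset_integral => //.
by apply: measurable_funTS.
Qed.

Lemma rect_integral w Q : intg2 w Q -> (\int[leb2]_(z in drect Q) (w z)%:E = (darea Q * rect_avg w Q)%:E)%E.
Proof.
move=> wi; have a0 := @darea_gt0 R Q.
rewrite /rect_avg mulrA divff ?gt_eqF// mul1r /Rintegral fineK//.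
exact: integrable_fin_num.
Qed.

Lemma rect_avg_gt0 w Q : intg2 w Q -> (forall z, 0 < w z) -> 0 < rect_avg w Q.
Proof.
move=> wi w0; have a0 := @darea_gt0 R Q.
have i0 : (0 <= \int[leb2]_(z in drect Q) (w z)%:E)%E by apply: integral_ge0 => z _; rewrite lee_fin ltW.
have r0 : 0 <= rect_avg w Q by apply: mulr_ge0; [rewrite invr_ge0 ltW|exact: fine_ge0 i0].
rewrite lt_neqAle r0 andbT; apply/eqP => e.
have I0 := rect_integral wi; rewrite -e mulr0 in I0.
have mw : measurable_fun (drect Q) (EFin \o w) by exact: measurable_int wi.
have := @integral_eq0_ae _ _ _ leb2 _ _ (measurable_drect Q) mw.
move=> /(_ (fun z _ => ltW (w0 z))); rewrite /comp I0 => /(_ (lexx _)).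
move=> h; have : (\int[leb2]_(z in drect Q) (1 : R)%:E = \int[leb2]_(z in drect Q) 0)%E.
  apply: eq_leb2_ae => //; apply: ae_imp h => z h /h /eqP.
  by rewrite eqe gt_eqF.
rewrite integral0 integral_cst// mul1e leb2_drect => /eqP.
by rewrite eqe gt_eqF.
Qed.

(** The weight is set to 1 on the null set where it is not positive, which changes no integral. The
    dual weight is locally integrable because otherwise the characteristic would be infinite. The
    constant is the p-th root of the characteristic, raised to at least 1. *)
Lemma normalise p q w : conjugate p q -> dyadic_Ap p w -> exists w' A,
  [/\ 1 <= A, Ap2 p q A w', mfun w & {ae leb2, forall z, w z = w' z}].
Proof.
move=> pq [[lw w0] cA]; have [p1 q1 pq1] := pq; have [mw iw] := loc_integrable2_intg lw.
have p0 : 0 < p by lra.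
pose w' z := if 0 < w z then w z else 1.
have mw' : mfun w'.
  by apply: measurable_fun_ifT => //; apply: measurable_fun_ltr.
have w'0 z : 0 < w' z by rewrite /w'; case: ifP.
have ww' : {ae leb2, forall z, w z = w' z} by apply: ae_imp w0 => z; rewrite /w' => ->.
have eqi (h : R -> R) Q : measurable_fun setT h ->
    (\int[leb2]_(z in drect Q) (h (w z))%:E = \int[leb2]_(z in drect Q) (h (w' z))%:E)%E.
  move=> mh; have mhc F : mfun F -> measurable_fun (drect Q) (fun z => (h (F z))%:E).
    by move=> mF; apply/measurable_EFinP; apply: measurable_funTS; apply: (measurableT_comp mh mF).
  by apply: eq_leb2_ae; [exact: measurable_drect|exact: mhc|exact: mhc|apply: ae_imp ww' => z ->].
have intgP F Q : mfun F -> (forall z, 0 <= F z) ->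
    (\int[leb2]_(z in drect Q) (F z)%:E < +oo)%E -> intg2 F Q.
  move=> mF F0 h; apply/integrableP; split.
    by apply/measurable_EFinP; exact: measurable_funTS.
  apply: le_lt_trans h; rewrite le_eqVlt; apply/orP; left; apply/eqP.
  by apply: eq_integral => z _; rewrite /= ger0_norm.
have iw' Q : intg2 w' Q.
  apply: intgP => // [z|]; first exact: ltW.
  rewrite -(eqi id)//; have /integrableP[_] := iw Q; apply: le_lt_trans.
  have E1 := eqi id Q (@measurable_id _ _ _); have E2 := eqi (fun r => `|r|) Q (@normr_measurable R setT).
  have E3 : (\int[leb2]_(z in drect Q) `|w' z|%:E = \int[leb2]_(z in drect Q) (w' z)%:E)%E.
    by apply: eq_integral => z _; rewrite ger0_norm// ltW.
  by rewrite /= in E1 E2 *; rewrite E1 E2 E3.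
have md : mfun (dual2 p w') by apply: (measurableT_comp (measurable_powR _)).
have d0 z : 0 < dual2 p w' z by rewrite powR_gt0.
pose S := fine (Ap_char p w).
have bound Q : (((darea Q)^-1%:E * \int[leb2]_(z in drect Q) (w' z)%:E) *
    ((darea Q)^-1%:E * \int[leb2]_(z in drect Q) (dual2 p w' z)%:E) `^ (p - 1) <= Ap_char p w)%E.
  rewrite -(eqi id)// -(eqi (fun r => r `^ (- (p - 1)^-1)))//.
  by apply: ereal_sup_ubound; exists Q.
have a0 Q : 0 < (darea Q)^-1 :> R by rewrite invr_gt0 darea_gt0.
have id' Q : intg2 (dual2 p w') Q.
  apply: intgP => // [z|]; first exact: ltW.
  rewrite ltNge leye_eq; apply/negP => /eqP h.
  have := le_lt_trans (bound Q) cA; rewrite h rect_integral// mulry gtr0_sg// mul1e poweRyr; last by rewrite gt_eqF//; lra.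
  rewrite -EFinM mulry gtr0_sg ?mul1e ?ltxx//.
  by rewrite mulr_gt0// mulr_gt0 ?darea_gt0// rect_avg_gt0.
have S0 : (0 <= Ap_char p w)%E.
  apply: le_trans (bound ((0, 0), (0, 0))); apply: mule_ge0; last exact: poweR_ge0.
  by apply: mule_ge0; [rewrite lee_fin ltW|apply: integral_ge0 => z _; rewrite lee_fin ltW].
have SE : Ap_char p w = S%:E by rewrite fineK// ge0_fin_numE.
have hS Q : rect_avg w' Q * rect_avg (dual2 p w') Q `^ (p - 1) <= S.
  have e r : (darea Q)^-1 * (darea Q * r) = r :> R by rewrite mulrA mulVf ?mul1r// gt_eqF// darea_gt0.
  have := bound Q; rewrite SE (rect_integral (iw' Q)) (rect_integral (id' Q)).
  by rewrite -[X in (X * _ * _)%E]/(_%:E) -!EFinM lee_fin !e.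
exists w', (Num.max 1 (S `^ p^-1)); split=> //; first by rewrite le_max lexx.
split=> // Q; rewrite le_max; apply/orP; right.
have r1 := rect_avg_gt0 (iw' Q) w'0; have r2 := rect_avg_gt0 (id' Q) d0.
have -> : q^-1 = (p - 1) * p^-1.
  have q0 : q != 0 by rewrite gt_eqF//; lra.
  have pn0 : p != 0 by rewrite gt_eqF.
  by apply: (mulfI q0); rewrite divff// mulrA; apply: (mulIf pn0); rewrite -mulrA mulVf// mul1r mulr1; lra.
rewrite powRrM -(powRM _ (ltW r1) (powR_ge0 _ _)); apply: powR_mono; [by rewrite invr_gt0| |exact: hS].
by apply: mulr_ge0; [exact: ltW r1|exact: powR_ge0].
Qed.

End Normalisation.

(** * Passage between norms and integral inequalities *)

Section Assembly.
Context {R : realType}.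
Implicit Types (Q : dyadic_index * dyadic_index) (X Y : \bar R).
Local Notation lam := (@lebesgue_measure R).
Local Notation borelR2 := (measurableTypeR R * measurableTypeR R)%type.
Implicit Types (w f g F G b : R * R -> R).
Hint Resolve measurable_dyadic measurable_dyadicR measurable_drect : core.

Lemma Ap2_mono p q A A' w : A <= A' -> Ap2 p q A w -> Ap2 p q A' w.
Proof. by move=> AA [h1 h2 h3 h4]; split=> // Q; exact: le_trans (h4 Q) AA. Qed.

Lemma bmo_norm_ge0 (p : R) (mu la b : R * R -> R) : (0 <= bmo_norm p mu la b)%E.
Proof.
pose Q : dyadic_index * dyadic_index := ((0, 0), (0, 0)).
apply: (@le_trans _ _ (((fine (wmass mu (drect Q)))^-1%:E *
   \int[leb2]_(z in drect Q) (`|b z - rect_avg b Q| `^ p * la z)%:E) `^ p^-1)%E).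
  exact: poweR_ge0.
by apply: ereal_sup_ubound; exists Q.
Qed.

Lemma test_function_box f : test_function f -> exists N, forall z, ~ box N z -> f z = 0.
Proof.
move=> [_ _ cK]; set K := closure _ in cK.
have c1 : compact (fst @` K).
  by apply: continuous_compact => //; apply: continuous_subspaceT => x; exact: cvg_fst.
have c2 : compact (snd @` K).
  by apply: continuous_compact => //; apply: continuous_subspaceT => x; exact: cvg_snd.
have [N1 h1] := compact_tops c1; have [N2 h2] := compact_tops c2.
exists (maxn N1 N2) => z nb; apply/eqP/negPn/negP => fz; apply: nb.
have Kz : K z by apply: subset_closure.
have t N (x : R) : (N <= maxn N1 N2)%N -> tops N x -> exists e, dyadic (top (maxn N1 N2) e) x.
  by move=> NN [] /(top_le NN); [exists false|exists true].
split; first by apply: (t N1); [exact: leq_maxl|apply: h1; exists z].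
by apply: (t N2); [exact: leq_maxr|apply: h2; exists z].
Qed.

Lemma test_function_drect Q : test_function (\1_(drect Q) : R * R -> R).
Proof.
split; first by apply: measurable_indic.
  by exists 1 => z; rewrite indicE; case: (_ \in _); rewrite ?normr1 ?normr0.
have [K cK QK] := @drect_compact R Q.
apply: (@subclosed_compact _ _ K) => //; first exact: closed_closure.
have clK : closed K by apply: compact_closed => //; exact: norm_hausdorff.
rewrite (closure_id K).1//; apply: closure_subset => z /= h; apply: QK.
by apply: contrapT => nQ; move: h; rewrite indicE memNset// eqxx.
Qed.

Section Weighted.
Variables (p q A : R) (mu la mu' la' : R * R -> R).
Hypotheses (pq : conjugate p q) (A1 : 1 <= A) (muA : Ap2 p q A mu') (laA : Ap2 p q A la')
  (mmu : mfun mu) (mla : mfun la)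
  (hmu : {ae leb2, forall z, mu z = mu' z}) (hla : {ae leb2, forall z, la z = la' z}).

Let m Q : R := darea Q * rect_avg mu' Q.

Let m_gt0 Q : 0 < m Q.
Proof. by have [[_ iw] w0 _ _] := muA; rewrite mulr_gt0 ?darea_gt0// rect_avg_gt0. Qed.

Lemma wmassE Q : wmass mu (drect Q) = (m Q)%:E.
Proof.
have [[mw iw] w0 _ _] := muA; rewrite -(rect_integral (iw Q)).
apply: eq_leb2_ae => //.
- by apply/measurable_EFinP; exact: measurable_funTS.
- by apply/measurable_EFinP; exact: measurable_funTS.
- by apply: ae_imp hmu => z -> _.
Qed.

Lemma weighted_ae (D : set borelR2) w w' h : measurable D -> mfun w -> mfun w' -> mfun h ->
  {ae leb2, forall z, w z = w' z} ->
  (\int[leb2]_(z in D) (`|h z| `^ p * w z)%:E = \int[leb2]_(z in D) (wpow p w' h z)%:E)%E.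
Proof.
move=> mD mw mw' mh ww; apply: eq_leb2_ae => //.
- by apply/measurable_EFinP; apply: measurable_funTS; exact: (mfun_wpow p mw mh).
- by apply/measurable_EFinP; apply: measurable_funTS; exact: (mfun_wpow p mw' mh).
- by apply: ae_imp ww => z e _; rewrite /wpow e.
Qed.

Lemma wLp_normE w w' h : mfun w -> mfun w' -> mfun h -> {ae leb2, forall z, w z = w' z} ->
  (wLp_norm p w h = (\int[leb2]_z (wpow p w' h z)%:E) `^ p^-1)%E.
Proof. by move=> mw mw' mh ww; rewrite /wLp_norm (weighted_ae measurableT mw mw' mh ww). Qed.

(** Trades the supremum of p-th roots for one integral inequality per rectangle; [m Q] is the mass
    of mu. *)
Lemma bmo_normP b (n : R) : mfun b -> 0 <= n ->
  (bmo_norm p mu la b <= n%:E)%E <-> forall Q,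
  (\int[leb2]_(z in drect Q) (wpow p la' (fun z => b z - rect_avg b Q) z)%:E <= (n `^ p * m Q)%:E)%E.
Proof.
move=> mb n0; have [p1 _ _] := pq; have [[ml _] l0 _ _] := laA.
have mbb Q : mfun (fun z => b z - rect_avg b Q) by exact: measurable_funB.
have i0 Q : (0 <= \int[leb2]_(z in drect Q) (wpow p la' (fun z => b z - rect_avg b Q) z)%:E)%E.
  by apply: integral_ge0 => z _; rewrite lee_fin wpow_ge0.
have E Q : (((fine (wmass mu (drect Q)))^-1%:E *
      \int[leb2]_(z in drect Q) (`|b z - rect_avg b Q| `^ p * la z)%:E) `^ p^-1 =
   ((m Q)^-1%:E * \int[leb2]_(z in drect Q) (wpow p la' (fun z => b z - rect_avg b Q) z)%:E) `^ p^-1)%E.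
  by rewrite wmassE (weighted_ae (measurable_drect Q) mla ml (mbb Q) hla).
have j0 Q : (0 <= (m Q)^-1%:E * \int[leb2]_(z in drect Q) (wpow p la' (fun z => b z - rect_avg b Q) z)%:E)%E.
  by rewrite mule_ge0// lee_fin invr_ge0 ltW.
have one1 : (1 `^ p^-1 = 1 :> \bar R)%E by rewrite poweR1r.
split=> [h Q|h].
  have : (((m Q)^-1%:E * \int[leb2]_(z in drect Q) (wpow p la' (fun z => b z - rect_avg b Q) z)%:E) `^ p^-1
     <= n%:E * 1 `^ p^-1)%E.
    by rewrite one1 mule1 -E; apply: le_trans h; apply: ereal_sup_ubound; exists Q.
  move=> /(pow_le p1 (j0 Q) lee01 n0); rewrite mule1 lee_pdivrMl//.
  by rewrite -EFinM mulrC.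
apply: ge_ereal_sup => _ [Q _ <-]; rewrite E.
have : (((m Q)^-1%:E * \int[leb2]_(z in drect Q) (wpow p la' (fun z => b z - rect_avg b Q) z)%:E) `^ p^-1
     <= n%:E * 1 `^ p^-1)%E.
  apply: (root_le p1 (j0 Q) lee01 n0); rewrite mule1 lee_pdivrMl//.
  by rewrite -EFinM mulrC.
by rewrite one1 mule1.
Qed.

Section Symbol.
Variables (b : R * R -> R) (n : R).
Hypotheses (bi : loc_intg2 b) (n0 : 0 <= n) (bn : (bmo_norm p mu la b <= n%:E)%E).

Lemma loc_oscillation Q : intg2 (wpow p la' (fun z => b z - rect_avg b Q)) Q.
Proof.
have [[ml _] l0 _ _] := laA; have h := (bmo_normP bi.1 n0).1 bn Q.
have mbb : mfun (fun z => b z - rect_avg b Q) by apply: measurable_funB => //; exact: bi.1.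
have mw := mfun_wpow p ml mbb.
apply/integrableP; split; first by apply/measurable_EFinP; exact: measurable_funTS.
apply: (@le_lt_trans _ _ (n `^ p * m Q)%:E); last by rewrite ltry.
apply: le_trans h; rewrite le_eqVlt; apply/orP; left; apply/eqP.
by apply: eq_integral => z _; rewrite /= ger0_norm// wpow_ge0.
Qed.

(** On a rectangle [b] is a constant plus its oscillation, and the bmo bound makes the p-th power of
    the latter integrable against [la']. *)
Lemma loc_symbol : loc_intg2 (wpow p la' b).
Proof.
have [[ml il] l0 _ _] := laA; have [p1 _ _] := pq; have p0 : 0 < p by lra.
have mw := mfun_wpow p ml bi.1; split=> // Q.
have i1 : leb2.-integrable (drect Q) (fun z => ((2 `^ p)%:E *
   ((wpow p la' (fun z => b z - rect_avg b Q) z)%:E + (`|rect_avg b Q| `^ p)%:E * (la' z)%:E))%E).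
  apply: integrableZl => //; apply: integrableD => //; first exact: loc_oscillation.
  by apply: integrableZl => //; exact: il.
apply: (le_integrable _ _ _ i1) => //.
  by apply/measurable_EFinP; exact: measurable_funTS.
move=> z _; rewrite [leRHS](_ : _ = `|2 `^ p * (wpow p la' (fun z => b z - rect_avg b Q) z +
  `|rect_avg b Q| `^ p * la' z)|%:E)//= lee_fin.
have W F : 0 <= wpow p la' F z by exact: wpow_ge0.
have C0 : 0 <= `|rect_avg b Q| `^ p * la' z by rewrite mulr_ge0 ?powR_ge0// ltW.
rewrite ger0_norm// ger0_norm ?mulr_ge0 ?powR_ge0 ?addr_ge0//.
rewrite /wpow -mulrDl mulrA ler_pM2r//; apply: powR_sum_le => //.
by apply: le_trans (ler_normD _ _); rewrite subrK.
Qed.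

(** Hoelder lowers the L^p oscillation to the L^1 oscillation used on trees; the dual weight
    supplies the second factor. *)
Lemma bmo2_symbol : bmo2 p q mu' la' b n.
Proof.
move=> Q; have [[ml il] l0 [md id] _] := laA; have [[_ imu] mu0 _ _] := muA.
have [p1 q1 _] := pq; have p0 : 0 < p by lra.
have a0 : 0 <= (darea Q)^-1 :> R by rewrite invr_ge0 ltW// darea_gt0.
have io := loc_oscillation Q.
have c0 := (loc_absB (rect_avg b Q) bi).2 Q.
have pt z : `|b z - rect_avg b Q| <= wpow p la' (fun z => b z - rect_avg b Q) z `^ p^-1 * dual2 p la' z `^ q^-1.
  rewrite /wpow (root_pow p1 (normr_ge0 _) (ltW (l0 z))) -mulrA.
  by have := @dual_root _ p q (fun=> la' z) 0 pq (l0 z); rewrite /dual /dual2 => ->; rewrite mulr1.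
have H : rect_avg (fun z => `|b z - rect_avg b Q|) Q <=
    rect_avg (wpow p la' (fun z => b z - rect_avg b Q)) Q `^ p^-1 * rect_avg (dual2 p la') Q `^ q^-1.
  exact: (holder_Rintegral pq (measurable_drect Q) a0 io (id Q) c0
    (fun z _ => wpow_ge0 p _ z l0) (fun z _ => powR_ge0 _ _) (fun z _ => pt z)).
apply: le_trans H _; rewrite mulrA; apply: ler_wpM2r; first exact: powR_ge0.
have h := (bmo_normP bi.1 n0).1 bn Q; rewrite (rect_integral io) lee_fin in h.
have {}h : rect_avg (wpow p la' (fun z => b z - rect_avg b Q)) Q <= n `^ p * rect_avg mu' Q.
  have d0 := @darea_gt0 R Q.
  by rewrite -(ler_pM2l d0); apply: le_trans h _; rewrite /m mulrCA.
have w0 : 0 <= rect_avg (wpow p la' (fun z => b z - rect_avg b Q)) Q.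
  by apply: mulr_ge0 => //; apply: fine_ge0; apply: integral_ge0 => z _; rewrite lee_fin wpow_ge0.
have r0 := rect_avg_gt0 (imu Q) mu0.
apply: le_trans (powR_mono _ w0 h) _; first by rewrite invr_gt0.
by rewrite (root_pow p1 n0 (ltW r0)).
Qed.

End Symbol.

Lemma upper_bound : exists2 C, 0 < C & forall b n, loc_intg2 b -> 0 <= n ->
  (bmo_norm p mu la b <= n%:E)%E -> (commutator_norm p mu la b <= (C * n)%:E)%E.
Proof.
have [C C0 HC] := upper_core pq A1; exists C; first exact: C0.
move=> b n bi n0 bn; have [p1 _ _] := pq.
have [[mmu' _] mu0 _ _] := muA; have [[mla' _] la0 _ _] := laA.
apply: ereal_inf_lbound; exists (C * n) => //; split; first by rewrite mulr_ge0// ltW.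
move=> f tf; have [mf fM _] := tf; have fN := test_function_box tf.
have [g [cg mg hg]] := HC mu' la' b f n muA laA bi (loc_symbol bi n0 bn) n0 (bmo2_symbol bi n0 bn) mf fM fN.
exists g; split => //.
rewrite (wLp_normE mla mla' mg hla) (wLp_normE mmu mmu' mf hmu).
apply: root_le => //; last by rewrite mulr_ge0// ltW.
- by apply: integral_ge0 => z _; rewrite lee_fin wpow_ge0.
- by apply: integral_ge0 => z _; rewrite lee_fin wpow_ge0.
Qed.

(** Each admissible constant [K] is tested on indicators of rectangles, whose norm for mu is the
    mass in the bmo norm. Finiteness of that norm places [b] locally in L^p of la. *)
Lemma lower_bound : exists2 c, 0 < c & forall b, loc_intg2 b ->
  (bmo_norm p mu la b < +oo)%E -> (bmo_norm p mu la b <= c%:E * commutator_norm p mu la b)%E.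
Proof.
have [C C0 HC] := lower_core pq A1; have [p1 _ _] := pq; have p0 : 0 < p by lra.
pose c := C `^ p^-1; have c0 : 0 < c by exact: powR_gt0.
exists c; first exact: c0.
move=> b bi bfin.
have [[mmu' imu] mu0 _ _] := muA; have [[mla' _] la0 _ _] := laA.
have b0 := bmo_norm_ge0 p mu la b.
pose n := fine (bmo_norm p mu la b).
have nE : bmo_norm p mu la b = n%:E by rewrite fineK// ge0_fin_numE.
have n0 : 0 <= n by rewrite -lee_fin -nE.
have bp : loc_intg2 (wpow p la' b) by apply: (loc_symbol (n := n)) => //; rewrite nE.
rewrite -lee_pdivrMl//; apply: le_ereal_inf_tmp => _ [K [K0 HK] <-].
rewrite lee_pdivrMl// -EFinM; have cK0 : 0 <= c * K by rewrite mulr_ge0// ltW.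
apply/(bmo_normP bi.1 cK0) => Q.
have [g [cg hg]] := HK _ (test_function_drect Q).
have mg := mfun_commutator bi.1 cg.
have [mi _ _] := test_function_drect Q.
rewrite (wLp_normE mla mla' mg hla) (wLp_normE mmu mmu' mi hmu) in hg.
have hg' := pow_le p1 _ _ K0 hg.
have ge w h : (forall z, 0 < w z) -> (0 <= \int[leb2]_z (wpow p w h z)%:E)%E.
  by move=> w0; apply: integral_ge0 => z _; rewrite lee_fin wpow_ge0.
have {}hg' := hg' (ge _ _ la0) (ge _ _ mu0).
have E : (\int[leb2]_z (wpow p mu' (\1_(drect Q)) z)%:E = (m Q)%:E)%E.
  rewrite -(rect_integral (imu Q)) integral_cut; apply: eq_integral => z _.
  rewrite /wpow /cut indicE; case: (_ \in _); rewrite ?normr1 ?normr0 ?powR1 ?mul1r ?mulr1//.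
  by rewrite powR0 ?mul0r ?mulr0// gt_eqF.
rewrite E in hg'.
apply: le_trans (HC la' b Q g laA bi bp cg) _.
apply: le_trans (lee_wpmul2l (ltW C0 : (0 <= C%:E)%E) hg') _.
rewrite -!EFinM lee_fin powRM ?(ltW c0)// /c -powRrM mulVf ?powRr1 ?(ltW C0)//; last by rewrite gt_eqF.
by rewrite mulrA.
Qed.

End Weighted.
End Assembly.

Theorem theorem5p1 (R : realType) (p : R) (mu la : R * R -> R) :
  1 < p -> dyadic_Ap p mu -> dyadic_Ap p la ->
  exists c C : R, [/\ 0 < c, 0 < C &
    forall b : R * R -> R, loc_integrable2 b ->
      (bmo_norm p mu la b < +oo)%E ->
      (bmo_norm p mu la b <= c%:E * commutator_norm p mu la b)%E /\
      (commutator_norm p mu la b <= C%:E * bmo_norm p mu la b)%E].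
Proof.
move=> p1 hmu hla; pose q := 1 + (p - 1)^-1.
have pq : conjugate p q.
  have d0 : 0 < p - 1 by rewrite subr_gt0.
  split=> //; first by rewrite /q ltrDl invr_gt0.
  by rewrite /q addrAC subrr add0r divff// gt_eqF.
have [mu' [A [A1 muA mmu mue]]] := normalise pq hmu.
have [la' [A' [A'1 laA mla lae]]] := normalise pq hla.
have A1' : 1 <= Num.max A A' by rewrite le_max A1.
have {}muA := Ap2_mono (_ : A <= Num.max A A') muA.
have {}laA := Ap2_mono (_ : A' <= Num.max A A') laA.
have {}muA := muA (ltac:(by rewrite le_max lexx)).
have {}laA := laA (ltac:(by rewrite le_max lexx orbT)).
have [C C0 HC] := upper_bound pq A1' muA laA mmu mla mue lae.
have [c c0 Hc] := lower_bound pq A1' muA laA mmu mla mue lae.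
exists c, C; split=> // b /loc_integrable2_intg bi bfin; split; first exact: Hc.
have b0 := bmo_norm_ge0 p mu la b.
have nE : bmo_norm p mu la b = (fine (bmo_norm p mu la b))%:E by rewrite fineK// ge0_fin_numE.
rewrite nE -EFinM; apply: HC => //; first exact: fine_ge0.
by rewrite -nE.
Qed.
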